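(* Let $\mathcal{S}$ be a 2D surface with $k$ circular boundaries, which are divided into $N$ atomic regions in total. Given a list of entropies for various unions of those atomic regions (which need not be contiguous), suppose there exists a weighted undirected graph $G$ solving the DBRP for these data which can be embedded onto $\mathcal{S}$. Then there exists another weighted graph $H$ with at most $O(N^4)$ vertices, which is also embeddable onto $\mathcal{S}$ and which has the same min-cut values as $G$ for all boundary regions (i.e. for every $R\subseteq[N]$, the min-cut value separating the boundary vertices of $R$ from those of $[N]\setminus R$ is the same in $H$ as in $G$).
   Context: Atomic regions are arcs, labelled $1,\ldots,N$, partitioning the union of the $k$ boundary circles of $\mathcal{S}$. The DBRP data is a list of subsets $R_1,\ldots,R_m\subseteq[N]$ with values $S(R_i)\ge0$; a weighted graph solves it if it is a finite undirected graph with nonnegative real edge weights and distinguished boundary vertices $v_1,\ldots,v_N$ such that for each $i$ the min-cut value between $\{v_j:j\in R_i\}$ and $\{v_j:j\notin R_i\}$ (minimum total weight of an edge set whose removal disconnects every vertex of the first set from every vertex of the second) equals $S(R_i)$. A graph is embeddable onto $\mathcal{S}$ if it can be drawn on $\mathcal{S}$ without edge crossings with each boundary vertex $v_j$ placed on the boundary of $\mathcal{S}$ within the atomic arc $j$. *)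

(* Defs.v *)
From HB Require Import structures.
From mathcomp Require Import all_boot all_order all_algebra.
From mathcomp Require Import all_classical all_reals all_analysis.
Set Implicit Arguments. Unset Strict Implicit. Unset Printing Implicit Defensive.
Import Order.TTheory GRing.Theory Num.Theory.
Import numFieldNormedType.Exports.
Local Open Scope classical_set_scope.
Local Open Scope ring_scope.

Section Defs.
Variable R : realType.

Definition I01 : set R := [set t | 0 <= t <= 1].

Definition halfplane : set (R * R) := [set p | 0 <= p.2].
Definition unit_circle : set (R * R) := [set p | p.1 ^+ 2 + p.2 ^+ 2 = 1].

Definition homeo_sets (T U : topologicalType) (A : set T) (B : set U) : Prop :=
  exists (f : T -> U) (g : U -> T),
    [/\ {within A, continuous f}, {within B, continuous g}, f @` A = B,
        (forall x, A x -> g (f x) = x) & (forall y, B y -> f (g y) = y)].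

Definition is_surface (T : topologicalType) : Prop :=
  [/\ hausdorff_space T, compact [set: T], connected [set: T] &
      forall x : T, exists U : set T, [/\ open U, U x &
        exists W : set (R * R), open W /\ homeo_sets U (W `&` halfplane)]].

Definition surface_boundary (T : topologicalType) : set T :=
  [set x | ~ exists U : set T, [/\ open U, U x &
             exists V : set (R * R), open V /\ homeo_sets U V]].

Definition has_circle_boundaries (T : topologicalType) (k : nat) : Prop :=
  exists C : 'I_k -> set T,
    [/\ forall i, homeo_sets (C i) unit_circle,
        forall i j, i != j -> C i `&` C j = set0 &
        [set x | exists i, C i x] = @surface_boundary T].

Definition atomic_arcs (T : topologicalType) (N : nat) (A : 'I_N -> set T) : Prop :=
  [/\ forall j, connected (A j) /\ exists x y, [/\ A j x, A j y & x <> y],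
      forall i j, i != j -> A i `&` A j = set0 &
      [set x | exists j, A j x] = @surface_boundary T].

End Defs.

Record wgraph (R : realType) (N : nat) := WGraph {
  vert : finType;
  edges : {set {set vert}};
  weight : {set vert} -> R;
  bvert : 'I_N -> vert }.

Arguments weight {R N} w _.
Arguments bvert {R N} w _.
Arguments edges {R N} w.

Local Close Scope classical_set_scope.
Section Graphs.
Variables (R : realType) (N : nat).
Implicit Types (G : wgraph R N).

Definition wf_graph G : Prop :=
  forall e, e \in edges G -> #|e| = 2 /\ 0 <= weight G e.

Definition linked G (F : {set {set vert G}}) (x y : vert G) : bool :=
  connect [rel a b | [set a; b] \in edges G :\: F] x y.

Definition separates G (F : {set {set vert G}}) (Rr : {set 'I_N}) : Prop :=
  forall i j, i \in Rr -> j \notin Rr -> ~~ linked F (bvert G i) (bvert G j).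

Definition mincut G (Rr : {set 'I_N}) (c : R) : Prop :=
  (exists F : {set {set vert G}}, [/\ F \subset edges G, separates F Rr & \sum_(e in F) weight G e = c])
  /\ (forall F : {set {set vert G}}, F \subset edges G -> separates F Rr -> c <= \sum_(e in F) weight G e).

Definition solves_DBRP G (m : nat) (Rs : 'I_m -> {set 'I_N}) (S : 'I_m -> R) : Prop :=
  forall i, mincut G (Rs i) (S i).

Definition embeds (T : topologicalType) (A : 'I_N -> set T) G : Prop :=
  exists (pos : vert G -> T) (path : {set vert G} -> R -> T),
  [/\ injective pos,
      forall j, A j (pos (bvert G j)),
      forall e, e \in edges G ->
        [/\ ({within @I01 R, continuous (path e)})%classic,
            (forall t s, @I01 R t -> @I01 R s -> path e t = path e s -> t = s),
            (exists x y, [/\ e = [set x; y], path e 0 = pos x & path e 1 = pos y]) &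
            (forall t v, 0 < t < 1 -> path e t <> pos v)] &
      forall e e' t s, e \in edges G -> e' \in edges G -> e != e' ->
        @I01 R t -> @I01 R s -> path e t = path e' s ->
        exists v, v \in e :&: e' /\ path e t = pos v].

End Graphs.

(* Main.v *)
Require Import Defs.
From HB Require Import structures.
From mathcomp Require Import all_boot all_order all_algebra.
From mathcomp Require Import all_classical all_reals all_analysis.
From mathcomp Require Import ring lra zify.
Set Implicit Arguments. Unset Strict Implicit. Unset Printing Implicit Defensive.
Import Order.TTheory GRing.Theory Num.Theory.
Import numFieldNormedType.Exports.

(* Perturb the weights so that the minimum cuts of all boundary regions are unique.
   A minimum cut is a set of edges crossed by curves on the surface, so in the dual graph it splits
   into walks whose ends are accounted for by the boundary arcs, or which are closed.  Mod 2, a closed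
   dual walk is a coboundary as soon as its crossing parities with a finite family of loops vanish, and
   finitely many charts give a number of such parities that depends on the surface only.  Uniqueness
   of the minimisers prevents two dual walks of the same class from separating and meeting again, hence
   the union X of all minimum cuts has O(N^4) complementary components.  Contracting the edges outside
   X keeps the drawing and all min-cut values; the contraction is done geometrically, by pulling
   a neighbour into a small flat disc around a vertex. *)

(** * Drawings and contraction of an edge *)

(** The faces of the drawing are never formed. Their substitute is combinatorial: the part of the
    graph joined to a boundary circle is contracted to one terminal on it, where the half-edges are
    linearly ordered because only half a disc surrounds it, and the gaps between them are glued into
    abstract faces. All that is asked of the surface is one parity statement: two loops of the same
    class at a boundary point interlace a third loop, disjoint from both elsewhere, with the same
    parity. The class of a loop is the vector of parities of the chart overlaps that it uses, so the
    atlas alone fixes the number of classes. Dual walks must end in few places. Hence arcs between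
    consecutive terminals are added as free edges, which gives at most 2N end faces; the drawing is
    first pushed off the boundary to make room for them. The exponent 4 arises so: a walk is
    determined by its two end faces and its class, which makes O(N^2) walks, and each ordered pair
    of walks contributes boundedly many edges, which together suffice to recover any cut inside X.
    The number of components is the binary logarithm of the number of such cuts. *)

Module Discs.
Local Open Scope classical_set_scope.
Local Open Scope ring_scope.

Section Plane.
Variable R : realType.
Implicit Types (p q c : R * R) (r : R).

Lemma nrm_lt p r : (`|p| < r) = (`|p.1| < r) && (`|p.2| < r).
Proof. by rewrite prod_normE gt_max. Qed.

Lemma nrm_le p r : (`|p| <= r) = (`|p.1| <= r) && (`|p.2| <= r).
Proof. by rewrite prod_normE ge_max. Qed.

Lemma pair_cts (T : topologicalType) (f g : T -> R) :
  continuous f -> continuous g -> continuous (fun x => (f x, g x) : R * R).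
Proof. by move=> cf cg x; exact: (cvg_pair (cf x) (cg x)). Qed.

Lemma fst_cts : continuous (fst : R * R -> R).
Proof. by move=> x; apply: cvg_fst. Qed.
Lemma snd_cts : continuous (snd : R * R -> R).
Proof. by move=> x; apply: cvg_snd. Qed.

Definition clampR (a b x : R) := Num.max a (Num.min b x).

Lemma clampR_cts a b : continuous (clampR a b).
Proof.
move=> x; apply: (@continuous_max R R (cst a) (fun x => Num.min b x)); first exact: cvg_cst.
by apply: (@continuous_min R R (cst b) id); [exact: cvg_cst|exact: cvg_id].
Qed.

Lemma clampR_in a b x : a <= b -> a <= clampR a b x <= b.
Proof. by move=> ab; rewrite /clampR le_max lexx /= ge_max ab /= ge_min lexx. Qed.

Lemma clampR_id a b x : a <= x <= b -> clampR a b x = x.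
Proof.
by move=> /andP[ax xb]; rewrite /clampR (min_idPr _) // (max_idPr _).
Qed.

(** Boxes of the sup norm cut by the half-plane, so that one notion serves interior points and
    boundary points of the surface. *)
Definition hbox c r p := (`|p - c| <= r) && (0 <= p.2).
Definition hboxo c r p := (`|p - c| < r) && (0 <= p.2).

(** Retraction of the plane onto the half-box; it extends the inverse of a chart to a globally
    continuous map. *)
Definition clamp c r p : R * R :=
  (clampR (c.1 - r) (c.1 + r) p.1, clampR (Num.max 0 (c.2 - r)) (c.2 + r) p.2).

Lemma clamp_cts c r : continuous (clamp c r).
Proof.
apply: pair_cts => x.
  by apply: (continuous_comp (f := fst)); [exact: fst_cts|exact: clampR_cts].
by apply: (continuous_comp (f := snd)); [exact: snd_cts|exact: clampR_cts].
Qed.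

Lemma hboxE c r p : 0 <= c.2 -> hbox c r p =
  (c.1 - r <= p.1 <= c.1 + r) && (Num.max 0 (c.2 - r) <= p.2 <= c.2 + r).
Proof.
move=> c0; rewrite /hbox nrm_le /= !ler_norml ge_max.
by apply/idP/idP; lra.
Qed.

Lemma clamp_in c r p : 0 <= r -> 0 <= c.2 -> hbox c r (clamp c r p).
Proof.
move=> r0 c0; rewrite hboxE //= !clampR_in //; last by lra.
by rewrite ge_max; apply/andP; split; lra.
Qed.

Lemma clamp_id c r p : 0 <= c.2 -> hbox c r p -> clamp c r p = p.
Proof.
by move=> c0; rewrite hboxE // => /andP[h1 h2]; rewrite /clamp !clampR_id //; case: p {h1 h2}.
Qed.

End Plane.

Section FirstHit.
Variables (R : realType) (T : topologicalType).

Lemma first_hit (L : set T) (p : R -> T) : closed L -> continuous p ->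
  ~ L (p 0) -> L (p 1) ->
  exists th : R, [/\ 0 < th <= 1, L (p th) & forall t, 0 <= t < th -> ~ L (p t)].
Proof.
move=> cL cp L0 L1.
pose S := [set t : R | 0 <= t <= 1 /\ L (p t)].
have S1 : S 1 by rewrite /S /= ler01 lexx.
have hS : has_inf S by split; [exists 1|exists 0 => x [/andP[]]].
have i0 : 0 <= inf S by apply: lb_le_inf; [exists 1|move=> x [/andP[]]].
have i1 : inf S <= 1 by apply: ge_inf => //; case: hS.
have Li : L (p (inf S)).
  apply: contrapT => nL.
  have : nbhs (inf S) (p @^-1` (~` L)).
    apply: cp; apply: open_nbhs_nbhs; split => //.
    by apply: closed_openC.
  move=> /nbhs_ballP[e /= e0 he].
  have [x Sx xlt] := inf_adherent e0 hS.
  have ix : inf S <= x by apply: ge_inf => //; case: hS.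
  apply: (he x _ (proj2 Sx)).
  by rewrite /ball /= ltr_norml; apply/andP; split; lra.
exists (inf S); split => //.
  rewrite i1 andbT lt_neqAle i0 andbT; apply/eqP => e; apply: L0; by rewrite e.
move=> t /andP[t0 ti] Lt.
have : inf S <= t.
  apply: ge_inf; first by case: hS.
  by split => //; apply/andP; split => //; lra.
by lra.
Qed.

End FirstHit.

Section Disc.
Variables (R : realType) (T : topologicalType).

(** [g] is continuous on the whole plane, so paths in the disc can be written without domain
    conditions, while [f] is controlled on the image of the box only. Openness of the image of the
    open half-box is what locates the frontier of the disc in the surface. *)
Record disc (f : T -> R * R) (g : R * R -> T) (c : R * R) (r : R) : Prop := Disc {
  disc_r : 0 < r;
  disc_c : 0 <= c.2;
  disc_g : continuous g;
  disc_fg : forall p, hbox c r p -> f (g p) = p;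
  disc_f : forall p, hboxo c r p -> {for g p, continuous f};
  disc_open : open (g @` [set p | hboxo c r p]) }.

Lemma hboxoW (c : R * R) r p : hboxo c r p -> hbox c r p.
Proof. by move=> /andP[h1 h2]; rewrite /hbox h2 (ltW h1). Qed.

Lemma sub_disc f g c r c' r' : disc f g c r -> 0 < r' -> 0 <= c'.2 ->
  `|c' - c| + r' <= r -> disc f g c' r'.
Proof.
move=> [r0 c0 cg fg cf og] r0' c0' le.
have sub p : hbox c' r' p -> hbox c r p.
  move=> /andP[h1 h2]; rewrite /hbox h2 andbT.
  have := ler_distD c' p c; lra.
have subo p : hboxo c' r' p -> hboxo c r p.
  move=> /andP[h1 h2]; rewrite /hboxo h2 andbT.
  have := ler_distD c' p c; lra.
split => //.
- by move=> p /sub; exact: fg.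
- by move=> p /subo; exact: cf.
have -> : g @` [set p | hboxo c' r' p] =
   [set x | (g @` [set p | hboxo c r p]) x /\ `|f x - c'| < r'].
  apply/seteqP; split => [x [p /= hp <-]|x [[p /= hp <-]]].
    split; first by exists p => //; exact: subo.
    by rewrite fg; [case/andP: hp|exact/hboxoW/subo].
  rewrite fg; last exact: hboxoW.
  by move=> h; exists p => //=; apply/andP; split=> //; case/andP: hp.
rewrite openE => x [Ox] /= hx.
have [p hp gp] := Ox; rewrite -gp in hx *.
rewrite /interior; apply: filterI.
  by apply: open_nbhs_nbhs; split => //; exists p.
have n1 : nbhs (f (g p)) [set q | `|q - c'| < r'].
  rewrite -nbhs_nbhs_norm; exists (r' - `|f (g p) - c'|); first by rewrite /= subr_gt0.
  move=> q /= hq.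
  move: hq; rewrite /= distrC; have := ler_distD (f (g p)) q c'; lra.
exact: (cf _ hp _ n1).
Qed.

Lemma disc_closed f g c r : hausdorff_space T -> disc f g c r ->
  closed (g @` [set p | hbox c r p]).
Proof.
move=> hT [r0 c0 cg fg cf og].
apply: compact_closed => //; apply: continuous_compact.
  by apply: continuous_subspaceT.
have -> : [set p | hbox c r p] = `[c.1 - r, c.1 + r]%classic `*` `[Num.max 0 (c.2 - r), c.2 + r]%classic.
  by apply/seteqP; split => p /=; rewrite hboxE // !in_itv /=; [move/andP|move=> [-> ->]].
by apply: compact_setX; exact: segment_compact.
Qed.

Lemma disc_inO f g c r p : disc f g c r -> hboxo c r p -> nbhs (g p) (g @` [set p | hboxo c r p]).
Proof. by move=> D hp; apply: open_nbhs_nbhs; split; [case: D|exists p]. Qed.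

Lemma chart_disc (U : set T) (W : set (R * R)) x : open U -> U x -> open W ->
  homeo_sets U (W `&` @halfplane R) ->
  exists f g r, [/\ disc f g (f x) r, g (f x) = x & forall p, hbox (f x) r p -> U (g p) /\ W p].
Proof.
move=> oU Ux oW [f [g [cf cg fU gf fg]]].
have fU' y : U y -> (W `&` @halfplane R) (f y) by move=> Uy; rewrite -fU; exists y.
have gU p : (W `&` @halfplane R) p -> U (g p).
  by rewrite -fU => -[y Uy <-]; rewrite gf.
have [Wx hx] := fU' _ Ux; rewrite /halfplane /= in hx.
have : nbhs (f x) W by apply: open_nbhs_nbhs.
rewrite -nbhs_nbhs_norm => -[e /= e0 he].
pose r := e / 2; have r0 : 0 < r by rewrite divr_gt0.
have inW p : hbox (f x) r p -> (W `&` @halfplane R) p.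
  move=> /andP[h1 h2]; split => //; apply: he; rewrite /= distrC.
  by apply: le_lt_trans h1 _; rewrite /r; lra.
pose g' := g \o clamp (f x) r.
have g'E p : hbox (f x) r p -> g' p = g p by move=> h; rewrite /g' /= clamp_id.
have cfU y : U y -> {for y, continuous f}.
  move=> Uy B Bfy; move/subspace_continuousP: cf => /(_ y Uy) /(_ B Bfy) /= h.
  have h' : nbhs y [set z | U z -> B (f z)] := h.
  apply: filterS (filterI h' (open_nbhs_nbhs (conj oU Uy))).
  by move=> z [hz Uz]; exact: hz.
exists f, g', r; split; first split => //.
- move=> p B Bg.
  move/subspace_continuousP: cg => /(_ (clamp (f x) r p)) h.
  have inV : (W `&` @halfplane R) (clamp (f x) r p) by apply: inW; apply: clamp_in => //; exact: ltW.
  have h2 : nbhs (clamp (f x) r p) [set z | (W `&` @halfplane R) z -> B (g z)] := h inV B Bg.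
  have h3 : nbhs p [set z | (W `&` @halfplane R) (clamp (f x) r z) -> B (g' z)] := clamp_cts h2.
  change (nbhs p [set z | B (g' z)]).
  apply: (filterS _ h3) => z /= hz; apply: hz.
  by apply: inW; apply: clamp_in => //; exact: ltW.
- by move=> p hp; rewrite g'E // fg //; exact: inW.
- by move=> p hp; apply: cfU; rewrite g'E ?hboxoW //; apply: gU; apply: inW; exact: hboxoW.
- have -> : g' @` [set p | hboxo (f x) r p] = [set y | U y /\ `|f y - f x| < r].
    apply/seteqP; split => [y [p /= hp <-]|y [Uy hy]].
      rewrite g'E ?hboxoW //; have := inW _ (hboxoW hp) => h; split; first exact: gU.
      by rewrite fg //; case/andP: hp.
    have hb : hboxo (f x) r (f y) by rewrite /hboxo hy /=; have [] := fU' _ Uy.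
    by exists (f y) => //=; rewrite g'E ?hboxoW // gf.
  rewrite openE => y [Uy hy]; rewrite /interior; apply: filterI; first exact: open_nbhs_nbhs.
  apply: (cfU _ Uy [set q | `|q - f x| < r]) => /=.
  rewrite -nbhs_nbhs_norm; exists (r - `|f y - f x|); first by rewrite /= subr_gt0.
  move=> q /= hq.
  move: hq; rewrite /= distrC; have := ler_distD (f y) q (f x); lra.
- by rewrite g'E ?gf // /hbox subrr normr0 ltW.
- by move=> p hp; rewrite g'E //; split; [exact/gU/inW|have [] := inW _ hp].
Qed.

End Disc.

End Discs.

(** * Drawings as families of paths, and rerouting of edges *)

Module Embeddings.
Import Discs.
Local Open Scope classical_set_scope.
Local Open Scope ring_scope.

Section Glue.
Variables (R : realType) (T : topologicalType).

Lemma cts_nbhs (S U : topologicalType) (f : S -> U) x (B : set U) :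
  {for x, continuous f} -> nbhs (f x) B -> nbhs x (fun y => B (f y)).
Proof. by move=> cf; exact: cf. Qed.

Lemma glue_cts (f g : R -> T) (a : R) : continuous f -> continuous g -> f a = g a ->
  continuous (fun t => if t <= a then f t else g t).
Proof.
move=> cf cg fga x B; set h := fun t => _.
suff hh : nbhs (h x) B -> nbhs x (fun y => B (h y)) by exact: hh.
rewrite /h.
have [xa|ax|->] := ltrgtP x a.
- move=> /(cts_nbhs (cf x)) Bf.
  by move: Bf (lt_nbhsl xa); apply: filterS2 => y By ya; rewrite (ltW ya).
- move=> /(cts_nbhs (cg x)) Bf.
  by move: Bf (lt_nbhsr ax); apply: filterS2 => y By ya; rewrite leNgt ya.
- move=> Bf; have Bg := Bf; rewrite fga in Bg.
  by move: (cts_nbhs (cf a) Bf) (cts_nbhs (cg a) Bg); apply: filterS2 => y By1 By2; case: ifP.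
Qed.

Lemma affine_cts (f : R -> T) (a b : R) : continuous f -> continuous (fun t => f (a * t + b)).
Proof.
move=> cf x; apply: (@continuous_comp _ _ _ (fun t => a * t + b) f); last exact: cf.
by apply: cvgD; [apply: cvgM; [exact: cvg_cst|exact: cvg_id]|exact: cvg_cst].
Qed.

End Glue.

Section Emb.
Variables (R : realType) (T : topologicalType) (V E : finType).
Implicit Types (s t : E -> V) (A : {set V}) (F D : {set E}) (pos : V -> T) (path : E -> R -> T).

(** Edges are oriented, and loops and parallel edges are allowed, because contractions create them.
    In [emb_i] one parameter is interior and the other arbitrary; it thus covers both the
    disjointness of two edges and the injectivity of one. *)
Record emb s t A F pos path : Prop := Emb {
  emb_inj : {in A &, injective pos};
  emb_s : forall e, e \in F -> s e \in A;
  emb_t : forall e, e \in F -> t e \in A;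
  emb_c : forall e, e \in F -> continuous (path e);
  emb_0 : forall e, e \in F -> path e 0 = pos (s e);
  emb_1 : forall e, e \in F -> path e 1 = pos (t e);
  emb_i : forall e e' (x y : R), e \in F -> e' \in F -> 0 < x < 1 -> 0 <= y <= 1 ->
    path e x = path e' y -> e = e' /\ x = y;
  emb_v : forall e v (x : R), e \in F -> v \in A -> 0 < x < 1 -> path e x <> pos v }.

(** Two thirds of the parameter interval run through the part of the edge that is kept, the last
    third through the ray. *)
Definition repath D path (ray : E -> R -> T) (th : E -> R) e (u : R) : T :=
  if e \in D then (if u <= 2 / 3 then path e (3 / 2 * th e * u) else ray e (3 * u - 2))
  else path e u.

(** The edges that point at [v] are cut at time [th e] and continued by rays to [x]. There are
    separate data [t'], [A'], [pos'] because the lemma serves both to move [v] to the centre of a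
    disc and to merge [v] into another vertex. *)
Lemma reroute s t A F pos path v (L : set T) (th : E -> R) (ray : E -> R -> T) (x : T)
    (t' : E -> V) (A' : {set V}) (pos' : V -> T) :
  let D := [set e in F | t e == v] in
  emb s t A F pos path ->
  (forall e, e \in F -> s e != v) ->
  (forall e, e \in D -> [/\ 0 < th e < 1, continuous (ray e), ray e 0 = path e (th e) & ray e 1 = x]) ->
  (forall e e' u u', e \in D -> e' \in D -> 0 <= u < 1 -> 0 <= u' <= 1 ->
     ray e u = ray e' u' -> e = e' /\ u = u') ->
  (forall e e' u y, e \in D -> e' \in F -> 0 < u < 1 -> 0 <= y <= 1 -> (e' \in D -> y <= th e') ->
     ray e u <> path e' y) ->
  (forall e y, e \in F -> 0 < y < 1 -> (e \in D -> y <= th e) -> path e y <> x) ->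
  (forall e u w, e \in D -> w \in A' -> 0 < u < 1 -> ray e u <> pos' w) ->
  {in A' &, injective pos'} ->
  (forall w, w \in A' -> pos' w = x \/ (w \in A /\ pos' w = pos w)) ->
  (forall e, e \in F -> [/\ s e \in A', t' e \in A', pos' (s e) = pos (s e) &
     pos' (t' e) = if e \in D then x else pos (t e)]) ->
  emb s t' A' F pos' (repath D path ray th).
Proof.
move=> D H sv hth r1 r2 r2x r3 inj' hA' hF.
have DF e : e \in D -> e \in F by rewrite inE => /andP[].
(* A point of a new path is a point of the old path before the cut or a point of the ray; [hP] says
   so for interior parameters, [hQ] for all. *)
have hP e : e \in F -> forall u, 0 < u < 1 ->
   (exists y, [/\ 0 < y < 1, (e \in D -> y <= th e), repath D path ray th e u = path e y &
       y = if e \in D then 3 / 2 * th e * u else u]) \/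
   (e \in D /\ exists y, [/\ 0 < y < 1, repath D path ray th e u = ray e y & y = 3 * u - 2]).
  move=> eF u u01; rewrite /repath; case: ifP => eD; last by left; exists u.
  have [t01 _ _ _] := hth _ eD.
  case: ifP => hu; last by right; split=> //; exists (3 * u - 2); split => //; lra.
  by left; exists (3 / 2 * th e * u); split => //; nra.
have hQ e : e \in F -> forall u, 0 <= u <= 1 ->
   (exists y, [/\ 0 <= y <= 1, (e \in D -> y <= th e), repath D path ray th e u = path e y &
       y = if e \in D then 3 / 2 * th e * u else u]) \/
   (e \in D /\ exists y, [/\ 0 < y <= 1, repath D path ray th e u = ray e y & y = 3 * u - 2]).
  move=> eF u u01; rewrite /repath; case: ifP => eD; last by left; exists u.
  have [t01 _ _ _] := hth _ eD.
  case: ifP => hu; last by right; split=> //; exists (3 * u - 2); split => //; lra.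
  by left; exists (3 / 2 * th e * u); split => //; nra.
split => //.
- by move=> e /hF[].
- by move=> e /hF[].
- move=> e eF; rewrite /repath; case: (boolP (e \in D)) => eD; last exact: (emb_c H).
  have [t01 cr r0 _] := hth _ eD.
  apply: glue_cts.
  + have := @affine_cts R T (path e) (3 / 2 * th e) 0 (emb_c H eF).
    by under eq_fun do rewrite addr0.
  + exact: (@affine_cts R T (ray e) 3 (- 2)).
  + have -> : 3 / 2 * th e * (2 / 3) = th e by lra.
    by have -> : 3 * (2 / 3) - 2 = 0 :> R by lra.
- move=> e eF; have [_ _ -> _] := hF _ eF; rewrite /repath mulr0.
  have -> : 0 <= 2 / 3 :> R by lra.
  by case: ifP => _; exact: (emb_0 H).
- move=> e eF; have [_ _ _ ->] := hF _ eF; rewrite /repath.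
  case: ifP => eD; last exact: (emb_1 H).
  have -> : (1 <= 2 / 3 :> R) = false by lra.
  have -> : 3 * 1 - 2 = 1 :> R by lra.
  by have [] := hth _ eD.
- move=> e e' u u' eF e'F u01 u'01.
  case: (hP _ eF _ u01) => [[y [y01 yth -> ye]]|[eD [y [y01 -> ye]]]];
  case: (hQ _ e'F _ u'01) => [[z [z01 zth -> ze]]|[e'D [z [z01 -> ze]]]].
  + move/(emb_i H eF e'F y01 z01) => [ee yz]; split => //; subst e' z.
    move: ye; rewrite yz; case: ifP => eD => //.
    have [t01 _ _ _] := hth _ eD => h.
    have : 3 / 2 * th e * (u - u') = 0 by lra.
    by move/eqP; rewrite !mulf_eq0 => /orP[/orP[]|]; lra.
  + move=> h; exfalso; have [z1|z1] := eqVneq z 1.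
      by apply: (r2x e y eF y01 yth); rewrite h z1; have [_ _ _ ->] := hth _ e'D.
    apply: (r2 e' e z y e'D eF _ _ yth (esym h)); last lra.
    by move/andP: z01 => [-> z2]; rewrite lt_neqAle z1 z2.
  + move=> h; exfalso; exact: (r2 e e' y z eD e'F y01 z01 zth h).
  + move=> h; have [||ee yz] := r1 _ _ _ _ eD e'D _ _ h; [lra|lra|split => //; lra].
- move=> e w u eF wA u01.
  case: (hP _ eF _ u01) => [[y [y01 yth -> ye]]|[eD [y [y01 -> ye]]]]; last exact: r3.
  case: (hA' _ wA) => [->|[wA0 ->]]; [exact: r2x|exact: (emb_v H)].
Qed.

(** At a vertex without loops, a reversal makes all edges point towards it. *)
Lemma rev_emb s t A F pos path D : emb s t A F pos path ->
  emb (fun e => if e \in D then t e else s e) (fun e => if e \in D then s e else t e)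
    A F pos (fun e => if e \in D then (fun u => path e (1 - u)) else path e).
Proof.
move=> H; split.
- exact: (emb_inj H).
- by move=> e eF; case: ifP => _; [exact: (emb_t H)|exact: (emb_s H)].
- by move=> e eF; case: ifP => _; [exact: (emb_s H)|exact: (emb_t H)].
- move=> e eF; case: ifP => _; last exact: (emb_c H).
  have := @affine_cts R T (path e) (-1) 1 (emb_c H eF).
  by under eq_fun do rewrite mulN1r addrC.
- by move=> e eF; case: ifP => _; [rewrite subr0 (emb_1 H)|exact: (emb_0 H)].
- by move=> e eF; case: ifP => _; [rewrite subrr (emb_0 H)|exact: (emb_1 H)].
- move=> e e' x y eF e'F x01 y01 h.
  have [|||ee xy] := @emb_i _ _ _ _ _ _ H e e' (if e \in D then 1 - x else x) (if e' \in D then 1 - y else y) eF e'F.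
  + by case: ifP => _; lra.
  + by case: ifP => _; lra.
  + by move: h; case: ifP => _; case: ifP => _.
  + by split=> //; move: xy; rewrite -ee; case: ifP => _; lra.
- move=> e v x eF vA x01; have := @emb_v _ _ _ _ _ _ H e v (if e \in D then 1 - x else x) eF vA.
  by case: ifP => _; apply; lra.
Qed.

Lemma emb_sub s t A F pos path A' F' : emb s t A F pos path -> A' \subset A -> F' \subset F ->
  (forall e, e \in F' -> s e \in A' /\ t e \in A') -> emb s t A' F' pos path.
Proof.
move=> H /fintype.subsetP sA /fintype.subsetP sF hF; split.
- by move=> v w /sA vA /sA wA; exact: (emb_inj H).
- by move=> e /hF[].
- by move=> e /hF[].
- by move=> e /sF; exact: (emb_c H).
- by move=> e /sF; exact: (emb_0 H).
- by move=> e /sF; exact: (emb_1 H).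
- by move=> e e' x y /sF eF /sF e'F; exact: (emb_i H).
- by move=> e v x /sF eF /sA vA; exact: (emb_v H).
Qed.

End Emb.

End Embeddings.

(** * Straightening the edges at a vertex inside a disc *)

Module Stars.
Import Discs Embeddings.
Local Open Scope classical_set_scope.
Local Open Scope ring_scope.

Section Star.
Variables (R : realType) (T : topologicalType) (V E : finType).
Hypothesis hT : hausdorff_space T.
Implicit Types (s t : E -> V) (A : {set V}) (F D : {set E}) (pos : V -> T) (path : E -> R -> T).
Implicit Types (f : T -> R * R) (g : R * R -> T) (c q : R * R) (r : R).

Definition dset g c r : set T := g @` [set p | hbox c r p].

Lemma disc_inj f g c r p q : disc f g c r -> hbox c r p -> hbox c r q -> g p = g q -> p = q.
Proof. by move=> D hp hq e; rewrite -(disc_fg D hp) e (disc_fg D hq). Qed.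

Lemma hbox_center c r : 0 <= r -> 0 <= c.2 -> hbox c r c.
Proof. by move=> r0 c0; rewrite /hbox subrr normr0 r0. Qed.

Lemma hbox_seg c r q u : 0 <= c.2 -> hbox c r q -> 0 <= u <= 1 -> hbox c r (c + u *: (q - c)).
Proof.
move=> c0 /andP[h1 h2] u01; apply/andP; split.
  rewrite addrAC subrr add0r normrZ ger0_norm; last lra.
  by have := normr_ge0 (q - c); nra.
by rewrite /= /GRing.scale /=; nra.
Qed.

Lemma ray_cts g c (d : R * R) : continuous g -> continuous (fun u : R => g (c + (1 - u) *: d)).
Proof.
move=> cg u; apply: (@continuous_comp _ _ _ (fun u : R => c + (1 - u) *: d) g u); last exact: cg.
apply: cvgD; first exact: cvg_cst.
by apply: cvgZr_tmp; apply: cvgB; [exact: cvg_cst|exact: cvg_id].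
Qed.

(** If the point were in the open half-box, whose image is open, the path would already have been in
    the disc a little earlier. *)
Lemma hit_frontier f g c r (p : R -> T) th : disc f g c r -> continuous p -> 0 < th ->
  dset g c r (p th) -> (forall y : R, 0 <= y < th -> ~ dset g c r (p y)) ->
  exists q, [/\ hbox c r q, `|q - c| = r & p th = g q].
Proof.
move=> D cp th0 [q /= hq qE] hn; exists q; split => //.
apply/eqP; rewrite eq_le; have /andP[-> q2] := hq => /=; rewrite leNgt; apply/negP => lt.
have ho : hboxo c r q by rewrite /hboxo lt.
have := disc_inO D ho; rewrite qE => /(cts_nbhs (cp th)) /nbhs_ballP[e /= e0 he].
pose t : R := Num.max 0 (th - e / 2).
have t0 : 0 <= t by rewrite /t le_max lexx.
have t1 : t < th by rewrite /t gt_max th0 /=; lra.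
have : (g @` [set p | hboxo c r p]) (p t).
  apply: he; rewrite /ball /=.
  have t2 : th - e / 2 <= t by rewrite /t le_max lexx orbT.
  by rewrite ger0_norm; lra.
by case=> q' hq' q'E; apply: (hn t); [rewrite t0|exists q' => //; exact: hboxoW].
Qed.

Definition upd (pos : V -> T) v x w := if w == v then x else pos w.

(** Each edge at [v] is followed to its first entry into the disc and then straight to the centre.
    Entry points of distinct edges differ, so the radii are disjoint, and nothing else of the
    drawing meets the disc. *)
Lemma star s t A F pos path v f g c r p0 :
  emb s t A F pos path -> v \in A -> disc f g c r ->
  (forall e, e \in F -> s e != v) ->
  hboxo c r p0 -> pos v = g p0 ->
  (forall w, w \in A -> w != v -> ~ dset g c r (pos w)) ->
  (forall e (y : R), e \in F -> t e != v -> 0 <= y <= 1 -> ~ dset g c r (path e y)) ->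
  exists path', [/\ emb s t A F (upd pos v (g c)) path',
    (forall e, e \in F -> t e != v -> path' e = path e) &
    (forall e, e \in F -> t e = v -> exists (th : R) q,
      [/\ 0 < th < 1, hbox c r q /\ `|q - c| = r, path e th = g q,
         (forall y : R, 0 <= y < th -> ~ dset g c r (path e y)) &
         forall u : R, path' e u = if u <= 2 / 3 then path e (3 / 2 * th * u)
                   else g (c + (1 - (3 * u - 2)) *: (q - c))])].
Proof.
move=> H vA D sv h0 pv hw he.
pose DD := [set e in F | t e == v].
have [r0 c0 cg fg _ _] := D.
have hit e : exists tq : R * (R * R), e \in DD ->
  [/\ 0 < tq.1 < 1, hbox c r tq.2 /\ `|tq.2 - c| = r, path e tq.1 = g tq.2 &
     forall y, 0 <= y < tq.1 -> ~ dset g c r (path e y)].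
  have [eD|eD] := boolP (e \in DD); last by exists (0, c) => h.
  move: eD; rewrite inE => /andP[eF /eqP te].
  have [||th [t01 Lt Ln]] := first_hit (disc_closed hT D) (emb_c H eF).
  - by rewrite (emb_0 H eF); apply: hw; [exact: (emb_s H)|exact: sv].
  - by rewrite (emb_1 H eF) te pv; exists p0 => //; exact: hboxoW.
  have [|q [hq qr pq]] := hit_frontier D (emb_c H eF) _ Lt Ln; first lra.
  exists (th, q) => _ /=; split => //.
  have t1 : th != 1.
    apply/eqP => th1; move: pq; rewrite th1 (emb_1 H eF) te pv => /(disc_inj D (hboxoW h0) hq) e0.
    by move: h0; rewrite e0 /hboxo qr ltxx.
  by move/andP: t01 => [-> /= t2]; rewrite lt_neqAle t1.
have [tq htq] := choice hit; pose th e := (tq e).1; pose q e := (tq e).2.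
pose ray e u := g (c + (1 - u) *: (q e - c)).
have Bq e u : e \in DD -> 0 <= u <= 1 -> hbox c r (c + (1 - u) *: (q e - c)).
  by move=> eD u01; have [_ [? _] _ _] := htq _ eD; apply: hbox_seg => //; lra.
have gi e e' u u' : e \in DD -> e' \in DD -> 0 <= u < 1 -> 0 <= u' <= 1 ->
     ray e u = ray e' u' -> e = e' /\ u = u'.
  move=> eD e'D u01 u'01; have [t1 [q1 qr1] p1 n1] := htq _ eD; have [t2 [q2 qr2] p2 n2] := htq _ e'D.
  move=> h; have {h} := disc_inj D (Bq e u eD _) (Bq e' u' e'D _) h.
  move=> /(_ ltac:(lra) ltac:(lra)) /addrI hh.
  have : `|(1 - u) *: (q e - c)| = `|(1 - u') *: (q e' - c)| by rewrite hh.
  rewrite !normrZ qr1 qr2 => /(mulIf (lt0r_neq0 r0)).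
  rewrite !ger0_norm ?subr_ge0; [move=> uu|by case/andP: u'01|by case/andP: u01 => _ /ltW].
  have uu' : u = u' by move: uu => /(congr1 (fun z => 1 - z)); rewrite !subKr.
  move: hh; rewrite uu' => /(@scalerI _ _ (1 - u')) => h2.
  have {h2} : q e - c = q e' - c.
    by apply: h2; rewrite -uu' subr_eq0; apply/eqP => h1; move: u01; rewrite -h1 ltxx andbF.
  move=> /addIr qq; have : path e (th e) = path e' (th e') by rewrite /th p1 p2 -/(q e) qq.
  case/(emb_i H) => //; rewrite ?inE.
  - by move: eD; rewrite inE => /andP[].
  - by move: e'D; rewrite inE => /andP[].
  - by rewrite /th; lra.
have inL e u : e \in DD -> 0 <= u <= 1 -> dset g c r (ray e u).
  move=> eD u01; have [t1 [q1 qr1] p1 n1] := htq _ eD.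
  by exists (c + (1 - u) *: (q e - c)) => //=; apply: hbox_seg => //; lra.
have cL : dset g c r (g c) by exists c => //; apply: hbox_center => //; exact: ltW.
have rayc e u : e \in DD -> 0 <= u < 1 -> ray e u <> g c.
  move=> eD u01; have [t1 [q1 qr1] p1 n1] := htq _ eD => h.
  have {h} := disc_inj D (Bq e u eD _) (hbox_center (ltW r0) c0) h.
  move=> /(_ ltac:(lra)) /eqP; rewrite -subr_eq0 addrAC subrr add0r => /eqP/(congr1 (fun x => `|x|)).
  by rewrite normrZ qr1 normr0 => /eqP; rewrite mulf_eq0 normr_eq0 => /orP[]/eqP; lra.
have retL e y : e \in F -> 0 <= y <= 1 -> (e \in DD -> y <= th e) -> dset g c r (path e y) ->
    e \in DD /\ y = th e.
  move=> eF y01 hy Ly; have [eD|eD] := boolP (e \in DD); last first.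
    by exfalso; apply: (he _ _ eF _ y01 Ly); move: eD; rewrite inE eF.
  have [t1 [q1 qr1] p1 n1] := htq _ eD; split => //; apply/eqP; rewrite eq_le hy //= leNgt.
  by apply/negP => lt; apply: (n1 y) => //; rewrite lt; case/andP: y01 => ->.
have rayp e : e \in DD -> path e (th e) = ray e 0.
  by move=> eD; have [t1 [q1 qr1] p1 n1] := htq _ eD; rewrite /th p1 /ray subr0 scale1r addrC subrK.
exists (repath DD path ray th); split.
- apply: (@reroute R T V E s t A F pos path v (dset g c r) th ray (g c)) => //.
  + move=> e eD; have [t1 [q1 qr1] p1 n1] := htq _ eD; split => //.
    * exact: ray_cts.
    * by rewrite rayp.
    * by rewrite /ray subrr scale0r addr0.
  + move=> e e' u y eD e'F u01 y01 hy h.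
    have [|e'D yth] := retL e' y e'F y01 hy; first by rewrite -h; apply: inL => //; lra.
    move: h; rewrite yth rayp // => /gi => /(_ eD e'D) [||_ ]; lra.
  + move=> e y eF y01 hy h.
    have [||eD yth] := retL e y eF _ hy; [lra|by rewrite h|].
    by move: h; rewrite yth rayp //; apply: rayc => //; lra.
  + move=> e u w eD wA u01; rewrite /upd; case: eqP => [_|/eqP wv]; first by apply: rayc => //; lra.
    by move=> h; apply: (hw w wA wv); rewrite -h; apply: inL => //; lra.
  + move=> w w' wA w'A; rewrite /upd; case: eqP => [->|/eqP wv]; case: eqP => [->|/eqP w'v] //.
    * by move=> h; case: (hw w' w'A w'v); rewrite -h.
    * by move=> h; case: (hw w wA wv); rewrite h.
    * exact: (emb_inj H).
  + by move=> w wA; rewrite /upd; case: eqP; [left|right].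
  + move=> e eF; split; [exact: (emb_s H)|exact: (emb_t H)| |].
      by rewrite /upd (negbTE (sv _ eF)).
    by rewrite /upd /DD inE eF.
- by move=> e eF te; rewrite /repath inE eF (negbTE te).
- move=> e eF te; have eD : e \in DD by rewrite inE eF te eqxx.
  have [t1 [q1 qr1] p1 n1] := htq _ eD; exists (th e), (q e); split => //.
  by move=> u; rewrite /repath eD.
Qed.

End Star.

End Stars.

(** * Discs in which the drawing is a union of radii *)

Module FlatDiscs.
Import Discs Embeddings Stars.
Local Open Scope classical_set_scope.
Local Open Scope ring_scope.

Section Flat.
Variables (R : realType) (T : topologicalType) (V E : finType).
Hypothesis hT : hausdorff_space T.
Implicit Types (s t : E -> V) (A : {set V}) (F D : {set E}) (pos : V -> T) (path : E -> R -> T).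
Implicit Types (f : T -> R * R) (g : R * R -> T) (c q : R * R) (r : R).

Definition eset path F : set T := [set y | exists e, e \in F /\ exists2 x : R, 0 <= x <= 1 & path e x = y].
Definition vset pos A : set T := [set y | exists2 w, w \in A & pos w = y].

Lemma closed_fin (I : finType) (P : pred I) (B : I -> set T) :
  (forall i, P i -> closed (B i)) -> closed [set y | exists2 i, P i & B i y].
Proof.
move=> cB.
apply: (@closed_bigcup _ I [set i | P i] B) => //.
exact: finite_finset.
Qed.

Lemma closed_eset path F : (forall e, e \in F -> continuous (path e)) -> closed (eset path F).
Proof.
move=> cp.
have -> : eset path F = [set y | exists2 e, e \in F & (path e @` `[0, 1]%classic) y].
  apply/seteqP; split => [y [e [eF [x hx xy]]]|y [e eF [x /= hx xy]]].
    by exists e => //; exists x => //=; rewrite in_itv.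
  by exists e; split=> //; exists x; move: hx; rewrite ?in_itv.
apply: closed_fin => e eF; apply: compact_closed => //; apply: continuous_compact.
  by apply: continuous_subspaceT; exact: cp.
exact: segment_compact.
Qed.

Lemma closed_vset pos A : closed (vset pos A).
Proof.
have -> : vset pos A = [set y | exists2 w, w \in A & [set pos w] y].
  by apply/seteqP; split => [y [w wA <-]|y [w wA ->]]; exists w.
apply: closed_fin => w _; exact: (accessible_closed_set1 (hausdorff_accessible hT)).
Qed.

(** The factor 2 leaves a collar around the disc of radius [r], used when a neighbour is brought
    close to that disc. *)
Lemma small_disc f g c (rho : R) (Y : set T) : disc f g c rho -> closed Y -> ~ Y (g c) ->
  exists r, [/\ 0 < r, 2 * r <= rho & forall p, `|p - c| <= 2 * r -> ~ Y (g p)].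
Proof.
move=> D cY Yc; have cg := disc_g D; have r0 := disc_r D.
have := cts_nbhs (cg c) (open_nbhs_nbhs (conj (closed_openC cY) Yc)).
move=> /nbhs_ballP[e /= e0 he].
exists (Num.min (rho / 2) (e / 3)); split.
- by rewrite lt_min; apply/andP; split; lra.
- have : Num.min (rho / 2) (e / 3) <= rho / 2 by rewrite ge_min lexx.
  by lra.
- move=> p hp; apply: he; rewrite -ball_normE /= distrC.
  have : Num.min (rho / 2) (e / 3) <= e / 3 by rewrite ge_min lexx orbT.
  lra.
Qed.

(** A half-edge is a pair [(e, b)], with [b = true] for the target end, so that a loop has two
    half-edges at its vertex. *)
Definition endp s t (b : bool) (e : E) : V := if b then t e else s e.
Definition hpath path (b : bool) (e : E) (u : R) : T := path e (if b then 1 - u else u).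

(** In the disc the drawing consists of one radius per half-edge at [u0]; the order of the
    half-edges around [u0] can be read off the points [dir e b]. *)
Record flat s t A F pos path (u0 : V) f g c r (dir : E -> bool -> R * R) : Prop := Flat {
  fl_disc : disc f g c (2 * r);
  fl_r : 0 < r;
  fl_pos : pos u0 = g c;
  fl_vert : forall w, w \in A -> w != u0 -> ~ dset g c r (pos w);
  fl_dir : forall e b, e \in F -> endp s t b e = u0 ->
     hbox c r (dir e b) /\ `|dir e b - c| = r;
  fl_rad : forall e b, e \in F -> endp s t b e = u0 -> exists2 al : R, 0 < al < 1 &
     forall x, 0 <= x <= al -> hpath path b e x = g (c + (x / al) *: (dir e b - c));
  fl_in : forall e (x : R), e \in F -> 0 <= x <= 1 -> dset g c r (path e x) ->
     exists b (l : R), [/\ endp s t b e = u0, 0 <= l <= 1 & path e x = g (c + l *: (dir e b - c))] }.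

Lemma upd_id pos v x : pos v = x -> upd pos v x = pos.
Proof. by move=> vx; apply: funext => w; rewrite /upd; case: eqP => [->|]. Qed.

Lemma upd_upd pos v x y : upd (upd pos v x) v y = upd pos v y.
Proof. by apply: funext => w; rewrite /upd; case: eqP. Qed.

Lemma disc_le f g c r r' : disc f g c r -> 0 < r' <= r -> disc f g c r'.
Proof.
by move=> D hr; apply: (sub_disc D); [lra|exact: (disc_c D)|rewrite subrr normr0; lra].
Qed.

Lemma hbox_le c r r' p : r' <= r -> hbox c r' p -> hbox c r p.
Proof. by move=> h /andP[h1 h2]; rewrite /hbox h2 (le_trans h1). Qed.

Lemma flat_disc1 s t A F pos path u0 f g c r dir : flat s t A F pos path u0 f g c r dir -> disc f g c r.
Proof. by move=> H; apply: (disc_le (fl_disc H)); have := fl_r H; lra. Qed.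

(* The edges at [u0] are assumed to be oriented towards [u0]. *)
Lemma flatten_to s t A F pos path u0 f g c rho : emb s t A F pos path -> u0 \in A ->
  disc f g c rho -> pos u0 = g c -> (forall e, e \in F -> s e != u0) ->
  exists path' r dir, [/\ emb s t A F pos path', flat s t A F pos path' u0 f g c r dir,
     2 * r <= rho &
     forall e, e \in F -> t e != u0 -> path' e = path e].
Proof.
move=> H uA D pu su.
pose F' := [set e in F | t e != u0].
have F'F e : e \in F' -> e \in F by rewrite inE => /andP[].
pose Y := eset path F' `|` vset pos (A :\ u0).
have cY : closed Y.
  by apply: closedU; [apply: closed_eset => e /F'F; exact: (emb_c H)|exact: closed_vset].
have nY : ~ Y (g c).
  rewrite -pu => -[[e [eF' [x x01]]]|[w]].
    have eF := F'F _ eF'; move: eF'; rewrite inE eF /= => tu px.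
    have [x0|xn0] := eqVneq x 0.
      by move: px; rewrite x0 (emb_0 H eF) => /(emb_inj H (emb_s H eF) uA)/eqP; apply/negP/su.
    have [x1|xn1] := eqVneq x 1.
      by move: px; rewrite x1 (emb_1 H eF) => /(emb_inj H (emb_t H eF) uA)/eqP; apply/negP.
    by apply: (emb_v H eF uA _ px); rewrite !lt_neqAle xn1 eq_sym xn0.
  by rewrite !inE => /andP[wu wA] /(emb_inj H wA uA)/eqP; apply/negP.
have [r [r0 r2 hr]] := small_disc D cY nY.
have D2 : disc f g c (2 * r) by apply: (disc_le D); lra.
have D1 : disc f g c r by apply: (disc_le D2); lra.
have nL p : hbox c r p -> ~ Y (g p) by move=> /andP[h _]; apply: hr; lra.
have c0 := disc_c D.
have hv w : w \in A -> w != u0 -> ~ dset g c r (pos w).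
  by move=> wA wu [p /= hp pw]; apply: (nL p hp); right; exists w => //; rewrite !inE wu.
have he e y : e \in F -> t e != u0 -> 0 <= y <= 1 -> ~ dset g c r (path e y).
  move=> eF tu y01 [p /= hp pw]; apply: (nL p hp); left; exists e; rewrite inE eF tu.
  by split=> //; exists y.
have h0 : hboxo c r c by rewrite /hboxo subrr normr0 r0 c0.
have [path' [H' h1 h2]] := star hT H uA D1 su h0 pu hv he.
rewrite upd_id // in H'.
have hq e : exists q, e \in F -> t e = u0 -> [/\ hbox c r q, `|q - c| = r &
     (forall u, 2 / 3 <= u <= 1 -> path' e u = g (c + (1 - (3 * u - 2)) *: (q - c))) /\
     (forall u, 0 <= u <= 1 -> dset g c r (path' e u) -> 2 / 3 <= u)].
  have [/andP[eF /eqP te]|h] := boolP ((e \in F) && (t e == u0)); last first.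
    by exists c => eF te; move: h; rewrite eF te eqxx.
  have [th [q [th01 [q1 q2] pth nth hp]]] := h2 e eF te.
  exists q => _ _; split => //; split => [u u01|u u01].
    rewrite hp; case: ifP => hu //.
    have -> : u = 2 / 3 by lra.
    have -> : 3 / 2 * th * (2 / 3) = th by lra.
    have -> : 1 - (3 * (2 / 3) - 2) = 1 :> R by lra.
    by rewrite scale1r addrC subrK.
  move=> hd; rewrite leNgt; apply/negP => ltu; move: hd; rewrite hp ifT; last by lra.
  by apply: nth; apply/andP; split; nra.
have [q hq'] := choice hq.
exists path', r, (fun e _ => q e); split; [exact: H'| |exact: r2|exact: h1].
split => //.
- move=> e [|] eF; rewrite /endp => te; last by move: (su e eF); rewrite te eqxx.
  by have [] := hq' e eF te.
- move=> e [|] eF; rewrite /endp => te; last by move: (su e eF); rewrite te eqxx.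
  (* The ray built by [star] occupies the last third of the parameter interval. *)
  exists (1 / 3); first by lra.
  move=> x x01; have [_ _ [h _]] := hq' e eF te; rewrite /hpath h; last lra.
  by congr (g (c + _ *: _)); field.
- move=> e x eF x01; have [te|te] := eqVneq (t e) u0.
    move=> hd; exists true, (1 - (3 * x - 2)); have [_ _ [h h']] := hq' e eF te.
    have x23 := h' _ x01 hd.
    by split => //; [lra|apply: h; lra].
  by rewrite h1 // => hd; case: (he e x eF te x01).
Qed.

End Flat.

End FlatDiscs.

(** * Moving a vertex along a connected set *)

Module Sliding.
Import Discs Embeddings Stars FlatDiscs.
Local Open Scope classical_set_scope.
Local Open Scope ring_scope.

Section Slide.
Variables (R : realType) (T : topologicalType) (V E : finType).
Hypothesis hT : hausdorff_space T.
Hypothesis hD : forall x : T, exists (f : T -> R * R) g r, disc f g (f x) r /\ g (f x) = x.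
Implicit Types (s t : E -> V) (A : {set V}) (F D : {set E}) (pos : V -> T) (path : E -> R -> T).
Implicit Types (f : T -> R * R) (g : R * R -> T) (c q : R * R) (r : R).

(* An edge entering a small disc [L] far from the flat disc keeps its radial part at [u0]. *)
Lemma flat_star s t A F pos path u0 f g c r dir v y path' (L : set T) :
  flat s t A F pos path u0 f g c r dir -> v != u0 ->
  (forall e, e \in F -> s e != v) ->
  (forall z, L z -> ~ dset g c r z) -> L y ->
  (forall e, e \in F -> t e != v -> path' e = path e) ->
  (forall e, e \in F -> t e = v -> exists th : R, [/\ 0 < th < 1, L (path e th),
     forall u : R, 0 <= u <= 2 / 3 -> path' e u = path e (3 / 2 * th * u) &
     forall u : R, 2 / 3 <= u <= 1 -> L (path' e u)]) ->
  flat s t A F (upd pos v y) path' u0 f g c r dir.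
Proof.
move=> H vu sv hL Ly h1 h2; have c0 := disc_c (fl_disc H).
have uv : u0 != v by rewrite eq_sym.
split; [exact: (fl_disc H)|exact: (fl_r H)| | |exact: (fl_dir H)| |].
- by rewrite /upd (negbTE uv); exact: (fl_pos H).
- move=> w wA wu; rewrite /upd; case: eqP => [_|_]; [exact: hL|exact: (fl_vert H)].
- move=> e b eF he; have [te|te] := eqVneq (t e) v; last first.
    by rewrite /hpath h1 //; exact: (fl_rad H eF he).
  have [th [th01 Lth hp _]] := h2 e eF te.
  have [al al01 hal] := fl_rad H eF he.
  have bF : b = false by case: b he {hal} => //; rewrite /endp te => h; rewrite h eqxx in vu.
  subst b; rewrite /hpath in hal.
  have alth : al < th.
    rewrite ltNge; apply/negP => le; apply: (hL _ Lth).
    rewrite hal; last lra.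
    have [hd _] := fl_dir H eF he.
    exists (c + (th / al) *: (dir e false - c)) => //=; apply: hbox_seg => //.
    by rewrite divr_ge0 ?ler_pdivrMr //; lra.
  have al' : 0 < al / (3 / 2 * th) <= 2 / 3.
    by rewrite divr_gt0 ?ler_pdivrMr; lra.
  exists (al / (3 / 2 * th)); first lra.
  move=> x x01; rewrite /hpath hp; last lra.
  have xx : 3 / 2 * th * x <= al.
    by move: x01 => /andP[_]; rewrite ler_pdivlMr; [lra|lra].
  rewrite hal; last by apply/andP; split => //; nra.
  congr (g (c + _ *: _)); field; apply/andP; split; lra.
- move=> e x eF x01; have [te|te] := eqVneq (t e) v; last by rewrite h1 //; exact: (fl_in H).
  have [th [th01 Lth hp hp2]] := h2 e eF te.
  have [x23|x23] := leP x (2 / 3).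
    rewrite hp; last lra.
    by move=> hd; apply: (fl_in H) => //; nra.
  by move=> hd; exfalso; apply: (hL (path' e x)) => //; apply: hp2; lra.
Qed.

(** The positions that [v] can reach form an open and closed part of [K]. The neighbourhood in which
    a further step is possible depends on the fixed obstacles [Z] only, and not on the edges at [v],
    which are not controlled on the way. *)
Lemma slide s t A F pos path u0 f g c r dir v (K : set T) y :
  emb s t A F pos path -> flat s t A F pos path u0 f g c r dir ->
  v \in A -> v != u0 -> (forall e, e \in F -> s e != v) ->
  connected K -> K (pos v) -> K y ->
  (forall z, K z -> ~ (dset g c r `|` vset pos (A :\ v) `|` eset path [set e in F | t e != v]) z) ->
  exists path', [/\ emb s t A F (upd pos v y) path',
    flat s t A F (upd pos v y) path' u0 f g c r dir &
    forall e, e \in F -> t e != v -> path' e = path e].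
Proof.
move=> H Hf vA vu sv cK Kv Ky hK.
set Z := _ `|` _ `|` _ in hK.
have cZ : closed Z.
  apply: closedU; [apply: closedU|].
  - exact: disc_closed hT (flat_disc1 Hf).
  - exact: closed_vset.
  - by apply: closed_eset => // e; rewrite inE => /andP[eF _]; exact: (emb_c H).
pose Sl z := exists path', [/\ emb s t A F (upd pos v z) path',
    flat s t A F (upd pos v z) path' u0 f g c r dir &
    forall e, e \in F -> t e != v -> path' e = path e].
have nb z : ~ Z z -> exists N, [/\ nbhs z N, (forall z', N z' -> ~ Z z') &
    forall z1 z2, N z1 -> N z2 -> Sl z1 -> Sl z2].
  move=> nZ; have [f1 [g1 [r1 [D1 gz]]]] := hD z.
  set c1 := f1 z in D1 gz; have c10 := disc_c D1.
  have [r2 [r20 r21 hr]] := small_disc D1 cZ (c := c1) ltac:(by rewrite gz).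
  have D2 : disc f1 g1 c1 (2 * r2) by apply: (disc_le D1); lra.
  have D3 : disc f1 g1 c1 (r2 / 2) by apply: (disc_le D1); lra.
  exists (g1 @` [set p | hboxo c1 (r2 / 2) p]); split.
  - by rewrite -gz; apply: (disc_inO D3); rewrite /hboxo subrr normr0 c10 andbT; lra.
  - by move=> _ [p /= /andP[hp _] <-]; apply: hr; lra.
  move=> _ _ [p1 /= hp1 <-] [p2 /= hp2 <-] [path1 [H1 Hf1 he1]].
  have [/andP[hp11 hp12] /andP[hp21 hp22]] := (hp1, hp2).
  (* The disc is recentred at the new position [p2]; radius [r2] is enough to contain the old
     position [p1] and small enough to avoid [Z]. *)
  have D4 : disc f1 g1 p2 r2 by apply: (sub_disc D2) => //; lra.
  pose L := dset g1 p2 r2.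
  have LZ z' : L z' -> ~ Z z'.
    move=> [p /= /andP[hp _] <-]; apply: hr; have := ler_distD p2 p c1; lra.
  have h0 : hboxo p2 r2 p1.
    by rewrite /hboxo hp12 andbT; have := ler_distD c1 p1 p2; rewrite (distrC c1 p2); lra.
  have uv1 : upd pos v (g1 p1) v = g1 p1 by rewrite /upd eqxx.
  have hv w : w \in A -> w != v -> ~ L (upd pos v (g1 p1) w).
    move=> wA wv; rewrite /upd (negbTE wv) => /LZ; apply; left; right; exists w => //.
    by rewrite !inE wv.
  have he e x : e \in F -> t e != v -> 0 <= x <= 1 -> ~ L (path1 e x).
    move=> eF te x01; rewrite he1 // => /LZ; apply; right; exists e; rewrite inE eF te; split => //.
    by exists x.
  have [path2 [H2 he2 hi2]] := star hT H1 vA D4 sv h0 uv1 hv he.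
  rewrite upd_upd in H2.
  have Lp2 : L (g1 p2) by exists p2 => //; apply: hbox_center => //; exact: ltW.
  exists path2; split => //; last by move=> e eF te; rewrite he2 // he1.
  rewrite -(upd_upd pos v (g1 p1)).
  apply: (flat_star (L := L) Hf1) => //.
  - by move=> z' /LZ nz h; apply: nz; left; left.
  - move=> e eF te; have [th [q [th01 [q1 q2] pth nth hp]]] := hi2 e eF te.
    have Lq : L (g1 q) by exists q.
    exists th; split => //; first by rewrite pth.
      by move=> u u01; rewrite hp ifT //; lra.
    move=> u u01; rewrite hp; case: ifP => hu.
      have -> : u = 2 / 3 by lra.
      by have -> : 3 / 2 * th * (2 / 3) = th by [lra]; rewrite pth.
    by exists (p2 + (1 - (3 * u - 2)) *: (q - p2)) => //=; apply: hbox_seg => //; lra.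
have S0 : Sl (pos v) by exists path; rewrite upd_id.
suff : (K `&` [set z | ~ Z z /\ Sl z]) y by case=> _ [_].
suff -> : K `&` [set z | ~ Z z /\ Sl z] = K by [].
apply: cK.
- by exists (pos v); split => //; split => //; exact: hK.
- exists [set z | ~ Z z /\ Sl z] => //; rewrite openE => z [nZ Sz].
  have [N [Nz NZ NS]] := nb z nZ; rewrite /interior; apply: filterS (Nz) => z' Nz'.
  by split; [exact: NZ|apply: (NS z) => //; exact: nbhs_singleton].
- exists (~` [set z | ~ Z z /\ ~ Sl z]).
    apply: open_closedC; rewrite openE => z [nZ Sz].
    have [N [Nz NZ NS]] := nb z nZ; rewrite /interior; apply: filterS (Nz) => z' Nz'.
    split; first exact: NZ.
    by move=> Sz'; apply: Sz; apply: (NS z' z) => //; exact: nbhs_singleton.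
  apply/seteqP; split => z [Kz].
    by move=> [nZ Sz]; split => // -[].
  move=> h; split => //; split; first exact: hK.
  by apply: contrapT => nS; apply: h; split => //; exact: hK.
Qed.

End Slide.

End Sliding.

(** * Pulling a neighbour into a flat disc *)

Module Absorption.
Import Discs Embeddings Stars FlatDiscs Sliding.
Local Open Scope classical_set_scope.
Local Open Scope ring_scope.

Section Absorb.
Variables (R : realType) (T : topologicalType) (V E : finType).
Hypothesis hT : hausdorff_space T.
Hypothesis hD : forall x : T, exists (f : T -> R * R) g r, disc f g (f x) r /\ g (f x) = x.
Implicit Types (s t : E -> V) (A : {set V}) (F D : {set E}) (pos : V -> T) (path : E -> R -> T).
Implicit Types (f : T -> R * R) (g : R * R -> T) (c q : R * R) (r : R).

Lemma flat_sub s t A F pos path u0 f g c r dir A' F' :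
  flat s t A F pos path u0 f g c r dir -> A' \subset A -> F' \subset F ->
  flat s t A' F' pos path u0 f g c r dir.
Proof.
move=> H /fintype.subsetP sA /fintype.subsetP sF.
split; [exact: (fl_disc H)|exact: (fl_r H)|exact: (fl_pos H)| | | |].
- by move=> w /sA; exact: (fl_vert H).
- by move=> e b /sF; exact: (fl_dir H).
- by move=> e b /sF; exact: (fl_rad H).
- by move=> e x /sF; exact: (fl_in H).
Qed.

Lemma radial_eq c (r l m : R) (p q : R * R) : 0 < r -> `|p - c| = r -> `|q - c| = r ->
  0 < l -> 0 <= m -> c + l *: (p - c) = c + m *: (q - c) -> l = m /\ p = q.
Proof.
move=> r0 pr qr l0 m0 /addrI h.
have : `|l *: (p - c)| = `|m *: (q - c)| by rewrite h.
rewrite !normrZ pr qr => /(mulIf (lt0r_neq0 r0)).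
rewrite (gtr0_norm l0) (ger0_norm m0) => lm; split=> //.
move: h; rewrite -lm => /(scalerI (lt0r_neq0 l0)).
by move=> /addIr.
Qed.

Lemma cc01 (u : R) : 0 <= u <= 1 -> 0 <= 1 - u <= 1. Proof. lra. Qed.
Lemma oo01 (u : R) : 0 < u < 1 -> 0 <= 1 - u <= 1. Proof. lra. Qed.
Lemma co01' (u : R) : 0 <= u < 1 -> 0 < 1 - u. Proof. lra. Qed.
Lemma oo01' (u : R) : 0 < u < 1 -> 0 < 1 - u. Proof. lra. Qed.
Lemma ooW (u : R) : 0 < u < 1 -> 0 <= u <= 1. Proof. lra. Qed.
Lemma coW (u : R) : 0 <= u < 1 -> 0 <= u <= 1. Proof. lra. Qed.
Lemma ooWl (u : R) : 0 < u < 1 -> 0 <= u < 1. Proof. lra. Qed.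
Lemma c001 : 0 <= (0 : R) <= 1. Proof. lra. Qed.
Lemma c101 : 0 <= (1 : R) <= 1. Proof. lra. Qed.
Lemma mul01 (x y : R) : 0 <= x <= 1 -> 0 < y < 1 -> 0 <= x * y <= y. Proof. nra. Qed.
Lemma cW01 (x y : R) : 0 <= x <= y -> 0 < y < 1 -> 0 <= x <= 1. Proof. lra. Qed.
Lemma div01 (x y : R) : 0 < x <= y -> 0 <= x / y <= 1.
Proof. by move=> /andP[x0 xy]; have y0 := lt_le_trans x0 xy; rewrite divr_ge0 ?ler_pdivrMr ?mul1r // ltW. Qed.
Lemma th23 (th x : R) : 0 < th < 1 -> 0 <= x <= 2 / 3 -> 0 <= 3 / 2 * th * x <= th.
Proof. nra. Qed.
Lemma th23' (th x : R) : 0 < th < 1 -> 0 <= x < 2 / 3 -> 0 <= 3 / 2 * th * x < th.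
Proof. nra. Qed.
Lemma third (x : R) : 0 <= x <= 1 -> (x <= 2 / 3) = false -> 0 <= 1 - (3 * x - 2) <= 1.
Proof. by move=> x1 /negbT; rewrite -ltNge => h; lra. Qed.
Lemma third' (x u : R) : 0 < u < 1 -> 0 <= x < 2 / 3 + u / 3 -> (x <= 2 / 3) = false -> 0 <= 3 * x - 2 < u.
Proof. by move=> u1 x1 /negbT; rewrite -ltNge => h; lra. Qed.
Lemma tusP (u : R) : 0 < u < 1 -> 0 < 2 / 3 + u / 3 < 1. Proof. lra. Qed.
Lemma tusP' (u : R) : 0 < u < 1 -> 2 / 3 < 2 / 3 + u / 3. Proof. lra. Qed.
Lemma third01 : 0 < (1 / 3 : R) < 1. Proof. lra. Qed.
Lemma x13P (x : R) : 0 <= x <= 1 / 3 -> 1 - x <= 2 / 3 -> x = 1 / 3. Proof. lra. Qed.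
Lemma le23lt (x : R) : 0 < x <= 2 / 3 -> 0 < x < 1. Proof. lra. Qed.
Lemma rescale_rad (p1 p2 : R -> T) g c q (al th : R) : 0 < al < th -> th < 1 ->
  (forall x, 0 <= x <= 2 / 3 -> p2 x = p1 (3 / 2 * th * x)) ->
  (forall x, 0 <= x <= al -> p1 x = g (c + (x / al) *: (q - c))) ->
  exists2 al2 : R, 0 < al2 <= 2 / 3 & forall x, 0 <= x <= al2 -> p2 x = g (c + (x / al2) *: (q - c)).
Proof.
move=> ha th1 h1 h2.
have th0 : 0 < 3 / 2 * th by lra.
have al' : 0 < al / (3 / 2 * th) <= 2 / 3.
  rewrite divr_gt0 //=; last lra.
  rewrite ler_pdivrMr //; lra.
exists (al / (3 / 2 * th)) => // x hx.
have xx : 0 <= 3 / 2 * th * x <= al.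
  by case/andP: hx => x0; rewrite ler_pdivlMr // mulrC mulr_ge0 //; exact: ltW.
rewrite h1; last by lra.
rewrite h2 //; congr (g (c + _ *: _)); field.
by apply/andP; split; apply: lt0r_neq0; lra.
Qed.

(** Locates the entry into the flat disc of a straight piece that ends at [m]: the piece stays in
    the box around [m], so the entry point is within [d] of [m]. *)
Lemma lens_hit f g c r m d q' : disc f g c (2 * r) -> 0 < r -> hbox c r m -> `|m - c| < r ->
  `|m - c| + d <= 2 * r -> hbox m d q' -> ~ dset g c r (g q') ->
  exists (us : R) p, [/\ 0 < us < 1, [/\ hbox c r p, `|p - c| = r & hbox m d p],
    g (m + (1 - us) *: (q' - m)) = g p &
    forall u, 0 <= u < us -> ~ dset g c r (g (m + (1 - u) *: (q' - m)))].
Proof.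
move=> D2 r0 hm mr md hq' nq'.
have D1 : disc f g c r by apply: (disc_le D2); lra.
have m2 : 0 <= m.2 by case/andP: hm.
pose p3 u := g (m + (1 - u) *: (q' - m)).
have cp3 : continuous p3 by apply: ray_cts; exact: (disc_g D1).
have p30 : p3 0 = g q' by rewrite /p3 subr0 scale1r addrC subrK.
have p31 : p3 1 = g m by rewrite /p3 subrr scale0r addr0.
have [||us [us01 Lus nus]] := first_hit (disc_closed hT D1) cp3.
- by rewrite p30.
- by rewrite p31; exists m.
have [|p [p1 p2 p3E]] := hit_frontier D1 cp3 _ Lus nus; first by case/andP: us01.
have hbs u : 0 <= u <= 1 -> hbox m d (m + (1 - u) *: (q' - m)).
  by move=> u01; apply: hbox_seg => //; exact: cc01.
have us02 : 0 <= us <= 1 by case/andP: us01 => /ltW ->.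
have pE : m + (1 - us) *: (q' - m) = p.
  apply: (disc_inj D2) => //.
    have /andP[h1 h2] := hbs us us02; rewrite /hbox h2 andbT.
    have := ler_distD m (m + (1 - us) *: (q' - m)) c; lra.
  by apply: hbox_le p1; lra.
exists us, p; split => //.
- case/andP: us01 => -> h /=; rewrite lt_neqAle h andbT; apply/eqP => us1.
  by move: mr; rewrite -p2 -pE us1 subrr scale0r addr0 ltxx.
- by split => //; rewrite -pE; exact: hbs.
Qed.

(* Just after the vertex [v] has been slid along [e0] close to the flat disc of [u0], the edges at
   [v] enter that disc only through a tiny disc around the end of the radial part of [e0]. *)
Lemma absorb_prep s t A F pos path u0 f g c r dir v e0 (delta : R) :
  emb s t A F pos path -> flat s t A F pos path u0 f g c r dir ->
  u0 \in A -> v \in A -> v != u0 -> (forall e, e \in F -> s e != v) ->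
  e0 \in F -> s e0 = u0 -> t e0 = v -> 0 < delta ->
  exists path2 m (tp : E -> R * (R * R)), [/\
    emb s t A (F :\ e0) (upd pos v (g m)) path2,
    (forall e, e \in F :\ e0 -> t e != v -> path2 e = path e) &
    forall e, e \in F :\ e0 -> t e = v ->
      [/\ 0 < (tp e).1 < 1,
        [/\ hbox c r (tp e).2, `|(tp e).2 - c| = r, `|(tp e).2 - dir e0 false| <= delta &
          forall e' b, e' \in F :\ e0 -> endp s t b e' = u0 -> (tp e).2 <> dir e' b],
        path2 e (tp e).1 = g (tp e).2,
        (forall y : R, 0 <= y < (tp e).1 -> dset g c r (path2 e y) ->
          s e = u0 /\ exists2 l : R, 0 <= l <= 1 & path2 e y = g (c + l *: (dir e false - c))) &
        (s e = u0 -> exists2 al : R, 0 < al < (tp e).1 &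
          forall x, 0 <= x <= al -> path2 e x = g (c + (x / al) *: (dir e false - c)))]].
Proof.
move=> H Hf uA vA vu sv e0F se0 te0 d0.
have uv : u0 != v by rewrite eq_sym.
pose F1 := F :\ e0.
have F1F' e : e \in F1 -> e \in F by rewrite !inE => /andP[].
have F1F : F1 \subset F by exact: subD1set.
have H1 : emb s t A F1 pos path.
  by apply: (emb_sub H) => // e /F1F' eF; split; [exact: (emb_s H)|exact: (emb_t H)].
have Hf1 : flat s t A F1 pos path u0 f g c r dir by apply: (flat_sub Hf).
have r0 := fl_r Hf; have D2 := fl_disc Hf; have D1 := flat_disc1 Hf; have c0 := disc_c D1.
have he0 : endp s t false e0 = u0 by [].
have [hq qr] := fl_dir Hf e0F he0; have [al0 al01 hal0] := fl_rad Hf e0F he0.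
have al02 := ooW al01.
set q := dir e0 false in hq qr hal0 *; rewrite /hpath in hal0.
have al00 : al0 != 0 by rewrite lt0r_neq0 //; case/andP: al01.
have r00 : r != 0 by exact: lt0r_neq0.
have pal0 : path e0 al0 = g q.
  rewrite hal0; last by rewrite lexx andbT; case/andP: al02.
  by rewrite divff // scale1r addrC subrK.
pose F' := [set e in F1 | t e != v].
have F'F1 e : e \in F' -> e \in F1 by rewrite inE => /andP[].
pose U := [set e in F1 | s e == u0].
pose seg e : set T := (fun l : R => g (c + (1 - l) *: (dir e false - c))) @` `[0, 1]%classic.
have segP e l : 0 <= l <= 1 -> seg e (g (c + l *: (dir e false - c))).
  by move=> l01; exists (1 - l); rewrite /= ?in_itv /= ?subKr ?cc01.
(* The obstacles near the flat disc: the edges away from [v], the other vertices, and the radii of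
   all edges that leave [u0], including those that end at [v]. *)
pose Y := eset path F' `|` vset pos (A :\ v) `|` [set z | exists2 e, e \in U & seg e z].
have cY : closed Y.
  apply: closedU; [apply: closedU|].
  - by apply: closed_eset => // e /F'F1; exact: (emb_c H1).
  - exact: closed_vset.
  - apply: closed_fin => e _; apply: compact_closed => //; apply: continuous_compact.
      by apply: continuous_subspaceT; apply: ray_cts; exact: (disc_g D1).
    exact: segment_compact.
have segI e b l : e \in F1 -> endp s t b e = u0 -> 0 <= l <= 1 ->
    exists2 y : R, 0 <= y <= 1 & g (c + l *: (dir e b - c)) = path e y.
  move=> eF he l01; have [al ala hal] := fl_rad Hf1 eF he.
  have la := mul01 l01 ala; have la1 := cW01 la ala.
  exists (if b then 1 - l * al else l * al); first by case: (b); rewrite ?cc01.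
  by have := hal (l * al) la; rewrite /hpath => ->; rewrite mulfK // lt0r_neq0 //; case/andP: ala.
have nY : ~ Y (g q).
  rewrite -pal0 => -[[[e [eF' [x x01 h]]]|[w wA h]]|[e eU [l /= l01 h]]].
  - have [ee _] := emb_i H e0F (F1F' e (F'F1 e eF')) al01 x01 (esym h).
    by have := F'F1 e eF'; rewrite -ee !inE eqxx.
  - by move: wA; rewrite !inE => /andP[_ wA]; exact: (emb_v H e0F wA al01 (esym h)).
  - move: eU; rewrite inE => /andP[eF1 /eqP se].
    have [|y y01 hy] := segI e false (1 - l) eF1 se; first by rewrite cc01 //; move: l01; rewrite in_itv.
    have [ee _] := emb_i H e0F (F1F' e eF1) al01 y01 (etrans (esym h) hy).
    by move: eF1; rewrite -ee !inE eqxx.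
have Dq : disc f g q r.
  by apply: (sub_disc D2) => //; [case/andP: hq|rewrite qr mulrDl !mul1r].
have [r1 [r10 r1r hr1]] := small_disc Dq cY nY.
(* Entry points will be within [d] of [m], hence within [3 d / 2] of [q], which is less than
   [delta]. *)
pose d := Num.min r1 (delta / 3).
have d00 : 0 < d by rewrite /d lt_min r10 /= divr_gt0.
have dr1 : d <= r1 by rewrite /d ge_min lexx.
have dd : d <= delta / 3 by rewrite /d ge_min lexx orbT.
have dr : d * 2 <= r by clear -dr1 r1r; lra.
have drr : 0 < d / (2 * r) < 1.
  by clear -d00 dr r0; rewrite divr_gt0 ?ltr_pdivrMr ?mulr_gt0 // mul1r; lra.
(* On the radius of [e0], at depth [d / 2] in the flat disc: the box of radius [d] around [m]
   contains [q] and a bit of [e0] beyond it. *)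
pose m := c + (1 - d / (2 * r)) *: (q - c).
have mq : `|m - q| = d / 2.
  have -> : m - q = (d / (2 * r)) *: (c - q).
    have h : c + ((q - c) - (d / (2 * r)) *: (q - c)) = q - (d / (2 * r)) *: (q - c).
      by rewrite addrA (addrC c) subrK.
    by rewrite /m scalerBl scale1r h addrAC subrr sub0r -scalerN opprB.
  rewrite normrZ (distrC c q) qr gtr0_norm; last by case/andP: drr.
  by field.
have mc : `|m - c| = r - d / 2.
  rewrite /m addrAC subrr add0r normrZ qr gtr0_norm; last by exact: oo01'.
  by field.
have mcr : `|m - c| < r by rewrite mc; clear -d00; lra.
have mcd : `|m - c| + d <= 2 * r by rewrite mc; clear -d00 dr; lra.
have hm : hbox c r m by apply: hbox_seg => //; exact: oo01.
have m2 : 0 <= m.2 by case/andP: hm.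
have Dm : disc f g m d by apply: (sub_disc D2).
have mY p : hbox m d p -> ~ Y (g p).
  by move=> /andP[hp _]; apply: hr1; have := ler_distD m p q; rewrite mq; clear -hp dr1 d00; lra.
have hqm : hboxo m d q.
  by rewrite /hboxo distrC mq; case/andP: hq => _ ->; rewrite andbT; clear -d00; lra.
(* A point of [e0] just after its radius, outside the flat disc and already in the box around [m]:
   [v] slides along [e0] up to this point. *)
have [y1 [y101 [p0 hp0 p0E]]] : exists y1, al0 < y1 < 1 /\ (g @` [set p | hboxo m d p]) (path e0 y1).
  have := disc_inO Dm hqm; rewrite -pal0 => /(cts_nbhs (emb_c H e0F (x := al0))) /nbhs_ballP[e /= e0' he].
  pose y1 := Num.min (al0 + e / 2) ((al0 + 1) / 2).
  have h1 : y1 <= al0 + e / 2 by rewrite /y1 ge_min lexx.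
  have h2 : y1 <= (al0 + 1) / 2 by rewrite /y1 ge_min lexx orbT.
  have h3 : al0 < y1 by rewrite /y1 lt_min; clear -e0' al01; lra.
  exists y1; split; first by clear -h3 h2 al01; lra.
  by apply: he; rewrite -ball_normE /= ltr_norml; clear -h3 h1 e0'; lra.
have y1y y : y \in `[y1, 1] -> [/\ 0 <= y <= 1, al0 < y & y != 1 -> 0 < y < 1].
  rewrite in_itv /=; clear -y101 al01 => hy.
  by split => [||/eqP h]; first lra; first lra; rewrite [_ < 1]lt_neqAle; apply/and3P; split; first lra; [exact/eqP|lra].
pose K : set T := path e0 @` `[y1, 1]%classic.
have cK : connected K.
  apply: connected_continuous_connected; first exact: segment_connected.
  by apply: continuous_subspaceT; exact: (emb_c H).
have K1 : K (pos v).
  by exists 1; [rewrite /= in_itv /= lexx andbT ltW //; case/andP: y101|rewrite (emb_1 H) ?te0].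
have K2 : K (path e0 y1) by exists y1 => //; rewrite /= in_itv /= lexx ltW //; case/andP: y101.
have hK z : K z -> ~ (dset g c r `|` vset pos (A :\ v) `|` eset path F') z.
  move=> [y /y1y [y01 aly yoo] <-].
  have [y1'|y1'] := eqVneq y 1; last have yy := yoo y1'.
  - rewrite y1' (emb_1 H e0F) te0 => -[[h|[w]]|[e [eF' [x x01 h]]]].
    + by apply: (fl_vert Hf vA vu h).
    + by rewrite !inE => /andP[wv wA] /(emb_inj H wA vA)/eqP; apply/negP.
    + have eF1 := F'F1 _ eF'; have eF := F1F' _ eF1; move: eF'; rewrite inE eF1 /= => te.
      have [x0|x0] := eqVneq x 0.
        by move: h; rewrite x0 (emb_0 H eF) => /(emb_inj H (emb_s H eF) vA)/eqP; apply/negP/sv.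
      have [x1|x1] := eqVneq x 1.
        by move: h; rewrite x1 (emb_1 H eF) => /(emb_inj H (emb_t H eF) vA)/eqP; apply/negP.
      by apply: (emb_v H eF vA _ h); rewrite !lt_neqAle x1 eq_sym x0.
  - move=> [[h|[w]]|[e [eF' [x x01 h]]]].
    + have [b [l [hb l01 hl]]] := fl_in Hf e0F y01 h.
      have bF : b = false by case: b hb {hl} => //; rewrite /endp te0 => vu'; rewrite vu' eqxx in vu.
      subst b; have la := mul01 l01 al01; have la1 := cW01 la al01.
      have := hal0 (l * al0) la; rewrite mulfK // -hl => h'.
      have [_ h2] := emb_i H e0F e0F yy la1 (esym h').
      by move: aly; rewrite h2; case/andP: la => _; rewrite leNgt => /negP.
    + by rewrite !inE => /andP[wv wA] /esym; exact: (emb_v H).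
    + have [ee _] := emb_i H e0F (F1F' e (F'F1 e eF')) yy x01 (esym h).
      by have := F'F1 e eF'; rewrite -ee !inE eqxx.
have sv1 e : e \in F1 -> s e != v by move/F1F'; exact: sv.
have [path1 [H1' Hf1' h11]] := slide hT hD H1 Hf1 vA vu sv1 cK K1 K2 hK.
have uv1 : upd pos v (path e0 y1) v = g p0 by rewrite /upd eqxx.
have hv w : w \in A -> w != v -> ~ dset g m d (upd pos v (path e0 y1) w).
  move=> wA wv; rewrite /upd (negbTE wv) => -[p /= /mY hp pw]; apply: hp; left; right.
  by exists w => //; rewrite !inE wv.
have he e x : e \in F1 -> t e != v -> 0 <= x <= 1 -> ~ dset g m d (path1 e x).
  move=> eF te x01; rewrite h11 // => -[p /= /mY hp pw]; apply: hp; left; left.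
  by exists e; rewrite inE eF te; split => //; exists x.
have [path2 [H2 h22 hi2]] := star hT H1' vA Dm sv1 hp0 uv1 hv he.
rewrite upd_upd in H2.
have dirY e b : e \in F1 -> endp s t b e = u0 -> Y (g (dir e b)).
  move=> eF1 hb; have [bs|bs] := boolP (b && (t e != v)).
    have [y y01] := segI e b 1 eF1 hb c101.
    rewrite scale1r addrC subrK => ->; left; left; exists e.
    by rewrite inE eF1; case/andP: bs => _ ->; split=> //; exists y.
  have bF : b = false by case: b hb bs => //=; rewrite negbK /endp => tu /eqP tv; move: vu; rewrite -tv tu eqxx.
  subst b; right; exists e; first by rewrite inE eF1 -hb eqxx.
  by have := segP e 1 c101; rewrite scale1r addrC subrK.
have key e : exists tp : R * (R * R), e \in F1 -> t e = v ->
      [/\ 0 < tp.1 < 1,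
        [/\ hbox c r tp.2, `|tp.2 - c| = r, `|tp.2 - q| <= delta &
          forall e' b, e' \in F1 -> endp s t b e' = u0 -> tp.2 <> dir e' b],
        path2 e tp.1 = g tp.2,
        (forall y : R, 0 <= y < tp.1 -> dset g c r (path2 e y) ->
          s e = u0 /\ exists2 l : R, 0 <= l <= 1 & path2 e y = g (c + l *: (dir e false - c))) &
        (s e = u0 -> exists2 al : R, 0 < al < tp.1 &
          forall x, 0 <= x <= al -> path2 e x = g (c + (x / al) *: (dir e false - c)))].
  have [/andP[eF1 /eqP te]|hn] := boolP ((e \in F1) && (t e == v)); last first.
    by exists (0, c) => h1 h2; move: hn; rewrite h1 h2 eqxx.
  have [th1 [q' [th101 [q'1 q'2] pth nth hp]]] := hi2 e eF1 te.
  have inB y : 0 <= y <= 1 -> dset g c r (path1 e y) ->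
        s e = u0 /\ exists2 l : R, 0 <= l <= 1 & path1 e y = g (c + l *: (dir e false - c)).
    move=> y01 hb; have [b [l [hb' l01 hl]]] := fl_in Hf1' eF1 y01 hb.
    have bF : b = false by case: b hb' {hl} => //; rewrite /endp te => vu'; rewrite vu' eqxx in vu.
    by subst b; split => //; exists l.
  have q'nB : ~ dset g c r (g q').
    rewrite -pth => /(inB _ (ooW th101)) [se [l l01]].
    rewrite pth => h; apply: (mY q' q'1); right; exists e; first by rewrite inE eF1 se eqxx.
    by rewrite h; exact: segP.
  have [us [p [us01 [p1 p2 p3] pE nus]]] := lens_hit D2 r0 hm mcr mcd q'1 q'nB.
  have tus : 0 < 2 / 3 + us / 3 < 1 by exact: tusP.
  have tus' : 2 / 3 < 2 / 3 + us / 3 by exact: tusP'.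
  exists (2 / 3 + us / 3, p) => _ _; rewrite [_.1]/= [_.2]/=; split => //.
  + split => //; first by case/andP: p3 => p3 _; have := ler_distD m p q; rewrite mq; clear -p3 dd d00; lra.
    by move=> e' b e'F hb pd; apply: (mY p p3); rewrite pd; exact: dirY.
  + rewrite hp leNgt tus' /= -pE; congr (g (m + (1 - _) *: _)); by field.
  + move=> y y01; rewrite hp; case: ifP => h.
      have yy : 0 <= y <= 2 / 3 by rewrite h; case/andP: y01 => ->.
      by apply: inB; exact: (cW01 (th23 th101 yy) th101).
    by move=> hb; case: (nus (3 * y - 2) (third' us01 y01 h)).
  + move=> se; have [al ala hal] := fl_rad Hf1' (b := false) eF1 se.
    rewrite /hpath in hal.
    have alth : 0 < al < th1.
      case/andP: ala => -> _; rewrite ltNge; apply/negP => le; apply: q'nB; rewrite -pth hal; last first.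
        by rewrite le ltW //; case/andP: th101.
      have [hd _] := fl_dir Hf1' (b := false) eF1 se.
      exists (c + (th1 / al) *: (dir e false - c)) => //=; apply: hbox_seg => //.
      by apply: div01; rewrite le; case/andP: th101 => ->.
    have [||al2 al21 hal2] := rescale_rad (p2 := path2 e) alth _ _ hal.
    * by case/andP: th101.
    * by move=> x /andP[_ x01]; rewrite hp x01.
    exists al2 => //; case/andP: al21 => -> h /=; exact: (le_lt_trans h tus').
have [tp htp] := choice key.
exists path2, m, tp; split; [exact: H2| |exact: htp].
by move=> e eF te; rewrite h22 // h11.
Qed.

(** The edges of [v] are cut where they enter the flat disc and continued by radii to [u0]. The
    entry points differ from all earlier directions, so the new radii are disjoint from the old
    ones. Edges parallel to [e0] become loops and keep their first radius. *)
Lemma absorb_to s t A F pos path u0 f g c r dir v e0 (delta : R) :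
  let t' e := if t e == v then u0 else t e in
  emb s t A F pos path -> flat s t A F pos path u0 f g c r dir ->
  u0 \in A -> v \in A -> v != u0 -> (forall e, e \in F -> s e != v) ->
  e0 \in F -> s e0 = u0 -> t e0 = v -> 0 < delta ->
  exists path' dir', [/\ emb s t' (A :\ v) (F :\ e0) pos path',
    flat s t' (A :\ v) (F :\ e0) pos path' u0 f g c r dir',
    (forall e b, e \in F :\ e0 -> endp s t b e = u0 -> dir' e b = dir e b) &
    (forall e, e \in F :\ e0 -> t e = v -> `|dir' e true - dir e0 false| <= delta)].
Proof.
move=> t' H Hf uA vA vu sv e0F se0 te0 d0.
have uv : u0 != v by rewrite eq_sym.
have [path2 [m [tp [H2 p2e htp]]]] := absorb_prep H Hf uA vA vu sv e0F se0 te0 d0.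
set F1 := F :\ e0 in H2 p2e htp *.
have F1F : F1 \subset F by exact: subD1set.
have F1F' e : e \in F1 -> e \in F by rewrite !inE => /andP[].
have H1 : emb s t A F1 pos path.
  by apply: (emb_sub H) => // e /F1F' eF; split; [exact: (emb_s H)|exact: (emb_t H)].
have Hf1 : flat s t A F1 pos path u0 f g c r dir by apply: (flat_sub Hf).
have r0 := fl_r Hf; have D1 := flat_disc1 Hf; have c0 := disc_c D1.
have sv1 e : e \in F1 -> s e != v by move/F1F'; exact: sv.
pose D := [set e in F1 | t e == v].
have DP e : e \in D -> e \in F1 /\ t e = v by rewrite inE => /andP[-> /eqP].
have ND e : e \in F1 -> e \notin D -> t e != v by move=> eF; rewrite inE eF.
clear H F1F sv e0F se0 te0 d0.
pose th e := (tp e).1; pose p e := (tp e).2.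
pose ray e u := g (c + (1 - u) *: (p e - c)).
have Bray e u : e \in D -> 0 <= u <= 1 -> hbox c r (c + (1 - u) *: (p e - c)).
  move=> /DP[eF te] u01; have [_ [? _ _ _] _ _ _] := htp _ eF te.
  by apply: hbox_seg => //; exact: cc01.
have rayth e : e \in D -> ray e 0 = path2 e (th e).
  move=> /DP[eF te]; have [_ _ pe _ _] := htp _ eF te.
  by rewrite /th pe /ray subr0 scale1r addrC subrK.
have gi e e' u u' : e \in D -> e' \in D -> 0 <= u < 1 -> 0 <= u' <= 1 ->
     ray e u = ray e' u' -> e = e' /\ u = u'.
  move=> eD e'D u01 u'01; have [[eF te] [e'F te']] := (DP _ eD, DP _ e'D).
  have [t1 [q1 qr1 _ _] p1 _ _] := htp _ eF te; have [t2 [q2 qr2 _ _] p2 _ _] := htp _ e'F te'.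
  move=> h; have {h} := disc_inj D1 (Bray e u eD (coW u01)) (Bray e' u' e'D u'01) h.
  move=> h; have u'02 : 0 <= 1 - u' by case/andP: (cc01 u'01).
  have [uu pp] := radial_eq r0 qr1 qr2 (co01' u01) u'02 h.
  have : path2 e (th e) = path2 e' (th e') by rewrite /th p1 p2 pp.
  move=> /(emb_i H2 eF e'F t1 (ooW t2)) [ee _]; split=> //.
  by move/(congr1 (fun z => 1 - z)): uu; rewrite !subKr.
have raydir e e' b u l : e \in D -> e' \in F1 -> endp s t b e' = u0 -> 0 <= u < 1 -> 0 <= l <= 1 ->
    ray e u <> g (c + l *: (dir e' b - c)).
  move=> eD e'F hb u01 l01 h; have [eF te] := DP _ eD.
  have [t1 [q1 qr1 _ nd] _ _ _] := htp _ eF te.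
  have [hd1 hd2] := fl_dir Hf1 e'F hb.
  have h' := disc_inj D1 (Bray e u eD (coW u01)) (hbox_seg c0 hd1 l01) h.
  have [l0 _] := andP l01.
  have [_ pp] := radial_eq r0 qr1 hd2 (co01' u01) l0 h'.
  exact: (nd e' b e'F hb pp).
have raym e u : e \in D -> 0 < u < 1 -> ray e u <> g c.
  move=> eD u01 h; have [eF te] := DP _ eD; have [t1 [q1 qr1 _ _] _ _ _] := htp _ eF te.
  have /eqP := disc_inj D1 (Bray e u eD (ooW u01)) (hbox_center (ltW r0) c0) h.
  rewrite -subr_eq0 addrAC subrr add0r => /eqP/(congr1 (fun x => `|x|)).
  rewrite normrZ qr1 normr0 => /eqP; rewrite mulf_eq0 normr_eq0 => /orP[]/eqP h0.
    by have := oo01' u01; rewrite h0 ltxx.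
  by move: r0; rewrite h0 ltxx.
have inray e u : e \in D -> 0 <= u <= 1 -> dset g c r (ray e u).
  by move=> eD u01; exists (c + (1 - u) *: (p e - c)) => //; exact: Bray.
have sD e : e \in D -> s e != u0 -> forall y, 0 <= y < th e -> ~ dset g c r (path2 e y).
  move=> /DP[eF te] se y y01 h; have [_ _ _ n1 _] := htp _ eF te.
  by have [/eqP] := n1 y y01 h; rewrite (negbTE se).
exists (repath D path2 ray th), (fun e b => if (t e == v) && b then p e else dir e b).
have HR : emb s t' (A :\ v) F1 pos (repath D path2 ray th).
  apply: (@reroute R T V E s t A F1 _ path2 v (dset g c r) th ray (g c) t' (A :\ v) pos H2) => //.
  - move=> e /[dup] eD /DP[eF te]; have [t1 _ p1 _ _] := htp _ eF te; split => //.
    + by apply: ray_cts; exact: (disc_g D1).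
    + exact: rayth.
    + by rewrite /ray subrr scale0r addr0.
  - move=> e e' u y eD e'F u01 y01 hy h.
    have rB : dset g c r (path2 e' y) by rewrite -h; apply: inray => //; exact: ooW.
    have [e'D|e'D] := boolP (e' \in D); last first.
      move: rB h; rewrite p2e ?ND // => rB h.
      have [b [l [hb l01 hl]]] := fl_in Hf1 e'F y01 rB.
      by apply: (raydir e e' b u l) => //; [exact: ooWl|rewrite h].
    have [t1 _ _ n1 _] := htp _ e'F (proj2 (DP _ e'D)).
    have [yth|yth] := eqVneq y (th e').
      move: h; rewrite yth -rayth // => /gi => /(_ eD e'D (ooWl u01) c001) [_ u00].
      by move: u01; rewrite u00 ltxx.
    have [|se [l l01 hl]] := n1 y _ rB.
      by rewrite lt_neqAle yth hy //; case/andP: y01 => ->.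
    by apply: (raydir e e' false u l) => //; [exact: ooWl|rewrite h].
  - move=> e y eF y01 hy; have := emb_v H2 (v := u0) eF uA y01.
    by rewrite /upd (negbTE uv) (fl_pos Hf).
  - move=> e u w eD; rewrite !inE => /andP[wv wA] u01.
    have [-> |wu] := eqVneq w u0; first by rewrite (fl_pos Hf); exact: raym.
    by move=> h; apply: (fl_vert Hf wA wu); rewrite -h; apply: inray => //; exact: ooW.
  - by move=> w w'; rewrite !inE => /andP[_ wA] /andP[_ w'A]; exact: (emb_inj H1).
  - by move=> w; rewrite !inE => /andP[wv wA]; right; rewrite /upd (negbTE wv).
  - move=> e eF; split.
    + by rewrite !inE (sv1 e eF) (emb_s H1 eF).
    + rewrite /t' !inE; have [_|te] := eqVneq (t e) v; first by rewrite uv uA.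
      by rewrite te (emb_t H1 eF).
    + by rewrite /upd (negbTE (sv1 e eF)).
    + rewrite /t' inE eF /=; have [_|te] := eqVneq (t e) v; first by rewrite (fl_pos Hf).
      by rewrite /upd (negbTE te).
have thn e : e \in D -> 3 / 2 * th e * (2 / 3) = th e by move=> _; field.
split => //.
- split; [exact: (fl_disc Hf)|exact: r0|exact: (fl_pos Hf)| | | |].
  + by move=> w; rewrite !inE => /andP[_]; exact: (fl_vert Hf).
  + move=> e b eF hb; case: ifP => [/andP[/eqP te _]|].
      by have [_ [? ? _ _] _ _ _] := htp e eF te.
    move=> h; apply: (fl_dir Hf1 eF); move: hb h; rewrite /endp /t'.
    by case: b => //; rewrite andbT => + h; rewrite h.
  + move=> e b eF hb; rewrite /hpath /repath.
    have [eD|eD] := boolP (e \in D); last first.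
      have te := negbTE (ND e eF eD); rewrite te /=.
      move: hb; rewrite /endp /t' te => hb; rewrite p2e ?te //.
      exact: (fl_rad Hf1 eF hb).
    have [_ te] := DP _ eD; have [t1 _ _ _ al] := htp _ eF te.
    rewrite te eqxx /=; case: b hb => /= hb.
      exists (1 / 3); first exact: third01.
      move=> x x01; case: ifP => h.
        have xx := x13P x01 h.
        have -> : 3 / 2 * th e * (1 - x) = th e by rewrite xx; field.
        by rewrite -rayth // /ray; congr (g (c + _ *: _)); rewrite xx; field.
      by rewrite /ray; congr (g (c + _ *: _)); field.
    have [al2 al21 hal] := al hb; have [_ th1] := andP t1.
    have [|al3 al31 hal3] := rescale_rad (p2 := repath D path2 ray th e) al21 th1 _ hal.
      by move=> x /andP[_ x01]; rewrite /repath eD x01.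
    exists al3; first exact: le23lt.
    by move=> x /hal3 <-; rewrite /repath eD.
  + move=> e x eF x01; rewrite /repath.
    have [eD|eD] := boolP (e \in D); last first.
      have te := negbTE (ND e eF eD).
      rewrite p2e ?te // => hb; have [b [l [hb' l01 hl]]] := fl_in Hf1 eF x01 hb.
      by exists b, l; split => //; move: hb'; rewrite /endp /t' te.
    have [_ te] := DP _ eD; have [t1 _ _ n1 al] := htp _ eF te; rewrite -/(th e) in t1 n1.
    case: ifP => h hb.
      have [x23|x23] := eqVneq x (2 / 3).
        exists true, 1; rewrite te eqxx /endp /t' te eqxx x23; split => //; first exact: c101.
        by rewrite thn // -rayth // /ray subr0.
      have x23' : 0 <= x < 2 / 3 by rewrite lt_neqAle x23 h; case/andP: x01 => ->.
      have [se [l l01 hl]] := n1 (3 / 2 * th e * x) (th23' t1 x23') hb.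
      by exists false, l; rewrite te andbF.
    by exists true, (1 - (3 * x - 2)); rewrite te eqxx /endp /t' te eqxx; split => //; exact: third.
- move=> e b eF hb; case: ifP => // /andP[/eqP te bt].
  by move: hb vu; rewrite /endp bt te => ->; rewrite eqxx.
- by move=> e eF te; rewrite te eqxx /=; have [_ [_ _ ? _] _ _ _] := htp e eF te.
Qed.

End Absorb.

End Absorption.

(** * Contraction of an edge of arbitrary orientation *)

Module Merging.
Import Discs Embeddings Stars FlatDiscs Sliding Absorption.
Local Open Scope classical_set_scope.
Local Open Scope ring_scope.

Section AbsorbU.
Variables (R : realType) (T : topologicalType) (V E : finType).
Hypothesis hT : hausdorff_space T.
Hypothesis hD : forall x : T, exists (f : T -> R * R) g r, disc f g (f x) r /\ g (f x) = x.
Implicit Types (s t : E -> V) (A : {set V}) (F D : {set E}) (pos : V -> T) (path : E -> R -> T).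
Implicit Types (f : T -> R * R) (g : R * R -> T) (c q : R * R) (r : R).

Lemma emb_ext s t s' t' A F pos path : emb s t A F pos path ->
  (forall e, e \in F -> s e = s' e) -> (forall e, e \in F -> t e = t' e) ->
  emb s' t' A F pos path.
Proof.
move=> H hs ht; split; [exact: (emb_inj H)| | |exact: (emb_c H)| | |exact: (emb_i H)|exact: (emb_v H)].
- by move=> e eF; rewrite -hs //; exact: (emb_s H).
- by move=> e eF; rewrite -ht //; exact: (emb_t H).
- by move=> e eF; rewrite -hs //; exact: (emb_0 H).
- by move=> e eF; rewrite -ht //; exact: (emb_1 H).
Qed.

Lemma flat_ext s t s' t' A F pos path u0 f g c r dir : flat s t A F pos path u0 f g c r dir ->
  (forall e, e \in F -> s e = s' e) -> (forall e, e \in F -> t e = t' e) ->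
  flat s' t' A F pos path u0 f g c r dir.
Proof.
move=> H hs ht.
have he e b : e \in F -> endp s' t' b e = endp s t b e.
  by move=> eF; case: b; rewrite /endp ?hs ?ht.
split; [exact: (fl_disc H)|exact: (fl_r H)|exact: (fl_pos H)|exact: (fl_vert H)| | |].
- by move=> e b eF; rewrite he //; exact: (fl_dir H).
- by move=> e b eF; rewrite he //; exact: (fl_rad H).
- by move=> e x eF x01 /(fl_in H eF x01)[b [l [h1 h2 h3]]]; exists b, l; rewrite he.
Qed.

Lemma endp_rev s t D b e : endp (fun e => if e \in D then t e else s e)
  (fun e => if e \in D then s e else t e) b e = endp s t (b (+) (e \in D)) e.
Proof. by rewrite /endp; case: (e \in D); case: b. Qed.

Lemma flat_rev s t A F pos path u0 f g c r dir D : flat s t A F pos path u0 f g c r dir ->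
  flat (fun e => if e \in D then t e else s e) (fun e => if e \in D then s e else t e) A F pos
   (fun e => if e \in D then (fun u => path e (1 - u)) else path e) u0 f g c r
   (fun e b => dir e (b (+) (e \in D))).
Proof.
move=> H; split; [exact: (fl_disc H)|exact: (fl_r H)|exact: (fl_pos H)|exact: (fl_vert H)| | |].
- by move=> e b eF; rewrite endp_rev; exact: (fl_dir H).
- move=> e b eF; rewrite endp_rev => /(fl_rad H eF)[al al01 hal]; exists al => // x /hal <-.
  by rewrite /hpath; case: (e \in D); case: (b) => //=; rewrite subKr.
- move=> e x eF x01 h.
  have [b [l [h1 h2 h3]]] := fl_in H (x := if e \in D then 1 - x else x) eF
    ltac:(by case: ifP => _; lra) ltac:(by move: h; case: (e \in D)).
  exists (b (+) (e \in D)), l; rewrite endp_rev addbK; split=> //.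
  by rewrite -h3; case: (e \in D).
Qed.

Lemma flatten s t A F pos path u0 f g c rho : emb s t A F pos path -> u0 \in A ->
  disc f g c rho -> pos u0 = g c -> (forall e, e \in F -> ~ (s e = u0 /\ t e = u0)) ->
  exists path' r dir, [/\ emb s t A F pos path', flat s t A F pos path' u0 f g c r dir & 2 * r <= rho].
Proof.
move=> H uA Dc pu nl; pose D := [set e in F | s e == u0].
have [|path1 [r [dir [H1 f1 r1 _]]]] := flatten_to hT (rev_emb D H) uA Dc pu.
  move=> e eF; rewrite inE eF /=; have := nl e eF.
  by case: (eqVneq (s e) u0) => // -> h; apply/eqP => h'; apply: h.
have H2 := rev_emb D H1; have f2 := flat_rev D f1.
do 3 eexists; split; [apply: (emb_ext H2)|apply: (flat_ext f2)|exact: r1];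
 by move=> e _ /=; case: (e \in D).
Qed.

Definition mg (v u0 w : V) := if w == v then u0 else w.

(** Besides the drawing it records how the order around [u0] changes: old half-edges keep their
    directions, and those of [v] appear within [delta] of the direction of [e0]. The dual of the
    contracted graph is later pulled back through this information. *)
Lemma absorb s t A F pos path u0 f g c r dir v e0 b0 (delta : R) :
  emb s t A F pos path -> flat s t A F pos path u0 f g c r dir ->
  u0 \in A -> v \in A -> v != u0 -> (forall e, e \in F -> ~ (s e = v /\ t e = v)) ->
  e0 \in F -> endp s t b0 e0 = u0 -> endp s t (~~ b0) e0 = v -> 0 < delta ->
  let s' e := mg v u0 (s e) in let t' e := mg v u0 (t e) in
  exists path' dir', [/\ emb s' t' (A :\ v) (F :\ e0) pos path',
    flat s' t' (A :\ v) (F :\ e0) pos path' u0 f g c r dir',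
    (forall e b, e \in F :\ e0 -> endp s t b e = u0 -> dir' e b = dir e b) &
    (forall e b, e \in F :\ e0 -> endp s t b e = v -> `|dir' e b - dir e0 b0| <= delta)].
Proof.
move=> H Hf uA vA vu nl e0F he0 he0' d0 s' t'.
pose D := [set e in F | s e == v].
have sv e : e \in F -> (if e \in D then t e else s e) != v.
  move=> eF; rewrite inE eF /=; have := nl e eF.
  by case: (eqVneq (s e) v) => // -> h; apply/eqP => h'; apply: h.
have e0D : (e0 \in D) = b0.
  rewrite inE e0F /=; move: he0 he0'; rewrite /endp; case: b0 => /= h1 h2; first by rewrite h2 eqxx.
  by rewrite h1 eq_sym (negbTE vu).
have [||path1 [dir1 [H1 f1 d1 d2]]] := absorb_to hT hD (rev_emb D H) (flat_rev D Hf) uA vA vu sv e0F _ _ d0.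
- by rewrite e0D; exact: he0.
- by rewrite e0D -he0'; case: (b0).
have H2 := rev_emb D H1; have f2 := flat_rev D f1.
have FF e : e \in F :\ e0 -> e \in F by rewrite !inE => /andP[].
have hsD e : e \in F -> e \in D -> s e = v /\ t e != v.
  by move=> eF eD; have := sv e eF; rewrite eD; move: eD; rewrite inE => /andP[_ /eqP].
have hsN e : e \in F -> e \notin D -> s e != v.
  by move=> eF eD; have := sv e eF; rewrite (negbTE eD).
do 2 eexists; split; [apply: (emb_ext H2)|apply: (flat_ext f2)| |].
- move=> e /FF eF; rewrite /s' /mg; have [eD|eD] := boolP (e \in D).
    by have [-> _] := hsD e eF eD; rewrite eqxx.
  by rewrite (negbTE (hsN e eF eD)).
- move=> e /FF eF; rewrite /t' /mg; have [eD|eD] := boolP (e \in D) => //.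
  by have [_ /negbTE ->] := hsD e eF eD.
- move=> e /FF eF; rewrite /s' /mg; have [eD|eD] := boolP (e \in D).
    by have [-> _] := hsD e eF eD; rewrite eqxx.
  by rewrite (negbTE (hsN e eF eD)).
- move=> e /FF eF; rewrite /t' /mg; have [eD|eD] := boolP (e \in D) => //.
  by have [_ /negbTE ->] := hsD e eF eD.
- move=> e b eF he /=; rewrite d1 //; first by rewrite addbK.
  by rewrite endp_rev addbK.
- move=> e b eF he /=.
  have bD : b (+) (e \in D) = true.
    have [eD|eD] := boolP (e \in D); case: b he => //; rewrite /endp.
      by have [_ /eqP] := hsD e (FF _ eF) eD.
    by move=> /eqP; rewrite (negbTE (hsN e (FF _ eF) eD)).
  rewrite bD; have := d2 e eF; rewrite e0D /=; apply.
  by move: he bD; rewrite /endp; case: (e \in D); case: (b).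
Qed.

End AbsorbU.

End Merging.

(** * Crossing parities of loops *)

Module CrossingParity.
Import Discs Embeddings Stars.
Local Open Scope classical_set_scope.
Local Open Scope ring_scope.

Section Winding.
Variable R : realType.
Implicit Types (p q r : R * R) (gm : R -> R * R).

Lemma nbhsP (X : normedModType R) (x : X) (B : set X) :
  nbhs x B <-> exists e : R, 0 < e /\ forall y, `|y - x| < e -> B y.
Proof.
rewrite -nbhs_nbhs_norm; split => [[e e0 he]|[e [e0 he]]]; exists e => //.
  by split => // y h; apply: he; rewrite /= distrC.
by move=> y /= h; apply: he; rewrite distrC.
Qed.

Lemma nbhsRP (x : R) (B : set R) : nbhs x B <-> exists e : R, 0 < e /\ forall y, `|y - x| < e -> B y.
Proof. exact: (@nbhsP (R^o : normedModType R)). Qed.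

Lemma nbhs2P p (B : set (R * R)) : nbhs p B <-> exists e : R, 0 < e /\ forall q, `|q - p| < e -> B q.
Proof. exact: (@nbhsP ((R^o * R^o)%type : normedModType R)). Qed.

(* Parity of the crossings of the segment [p, q] with the upward vertical ray from the origin. *)
Definition cr p q : bool :=
  [&& p.1 < 0, 0 <= q.1 & 0 < p.2 * q.1 - p.1 * q.2] ||
  [&& q.1 < 0, 0 <= p.1 & 0 < q.2 * p.1 - q.1 * p.2].

(** Four open half-planes that cover the punctured plane; on each of them [cr] depends additively on
    the end points, so a polygon inside one contributes its two ends only. *)
Definition sd (i s : bool) p : bool :=
  let x := if i then p.2 else p.1 in if s then 0 < x else x < 0.

(** Among the four half-planes the ray meets only the upper one, and there a segment crosses it when
    the first coordinates of its ends differ in sign. *)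
Lemma cr_sd i s p q : sd i s p -> sd i s q -> cr p q = [&& i, s & (p.1 < 0) (+) (q.1 < 0)].
Proof.
case: p q => [a b] [a' b']; rewrite /cr /sd /=; case: i; case: s => /= h1 h2.
- have [a0|a0] := ltP a 0; have [a'0|a'0] := ltP a' 0 => //=.
  + by apply/idP; nra.
  + by apply/idP; nra.
- have [a0|a0] := ltP a 0; have [a'0|a'0] := ltP a' 0 => //=.
  + by rewrite ?orbF; apply/negbTE; rewrite -leNgt; nra.
  + by rewrite ?orbF; apply/negbTE; rewrite -leNgt; nra.
- by rewrite (lt_gtF h1) (lt_gtF h2).
- by rewrite (lt_geF h1) (lt_geF h2) !andbF.
Qed.

Lemma cr_add i s p q r : sd i s p -> sd i s q -> sd i s r -> cr p q (+) cr q r = cr p r.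
Proof.
by move=> hp hq hr; rewrite !(@cr_sd i s) //; case: i {hp hq hr}; case: s => //=; do 3 case: (_ < 0).
Qed.

Lemma crxx p : cr p p = false.
Proof. by rewrite /cr; have [h|h] := ltP p.1 0; rewrite //= ?andbF //; rewrite leNgt h. Qed.

Lemma sd_ex p : p != 0 -> exists i s, sd i s p.
Proof.
move=> p0; have [h|h|h] := ltgtP p.1 0.
- by exists false, false.
- by exists false, true.
have [k|k|k] := ltgtP p.2 0.
- by exists true, false.
- by exists true, true.
by case/eqP: p0; case: p h k => a b /= -> ->.
Qed.

Lemma sd_n0 i s p : sd i s p -> p != 0.
Proof. by apply: contraTneq => ->; case: i; case: s; rewrite /sd /= ltxx. Qed.

Lemma sd_ball p : p != 0 -> exists i s (e : R), 0 < e /\ forall q, `|q - p| < e -> sd i s q.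
Proof.
move=> /sd_ex[i [s h]]; exists i, s, `|if i then p.2 else p.1|; split.
  by rewrite normr_gt0; case: i h; case: s; rewrite /sd /= => h; rewrite ?(gt_eqF h) ?(lt_eqF h).
move=> q; rewrite nrm_lt /= => /andP[h1 h2].
case: i h h1 h2; case: s; rewrite /sd /= => h; rewrite ?(gtr0_norm h) ?(ltr0_norm h) !ltr_norml => /andP[h1 h2] /andP[h3 h4]; lra.
Qed.

Lemma sd_conv i s p q (u : R) : 0 <= u <= 1 -> sd i s p -> sd i s q -> sd i s ((1 - u) *: p + u *: q).
Proof.
case: p q => [a b] [a' b'] u01; rewrite /sd; case: i; case: s => /= h1 h2; rewrite /GRing.scale /=; nra.
Qed.

(** A form of the Lebesgue number lemma; [P x d] stands for a property of the ball of centre [x] and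
    radius [d]. *)
Lemma lebesgue_ball (X : normedModType R) (K : set X) (P : X -> R -> Prop) : compact K ->
  (forall x0, K x0 -> exists e : R, 0 < e /\ forall x d, `|x0 - x| + d < e -> P x d) ->
  exists d : R, 0 < d /\ forall x, K x -> P x d.
Proof.
move=> /compact_near_coveringP cK h.
have [|d0 /= d00 hd] := cK R (nbhs (0 : R)^'+) (fun d x => P x d) _ _; last first.
  exists (d0 / 2); split; first by rewrite divr_gt0.
  move=> x Kx; apply: (hd (d0 / 2)) => //=; last by rewrite divr_gt0.
  by rewrite /ball /= sub0r normrN gtr0_norm ?divr_gt0 //; lra.
move=> x0 /h[e [e0 he]].
exists ([set x | `|x0 - x| < e / 2], [set d | d < e / 2]) => /=.
  split; first by apply/nbhs_ballP; exists (e / 2); [rewrite /= divr_gt0|move=> y; rewrite -ball_normE].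
  by apply: nbhs_right_lt; rewrite divr_gt0.
by move=> [x d] /= [h1 h2]; apply: he; lra.
Qed.

Definition cont01 (X : topologicalType) (f : R -> X) := forall x : R, 0 <= x <= 1 -> {for x, continuous f}.
Definition nz01 gm := forall x : R, 0 <= x <= 1 -> gm x != 0.

Definition fine n gm := forall k, (k < n)%N -> exists i s, forall x : R,
  k%:R / n%:R <= x <= k.+1%:R / n%:R -> sd i s (gm x).

Definition grid n gm : bool := \big[addb/false]_(0 <= k < n) cr (gm (k%:R / n%:R)) (gm (k.+1%:R / n%:R)).

Lemma ndiv01 n k : (k <= n)%N -> (0 < n)%N -> 0 <= (k%:R / n%:R : R) <= 1.
Proof.
move=> kn n0; rewrite divr_ge0 ?ler0n //= ler_pdivrMr ?ltr0n // mul1r ler_nat //.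
Qed.

Lemma ndiv_step n k (x d : R) : (0 < n)%N -> d^-1 < n%:R -> 0 < d ->
  k%:R / n%:R <= x <= k.+1%:R / n%:R -> `|x - k%:R / n%:R| < d.
Proof.
move=> n0 dn d0 /andP[h1 h2]; rewrite ger0_norm ?subr_ge0 //.
have n0' : (0 : R) < n%:R by rewrite ltr0n.
apply: (@le_lt_trans _ _ (n%:R^-1)).
  by move: h2; rewrite -addn1 natrD mulrDl mul1r; lra.
by rewrite -(invrK d) ltf_pV2 // posrE ?invr_gt0.
Qed.

Lemma fine_ex gm : cont01 gm -> nz01 gm -> exists n0, forall n, (n0 <= n)%N -> (0 < n)%N -> fine n gm.
Proof.
move=> cg ng.
have [|d [d0 hd]] := @lebesgue_ball (R^o : normedModType R) `[0, 1]%classic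
  (fun x d => exists i s, forall y : R, `|y - x| < d -> sd i s (gm y)) (@segment_compact R 0 1) _; last first.
  exists (Num.truncn d^-1).+1 => n hn n0 k kn.
  have [|i [s hs]] := hd (k%:R / n%:R) _; first by rewrite /= in_itv /= ndiv01 // ltnW.
  exists i, s => x hx; apply: hs; apply: ndiv_step => //.
  apply: lt_le_trans (truncnS_gt d^-1) _; by rewrite ler_nat.
move=> x0; rewrite /= in_itv /= => x01.
have [i [s [e [e0 he]]]] := sd_ball (ng _ x01).
have nb : nbhs (gm x0) [set q | `|q - gm x0| < e].
  by apply/nbhs2P; exists e.
have /nbhsRP[e' [e'0 he']] := cts_nbhs (cg _ x01) nb.
exists e'; split => // x d xd; exists i, s => y yx; apply: he; apply: he' => /=.
have := ler_distD x y x0; rewrite (distrC x x0); lra.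
Qed.

Lemma cr_chain i s (a : nat -> R * R) m n : (m <= n)%N -> (forall k, (m <= k <= n)%N -> sd i s (a k)) ->
  \big[addb/false]_(m <= k < n) cr (a k) (a k.+1) = cr (a m) (a n).
Proof.
move=> mn; rewrite -(subnKC mn); move: (n - m)%N => l {mn n}.
elim: l => [|l IH] hs; first by rewrite addn0 big_geq // crxx.
rewrite addnS big_nat_recr ?leq_addr //= IH; last first.
  by move=> k /andP[h1 h2]; apply: hs; rewrite h1 addnS leqW.
by apply: (@cr_add i s); apply: hs; lia.
Qed.

Lemma grid_mul n m gm : (0 < n)%N -> (0 < m)%N -> fine n gm -> grid (n * m) gm = grid n gm.
Proof.
move=> n0 m0 hf; rewrite /grid.
have n0' : (n%:R : R) != 0 by rewrite pnatr_eq0 -lt0n.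
have m0' : (m%:R : R) != 0 by rewrite pnatr_eq0 -lt0n.
suff h l : (l <= n)%N -> \big[addb/false]_(0 <= k < l * m) cr (gm (k%:R / (n * m)%:R)) (gm (k.+1%:R / (n * m)%:R))
   = \big[addb/false]_(0 <= k < l) cr (gm (k%:R / n%:R)) (gm (k.+1%:R / n%:R)) by exact: h.
elim: l => [|l IH] ln; first by rewrite mul0n !big_geq.
rewrite big_nat_recr //= -IH; last exact: ltnW.
rewrite (@big_cat_nat _ _ _ (l * m)%N) //=; last by rewrite leq_mul2r leqnSn orbT.
congr addb.
have E k : (k * m)%:R / (n * m)%:R = k%:R / n%:R :> R.
  by rewrite !natrM; field; rewrite n0' m0'.
have [i [s hs]] := hf l ln.
rewrite -(E l) -(E l.+1).
rewrite (@cr_chain i s (fun k => gm (k%:R / (n * m)%:R))) //; first by rewrite leq_mul2r leqnSn orbT.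
move=> k /andP[k1 k2]; apply: hs; rewrite -(E l) -(E l.+1).
have nm : (0 : R) <= ((n * m)%:R)^-1 by rewrite invr_ge0 ler0n.
by rewrite !ler_wpM2r // ler_nat.
Qed.

(** Winding parity about the origin, also for paths that are not closed: the parity of all fine
    enough inscribed polygons. As a classical truth value it is total, and [indE] gives it its
    meaning. *)
Definition ind gm : bool := `[< exists n0, forall n, (n0 <= n)%N -> (0 < n)%N -> grid n gm = true >].

(** Two fine subdivisions have the same parity as their common refinement, by [grid_mul]. *)
Lemma indE gm : cont01 gm -> nz01 gm -> exists n0, forall n, (n0 <= n)%N -> (0 < n)%N ->
  fine n gm /\ grid n gm = ind gm.
Proof.
move=> cg ng; have [n0 hn0] := fine_ex cg ng.
have e n m : (n0 <= n)%N -> (0 < n)%N -> (n0 <= m)%N -> (0 < m)%N -> grid n gm = grid m gm.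
  move=> a1 a2 a3 a4; rewrite -(grid_mul a2 a4 (hn0 _ a1 a2)) mulnC; exact: grid_mul a4 a2 (hn0 _ a3 a4).
exists n0 => n h1 h2; split; first exact: hn0.
rewrite /ind; case gn : (grid n gm); apply/esym/asboolP.
  by exists n0 => m *; rewrite -gn; exact: e.
move=> [n1 h]; have := h (maxn n1 n); rewrite leq_maxl leq_max h2 orbT => /(_ isT isT).
by rewrite (e _ n) ?gn // ?leq_max ?h1 ?h2 ?orbT.
Qed.

Lemma ind_hp i s gm : cont01 gm -> (forall x : R, 0 <= x <= 1 -> sd i s (gm x)) -> ind gm = cr (gm 0) (gm 1).
Proof.
move=> cg hs; have ng : nz01 gm by move=> x /hs; exact: sd_n0.
have [n0 hn0] := indE cg ng; have [_ <-] := hn0 n0.+1 (leqnSn _) isT.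
rewrite /grid (@cr_chain i s (fun k => gm (k%:R / n0.+1%:R))) //.
  by rewrite mul0r divff // pnatr_eq0.
by move=> k /andP[_ kn]; apply: hs; exact: ndiv01.
Qed.

Lemma tele (f : nat -> bool) n : \big[addb/false]_(0 <= k < n) (f k (+) f k.+1) = f 0 (+) f n.
Proof.
elim: n => [|n IH]; first by rewrite big_geq // addbb.
by rewrite big_nat_recr //= IH addbA addbK.
Qed.

Lemma pairl_cts (a : R) : continuous (fun x : R => (a, x)).
Proof. by apply: (@pair_cts R R (cst a) id) => x; [exact: cvg_cst|exact: cvg_id]. Qed.

Lemma pairr_cts (a : R) : continuous (fun x : R => (x, a)).
Proof. by apply: (@pair_cts R R id (cst a)) => x; [exact: cvg_id|exact: cvg_cst]. Qed.

(** Homotopy invariance with free ends: the boundary of a square has parity zero, as a sum over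
    small cells each of which is mapped into one half-plane. *)
Lemma ind_sq (Phi : R -> R -> R * R) :
  (forall x y : R, 0 <= x <= 1 -> 0 <= y <= 1 -> {for (x, y), continuous (fun z : R * R => Phi z.1 z.2)}) ->
  (forall x y : R, 0 <= x <= 1 -> 0 <= y <= 1 -> Phi x y != 0) ->
  ind (Phi 0) (+) ind (Phi 1) = ind (fun x => Phi x 0) (+) ind (fun x => Phi x 1).
Proof.
move=> cP nP.
have c1 a : 0 <= a <= 1 -> cont01 (Phi a).
  move=> a01 x x01; apply: (@continuous_comp _ _ _ (fun x : R => (a, x)) (fun z : R * R => Phi z.1 z.2)); last exact: cP.
  exact: pairl_cts.
have c2 a : 0 <= a <= 1 -> cont01 (fun x => Phi x a).
  move=> a01 x x01; apply: (@continuous_comp _ _ _ (fun x : R => (x, a)) (fun z : R * R => Phi z.1 z.2)); last exact: cP.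
  exact: pairr_cts.
have z01 : 0 <= (0 : R) <= 1 by rewrite lexx ler01.
have o01 : 0 <= (1 : R) <= 1 by rewrite lexx ler01.
have [n1 h1] := indE (c1 0 z01) (fun x => nP 0 x z01).
have [n2 h2] := indE (c1 1 o01) (fun x => nP 1 x o01).
have [n3 h3] := indE (c2 0 z01) (fun x x01 => nP x 0 x01 z01).
have [n4 h4] := indE (c2 1 o01) (fun x x01 => nP x 1 x01 o01).
have [|d [d0 hd]] := @lebesgue_ball (R^o * R^o)%type (`[0, 1]%classic `*` `[0, 1]%classic)
  (fun x d => exists i s, forall y : R * R, `|(y : R^o * R^o) - x| < d -> sd i s (Phi y.1 y.2))
  (compact_setX (@segment_compact R 0 1) (@segment_compact R 0 1)) _.
  move=> [x0 y0] /= [hx hy]; rewrite /= !in_itv /= in hx hy.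
  have [i [s [e [e0 he]]]] := sd_ball (nP _ _ hx hy).
  have nb : nbhs (Phi x0 y0) [set q | `|q - Phi x0 y0| < e].
    by apply/nbhs2P; exists e.
  have /nbhs2P[e' [e'0 he']] := cts_nbhs (cP _ _ hx hy) nb.
  exists e'; split => // x d xd; exists i, s => y yx; apply: he; apply: he' => /=.
  have := ler_distD x y ((x0, y0) : R^o * R^o); rewrite (distrC x); lra.
pose n := (n1 + n2 + n3 + n4 + Num.truncn d^-1).+1.
have n0 : (0 < n)%N by [].
have [_ <-] := h1 n ltac:(rewrite /n; lia) n0; have [_ <-] := h2 n ltac:(rewrite /n; lia) n0.
have [_ <-] := h3 n ltac:(rewrite /n; lia) n0; have [_ <-] := h4 n ltac:(rewrite /n; lia) n0.
have dn : d^-1 < n%:R.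
  apply: lt_le_trans (truncnS_gt d^-1) _; by rewrite ler_nat /n ltnS leq_addl.
pose a j k := Phi (j%:R / n%:R) (k%:R / n%:R).
pose A j := \big[addb/false]_(0 <= k < n) cr (a j k) (a j k.+1).
pose B k := \big[addb/false]_(0 <= j < n) cr (a j k) (a j.+1 k).
have -> : grid n (Phi 0) = A 0 by rewrite /A /a mul0r.
have -> : grid n (Phi 1) = A n by rewrite /A /a divff ?pnatr_eq0.
have -> : grid n (fun x => Phi x 0) = B 0 by rewrite /B /a mul0r.
have -> : grid n (fun x => Phi x 1) = B n by rewrite /B /a divff ?pnatr_eq0.
have cell j k : (j < n)%N -> (k < n)%N ->
   cr (a j k) (a j k.+1) (+) cr (a j.+1 k) (a j.+1 k.+1) = cr (a j k) (a j.+1 k) (+) cr (a j k.+1) (a j.+1 k.+1).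
  move=> jn kn.
  have [|i [s hs]] := hd (j%:R / n%:R, k%:R / n%:R) _.
    by split; rewrite /= in_itv /= ndiv01 // ltnW.
  have S j' k' : (j' == j) || (j' == j.+1) -> (k' == k) || (k' == k.+1) -> sd i s (a j' k').
    move=> hj hk; rewrite /a; apply: (hs (j'%:R / n%:R, k'%:R / n%:R)).
    rewrite nrm_lt /=.
    have st l l' : (l' == l) || (l' == l.+1) -> `|(l'%:R / n%:R : R) - l%:R / n%:R| < d.
      move=> hl; apply: ndiv_step => //.
      have ni : (0 : R) <= (n%:R)^-1 by rewrite invr_ge0 ler0n.
      by rewrite !ler_wpM2r // ler_nat; lia.
    by rewrite !st.
  have S00 := S j k; have S01 := S j k.+1; have S10 := S j.+1 k; have S11 := S j.+1 k.+1.
  rewrite !(@cr_sd i s) ?S00 ?S01 ?S10 ?S11 ?eqxx ?orbT //.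
  by case: i {hs S S00 S01 S10 S11}; case: s => //=; case: (_ < 0); case: (_ < 0); case: (_ < 0); case: (_ < 0).
have rowE j : (j < n)%N -> A j (+) A j.+1 = cr (a j 0) (a j.+1 0) (+) cr (a j n) (a j.+1 n).
  move=> jn; rewrite /A -big_split /= -(@tele (fun k => cr (a j k) (a j.+1 k))).
  by apply: eq_big_nat => k /andP[_ kn]; exact: cell.
rewrite -(@tele A) /B -big_split /=.
by apply: eq_big_nat => j /andP[_ jn]; exact: rowE.
Qed.

End Winding.

End CrossingParity.

(** * Local degree mod 2 of a plane map *)

Module TriangleParity.
Import Discs Embeddings Stars FlatDiscs CrossingParity.
Local Open Scope classical_set_scope.
Local Open Scope ring_scope.

Section Theta.
Variable R : realType.
Implicit Types (p q r : R * R).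

Lemma le3 a b c : [/\ a <= (a + b + c).+1, b <= (a + b + c).+1 & c <= (a + b + c).+1]%N.
Proof. by split; lia. Qed.

Definition seg p q (u : R) : R * R := (1 - u) *: p + u *: q.

Lemma comb_cts (X : topologicalType) (k : X -> R) (v w : X -> R * R) (x : X) :
  {for x, continuous k} -> {for x, continuous v} -> {for x, continuous w} ->
  {for x, continuous (fun y => (1 - k y) *: v y + k y *: w y)}.
Proof.
move=> ck cv cw; apply: cvgD; last exact: cvgZ.
by apply: cvgZ => //; apply: cvgB => //; exact: cvg_cst.
Qed.

Lemma seg_cts p q : continuous (seg p q).
Proof. by move=> x; apply: comb_cts; [exact: cvg_id|exact: cvg_cst|exact: cvg_cst]. Qed.

Lemma conv_lt (u a b m : R) : 0 <= u <= 1 -> a < m -> b < m -> (1 - u) * a + u * b < m.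
Proof. by move=> u01 am bm; have [u1|u1] := ltP u 1; nra. Qed.

Lemma conv_gt0 (u a b : R) : 0 <= u <= 1 -> 0 < a -> 0 < b -> 0 < (1 - u) * a + u * b.
Proof. by move=> u01 am bm; have [u1|u1] := ltP u 1; nra. Qed.

(** This lemma and its variants compare one coordinate of a point of a triangle, with apex at
    [m + k] or [m - k] and opposite side between [a] and [b], with the coordinate [m] of the
    puncture. *)
Lemma triA (x t k a b m : R) : 0 <= x <= 1 -> 0 <= t <= 1 -> 0 < k -> 0 < a - m -> 0 < b - m ->
  (1 - x) * (m + k) + x * ((1 - t) * a + t * b) <> m.
Proof.
move=> x01 t01 k0 a0 b0 e; have h := conv_gt0 t01 a0 b0; have := conv_gt0 x01 k0 h.
suff -> : (1 - x) * k + x * ((1 - t) * (a - m) + t * (b - m)) = 0 by rewrite ltxx.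
by transitivity ((1 - x) * (m + k) + x * ((1 - t) * a + t * b) - m); [ring|rewrite e subrr].
Qed.

Lemma triA' (x t k a b m : R) : 0 <= x <= 1 -> 0 <= t <= 1 -> 0 < k -> a - m < 0 -> b - m < 0 ->
  (1 - x) * (m - k) + x * ((1 - t) * a + t * b) <> m.
Proof.
move=> x01 t01 k0 a0 b0 e; apply: (@triA x t k (- a) (- b) (- m)) => //; [lra|lra|].
by transitivity (- ((1 - x) * (m - k) + x * ((1 - t) * a + t * b))); [ring|rewrite e].
Qed.

Lemma triB (x t k a b m : R) : 0 <= x <= 1 -> 0 <= t <= 1 -> 0 < k -> m <= a -> m <= b ->
  (1 - x) * (m + k) + x * ((1 - t) * a + t * b) = m -> x = 1.
Proof.
move=> x01 t01 k0 a0 b0 e.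
have e' : (1 - x) * k + x * ((1 - t) * (a - m) + t * (b - m)) = 0.
  by transitivity ((1 - x) * (m + k) + x * ((1 - t) * a + t * b) - m); [ring|rewrite e subrr].
have h : 0 <= x * ((1 - t) * (a - m) + t * (b - m)).
  by apply: mulr_ge0; [lra|apply: addr_ge0; apply: mulr_ge0; lra].
nra.
Qed.

Lemma triC (x t k b m : R) : 0 <= x <= 1 -> 0 <= t <= 1 -> 0 < k -> 0 < b - m ->
  (1 - x) * (m + k) + x * ((1 - t) * (m + 0) + t * b) = m -> x = 1 /\ t = 0.
Proof.
move=> x01 t01 k0 b0 e.
have x1 : x = 1 by apply: (triB x01 t01 k0 _ _ e); lra.
split => //; move: e; rewrite x1 => e.
have : t * (b - m) = 0 by lra.
by move/eqP; rewrite mulf_eq0 (gt_eqF b0) orbF => /eqP.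
Qed.

Lemma triC' (x t k b m : R) : 0 <= x <= 1 -> 0 <= t <= 1 -> 0 < k -> b - m < 0 ->
  (1 - x) * (m - k) + x * ((1 - t) * (m + 0) + t * b) = m -> x = 1 /\ t = 0.
Proof.
move=> x01 t01 k0 b0 e; apply: (@triC x t k (- b) (- m)) => //; first lra.
by transitivity (- ((1 - x) * (m - k) + x * ((1 - t) * (m + 0) + t * b))); [ring|rewrite e].
Qed.

Lemma hboxo_comb (c : R * R) (r : R) p q (u : R) : 0 <= u <= 1 -> hboxo c r p -> hboxo c r q ->
  hboxo c r ((1 - u) *: p + u *: q).
Proof.
move=> u01; rewrite /hboxo !nrm_lt /= => /andP[/andP[a1 a2] a3] /andP[/andP[a4 a5] a6].
move: a1 a2 a4 a5; rewrite !ltr_norml /GRing.scale /= => /andP[? ?] /andP[? ?] /andP[? ?] /andP[? ?].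
have h1 := @conv_lt u (p.1 - c.1) (q.1 - c.1) r u01; have h2 := @conv_lt u (p.2 - c.2) (q.2 - c.2) r u01.
have h3 := @conv_lt u (c.1 - p.1) (c.1 - q.1) r u01; have h4 := @conv_lt u (c.2 - p.2) (c.2 - q.2) r u01.
have {}h1 := h1 ltac:(lra) ltac:(lra); have {}h2 := h2 ltac:(lra) ltac:(lra).
have {}h3 := h3 ltac:(lra) ltac:(lra); have {}h4 := h4 ltac:(lra) ltac:(lra).
by apply/andP; split; [apply/andP; split; apply/andP; split; lra|nra].
Qed.

Lemma ind_cst p : ind (fun=> p) = false.
Proof.
rewrite /ind; apply/asboolP => -[n0 /(_ n0.+1 (leqnSn _) isT)].
by rewrite /grid big1 // => k _; exact: crxx.
Qed.

Lemma eq_ind gm gm' : (forall x : R, 0 <= x <= 1 -> gm x = gm' x) -> ind gm = ind gm'.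
Proof.
move=> h; rewrite /ind; congr asbool; apply: propext.
have e n : (0 < n)%N -> grid n gm = grid n gm'.
  by move=> n0; apply: eq_big_nat => k /andP[_ kn]; rewrite !h ?ndiv01 // ltnW.
by split => -[n0 hn]; exists n0 => n h1 h2; [rewrite -e|rewrite e] => //; exact: hn.
Qed.

(* [h] maps a half-box to the plane, [y] is avoided along the straight contraction of the loop. *)
Lemma ind_contract (c : R * R) (r : R) (h : R * R -> R * R) (y : R * R) (lam : R -> R * R) q0 :
  (forall p, hboxo c r p -> {for p, continuous h}) ->
  cont01 lam -> (forall x : R, 0 <= x <= 1 -> hboxo c r (lam x)) -> lam 0 = lam 1 -> hboxo c r q0 ->
  (forall s x : R, 0 <= s <= 1 -> 0 <= x <= 1 -> h ((1 - s) *: lam x + s *: q0) <> y) ->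
  ind (fun x => h (lam x) - y) = false.
Proof.
move=> ch cl hl l01 hq ha.
have := @ind_sq R (fun s x => h ((1 - s) *: lam x + s *: q0) - y).
rewrite /= => H; have {H} := H _ _.
have -> : (fun x => h ((1 - 0) *: lam x + 0 *: q0) - y) = (fun x => h (lam x) - y).
  by apply: funext => x; rewrite subr0 scale1r scale0r addr0.
have -> : (fun x => h ((1 - 1) *: lam x + 1 *: q0) - y) = (fun=> h q0 - y).
  by apply: funext => x; rewrite subrr scale0r scale1r add0r.
rewrite ind_cst addbF l01 addbb; apply.
  move=> s x s01 x01; apply: cvgB; last exact: cvg_cst.
  apply: (@continuous_comp _ _ _ (fun z : R * R => (1 - z.1) *: lam z.2 + z.1 *: q0) h).
    apply: comb_cts; [exact: fst_cts| |exact: cvg_cst].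
    by apply: (@continuous_comp _ _ _ snd lam); [exact: snd_cts|exact: cl].
  by apply: ch; apply: hboxo_comb => //; exact: hl.
by move=> s x s01 x01; rewrite subr_eq0; apply/eqP; exact: ha.
Qed.

Section J.
Variables (c : R * R) (r : R) (h : R * R -> R * R) (p0 : R * R).
Hypothesis ch : forall p, hboxo c r p -> {for p, continuous h}.
Hypothesis nh : forall p, hboxo c r p -> p <> p0 -> h p != 0.

Let sg p q := ind (fun u => h (seg p q u)).

(** [ind_sq] for the square collapsed to the cone with apex [p] over the segment from [q] to [w]. *)
Lemma tri p q w : hboxo c r p -> hboxo c r q -> hboxo c r w ->
  (forall s x : R, 0 <= s <= 1 -> 0 <= x <= 1 -> (1 - x) *: p + x *: seg q w s <> p0) ->
  sg p q (+) sg p w = sg q w.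
Proof.
move=> hp hq hw ha.
have := @ind_sq R (fun s x => h ((1 - x) *: p + x *: seg q w s)).
have -> : (fun x => h ((1 - x) *: p + x *: seg q w 0)) = (fun u => h (seg p q u)).
  by apply: funext => x; rewrite /seg subr0 scale1r scale0r addr0.
have -> : (fun x => h ((1 - x) *: p + x *: seg q w 1)) = (fun u => h (seg p w u)).
  by apply: funext => x; rewrite /seg subrr scale1r scale0r add0r.
have -> : (fun s => h ((1 - 0) *: p + 0 *: seg q w s)) = (fun=> h p).
  by apply: funext => x; rewrite subr0 scale1r scale0r addr0.
have -> : (fun s => h ((1 - 1) *: p + 1 *: seg q w s)) = (fun u => h (seg q w u)).
  by apply: funext => x; rewrite subrr scale1r scale0r add0r.
rewrite ind_cst => H; apply: H.
  move=> s x s01 x01.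
  apply: (@continuous_comp _ _ _ (fun z : R * R => (1 - z.2) *: p + z.2 *: seg q w z.1) h).
    apply: comb_cts; [exact: snd_cts|exact: cvg_cst|].
    by apply: (@continuous_comp _ _ _ fst (seg q w)); [exact: fst_cts|exact: seg_cts].
  by apply: ch; apply: hboxo_comb => //; apply: hboxo_comb.
by move=> s x s01 x01; apply: nh; [apply: hboxo_comb => //; exact: hboxo_comb|exact: ha].
Qed.

(** [J] is the degree mod 2 of [h] at [p0], the parity of [h] along a diamond around [p0]. The
    parity along a short segment is the coboundary of a potential [H], plus [J] when the segment
    crosses the ray above [p0]; along a closed loop the potential cancels. *)
Lemma windJ : hboxo c r p0 -> 0 < p0.2 -> exists J : bool, forall lam : R -> R * R,
  cont01 lam -> (forall x : R, 0 <= x <= 1 -> hboxo c r (lam x) /\ lam x <> p0) -> lam 0 = lam 1 ->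
  ind (fun x => h (lam x)) = J && ind (fun x => lam x - p0).
Proof.
move=> hp0 p02.
have [dl [dl0 hdl]] : exists dl : R, 0 < dl /\ forall a b : R, `|a| <= dl -> `|b| <= dl -> hboxo c r (p0 + (a, b)).
  move: (hp0); rewrite /hboxo => /andP[h1 _].
  pose dl := Num.min ((r - `|p0 - c|) / 2) p0.2.
  have d1 : dl <= (r - `|p0 - c|) / 2 by rewrite /dl ge_min lexx.
  have d2 : dl <= p0.2 by rewrite /dl ge_min lexx orbT.
  exists dl; split; first by rewrite /dl lt_min p02 divr_gt0 // subr_gt0.
  move=> a b a1 b1; apply/andP; split.
    have : `|p0 + (a, b) - c| <= `|p0 - c| + `|(a, b)|.
      by rewrite addrAC; exact: ler_normD.
    have : `|((a, b) : R * R)| <= dl by rewrite nrm_le /= a1 b1.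
    lra.
  by rewrite /=; move: b1; rewrite ler_norml => /andP[? ?]; lra.
pose eR := p0 + (dl, 0); pose eL := p0 + (- dl, 0); pose d := p0 + (0, - dl); pose u := p0 + (0, dl).
have ndl : `|dl| <= dl by rewrite gtr0_norm.
have ndl' : `|- dl| <= dl by rewrite normrN gtr0_norm.
have n0 : `|0 : R| <= dl by rewrite normr0 ltW.
have hR : hboxo c r eR by apply: hdl. have hL : hboxo c r eL by apply: hdl.
have hd : hboxo c r d by apply: hdl. have hu : hboxo c r u by apply: hdl.
(* From [d] along the side of the diamond on which [p] lies, then straight to [p]. *)
pose H p := if p0.1 <= p.1 then sg d eR (+) sg eR p else sg d eL (+) sg eL p.
pose J := sg u eR (+) sg u eL (+) (sg d eR (+) sg d eL).
have pE (p : R * R) : p = p0 -> p.1 = p0.1 /\ p.2 = p0.2 by move=> ->.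
have av (w : R * R) i s : w = p0 -> sd i s (w - p0) -> False.
  by move=> ->; rewrite subrr => /sd_n0; rewrite eqxx.
have sgC p q : hboxo c r p -> hboxo c r q -> (exists i s, sd i s (p - p0) /\ sd i s (q - p0)) -> sg p q = sg q p.
  move=> hp hq [i [s [sp sq]]].
  have sc x : 0 <= x <= 1 -> sd i s (seg q p x - p0).
    move=> x01; have := sd_conv x01 sq sp.
    suff -> : (1 - x) *: (q - p0) + x *: (p - p0) = seg q p x - p0 by [].
    by rewrite /seg !scalerBr addrACA -opprD -scalerDl subrK scale1r.
  rewrite -(@tri p q p) //; last first.
    move=> t x t01 x01 e; apply: (av _ i s e).
    have := sd_conv x01 sp (sc t t01).
    suff -> : (1 - x) *: (p - p0) + x *: (seg q p t - p0) = (1 - x) *: p + x *: seg q p t - p0 by [].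
    by rewrite !scalerBr addrACA -opprD -scalerDl subrK scale1r.
  have -> : sg p p = false.
    by rewrite /sg -[RHS](ind_cst (h p)); apply: eq_ind => x _; rewrite /seg -scalerDl subrK scale1r.
  by rewrite addbF.
(* Ends on different sides of [p0] are compared through [u] when they are above it and through [d]
   when below; only the first way picks up [J]. *)
have mixed p q i s : hboxo c r p -> hboxo c r q -> sd i s (p - p0) -> sd i s (q - p0) ->
    p0.1 <= p.1 -> q.1 < p0.1 ->
    sg p q = sg d eR (+) sg eR p (+) (sg d eL (+) sg eL q) (+) (J && [&& i & s]).
  move=> hp hq sp sq pr ql.
  case: i sp sq; case: s => sp sq; rewrite /= ?andbF ?andbT ?addbF.
  + have s1 : 0 < p.2 - p0.2 by []. have s2 : 0 < q.2 - p0.2 by [].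
    rewrite -(tri hu hp hq); last first.
      by move=> t x t01 x01 e; have [_ h1] := pE _ e; exact: (triA x01 t01 dl0 s1 s2 h1).
    rewrite -(tri hu hR hp); last first.
      move=> t x t01 x01 e; have [h2 h1] := pE _ e; have [x1 t0] := triC x01 t01 dl0 s1 h1.
      by move: h2; rewrite x1 t0 /seg /u /eR /= subrr scale0r add0r scale1r subr0 scale1r scale0r addr0; lra.
    rewrite -(tri hu hL hq); last first.
      move=> t x t01 x01 e; have [h2 h1] := pE _ e; have [x1 t0] := triC x01 t01 dl0 s2 h1.
      by move: h2; rewrite x1 t0 /seg /u /eL /= subrr scale0r add0r scale1r subr0 scale1r scale0r addr0; lra.
    by rewrite /J; case: (sg u p); case: (sg u q); case: (sg u eR); case: (sg u eL); case: (sg d eR); case: (sg d eL).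
  + have s1 : p.2 - p0.2 < 0 by []. have s2 : q.2 - p0.2 < 0 by [].
    rewrite -(tri hd hp hq); last first.
      by move=> t x t01 x01 e; have [_ h1] := pE _ e; exact: (triA' x01 t01 dl0 s1 s2 h1).
    rewrite -(tri hd hR hp); last first.
      move=> t x t01 x01 e; have [h2 h1] := pE _ e; have [x1 t0] := triC' x01 t01 dl0 s1 h1.
      by move: h2; rewrite x1 t0 /seg /d /eR /= subrr scale0r add0r scale1r subr0 scale1r scale0r addr0; lra.
    rewrite -(tri hd hL hq); last first.
      move=> t x t01 x01 e; have [h2 h1] := pE _ e; have [x1 t0] := triC' x01 t01 dl0 s2 h1.
      by move: h2; rewrite x1 t0 /seg /d /eL /= subrr scale0r add0r scale1r subr0 scale1r scale0r addr0; lra.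
    by case: (sg d p); case: (sg d q); case: (sg d eR); case: (sg d eL).
  + by exfalso; move: sq; rewrite /sd /=; lra.
  + by exfalso; move: sp; rewrite /sd /=; lra.
have key p q i s : hboxo c r p -> hboxo c r q -> sd i s (p - p0) -> sd i s (q - p0) ->
    sg p q = H p (+) H q (+) (J && cr (p - p0) (q - p0)).
  move=> hp hq sp sq; rewrite (cr_sd sp sq) /H /J.
  have sc x : 0 <= x <= 1 -> sd i s (seg p q x - p0).
    move=> x01; have := sd_conv x01 sp sq.
    suff -> : (1 - x) *: (p - p0) + x *: (q - p0) = seg p q x - p0 by [].
    rewrite /seg !scalerBr addrACA -opprD -scalerDl subrK scale1r //.
  have [pr|pl] := leP p0.1 p.1; have [qr|ql] := leP p0.1 q.1; rewrite /= ?subr_lt0.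
  - rewrite !ltNge pr qr /= !andbF addbF -(tri hR hp hq); first by case: (sg d eR); case: (sg eR p); case: (sg eR q).
    move=> t x t01 x01 e; have [h1 _] := pE _ e.
    have x1 := triB x01 t01 dl0 pr qr h1.
    by apply: (av _ i s _ (sc t t01)); move: e; rewrite x1 subrr scale0r scale1r add0r.
  - have -> : (p.1 < p0.1) = false by rewrite ltNge pr.
    by rewrite ql /= andbT; exact: (mixed p q i s).
  - have -> : (q.1 < p0.1) = false by rewrite ltNge qr.
    rewrite pl /= andbT (sgC p q) //; last by exists i, s.
    by rewrite (mixed q p i s) //; congr addb; exact: addbC.
  - rewrite pl ql /= !andbF addbF -(tri hL hp hq); first by case: (sg d eL); case: (sg eL p); case: (sg eL q).
    move=> t x t01 x01 e; have [h1 _] := pE _ e.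
    by apply: (triA' x01 t01 dl0 _ _ h1); rewrite subr_lt0.
exists J => lam cl hl l01.
have ch' : cont01 (fun x => h (lam x)).
  move=> x x01; apply: (@continuous_comp _ _ _ lam h); first exact: cl.
  by apply: ch; have [] := hl x x01.
have nh' : nz01 (fun x => h (lam x)) by move=> x x01; have [? ?] := hl x x01; exact: nh.
have cl' : cont01 (fun x => lam x - p0) by move=> x x01; apply: cvgB; [exact: cl|exact: cvg_cst].
have nl' : nz01 (fun x => lam x - p0).
  by move=> x x01; have [_ ?] := hl x x01; rewrite subr_eq0; apply/eqP.
have [n1 h1] := indE ch' nh'; have [n2 h2] := indE cl' nl'.
have [|dd [dd0 hdd]] := @lebesgue_ball R (R^o : normedModType R) `[0, 1]%classic
  (fun x dd => exists i s, forall y1 y2 w : R, `|y1 - x| < dd -> `|y2 - x| < dd -> 0 <= w <= 1 ->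
     sd i s (h (seg (lam y1) (lam y2) w))) (@segment_compact R 0 1).
  move=> x0; rewrite /= in_itv /= => x01.
  have [i [s [e [e0 he]]]] := sd_ball (nh' _ x01).
  have nb : nbhs (h (lam x0)) [set q | `|q - h (lam x0)| < e] by apply/nbhs2P; exists e.
  have /nbhs2P[e' [e'0 he']] := cts_nbhs (ch (proj1 (hl _ x01))) nb.
  have nb' : nbhs (lam x0) [set q | `|q - lam x0| < e'] by apply/nbhs2P; exists e'.
  have /nbhsRP[e2 [e20 he2]] := cts_nbhs (cl _ x01) nb'.
  exists e2; split => // x dd xd; exists i, s => y1 y2 w yx1 yx2 w01; apply: he; apply: he' => /=.
  have b1 : `|lam y1 - lam x0| < e'.
    by apply: he2; have := ler_distD x y1 x0; rewrite (distrC x x0); lra.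
  have b2 : `|lam y2 - lam x0| < e'.
    by apply: he2; have := ler_distD x y2 x0; rewrite (distrC x x0); lra.
  have -> : seg (lam y1) (lam y2) w - lam x0 = (1 - w) *: (lam y1 - lam x0) + w *: (lam y2 - lam x0).
    by rewrite /seg !scalerBr addrACA -opprD -scalerDl subrK scale1r.
  apply: le_lt_trans (ler_normD _ _) _; rewrite !normrZ !ger0_norm; [|lra|lra].
  exact: conv_lt.
pose n := (n1 + n2 + Num.trunc dd^-1).+1.
have n00 : (0 < n)%N by [].
have [n1n n2n _] := le3 n1 n2 (Num.trunc dd^-1); rewrite -/n in n1n n2n.
have [_ <-] := h1 n n1n n00; have [f2 <-] := h2 n n2n n00.
have dn : dd^-1 < n%:R.
  by apply: lt_le_trans (truncnS_gt dd^-1) _; rewrite ler_nat /n ltnS leq_addl.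
pose l k := lam (k%:R / n%:R).
have cell k : (k < n)%N -> cr (h (l k)) (h (l k.+1)) = H (l k) (+) H (l k.+1) (+) (J && cr (l k - p0) (l k.+1 - p0)).
  move=> kn.
  have ni : (0 : R) <= (n%:R)^-1 by rewrite invr_ge0 ler0n.
  have [i [s hs]] := f2 k kn.
  have [k1 k2] : 0 <= (k%:R / n%:R : R) <= 1 /\ 0 <= (k.+1%:R / n%:R : R) <= 1.
    by rewrite !ndiv01 // ltnW.
  rewrite -(@key _ _ i s); [|by have [] := hl _ k1|by have [] := hl _ k2| |].
  - have [|i' [s' hs']] := hdd (k%:R / n%:R); first by rewrite /= in_itv.
    have a1 : `|(k%:R / n%:R : R) - k%:R / n%:R| < dd by rewrite subrr normr0.
    have a2 : `|(k.+1%:R / n%:R : R) - k%:R / n%:R| < dd.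
      by apply: ndiv_step => //; rewrite lexx andbT ler_wpM2r // ler_nat.
    have e0 : seg (l k) (l k.+1) 0 = l k by rewrite /seg subr0 scale1r scale0r addr0.
    have e1 : seg (l k) (l k.+1) 1 = l k.+1 by rewrite /seg subrr scale0r scale1r add0r.
    rewrite /sg (@ind_hp _ i' s'); first by rewrite e0 e1.
      move=> w w01; apply: (@continuous_comp _ _ _ (seg (l k) (l k.+1)) h); first exact: seg_cts.
      by apply: ch; apply: hboxo_comb => //; [have [] := hl _ k1|have [] := hl _ k2].
    by move=> w w01; exact: hs'.
  - by apply: hs; rewrite lexx ler_wpM2r // ler_nat.
  - by apply: hs; rewrite lexx andbT ler_wpM2r // ler_nat.
rewrite /grid (eq_big_nat _ _ (F2 := fun k => H (l k) (+) H (l k.+1) (+) (J && cr (l k - p0) (l k.+1 - p0)))); last first.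
  by move=> k /andP[_ kn]; exact: cell.
rewrite big_split /= tele.
have -> : l n = l 0 by rewrite /l mul0r divff ?pnatr_eq0.
rewrite addbb addFb; case: (J) => //=.
by rewrite big1.
Qed.

End J.

End Theta.

End TriangleParity.

(** * Concatenation of paths and a test loop *)

Module LoopHomotopy.
Import Discs Embeddings Stars FlatDiscs CrossingParity TriangleParity.
Local Open Scope classical_set_scope.
Local Open Scope ring_scope.

Section Loop.
Variable R : realType.
Implicit Types (p q r : R * R).

Lemma ind_cat (al be : R -> R * R) : cont01 al -> cont01 be -> nz01 al -> nz01 be ->
  continuous al -> continuous be -> al 1 = be 0 ->
  ind (fun x => if x <= 1 / 2 then al (2 * x + 0) else be (2 * x + (-1))) = ind al (+) ind be.
Proof.
move=> ca cb na nb cca ccb ab; set ga := fun x => _.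
have e12 : (2 * (1 / 2) + 0 : R) = 1 /\ (2 * (1 / 2) + -1 : R) = 0 by split; lra.
have cg : cont01 ga.
  move=> x _; apply: glue_cts; [exact: affine_cts|exact: affine_cts|].
  by case: e12 => -> ->.
have ng : nz01 ga.
  by move=> x x01; rewrite /ga; case: ifP => h; [apply: na; lra|apply: nb; move/negbT: h; rewrite -ltNge; lra].
have [n1 h1] := indE ca na; have [n2 h2] := indE cb nb; have [n3 h3] := indE cg ng.
pose n := (n1 + n2 + n3).+1.
have [n1n n2n n3n] := le3 n1 n2 n3; rewrite -/n in n1n n2n n3n.
have [_ <-] := h1 n n1n isT; have [_ <-] := h2 n n2n isT.
(* An even number of pieces makes the junction a point of the grid. *)
have [_ <-] := h3 (n + n)%N (leq_trans n3n (leq_addr _ _)) isT.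
have nn : (n%:R : R) != 0 by rewrite pnatr_eq0.
have n0 : (0 : R) < n%:R by rewrite ltr0n.
have E k : k%:R / (n + n)%:R = (k%:R / n%:R) / 2 :> R by rewrite addnn -muln2 natrM invfM mulrA.
rewrite /grid (@big_cat_nat _ _ _ n) ?leq_addr //=; congr addb.
  apply: eq_big_nat => k /andP[_ kn]; rewrite /ga !E.
  have k1 := @ndiv01 R n k (ltnW kn) isT; have k2 := @ndiv01 R n k.+1 kn isT.
  rewrite !ifT; [|lra|lra]; congr (cr (al _) (al _)); lra.
rewrite -{1}[n]add0n big_addn addnK; apply: eq_big_nat => k /andP[_ kn]; rewrite /ga !E.
have k1 := @ndiv01 R n k (ltnW kn) isT; have k2 := @ndiv01 R n k.+1 kn isT.
have e k' : ((k' + n)%:R / n%:R : R) = k'%:R / n%:R + 1 by rewrite natrD; field.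
rewrite -addSn !e.
have B k' : 0 <= (k'%:R / n%:R : R) -> (if (k'%:R / n%:R + 1) / 2 <= 1 / 2 :> R then al (2 * ((k'%:R / n%:R + 1) / 2) + 0)
   else be (2 * ((k'%:R / n%:R + 1) / 2) + -1)) = be (k'%:R / n%:R).
  move=> k0; case: ifP => h; last by congr be; lra.
  have -> : k'%:R / n%:R = 0 :> R by lra.
  by rewrite -ab; congr al; lra.
by rewrite !B.
Qed.

(** A small loop of parity 1, with which the degree of a chart change is computed. *)
Lemma square_loop (e : R) : 0 < e -> exists mu : R -> R * R, [/\ continuous mu, mu 0 = mu 1,
  (forall x : R, 0 <= x <= 1 -> mu x != 0 /\ `|mu x| <= e) & ind mu = true].
Proof.
move=> e0.
pose a : R * R := (e, - e); pose b : R * R := (e, e); pose c : R * R := (- e, e); pose d : R * R := (- e, - e).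
have sc p q : continuous (seg p q) by exact: seg_cts.
have sc' p q : cont01 (seg p q) by move=> x _; exact: sc.
have s0 p q : seg p q 0 = p by rewrite /seg subr0 scale1r scale0r addr0.
have s1 p q : seg p q 1 = q by rewrite /seg subrr scale0r scale1r add0r.
have sdh i s p q x : sd i s p -> sd i s q -> 0 <= x <= 1 -> sd i s (seg p q x).
  by move=> hp hq x01; exact: sd_conv.
have e2 : - e < 0 by rewrite oppr_lt0.
have i1 : ind (seg a b) = false.
  rewrite (@ind_hp R false true) //; last by move=> x x01; exact: sdh.
  by rewrite s0 s1 (@cr_sd R false true).
have i2 : ind (seg b c) = true.
  rewrite (@ind_hp R true true) //; last by move=> x x01; exact: sdh.
  by rewrite s0 s1 (@cr_sd R true true) //= ltNge (ltW e0) e2.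
have i3 : ind (seg c d) = false.
  rewrite (@ind_hp R false false) //; last by move=> x x01; exact: sdh.
  by rewrite s0 s1 (@cr_sd R false false).
have i4 : ind (seg d a) = false.
  rewrite (@ind_hp R true false) //; last by move=> x x01; exact: sdh.
  by rewrite s0 s1 (@cr_sd R true false).
have nz i s p q : sd i s p -> sd i s q -> nz01 (seg p q).
  by move=> hp hq x x01; apply: (@sd_n0 R i s); exact: sdh.
have n1 : nz01 (seg a b) by apply: (nz false true).
have n2 : nz01 (seg b c) by apply: (nz true true).
have n3 : nz01 (seg c d) by apply: (nz false false).
have n4 : nz01 (seg d a) by apply: (nz true false).
pose cat (f g : R -> R * R) x := if x <= 1 / 2 then f (2 * x + 0) else g (2 * x + (-1)).
have catc (f g : R -> R * R) : continuous f -> continuous g -> f 1 = g 0 -> continuous (cat f g).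
  move=> cf cg fg; apply: glue_cts; [exact: affine_cts|exact: affine_cts|].
  by have -> : 2 * (1 / 2) + 0 = 1 :> R by [lra]; have -> : 2 * (1 / 2) + -1 = 0 :> R by lra.
have cat0 (f g : R -> R * R) : cat f g 0 = f 0.
  by rewrite /cat ifT; [congr f; lra|lra].
have cat1 (f g : R -> R * R) : cat f g 1 = g 1.
  by rewrite /cat ifF; [congr g; lra|apply/negbTE; rewrite -ltNge; lra].
have catP (P : R * R -> Prop) (f g : R -> R * R) : (forall x : R, 0 <= x <= 1 -> P (f x)) -> (forall x : R, 0 <= x <= 1 -> P (g x)) ->
    forall x : R, 0 <= x <= 1 -> P (cat f g x).
  by move=> hf hg x x01; rewrite /cat; case: ifP => h; [apply: hf; lra|apply: hg; move/negbT: h; rewrite -ltNge; lra].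
have c1 := catc _ _ (sc a b) (sc b c) (etrans (s1 _ _) (esym (s0 _ _))).
have c2 := catc _ _ (sc c d) (sc d a) (etrans (s1 _ _) (esym (s0 _ _))).
have m12 : cat (seg a b) (seg b c) 1 = cat (seg c d) (seg d a) 0 by rewrite cat1 cat0 s1 s0.
exists (cat (cat (seg a b) (seg b c)) (cat (seg c d) (seg d a))); split.
- exact: catc.
- by rewrite cat0 cat0 s0 cat1 cat1 s1.
- have nrm p : (p = a) \/ (p = b) \/ (p = c) \/ (p = d) -> `|p| <= e.
    move=> h; rewrite nrm_le; case: h => [->|[->|[->|->]]]; rewrite /= ?normrN gtr0_norm // lexx //.
  have sn p q x : `|p| <= e -> `|q| <= e -> 0 <= x <= 1 -> `|seg p q x| <= e.
    move=> hp hq x01; apply: le_trans (ler_normD _ _) _; rewrite !normrZ !ger0_norm; [nra|lra|lra].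
  apply: (catP (fun p => p != 0 /\ `|p| <= e)); apply: (catP (fun p => p != 0 /\ `|p| <= e)) => x x01;
   split; [exact: n1|apply: sn => //; apply: nrm; tauto|exact: n2|apply: sn => //; apply: nrm; tauto|
    exact: n3|apply: sn => //; apply: nrm; tauto|exact: n4|apply: sn => //; apply: nrm; tauto].
- rewrite (@ind_cat (cat (seg a b) (seg b c)) (cat (seg c d) (seg d a))) //.
  + rewrite (@ind_cat (seg a b) (seg b c)) ?(@ind_cat (seg c d) (seg d a)) ?s0 ?s1 //.
    by rewrite i1 i2 i3 i4.
  + by move=> x _; exact: c1.
  + by move=> x _; exact: c2.
  + exact: (catP (fun p => p != 0)).
  + exact: (catP (fun p => p != 0)).
Qed.

End Loop.

End LoopHomotopy.

(** * Independence of the winding parity from the chart *)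

Module BoundaryCharts.
Import Discs Embeddings Stars FlatDiscs CrossingParity TriangleParity LoopHomotopy.
Local Open Scope classical_set_scope.
Local Open Scope ring_scope.

Section ThetaT.
Variables (R : realType) (T : topologicalType).
Implicit Types (f : T -> R * R) (g : R * R -> T) (c q p : R * R) (r : R) (l : R -> T).

Definition oset g c r : set T := g @` [set p | hboxo c r p].

Definition Ix f g c r l (x : T) : bool := `[< oset g c r x >] && ind (fun u => f (l u) - f x).

Lemma oset_gf f g c r x : disc f g c r -> oset g c r x ->
  [/\ g (f x) = x, hboxo c r (f x) & {for x, continuous f}].
Proof.
move=> D [p /= hp <-]; rewrite (disc_fg D (hboxoW hp)); split => //.
by apply: (disc_f D).
Qed.

Lemma oset_inj f g c r x y : disc f g c r -> oset g c r x -> oset g c r y -> f x = f y -> x = y.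
Proof. by move=> D /(oset_gf D)[gx _ _] /(oset_gf D)[gy _ _] e; rewrite -gx e gy. Qed.

Lemma oset_open f g c r : disc f g c r -> open (oset g c r).
Proof. exact: disc_open. Qed.

Lemma hboxo_ball c r p : hboxo c r p -> exists e : R, 0 < e /\ forall q, `|q - p| <= e -> 0 <= q.2 -> hboxo c r q.
Proof.
move=> /andP[h1 h2]; exists ((r - `|p - c|) / 2); split; first by rewrite divr_gt0 // subr_gt0.
move=> q h3 h4; rewrite /hboxo h4 andbT; have := ler_distD p q c; lra.
Qed.

Lemma chart_ball f g c r x (N : set T) : disc f g c r -> oset g c r x -> nbhs x N ->
  exists e : R, 0 < e /\ forall q, `|q - f x| <= e -> 0 <= q.2 -> hboxo c r q /\ N (g q).
Proof.
move=> D Ox Nx; have [gx hx _] := oset_gf D Ox.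
have [e1 [e10 he1]] := hboxo_ball hx.
rewrite -gx in Nx; have /nbhs2P[e2 [e20 he2]] := cts_nbhs (disc_g D (x := f x)) Nx.
exists (Num.min e1 (e2 / 2)); split; first by rewrite lt_min e10 divr_gt0.
move=> q; rewrite le_min => /andP[h1 h2] q2; split; first exact: he1.
by apply: he2; lra.
Qed.

(** The loop is contracted in the small chart without meeting [x]: to the centre if [x] is outside,
    and to a point above [x] if [x] is on the edge of the half-plane. *)
Lemma theta_bd f g c r fq gq cq rq l x : disc f g c r -> disc fq gq cq rq ->
  (forall p, hboxo cq rq p -> oset g c r (gq p)) -> cont01 l ->
  (forall u : R, 0 <= u <= 1 -> oset gq cq rq (l u)) -> l 0 = l 1 ->
  (forall u : R, 0 <= u <= 1 -> l u <> x) -> oset g c r x -> ~ oset gq cq rq x \/ (fq x).2 = 0 ->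
  ind (fun u => f (l u) - f x) = false.
Proof.
move=> D Dq sub cl lq l01 nx Ox hx.
pose lam u := fq (l u).
have clam : cont01 lam.
  move=> u u01; apply: (@continuous_comp _ _ _ l fq); first exact: cl.
  by have [] := oset_gf Dq (lq u u01).
have hlam u : 0 <= u <= 1 -> hboxo cq rq (lam u) by move=> u01; have [] := oset_gf Dq (lq u u01).
have ch p : hboxo cq rq p -> {for p, continuous (f \o gq)}.
  move=> hp; apply: continuous_comp; first exact: (disc_g Dq).
  by have [] := oset_gf D (sub p hp).
have -> : ind (fun u => f (l u) - f x) = ind (fun u => (f \o gq) (lam u) - f x).
  by apply: eq_ind => u u01 /=; have [-> _ _] := oset_gf Dq (lq u u01).
have finj p : hboxo cq rq p -> f (gq p) = f x -> oset gq cq rq x /\ p = fq x.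
  move=> hp e; have ex := oset_inj D (sub p hp) Ox e.
  by split; [exists p|rewrite -ex (disc_fg Dq (hboxoW hp))].
have hc : hboxo cq rq cq by rewrite /hboxo subrr normr0 (disc_r Dq) (disc_c Dq).
have [nOq|Oq] := pselect (oset gq cq rq x); last first.
  apply: (@ind_contract R cq rq (f \o gq) (f x) lam cq) => //; first by rewrite /lam l01.
  by move=> s u s01 u01 /= e; have [|? _] := finj _ _ e; [apply: hboxo_comb => //; exact: hlam|].
have p02 : (fq x).2 = 0 by case: hx.
have [gx hp0 _] := oset_gf Dq nOq.
have [e [e0 he]] := hboxo_ball hp0.
pose q0 := fq x + (0, e).
have hq0 : hboxo cq rq q0.
  apply: he; last by rewrite /= p02 add0r ltW.
  by rewrite /q0 addrAC subrr add0r nrm_le /= normr0 gtr0_norm // lexx ltW.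
apply: (@ind_contract R cq rq (f \o gq) (f x) lam q0) => //; first by rewrite /lam l01.
move=> s u s01 u01 /= ee.
have [|_ e1] := finj _ _ ee; first by apply: hboxo_comb => //; exact: hlam.
have l2 : 0 <= (lam u).2 by have /andP[] := hlam u u01.
have : (1 - s) * (lam u).2 + s * e = 0.
  have : ((1 - s) *: lam u + s *: q0).2 = 0 by rewrite e1.
  by rewrite /= p02 add0r.
move=> e2; have s0 : s = 0.
  have h1 : 0 <= (1 - s) * (lam u).2 by apply: mulr_ge0 => //; lra.
  have : s * e = 0 by apply/eqP; rewrite eq_le mulr_ge0 ?andbT; [lra|lra|lra].
  by move/eqP; rewrite mulf_eq0 (gt_eqF e0) orbF => /eqP.
move: e1; rewrite s0 subr0 scale1r scale0r addr0 /lam => e1.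
by apply: (nx u u01); exact: (oset_inj Dq (lq u u01) nOq e1).
Qed.

(** A change of charts has degree 1 mod 2. The case of a point on the edge for the large chart but
    not for the small one is excluded by [theta_bd] with the charts exchanged. *)
Lemma theta f g c r fq gq cq rq l x : disc f g c r -> disc fq gq cq rq ->
  (forall p, hboxo cq rq p -> oset g c r (gq p)) -> cont01 l ->
  (forall u : R, 0 <= u <= 1 -> oset gq cq rq (l u)) -> l 0 = l 1 ->
  (forall u : R, 0 <= u <= 1 -> l u <> x) ->
  Ix f g c r l x = Ix fq gq cq rq l x.
Proof.
move=> D Dq sub cl lq l01 nx; rewrite /Ix.
have [Ox|nO] := pselect (oset g c r x); last first.
  rewrite !asboolF // => -[p hp px]; apply: nO; rewrite -px; exact: sub.
rewrite (asboolT Ox) /=.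
have [Oq|nOq] := pselect (oset gq cq rq x); last first.
  by rewrite (asboolF nOq) /=; apply: (theta_bd D Dq) => //; left.
rewrite (asboolT Oq) /=.
have subq p : hboxo cq rq p -> oset gq cq rq (gq p) by exists p.
have [gx hp0 cfq] := oset_gf Dq Oq; have [gfx hy cfx] := oset_gf D Ox.
have [p02|p02] := eqVneq (fq x).2 0.
  by rewrite (theta_bd D Dq) ?(theta_bd Dq Dq) //; right.
have {p02}p02 : 0 < (fq x).2 by rewrite lt_neqAle eq_sym p02; case/andP: hp0.
have ch p : hboxo cq rq p -> {for p, continuous (fun p => f (gq p) - f x)}.
  move=> hp; apply: cvgB; last exact: cvg_cst.
  apply: (@continuous_comp _ _ _ gq f); first exact: (disc_g Dq).
  by have [] := oset_gf D (sub p hp).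
have nh p : hboxo cq rq p -> p <> fq x -> f (gq p) - f x != 0.
  move=> hp np; rewrite subr_eq0; apply/eqP => e; apply: np.
  by rewrite -(oset_inj D (sub p hp) Ox e) (disc_fg Dq (hboxoW hp)).
have [J hJ] := windJ ch nh hp0 p02.
(* A small loop of parity 1 around [f x], read in the small chart, would have parity 0 if [J] were
   false. *)
have J1 : J = true.
  have nOq := open_nbhs_nbhs (conj (oset_open Dq) Oq).
  have [e [e0 he]] := chart_ball D Ox nOq.
  have [y2|y2] := eqVneq (f x).2 0; last first.
    have {}y2 : 0 < (f x).2 by rewrite lt_neqAle eq_sym y2; case/andP: hy.
    pose e' := Num.min e (f x).2.
    have [|mu [cmu mu01 hmu imu]] := @square_loop R e'; first by rewrite lt_min e0.
    have hm u : 0 <= u <= 1 -> hboxo c r (f x + mu u) /\ oset gq cq rq (g (f x + mu u)).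
      move=> u01; have [_ ] := hmu u u01; rewrite le_min => /andP[h1 h2].
      apply: he; first by rewrite addrAC subrr add0r.
      by move: h2; rewrite nrm_le => /andP[_]; rewrite ler_norml /= => /andP[? _]; lra.
    have := hJ (fun u => fq (g (f x + mu u))).
    have -> : ind (fun u => f (gq (fq (g (f x + mu u)))) - f x) = true.
      rewrite -imu; apply: eq_ind => u u01; have [h1 h2] := hm u u01.
      by have [-> _ _] := oset_gf Dq h2; rewrite (disc_fg D (hboxoW h1)) addrAC subrr add0r.
    move=> H; case: (J) H => // H; symmetry; apply: H.
    + move=> u u01; have [h1 h2] := hm u u01.
      apply: (@continuous_comp _ _ _ (fun u => g (f x + mu u)) fq); last by have [] := oset_gf Dq h2.
      apply: (@continuous_comp _ _ _ (fun u => f x + mu u) g); last exact: (disc_g D).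
      by apply: cvgD; [exact: cvg_cst|exact: cmu].
    + move=> u u01; have [h1 h2] := hm u u01; have [_ ? _] := oset_gf Dq h2; split => //.
      move=> /(oset_inj Dq h2 Oq) => h3; have [/eqP m0 _] := hmu u u01; apply: m0.
      have : f (g (f x + mu u)) = f x by rewrite h3.
      rewrite (disc_fg D (hboxoW h1)) => /eqP; rewrite -subr_eq0 addrAC subrr add0r => /eqP //.
    + by rewrite mu01.
  exfalso.
  have [e1 [e10 he1]] := hboxo_ball hy.
  pose e2 := Num.min (e / 2) ((r - `|f x - c|)).
  have e20 : 0 < e2 by rewrite lt_min divr_gt0 //= subr_gt0; case/andP: hy.
  have D' : disc f g (f x) e2.
    apply: (sub_disc D) => //; first by rewrite y2.
    by rewrite -lerBrDl ge_min lexx orbT.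
  have sub' p : hboxo (f x) e2 p -> oset gq cq rq (g p).
    move=> /andP[h1 h2]; have [] // := he p _ h2.
    have : e2 <= e / 2 by rewrite ge_min lexx.
    by lra.
  have Ox' : oset g (f x) e2 x by exists (f x) => //; rewrite /= /hboxo subrr normr0 e20 y2 lexx.
  have nO' := open_nbhs_nbhs (conj (oset_open D') Ox').
  have [e3 [e30 he3]] := chart_ball Dq Oq nO'.
  have [|mu [cmu mu01 hmu imu]] := @square_loop R (Num.min e3 (fq x).2); first by rewrite lt_min e30.
  have hm u : 0 <= u <= 1 -> hboxo cq rq (fq x + mu u) /\ oset g (f x) e2 (gq (fq x + mu u)).
    move=> u01; have [_ ] := hmu u u01; rewrite le_min => /andP[h1 h2].
    apply: he3; first by rewrite addrAC subrr add0r.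
    by move: h2; rewrite nrm_le => /andP[_]; rewrite ler_norml /= => /andP[? _]; lra.
  have := @theta_bd fq gq cq rq f g (f x) e2 (fun u => gq (fq x + mu u)) x Dq D' sub'.
  have -> : ind (fun u => fq (gq (fq x + mu u)) - fq x) = true.
    rewrite -imu; apply: eq_ind => u u01; have [h1 h2] := hm u u01.
    by rewrite (disc_fg Dq (hboxoW h1)) addrAC subrr add0r.
  move=> H; suff : true = false by [].
  apply: H => //.
  + move=> u u01; apply: (@continuous_comp _ _ _ (fun u => fq x + mu u) gq); last exact: (disc_g Dq).
    by apply: cvgD; [exact: cvg_cst|exact: cmu].
  + by move=> u u01; have [_ ?] := hm u u01.
  + by rewrite mu01.
  + move=> u u01 h3; have [h1 h2] := hm u u01; have [/eqP m0 _] := hmu u u01; apply: m0.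
    have : fq (gq (fq x + mu u)) = fq x by rewrite h3.
    by rewrite (disc_fg Dq (hboxoW h1)) => /eqP; rewrite -subr_eq0 addrAC subrr add0r => /eqP.
  + by right.
have := hJ (fun u => fq (l u)); rewrite J1 /= => <-.
- by apply: eq_ind => u u01; have [-> _ _] := oset_gf Dq (lq u u01).
- move=> u u01; apply: (@continuous_comp _ _ _ l fq); first exact: cl.
  by have [] := oset_gf Dq (lq u u01).
- move=> u u01; have [_ ? _] := oset_gf Dq (lq u u01); split => //.
  by move=> /(oset_inj Dq (lq u u01) Oq); exact: nx.
- by rewrite l01.
Qed.

End ThetaT.

End BoundaryCharts.

(** * Winding parities of paths in a chart, and change of chart *)

Module PathParity.
Import Discs Embeddings Stars FlatDiscs CrossingParity TriangleParity LoopHomotopy BoundaryCharts.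
Local Open Scope classical_set_scope.
Local Open Scope ring_scope.

Section Charts.
Variables (R : realType) (T : topologicalType).

Record chart := Chart { cf : T -> R * R; cg : R * R -> T; cc : R * R; crad : R; cD : disc cf cg cc crad }.

Implicit Types (i j q : chart) (x y b : T) (l ta : R -> T).

Definition Oc i : set T := oset (cg i) (cc i) (crad i).
Definition Kc (k : R) i : set T := dset (cg i) (cc i) (k * crad i).
Definition Ic i l x : bool := Ix (cf i) (cg i) (cc i) (crad i) l x.

Lemma Ocf i x : Oc i x -> {for x, continuous (cf i)}.
Proof. by move=> /(oset_gf (cD i))[]. Qed.

Lemma Oc_inj i x y : Oc i x -> Oc i y -> cf i x = cf i y -> x = y.
Proof. exact: oset_inj (cD i). Qed.

Lemma Ic_out i l x : ~ Oc i x -> Ic i l x = false.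
Proof. by move=> h; rewrite /Ic /Ix asboolF. Qed.

Lemma Ic_in i l x : Oc i x -> Ic i l x = ind (fun u => cf i (l u) - cf i x).
Proof. by move=> h; rewrite /Ic /Ix asboolT. Qed.

Lemma KcO k i x : k < 1 -> Kc k i x -> Oc i x.
Proof.
move=> k1 [p /= /andP[h1 h2] <-]; exists p => //=; rewrite /hboxo h2 andbT.
by apply: le_lt_trans h1 _; rewrite gtr_pMl // (disc_r (cD i)).
Qed.

Lemma cr_sym (p q : R * R) : cr p q = cr q p.
Proof. by rewrite /cr orbC. Qed.

Lemma ind_rev (gm : R -> R * R) : ind (fun u => gm (1 - u)) = ind gm.
Proof.
rewrite /ind; congr asbool; apply: propext.
have e n : (0 < n)%N -> grid n (fun u => gm (1 - u)) = grid n gm.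
  move=> n0; rewrite /grid big_nat_rev /=; apply: eq_big_nat => k /andP[_ kn].
  have n0' : (n%:R : R) != 0 by rewrite pnatr_eq0 -lt0n.
  rewrite add0n cr_sym; congr (cr (gm _) (gm _)).
    by rewrite subnSK // natrB ?(ltnW kn) //; field.
  by rewrite natrB //; field.
by split => -[n0 hn]; exists n0 => n h1 h2; [rewrite -e|rewrite e] => //; exact: hn.
Qed.

Definition clamp01 (u : R) := clampR 0 1 u.
Lemma clamp01_id (u : R) : 0 <= u <= 1 -> clamp01 u = u.
Proof. exact: clampR_id. Qed.
Lemma clamp01_in (u : R) : 0 <= clamp01 u <= 1.
Proof. by apply: clampR_in; exact: ler01. Qed.

Definition cat l ta (u : R) := if u <= 1 / 2 then l (2 * u + 0) else ta (2 * u + (-1)).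

Lemma cat_cts l ta : continuous l -> continuous ta -> l 1 = ta 0 -> continuous (cat l ta).
Proof.
move=> cl ct e x; apply: glue_cts.
- by apply: affine_cts.
- by apply: affine_cts.
- by rewrite -[LHS]/(l _) -[RHS]/(ta _); congr (_ = _) : e; [congr l|congr ta]; lra.
Qed.

Lemma cat_in l ta (P : T -> Prop) : (forall u : R, 0 <= u <= 1 -> P (l u)) -> (forall u : R, 0 <= u <= 1 -> P (ta u)) ->
  forall u : R, 0 <= u <= 1 -> P (cat l ta u).
Proof.
by move=> h1 h2 u u01; rewrite /cat; case: ifP => h; [apply: h1; lra|apply: h2; move/negbT: h; rewrite -ltNge; lra].
Qed.

Lemma cat0 l ta : cat l ta 0 = l 0.
Proof. by rewrite /cat ifT; [congr l; lra|lra]. Qed.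
Lemma cat1 l ta : cat l ta 1 = ta 1.
Proof. by rewrite /cat ifF; [congr ta; lra|apply/negbTE; rewrite -ltNge; lra]. Qed.

Lemma Ic_cat i l ta x : continuous l -> continuous ta -> l 1 = ta 0 ->
  (forall u : R, 0 <= u <= 1 -> Oc i (l u) /\ l u <> x) -> (forall u : R, 0 <= u <= 1 -> Oc i (ta u) /\ ta u <> x) ->
  Ic i (cat l ta) x = Ic i l x (+) Ic i ta x.
Proof.
move=> cl ct e hl ht.
have [Ox|nO] := pselect (Oc i x); last by rewrite !Ic_out.
rewrite !Ic_in //.
pose al u := cf i (l (clamp01 u)) - cf i x; pose be u := cf i (ta (clamp01 u)) - cf i x.
have C m : continuous m -> (forall u : R, 0 <= u <= 1 -> Oc i (m u) /\ m u <> x) ->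
    continuous (fun u => cf i (m (clamp01 u)) - cf i x).
  move=> cm hm u; apply: cvgB; last exact: cvg_cst.
  apply: (@continuous_comp _ _ _ (fun u => m (clamp01 u)) (cf i)).
    by apply: (@continuous_comp _ _ _ clamp01 m); [exact: clampR_cts|exact: cm].
  by apply: Ocf; have [] := hm _ (clamp01_in u).
have N m : (forall u : R, 0 <= u <= 1 -> Oc i (m u) /\ m u <> x) ->
    nz01 (fun u => cf i (m (clamp01 u)) - cf i x).
  move=> hm u u01; rewrite subr_eq0; apply/eqP; have [h1 h2] := hm _ (clamp01_in u).
  by move=> /(Oc_inj h1 Ox).
have ca := C _ cl hl; have cb := C _ ct ht.
have E m : ind (fun u => cf i (m u) - cf i x) = ind (fun u => cf i (m (clamp01 u)) - cf i x).
  by apply: eq_ind => u u01; rewrite clamp01_id.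
rewrite (E l) (E ta) -(@ind_cat _ al be) //.
- apply: eq_ind => u u01; rewrite /cat /al /be; case: ifP => h; rewrite clamp01_id //; first lra.
  by move/negbT: h; rewrite -ltNge; lra.
- by move=> u _; exact: ca.
- by move=> u _; exact: cb.
- exact: N.
- exact: N.
- by rewrite /al /be !clamp01_id ?e ?lexx ?ler01.
Qed.

Lemma Ic_rev i l x : Ic i (fun u => l (1 - u)) x = Ic i l x.
Proof. by rewrite /Ic /Ix (ind_rev (fun u => cf i (l u) - cf i x)). Qed.

Lemma rev_cts l : continuous l -> continuous (fun u : R => l (1 - u)).
Proof.
move=> cl u; apply: (@continuous_comp _ _ _ (fun u : R => 1 - u) l); last exact: cl.
by apply: cvgB; [exact: cvg_cst|exact: cvg_id].
Qed.

Lemma theta2 i q l ta x : (forall y, Oc q y -> Oc i y) -> continuous l -> continuous ta ->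
  l 0 = ta 0 -> l 1 = ta 1 ->
  (forall u : R, 0 <= u <= 1 -> Oc q (l u) /\ l u <> x) -> (forall u : R, 0 <= u <= 1 -> Oc q (ta u) /\ ta u <> x) ->
  Ic i l x (+) Ic i ta x = Ic q l x (+) Ic q ta x.
Proof.
move=> sub cl ct e0 e1 hl ht.
have cr := rev_cts ct.
have hr (u : R) : 0 <= u <= 1 -> Oc q (ta (1 - u)) /\ ta (1 - u) <> x by move=> u01; apply: ht; lra.
have e1' : l 1 = ta (1 - 0) by rewrite subr0.
have cc := cat_cts cl cr e1'.
rewrite -(Ic_rev i ta) -(Ic_rev q ta) -!Ic_cat //.
- have hc := @cat_in _ _ (fun y => Oc q y /\ y <> x) hl hr.
  apply: theta; [exact: cD|exact: cD| | | | |].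
  + by move=> p hp; apply: sub; exists p.
  + by move=> u _; exact: cc.
  + by move=> u u01; have [] := hc u u01.
  + by rewrite cat0 cat1 subrr.
  + by move=> u u01; have [] := hc u u01.
- by move=> u u01; have [h1 h2] := hl u u01; split => //; exact: sub.
- by move=> u u01; have [h1 h2] := hr u u01; split => //; exact: sub.
Qed.

Definition adm q y b x ta := [/\ continuous ta, ta 0 = y, ta 1 = b & forall u : R, 0 <= u <= 1 -> Oc q (ta u) /\ ta u <> x].

(** By [theta2] the parities of a path of [q], seen in [i] and in [j], add up to a number that
    depends on its ends only. It corrects the change of chart at a junction of a loop. *)
Definition conn i j q y b x : bool := `[< exists ta, adm q y b x ta /\ Ic i ta x (+) Ic j ta x >].

Lemma connE i j q y b x ta : (forall y, Oc q y -> Oc i y) -> (forall y, Oc q y -> Oc j y) ->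
  adm q y b x ta -> conn i j q y b x = Ic i ta x (+) Ic j ta x.
Proof.
move=> hi hj a; apply/asboolP/idP => [[ta' [a' h]]|h]; last by exists ta.
case: a a' => [c1 e1 e2 h1] [c2 e3 e4 h2].
have E1 := @theta2 i q ta ta' x hi c1 c2 _ _ h1 h2; have E2 := @theta2 j q ta ta' x hj c1 c2 _ _ h1 h2.
move: h E1 E2; rewrite e1 e2 e3 e4 => h /(_ erefl erefl) E1 /(_ erefl erefl) E2.
by move: h E1 E2; do 4!case: (Ic _ _ _) => //; do 2!case: (Ic _ _ _) => //.
Qed.

End Charts.

End PathParity.

(** * Avoiding a point, and the variation of a parity with the point *)

Module Detours.
Import Discs Embeddings Stars FlatDiscs CrossingParity TriangleParity LoopHomotopy BoundaryCharts PathParity.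
Local Open Scope classical_set_scope.
Local Open Scope ring_scope.

Section Charts2.
Variables (R : realType) (T : topologicalType).
Implicit Types (i j q : chart R T) (x y b : T) (l ta : R -> T).

Lemma detour_alg (d1 d2 u v e : R) : u * d1 * (1 - v) = - (v * e * d2) -> u * d2 * (1 - v) = v * e * d1 ->
  e != 0 -> u != 0 -> (d1, d2) != 0 -> False.
Proof.
move=> h1 h2 e0 u0 d0.
have n : d1 ^+ 2 + d2 ^+ 2 != 0.
  apply: contra d0 => /eqP h; apply/eqP.
  have [k1 k2] : d1 ^+ 2 = 0 /\ d2 ^+ 2 = 0 by have := sqr_ge0 d1; have := sqr_ge0 d2; lra.
  by move/eqP: k1; move/eqP: k2; rewrite !sqrf_eq0 => /eqP -> /eqP ->.
have : v * e * (d1 ^+ 2 + d2 ^+ 2) = 0.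
  have -> : v * e * (d1 ^+ 2 + d2 ^+ 2) = v * e * d1 * d1 - (- (v * e * d2)) * d2 by ring.
  by rewrite -h1 -h2; ring.
move/eqP; rewrite !mulf_eq0 (negbTE e0) (negbTE n) !orbF => /eqP v0.
move: h1 h2; rewrite v0 subr0 !mulr1 !mul0r oppr0 => /eqP; rewrite mulf_eq0 (negbTE u0) /= => /eqP d10.
by move=> /eqP; rewrite mulf_eq0 (negbTE u0) /= => /eqP d20; move: d0; rewrite d10 d20 eqxx.
Qed.

(** If the segment runs through [z], it is bent through a point displaced from [z] perpendicularly
    to it. The sign of [e] selects the side on which the second coordinate does not decrease, so the
    detour stays in the half-plane. *)
Lemma detour (c : R * R) r (p p' z : R * R) : hboxo c r p -> hboxo c r p' -> p <> z -> p' <> z ->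
  exists w, hboxo c r w /\ forall u : R, 0 <= u <= 1 -> seg p w u <> z /\ seg w p' u <> z.
Proof.
move=> hp hp' pz pz'.
have [H|H] := pselect (exists2 u : R, 0 <= u <= 1 & seg p p' u = z); last first.
  exists p; split => // u u01; split; last by move=> h; apply: H; exists u.
  by rewrite /seg -scalerDl subrK scale1r.
case: H => u u01 ez.
have [e0 [e00 he]] : exists e : R, 0 < e /\ forall q0 : R * R, `|q0 - z| <= e -> 0 <= q0.2 -> hboxo c r q0.
  by apply: hboxo_ball; rewrite -ez; exact: hboxo_comb.
pose d1 := (p' - p).1; pose d2 := (p' - p).2.
have d0 : (d1, d2) != 0.
  apply/eqP => -[k1 k2]; apply: pz; rewrite -ez /seg; have -> : p' = p by apply/eqP; rewrite -subr_eq0; apply/eqP; case: (p' - p) @d1 @d2 k1 k2 => a b /= -> ->.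
  by rewrite -scalerDl subrK scale1r.
have z2 : 0 <= z.2 by rewrite -ez; have /andP[] := hboxo_comb u01 hp hp'.
pose M := 1 + `|d1| + `|d2|.
have M0 : 0 < M by rewrite /M; have := normr_ge0 d1; have := normr_ge0 d2; lra.
pose e := (if 0 <= d1 then 1 else -1) * (e0 / M).
have ene : e != 0.
  by apply: mulf_neq0; [case: ifP => _; rewrite ?oppr_eq0 oner_eq0|rewrite gt_eqF ?divr_gt0].
have eb : `|e| = e0 / M.
  by rewrite /e normrM (gtr0_norm (divr_gt0 e00 M0)); case: ifP; rewrite ?normrN normr1 mul1r.
have ed : 0 <= e * d1.
  rewrite /e; have k := divr_gt0 e00 M0; case: ifP => h; first by rewrite mul1r mulr_ge0 // ltW.
  by move/negbT: h; rewrite -ltNge => h; rewrite mulN1r mulNr -mulrN mulr_ge0 ?(ltW k) // oppr_ge0 ltW.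
pose w : R * R := (z.1 - e * d2, z.2 + e * d1).
have nu : u != 0 by apply/eqP => u0; apply: pz; rewrite -ez /seg u0 subr0 scale1r scale0r addr0.
have nu' : 1 - u != 0 by apply/eqP => u0; apply: pz'; rewrite -ez /seg u0 scale0r add0r (_ : u = 1) ?scale1r //; lra.
have hw : hboxo c r w.
  apply: he; last by rewrite /= addr_ge0.
  have B d : `|d| <= M -> `|e * d| <= e0.
    by move=> h; rewrite normrM eb mulrAC ler_pdivrMr // ler_wpM2l // ltW.
  by rewrite nrm_le /=; apply/andP; split; rewrite addrAC subrr add0r ?normrN; apply: B; rewrite /M;
    have := normr_ge0 d1; have := normr_ge0 d2; lra.
exists w; split => // v v01.
have e1 : z.1 = (1 - u) * p.1 + u * p'.1 by rewrite -ez.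
have e2 : z.2 = (1 - u) * p.2 + u * p'.2 by rewrite -ez.
split => h.
- have k1 : (1 - v) * p.1 + v * (z.1 - e * d2) = z.1 by rewrite -[RHS](congr1 fst h).
  have k2 : (1 - v) * p.2 + v * (z.2 + e * d1) = z.2 by rewrite -[RHS](congr1 snd h).
  apply: (@detour_alg d1 d2 u v e) => //.
    by move: k1; rewrite /d1 /= e1 => k1; clear -k1; lra.
  by move: k2; rewrite /d2 /= e2 => k2; clear -k2; lra.
- have k1 : (1 - v) * (z.1 - e * d2) + v * p'.1 = z.1 by rewrite -[RHS](congr1 fst h).
  have k2 : (1 - v) * (z.2 + e * d1) + v * p'.2 = z.2 by rewrite -[RHS](congr1 snd h).
  apply: (@detour_alg d1 d2 (u - 1) (1 - v) e) => //; last by rewrite -oppr_eq0 opprB.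
    by move: k1; rewrite /d1 /= e1 => k1; clear -k1; lra.
  by move: k2; rewrite /d2 /= e2 => k2; clear -k2; lra.
Qed.

Lemma seg0 (p q : R * R) : seg p q 0 = p.
Proof. by rewrite /seg subr0 scale1r scale0r addr0. Qed.
Lemma seg1 (p q : R * R) : seg p q 1 = q.
Proof. by rewrite /seg subrr scale0r scale1r add0r. Qed.

Lemma adm_ex q y b x : Oc q y -> Oc q b -> y <> x -> b <> x -> exists ta, adm q y b x ta.
Proof.
move=> Oy Ob yx bx.
have OI p : hboxo (cc q) (crad q) p -> Oc q (cg q p) by move=> hp; exists p.
have [gy hy _] := oset_gf (cD q) Oy; have [gb hb _] := oset_gf (cD q) Ob.
have [w [hw H]] : exists w, hboxo (cc q) (crad q) w /\ forall u : R, 0 <= u <= 1 ->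
    cg q (seg (cf q y) w u) <> x /\ cg q (seg w (cf q b) u) <> x.
  have [Ox|nO] := pselect (Oc q x); last first.
    exists (cf q y); split => // u u01.
    by split => h; apply: nO; rewrite -h; apply: OI; apply: hboxo_comb.
  have yz : cf q y <> cf q x by move=> /(Oc_inj Oy Ox).
  have bz : cf q b <> cf q x by move=> /(Oc_inj Ob Ox).
  have [w [hw h]] := detour hy hb yz bz.
  exists w; split => // u u01; have [h1 h2] := h u u01.
  split => e; [apply: h1|apply: h2]; rewrite -e.
    by rewrite (disc_fg (cD q)) //; apply: hboxoW; exact: hboxo_comb.
  by rewrite (disc_fg (cD q)) //; apply: hboxoW; exact: hboxo_comb.
have C p p' : continuous (fun u => cg q (seg p p' u)).
  by move=> u; apply: (@continuous_comp _ _ _ (seg p p') (cg q)); [exact: seg_cts|exact: (disc_g (cD q))].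
exists (cat (fun u => cg q (seg (cf q y) w u)) (fun u => cg q (seg w (cf q b) u))); split.
- by apply: cat_cts => //; rewrite seg0 seg1.
- by rewrite cat0 seg0.
- by rewrite cat1 seg1.
- apply: (@cat_in _ _ _ _ (fun p => Oc q p /\ p <> x)) => u u01; have [h1 h2] := H u u01; split => //.
    by apply: OI; apply: hboxo_comb.
  by apply: OI; apply: hboxo_comb.
Qed.

(* Horizontal position of [y] below [x], seen in the chart [i]. *)
Definition hpos i x y : bool :=
  [&& `[< Oc i x >], (cf i x).2 < (cc i).2 - 3 / 4 * crad i & (cf i y).1 < (cf i x).1].

(** When the observed point moves along [si], the parity of a disjoint path changes by the
    difference of this function at the two ends of the path. The first case is for [si] in the
    chart; the second is meant for [si] outside the disc of ratio 3/4, where [hpos] is a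
    primitive. *)
Definition Ee i (si : R -> T) y : bool :=
  if `[< forall u : R, 0 <= u <= 1 -> Oc i (si u) >] then ind (fun u => cf i y - cf i (si u))
  else hpos i (si 0) y (+) hpos i (si 1) y.

(** A point outside the box sees the whole path in one half-plane, and its upward ray can meet the
    path only if the point is below the box. *)
Lemma Ic_hpos i l x : cont01 l -> (forall u : R, 0 <= u <= 1 -> Kc (3 / 4) i (l u)) -> ~ Kc (3 / 4) i x ->
  Ic i l x = hpos i x (l 0) (+) hpos i x (l 1).
Proof.
move=> cl hl nK; rewrite /hpos.
have [Ox|nO] := pselect (Oc i x); last by rewrite Ic_out // (asboolF nO).
rewrite (asboolT Ox) Ic_in //=.
have hb (u : R) : 0 <= u <= 1 -> hbox (cc i) (3 / 4 * crad i) (cf i (l u)).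
  move=> /hl[p /= hp <-]; rewrite (disc_fg (cD i)) //; apply: hbox_le hp.
  by have := disc_r (cD i); lra.
have [gx hx _] := oset_gf (cD i) Ox.
have nb : ~ hbox (cc i) (3 / 4 * crad i) (cf i x) by move=> h; apply: nK; exists (cf i x).
have x2 : 0 <= (cf i x).2 by case/andP: hx.
have cl' : cont01 (fun u => cf i (l u) - cf i x).
  move=> u u01; apply: cvgB; last exact: cvg_cst.
  apply: (@continuous_comp _ _ _ l (cf i)); first exact: cl.
  by apply: Ocf; apply: KcO (hl u u01); lra.
set k := 3 / 4 * crad i in hb nb *.
have hb1 (u : R) : 0 <= u <= 1 -> [/\ (cc i).1 - k <= (cf i (l u)).1, (cf i (l u)).1 <= (cc i).1 + k,
     (cc i).2 - k <= (cf i (l u)).2 & (cf i (l u)).2 <= (cc i).2 + k].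
  move=> /hb /andP[]; rewrite nrm_le !ler_norml /= => /andP[/andP[h1 h2] /andP[h3 h4]] _; split; lra.
have o0 : 0 <= (0 : R) <= 1 by rewrite lexx ler01.
have o1 : 0 <= (1 : R) <= 1 by rewrite lexx ler01.
have [lo|hi] := ltP (cf i x).2 ((cc i).2 - k).
  rewrite (@ind_hp R true true) //; last first.
    by move=> u u01; rewrite /sd /=; have [_ _ + _] := hb1 u u01; lra.
  rewrite (@cr_sd R true true) /sd /= ?subr_gt0; first by rewrite !subr_lt0.
    by have [_ _ + _] := hb1 0 o0; lra.
  by have [_ _ + _] := hb1 1 o1; lra.
have [hi2|lo2] := ltP ((cc i).2 + k) (cf i x).2.
  rewrite (@ind_hp R true false) //; last first.
    by move=> u u01; rewrite /sd /=; have [_ _ _ +] := hb1 u u01; lra.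
  rewrite (@cr_sd R true false) /sd /= ?subr_lt0 //.
    by have [_ _ _ +] := hb1 0 o0; lra.
  by have [_ _ _ +] := hb1 1 o1; lra.
have [h1|h1] := ltP (cf i x).1 ((cc i).1 - k).
  rewrite (@ind_hp R false true) //; last first.
    by move=> u u01; rewrite /sd /=; have [+ _ _ _] := hb1 u u01; lra.
  rewrite (@cr_sd R false true) /sd /= ?subr_gt0 //.
    by have [+ _ _ _] := hb1 0 o0; lra.
  by have [+ _ _ _] := hb1 1 o1; lra.
have [h2|h2] := ltP ((cc i).1 + k) (cf i x).1.
  rewrite (@ind_hp R false false) //; last first.
    by move=> u u01; rewrite /sd /=; have [_ + _ _] := hb1 u u01; lra.
  rewrite (@cr_sd R false false) /sd /= ?subr_lt0 //.
    by have [_ + _ _] := hb1 0 o0; lra.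
  by have [_ + _ _] := hb1 1 o1; lra.
exfalso; apply: nb; rewrite /hbox x2 andbT nrm_le !ler_norml /=; apply/andP; split; lra.
Qed.

(** If [si] is in the chart, these are the four sides of the square of differences between points of
    [l] and points of [si]. *)
Lemma Ic_Ee i l si : cont01 l -> cont01 si -> (forall u : R, 0 <= u <= 1 -> Kc (3 / 4) i (l u)) ->
  (forall u v : R, 0 <= u <= 1 -> 0 <= v <= 1 -> l u <> si v) ->
  (forall u : R, 0 <= u <= 1 -> Oc i (si u)) \/ (forall u : R, 0 <= u <= 1 -> ~ Kc (3 / 4) i (si u)) ->
  Ic i l (si 0) (+) Ic i l (si 1) = Ee i si (l 0) (+) Ee i si (l 1).
Proof.
move=> cl cs hl ha hs.
have o0 : 0 <= (0 : R) <= 1 by rewrite lexx ler01.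
have o1 : 0 <= (1 : R) <= 1 by rewrite lexx ler01.
have hlO (u : R) : 0 <= u <= 1 -> Oc i (l u) by move=> u01; apply: KcO (hl u u01); lra.
rewrite /Ee; case: asboolP => [H|H]; last first.
  have {}hs : forall u : R, 0 <= u <= 1 -> ~ Kc (3 / 4) i (si u) by case: hs.
  rewrite (Ic_hpos cl hl (hs 0 o0)) (Ic_hpos cl hl (hs 1 o1)).
  by do 4 case: (hpos _ _ _).
rewrite (Ic_in _ (H 0 o0)) (Ic_in _ (H 1 o1)).
rewrite -(@ind_sq R (fun v u => cf i (l v) - cf i (si u))) //. 
- move=> v u v01 u01; apply: cvgB.
    apply: (@continuous_comp _ _ _ (fun z : R * R => l z.1) (cf i)); last by apply: Ocf; exact: hlO.
    by apply: (@continuous_comp _ _ _ fst l); [exact: fst_cts|exact: cl].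
  apply: (@continuous_comp _ _ _ (fun z : R * R => si z.2) (cf i)); last by apply: Ocf; exact: H.
  by apply: (@continuous_comp _ _ _ snd si); [exact: snd_cts|exact: cs].
- by move=> v u v01 u01; rewrite subr_eq0; apply/eqP => /(Oc_inj (hlO v v01) (H u u01)); exact: ha.
Qed.

End Charts2.

End Detours.

(** * Parity of a segment, and sums mod 2 *)

Module SegmentParity.
Import Discs Embeddings Stars FlatDiscs CrossingParity TriangleParity LoopHomotopy BoundaryCharts PathParity Detours.
Local Open Scope classical_set_scope.
Local Open Scope ring_scope.

Section Segs.
Variable R : realType.

Lemma lin_neg (a d s t : R) : 0 <= d -> s <= t -> a + t * d < 0 -> a + s * d < 0.
Proof. by move=> h1 h2; apply: le_lt_trans; rewrite lerD2l ler_wpM2r. Qed.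

(** The determinant of two consecutive subdivision points is a positive multiple of that of the
    ends, so the crossings telescope over the sign of the first coordinate. *)
Lemma ind_seg (p q : R * R) : (forall u : R, 0 <= u <= 1 -> seg p q u != 0) -> ind (seg p q) = cr p q.
Proof.
move=> nz; have [|n0 hn] := @indE R (seg p q) _ nz; first by move=> u _; exact: seg_cts.
have [_ <-] := hn n0.+1 (leqnSn _) isT; rewrite /grid; set n := n0.+1.
pose X := p.2 * q.1 - p.1 * q.2.
pose s k : R := k%:R / n%:R.
have sS k : s k < s k.+1 by rewrite /s ltr_pM2r ?invr_gt0 ?ltr0n // ltr_nat.
have s0 : s 0%N = 0 by rewrite /s mul0r.
have s1 : s n = 1 by rewrite /s divff // pnatr_eq0.
have a1 u : (seg p q u).1 = (1 - u) * p.1 + u * q.1 by [].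
have a2 u : (seg p q u).2 = (1 - u) * p.2 + u * q.2 by [].
have e1 u : (seg p q u).1 = p.1 + u * (q.1 - p.1) by rewrite a1; ring.
have eX k : (seg p q (s k)).2 * (seg p q (s k.+1)).1 - (seg p q (s k)).1 * (seg p q (s k.+1)).2 = (s k.+1 - s k) * X.
  by rewrite !a1 !a2 /X; ring.
have eX' k : (seg p q (s k.+1)).2 * (seg p q (s k)).1 - (seg p q (s k.+1)).1 * (seg p q (s k)).2 = (s k.+1 - s k) * - X.
  by rewrite !a1 !a2 /X; ring.
have d0 k : 0 < s k.+1 - s k by rewrite subr_gt0.
have eC k : cr (seg p q (s k)) (seg p q (s k.+1)) =
   [&& (seg p q (s k)).1 < 0, 0 <= (seg p q (s k.+1)).1 & 0 < X] ||
   [&& (seg p q (s k.+1)).1 < 0, 0 <= (seg p q (s k)).1 & 0 < - X].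
  by rewrite /cr eX eX' !pmulr_rgt0.
have E : cr p q = [&& p.1 < 0, 0 <= q.1 & 0 < X] || [&& q.1 < 0, 0 <= p.1 & 0 < - X].
  by rewrite /cr /X opprB (mulrC q.2) (mulrC q.1).
have [dp|dn] := leP 0 (q.1 - p.1).
  have neg k : (seg p q (s k.+1)).1 < 0 -> (seg p q (s k)).1 < 0.
    by rewrite !e1; apply: lin_neg => //; exact: ltW.
  rewrite (eq_bigr (fun k => ((seg p q (s k)).1 < 0) && (0 < X) (+) ((seg p q (s k.+1)).1 < 0) && (0 < X))).
    rewrite (@tele (fun k => ((seg p q (s k)).1 < 0) && (0 < X))) s0 s1 seg0 seg1 E !leNgt.
    have : q.1 < 0 -> p.1 < 0 by lra.
    by case: (q.1 < 0) => [->|_] //=; case: (p.1 < 0) => //=; rewrite ?orbF ?addbF ?addbb.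
  move=> k _; rewrite eC !leNgt; have := neg k.
  by case: (_ < 0) => [->|_] //=; rewrite ?addbb //; case: (_ < 0) => //=; rewrite ?orbF ?addbF.
have neg k : (seg p q (s k)).1 < 0 -> (seg p q (s k.+1)).1 < 0.
  rewrite !e1; have := d0 k; have : 0 < - (q.1 - p.1) by lra.
  move=> h1 h2; have : 0 < (s k.+1 - s k) * - (q.1 - p.1) by apply: mulr_gt0.
  by rewrite mulrN mulrBl; lra.
rewrite (eq_bigr (fun k => ((seg p q (s k)).1 < 0) && (0 < - X) (+) ((seg p q (s k.+1)).1 < 0) && (0 < - X))).
  rewrite (@tele (fun k => ((seg p q (s k)).1 < 0) && (0 < - X))) s0 s1 seg0 seg1 E !leNgt.
  have : p.1 < 0 -> q.1 < 0 by lra.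
  by case: (p.1 < 0) => [->|_] //=; rewrite ?addbb //; case: (q.1 < 0) => //=; rewrite ?orbF ?addbF.
move=> k _; rewrite eC !leNgt; have := neg k.
by case: ((seg p q (s k)).1 < 0) => [->|_] //=; rewrite ?addbb //; case: (_ < 0) => //=; rewrite ?orbF ?addbF.
Qed.

Lemma addb_shift (A B : nat -> bool) m :
  \big[addb/false]_(0 <= k < m.+1) (A k (+) B k) =
  A 0%N (+) B m (+) \big[addb/false]_(0 <= k < m) (B k (+) A k.+1).
Proof.
elim: m => [|m IH]; first by rewrite big_nat1 big_geq // addbF.
rewrite big_nat_recr //= IH [in RHS]big_nat_recr //=.
move: (\big[addb/false]_(_ <= _ < _) _) (A 0%N) (B m) (A m.+1) (B m.+1).
by do 5 case.
Qed.

(** Only the parity of the number of uses of a label counts, so loops with equal parities get equal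
    sums. *)
Lemma par_sum (Q : finType) (G : Q -> bool) (lab : nat -> Q) m :
  \big[addb/false]_(0 <= k < m) G (lab k) =
  \big[addb/false]_(q : Q) ((\big[addb/false]_(0 <= k < m) (lab k == q)) && G q).
Proof.
have -> : \big[addb/false]_(q : Q) ((\big[addb/false]_(0 <= k < m) (lab k == q)) && G q) =
          \big[addb/false]_(q : Q) \big[addb/false]_(0 <= k < m) ((lab k == q) && G q).
  by apply: eq_bigr => q _; rewrite big_distrl.
rewrite exchange_big /=; apply: eq_bigr => k _.
rewrite (bigD1 (lab k)) //= eqxx /= big1 ?addbF // => q; rewrite eq_sym => /negbTE -> //.
Qed.

End Segs.

End SegmentParity.

(** * Crossing parity of a loop that runs through several charts *)

Module LoopPieces.
Import Discs Embeddings Stars FlatDiscs CrossingParity TriangleParity LoopHomotopy BoundaryCharts PathParity Detours SegmentParity.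
Local Open Scope classical_set_scope.
Local Open Scope ring_scope.

Section Loops.
Variables (R : realType) (T : topologicalType).
Hypothesis hT : hausdorff_space T.
Hypothesis hD : forall x : T, exists f g r, @disc R T f g (f x) r /\ g (f x) = x.
Variables (I Q : finType) (ch : I -> chart R T) (qc : Q -> chart R T) (qi qj : Q -> I).
Hypothesis subi : forall q y, Oc (qc q) y -> Kc (3 / 4) (ch (qi q)) y.
Hypothesis subj : forall q y, Oc (qc q) y -> Kc (3 / 4) (ch (qj q)) y.
Implicit Types (x y o : T) (a si : R -> T) (b : Q -> T).

(* A loop cut in [m.+1] pieces, each inside a chart, with the overlap used at each junction. *)
Record ldata (i0 : I) (a : R -> T) (m : nat) (idx : nat -> I) (lab : nat -> Q) : Prop := LData {
  ld_c : continuous a;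
  ld_0 : idx 0%N = i0;
  ld_m : idx m = i0;
  ld_piece : forall k, (k <= m)%N -> forall u : R, 0 <= u <= 1 -> Kc (1 / 2) (ch (idx k)) (a ((k%:R + u) / m.+1%:R));
  ld_qi : forall k, (k < m)%N -> qi (lab k) = idx k;
  ld_qj : forall k, (k < m)%N -> qj (lab k) = idx k.+1;
  ld_q : forall k, (k < m)%N -> Oc (qc (lab k)) (a (k.+1%:R / m.+1%:R)) }.

Definition piece a m k (u : R) : T := a ((k%:R + u) / m.+1%:R).

(** A mod 2 indicator of what the loop bounds, computed in charts. At each junction the change of
    chart is corrected by a connector to the base point of the overlap; what remains undetermined
    depends on the labels counted mod 2. *)
Definition W a m (idx : nat -> I) (lab : nat -> Q) b x : bool :=
  (\big[addb/false]_(0 <= k < m.+1) Ic (ch (idx k)) (piece a m k) x) (+)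
  (\big[addb/false]_(0 <= k < m) conn (ch (qi (lab k))) (ch (qj (lab k))) (qc (lab k)) (a (k.+1%:R / m.+1%:R)) (b (lab k)) x).

(** The defect in [Ic_Ee]: it vanishes if [si] avoids [l], and so measures how [si] crosses [l]. *)
Definition kap i l si : bool := (Ic i l (si 0) (+) Ic i l (si 1)) (+) (Ee i si (l 0) (+) Ee i si (l 1)).

Definition EE si q y : bool := Ee (ch (qi q)) si y (+) Ee (ch (qj q)) si y.

Definition small_path (i : chart R T) si := 
  (forall u : R, 0 <= u <= 1 -> Oc i (si u)) \/ (forall u : R, 0 <= u <= 1 -> ~ Kc (3 / 4) i (si u)).

Lemma piece0 a m k : piece a m k 0 = a (k%:R / m.+1%:R).
Proof. by rewrite /piece addr0. Qed.
Lemma piece1 a m k : piece a m k 1 = a (k.+1%:R / m.+1%:R).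
Proof. by rewrite /piece natr1. Qed.

(** The junction terms cancel between pieces and connectors by Abel summation. There remain the
    crossings, the two ends of the loop and a sum over the labels. *)
Lemma W_diff i0 a m idx lab b si : ldata i0 a m idx lab -> 
  (forall k, (k < m)%N -> 
     conn (ch (qi (lab k))) (ch (qj (lab k))) (qc (lab k)) (a (k.+1%:R / m.+1%:R)) (b (lab k)) (si 0) (+)
     conn (ch (qi (lab k))) (ch (qj (lab k))) (qc (lab k)) (a (k.+1%:R / m.+1%:R)) (b (lab k)) (si 1) =
     EE si (lab k) (a (k.+1%:R / m.+1%:R)) (+) EE si (lab k) (b (lab k))) ->
  W a m idx lab b (si 0) (+) W a m idx lab b (si 1) =
  \big[addb/false]_(0 <= k < m.+1) kap (ch (idx k)) (piece a m k) si (+)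
  (Ee (ch i0) si (a 0) (+) Ee (ch i0) si (a 1)) (+)
  \big[addb/false]_(0 <= k < m) EE si (lab k) (b (lab k)).
Proof.
move=> H hc; rewrite /W.
set P0 := \big[_/_]_(0 <= k < m.+1) _; set C0 := \big[_/_]_(0 <= k < m) _.
set P1 := \big[_/_]_(0 <= k < m.+1) Ic _ _ (si 1); set C1 := \big[_/_]_(0 <= k < m) conn _ _ _ _ _ (si 1).
have EC : C0 (+) C1 = \big[addb/false]_(0 <= k < m) EE si (lab k) (a (k.+1%:R / m.+1%:R)) (+)
    \big[addb/false]_(0 <= k < m) EE si (lab k) (b (lab k)).
  by rewrite -!big_split /=; apply: eq_big_nat => k /andP[_ km]; exact: hc.
have EP : P0 (+) P1 = \big[addb/false]_(0 <= k < m.+1) kap (ch (idx k)) (piece a m k) si (+)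
   (Ee (ch i0) si (a 0) (+) Ee (ch i0) si (a 1) (+) \big[addb/false]_(0 <= k < m) EE si (lab k) (a (k.+1%:R / m.+1%:R))).
  have -> : Ee (ch i0) si (a 0) (+) Ee (ch i0) si (a 1) (+) \big[addb/false]_(0 <= k < m) EE si (lab k) (a (k.+1%:R / m.+1%:R))
    = \big[addb/false]_(0 <= k < m.+1) (Ee (ch (idx k)) si (a (k%:R / m.+1%:R)) (+) Ee (ch (idx k)) si (a (k.+1%:R / m.+1%:R))).
    rewrite (addb_shift (fun k => Ee (ch (idx k)) si (a (k%:R / m.+1%:R))) (fun k => Ee (ch (idx k)) si (a (k.+1%:R / m.+1%:R)))).
    rewrite (ld_0 H) (ld_m H) mul0r divff ?pnatr_eq0 //; congr addb.
    by apply: eq_big_nat => k /andP[_ km]; rewrite /EE (ld_qi H km) (ld_qj H km).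
  rewrite -!big_split /=; apply: eq_big_nat => k /andP[_ km].
  rewrite /kap piece0 piece1.
  by move: (Ic _ _ _) (Ic _ _ (si 1)) (Ee _ _ _) (Ee _ _ (a (k.+1%:R / _))); do 4 case.
move: EC EP; move: C0 C1 P0 P1.
move: (\big[addb/false]_(0 <= k < m) EE si (lab k) (b (lab k))) => z1.
move: (\big[addb/false]_(0 <= k < m) EE si (lab k) _) => z2.
move: (\big[addb/false]_(0 <= k < m.+1) kap _ _ _) (Ee (ch i0) si (a 0)) (Ee (ch i0) si (a 1)) z1 z2.
by do 9 case.
Qed.

Lemma compact_path a : continuous a -> closed (a @` `[0, 1]%classic).
Proof.
move=> ca; apply: compact_closed => //; apply: continuous_compact.
  by apply: continuous_subspaceT.
exact: segment_compact.
Qed.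

Lemma conn_near o (i j q : chart R T) y (b : T) : (forall z, Oc q z -> Kc (3 / 4) i z) -> (forall z, Oc q z -> Kc (3 / 4) j z) ->
  Oc q y -> Oc q b -> y <> o -> b <> o -> exists2 M : set T, nbhs o M & 
   forall si, continuous si -> (forall u : R, 0 <= u <= 1 -> M (si u)) -> small_path i si -> small_path j si ->
   conn i j q y b (si 0) (+) conn i j q y b (si 1) = (Ee i si y (+) Ee j si y) (+) (Ee i si b (+) Ee j si b).
Proof.
move=> si sj Oy Ob yo bo; have [ta [ct e0 e1 ht]] := adm_ex Oy Ob yo bo.
exists (~` (ta @` `[0, 1]%classic)).
  apply: open_nbhs_nbhs; split; first by apply: closed_openC; exact: compact_path.
  by move=> [u /=]; rewrite in_itv /= => /ht[].
move=> s cs hs hi hj.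
have nz u v : 0 <= u <= 1 -> 0 <= v <= 1 -> ta u <> s v.
  by move=> u01 v01 e; apply: (hs v v01); exists u; rewrite //= in_itv.
have iO z : Oc q z -> Oc i z by move=> /si; apply: KcO; lra.
have jO z : Oc q z -> Oc j z by move=> /sj; apply: KcO; lra.
have A v : 0 <= v <= 1 -> adm q y b (s v) ta.
  by move=> v01; split => // u u01; split; [have [] := ht u u01|exact: nz].
have o0 : 0 <= (0 : R) <= 1 by rewrite lexx ler01.
have o1 : 0 <= (1 : R) <= 1 by rewrite lexx ler01.
rewrite (connE iO jO (A 0 o0)) (connE iO jO (A 1 o1)).
have ct' : cont01 ta by move=> u _; exact: ct.
have cs' : cont01 s by move=> u _; exact: cs.
have hit u : 0 <= u <= 1 -> Kc (3 / 4) i (ta u) by move=> u01; apply: si; have [] := ht u u01.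
have hjt u : 0 <= u <= 1 -> Kc (3 / 4) j (ta u) by move=> u01; apply: sj; have [] := ht u u01.
have := Ic_Ee ct' cs' hit nz hi; have := Ic_Ee ct' cs' hjt nz hj; rewrite e0 e1.
move: (Ic i ta (s 0)) (Ic i ta (s 1)) (Ic j ta (s 0)) (Ic j ta (s 1)) (Ee i s y) (Ee j s y) (Ee i s b) (Ee j s b).
by do 8 case.
Qed.

Lemma near_ord (m : nat) (P : nat -> set T -> Prop) o : (forall k M M', (forall x, M' x -> M x) -> P k M -> P k M') ->
  (forall k, (k < m)%N -> exists2 M : set T, nbhs o M & P k M) ->
  exists2 M : set T, nbhs o M & forall k, (k < m)%N -> P k M.
Proof.
move=> mono; elim: m => [|m IH] h; first by exists setT => //; exact: filterT.
have [|M1 n1 h1] := IH _; first by move=> k km; apply: h; exact: ltnW.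
have [M2 n2 h2] := h m (ltnSn m); exists (M1 `&` M2); first exact: filterI.
move=> k; rewrite ltnS leq_eqVlt => /orP[/eqP ->|km].
  by apply: mono h2 => x [].
by apply: mono (h1 k km) => x [].
Qed.

(* Paths near [o] cross none of the connectors. *)
Lemma W_near i0 a m idx lab b o : ldata i0 a m idx lab ->
  (forall k, (k < m)%N -> [/\ Oc (qc (lab k)) (b (lab k)), b (lab k) <> o & a (k.+1%:R / m.+1%:R) <> o]) ->
  exists2 M : set T, nbhs o M & forall si, continuous si -> (forall u : R, 0 <= u <= 1 -> M (si u)) ->
   (forall i, small_path (ch i) si) ->
   W a m idx lab b (si 0) (+) W a m idx lab b (si 1) =
  \big[addb/false]_(0 <= k < m.+1) kap (ch (idx k)) (piece a m k) si (+)
  (Ee (ch i0) si (a 0) (+) Ee (ch i0) si (a 1)) (+)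
  \big[addb/false]_(0 <= k < m) EE si (lab k) (b (lab k)).
Proof.
move=> H hb.
pose P k (M : set T) := forall si, continuous si -> (forall u : R, 0 <= u <= 1 -> M (si u)) ->
   (forall i, small_path (ch i) si) ->
     conn (ch (qi (lab k))) (ch (qj (lab k))) (qc (lab k)) (a (k.+1%:R / m.+1%:R)) (b (lab k)) (si 0) (+)
     conn (ch (qi (lab k))) (ch (qj (lab k))) (qc (lab k)) (a (k.+1%:R / m.+1%:R)) (b (lab k)) (si 1) =
     EE si (lab k) (a (k.+1%:R / m.+1%:R)) (+) EE si (lab k) (b (lab k)).
have [|k km|M nM hM] := @near_ord m P o.
- by move=> k M M' sub h si cs hs; apply: h => // u u01; exact/sub/hs.
- have [h1 h2 h3] := hb k km.
  have [M nM hM] := conn_near (@subi (lab k)) (@subj (lab k)) (ld_q H km) h1 h3 h2.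
  by exists M => // si cs hs sm; exact: hM.
exists M => // si cs hs sm; apply: W_diff => // k km.
exact: (hM k km si cs hs sm).
Qed.

(** A small enough disc about [o] is, for each chart, inside the chart or outside its disc of ratio
    3/4, so every path in it satisfies [small_path]. *)
Lemma near_disc o (M : set T) : nbhs o M -> exists f g r, [/\ @disc R T f g (f o) r, g (f o) = o,
   (forall y, oset g (f o) r y -> M y) &
   forall x x', oset g (f o) r x -> oset g (f o) r x' -> exists si, [/\ continuous si, si 0 = x, si 1 = x',
      (forall u : R, 0 <= u <= 1 -> oset g (f o) r (si u)) & forall i, small_path (ch i) si]].
Proof.
move=> nM.
have nK : \forall x \near o, forall i : I, (Oc (ch i) o -> Oc (ch i) x) /\ (~ Oc (ch i) o -> ~ Kc (3 / 4) (ch i) x).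
  apply: filter_forall => i; have [Oo|nO] := pselect (Oc (ch i) o).
    have : nbhs o (Oc (ch i)) by apply: open_nbhs_nbhs; split => //; exact: oset_open (cD (ch i)).
    by apply: filterS => x Ox; split.
  have : nbhs o (~` Kc (3 / 4) (ch i)).
    apply: open_nbhs_nbhs; split; last by move=> h; apply: nO; apply: KcO h; lra.
    apply: closed_openC; apply: disc_closed => //; apply: (disc_le (cD (ch i))).
    by have := disc_r (cD (ch i)); lra.
  by apply: filterS => x Ox; split.
have [f [g [r [D go]]]] := hD o.
have Oo : oset g (f o) r o.
  by exists (f o) => //=; rewrite /hboxo subrr normr0 (disc_r D) (disc_c D).
have [e [e0 he]] := chart_ball D Oo (filterI nM nK).
have ie p : hboxo (f o) (Num.min e r) p -> [/\ `|p - f o| <= e, 0 <= p.2 & M (g p) /\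
   forall i : I, (Oc (ch i) o -> Oc (ch i) (g p)) /\ (~ Oc (ch i) o -> ~ Kc (3 / 4) (ch i) (g p))].
  by move=> /andP[]; rewrite lt_min => /andP[h1 h2] h3; split => //; [exact: ltW|have [] := he p (ltW h1) h3].
exists f, g, (Num.min e r); have D' : disc f g (f o) (Num.min e r).
  by apply: (disc_le D); rewrite lt_min e0 (disc_r D) ge_min lexx orbT.
split => //.
  by move=> y [p /= /ie[_ _ []]] ? _ <-.
move=> x x' /(oset_gf D')[gx hx _] /(oset_gf D')[gx' hx' _].
exists (fun u => g (seg (f x) (f x') u)).
have S u : 0 <= u <= 1 -> hboxo (f o) (Num.min e r) (seg (f x) (f x') u) by move=> u01; exact: hboxo_comb.
split.
- by move=> u; apply: (@continuous_comp _ _ _ (seg (f x) (f x')) g); [exact: seg_cts|exact: (disc_g D)].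
- by rewrite seg0.
- by rewrite seg1.
- by move=> u u01; exists (seg (f x) (f x') u) => //; exact: S.
- move=> i; have [Oi|nO] := pselect (Oc (ch i) o); [left|right] => u u01; have [_ _ [_ /(_ i)[h1 h2]]] := ie _ (S u u01).
    exact: h1.
  exact: h2.
Qed.

End Loops.

End LoopPieces.

(** * Directions at a boundary point *)

Module RadialOrder.
Import Discs Embeddings Stars FlatDiscs CrossingParity TriangleParity LoopHomotopy BoundaryCharts PathParity Detours SegmentParity LoopPieces.
Local Open Scope classical_set_scope.
Local Open Scope ring_scope.

Section Xi.
Variable R : realType.
Implicit Types (D X : R * R).

(* Order of the directions at a boundary point, from left to right. *)
Definition xi X : R := X.1 / (`|X.1| + X.2).

Lemma xiZ (k : R) X : 0 < k -> xi (k *: X) = xi X.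
Proof.
move=> k0; rewrite /xi; have -> : (k *: X).1 = k * X.1 by [].
have -> : (k *: X).2 = k * X.2 by [].
by rewrite normrM (gtr0_norm k0) -mulrDr invfM mulrACA divff ?mul1r // gt_eqF.
Qed.

Lemma den_gt0 X : X != 0 -> 0 <= X.2 -> 0 < `|X.1| + X.2.
Proof.
move=> X0 X2; rewrite lt_neqAle addr_ge0 // andbT eq_sym; apply: contra X0 => /eqP h.
have h1 : `|X.1| = 0 by have := normr_ge0 X.1; lra.
have h2 : X.2 = 0 by lra.
by move/normr0_eq0: h1; move: h2; clear; case: X => a b /= -> ->.
Qed.

Lemma xi_lt D X : D != 0 -> 0 <= D.2 -> X != 0 -> 0 <= X.2 ->
  (xi D < xi X) = (D.1 * (`|X.1| + X.2) < X.1 * (`|D.1| + D.2)).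
Proof.
move=> D0 D2 X0 X2; rewrite /xi ltr_pdivrMr ?den_gt0 // mulrAC ltr_pdivlMr ?den_gt0 //.
Qed.

Lemma radcr_p (d1 d2 x1 x2 : R) : 0 < d1 -> x1 < d1 -> 0 <= x2 -> 0 <= d2 -> 0 < `|x1| + x2 ->
  [&& - x1 < 0, 0 <= d1 - x1 & 0 < - x2 * (d1 - x1) - - x1 * (d2 - x2)] ||
  [&& d1 - x1 < 0, 0 <= - x1 & 0 < (d2 - x2) * - x1 - (d1 - x1) * - x2] = (d1 * (`|x1| + x2) < x1 * (d1 + d2)).
Proof.
move=> d0 xd x20 d20 n0; have -> : (d1 - x1 < 0) = false by apply/negbTE; rewrite -leNgt; lra.
rewrite /= orbF; have -> : 0 <= d1 - x1 by lra.
rewrite oppr_lt0 /=; have -> : - x2 * (d1 - x1) - - x1 * (d2 - x2) = x1 * d2 - d1 * x2 by ring.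
have [x0|x0] := ltP 0 x1.
  by rewrite gtr0_norm // !mulrDr (mulrC x1 d1) ltrD2l subr_gt0.
have h1 : 0 < d1 * (`|x1| + x2) by rewrite mulr_gt0.
have h2 : x1 * (d1 + d2) <= 0 by rewrite mulr_le0_ge0 // addr_ge0 // ltW.
by apply/esym/negbTE; rewrite -leNgt; lra.
Qed.

Lemma radcr_n (d1 d2 x1 x2 : R) : d1 < 0 -> d1 < x1 -> 0 <= x2 -> 0 <= d2 -> 0 < `|x1| + x2 ->
  (x1 <= 0 -> x1 * d2 - d1 * x2 != 0) ->
  [&& - x1 < 0, 0 <= d1 - x1 & 0 < - x2 * (d1 - x1) - - x1 * (d2 - x2)] ||
  [&& d1 - x1 < 0, 0 <= - x1 & 0 < (d2 - x2) * - x1 - (d1 - x1) * - x2] = ~~ (d1 * (`|x1| + x2) < x1 * (- d1 + d2)).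
Proof.
move=> d0 xd x20 d20 n0 nr.
have -> : (0 <= d1 - x1) = false by apply/negbTE; rewrite -ltNge; lra.
rewrite andbF /=; have -> : d1 - x1 < 0 by lra.
rewrite oppr_ge0 /=; have -> : (d2 - x2) * - x1 - (d1 - x1) * - x2 = d1 * x2 - x1 * d2 by ring.
have [x0|x0] := leP x1 0.
  have := nr x0; rewrite neq_lt /= => nr'.
  rewrite ler0_norm // !mulrDr !mulrN (mulrC x1 d1) ltrD2l -leNgt subr_gt0 le_eqVlt.
  by case/orP: nr' => h; [rewrite (_ : (_ == _) = false) //=; apply/eqP; lra|rewrite (_ : (_ == _) = false) //=; apply/eqP; lra].
have h1 : d1 * (`|x1| + x2) < 0 by rewrite nmulr_rlt0.
have h2 : 0 < x1 * (- d1 + d2) by apply: mulr_gt0 => //; lra.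
by apply/esym/negbTE; rewrite negbK; lra.
Qed.

(** The vertical ray above [X] meets the radius when [X] is below it, which means to the right of a
    radius with [D.1 > 0] and to the left of one with [D.1 < 0]; hence the second summand. *)
Lemma rad_cr D X : D.1 != 0 -> `|X.1| < `|D.1| -> 0 <= D.2 -> 0 <= X.2 -> 
  (forall u : R, 0 <= u <= 1 -> X <> u *: D) -> cr (- X) (D - X) = (xi D < xi X) (+) (D.1 < 0).
Proof.
move=> D1 XD D2 X2 nr.
have X0 : X != 0 by apply/eqP => e; apply: (nr 0); rewrite ?lexx ?ler01 // scale0r.
have D0 : D != 0 by apply: contra D1 => /eqP ->.
rewrite xi_lt // /cr /=; have n0 := den_gt0 X0 X2.
have [d0|d0|] := ltgtP D.1 0; last by move/eqP; rewrite (negbTE D1).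
  move: XD; rewrite !(ltr0_norm d0) ltr_norml opprK => /andP[h _].
  rewrite radcr_n // ?addbT // => x0.
  apply/eqP => e; apply: (nr (X.1 / D.1)).
    rewrite -[X.1]opprK -[D.1]opprK invrN mulrNN divr_ge0 ?oppr_ge0 ?(ltW d0) //= ler_pdivrMr ?oppr_gt0 //.
    by rewrite mul1r; lra.
  have e1 : X.1 = X.1 / D.1 * D.1 by rewrite divfK.
  have e2 : X.2 = X.1 / D.1 * D.2 by apply: (mulfI D1); rewrite mulrA mulrCA divff // mulr1; lra.
  by rewrite [LHS]surjective_pairing {1}e1 e2.
move: XD; rewrite !(gtr0_norm d0) ltr_norml => /andP[_ h].
by rewrite radcr_p // addbF.
Qed.

Lemma rad_cr0 D X : D.1 = 0 -> cr (- X) (D - X) = false.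
Proof.
move=> d0; rewrite /cr /= d0 sub0r; case: (- X.1 < 0) / ltP => h //=.
Qed.

End Xi.

Section KapRad.
Variables (R : realType) (T : topologicalType).
Variables (i : chart R T).
Implicit Types (l si : R -> T) (D X : R * R).

Lemma segN D X (u : R) : seg (- X) (D - X) u = u *: D - X.
Proof. by rewrite /seg scalerN scalerBl scale1r opprB scalerBr addrCA [_ - _ - _]addrAC subrr add0r. Qed.

Lemma kap_rev l si : kap i (fun u => l (1 - u)) si = kap i l si.
Proof. by rewrite /kap !Ic_rev subr0 subrr [X in _ (+) X = _]addbC. Qed.

(** Near the foot of a radius the defect tells whether the ends of [si] are on different sides of
    it. The term [Ee i si (l 0)] does not depend on the direction and cancels over the four ends of
    two loops. *)
Lemma kap_rad l D p0 : D != 0 -> 0 <= D.2 -> (forall u : R, 0 <= u <= 1 -> cf i (l u) = p0 + u *: D) -> p0.2 = 0 ->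
  exists2 e : R, 0 < e & forall si, continuous si ->
   (forall u : R, 0 <= u <= 1 -> Oc i (si u) /\ `|cf i (si u) - p0| < e) ->
   (forall u : R, 0 <= u <= 1 -> l u <> si 0) -> (forall u : R, 0 <= u <= 1 -> l u <> si 1) ->
   (forall u : R, 0 <= u <= 1 -> Oc i (l u)) ->
   kap i l si = Ee i si (l 0) (+) ((xi D < xi (cf i (si 0) - p0)) (+) (xi D < xi (cf i (si 1) - p0))).
Proof.
move=> D0 D2 hl p02.
have o0 : 0 <= (0 : R) <= 1 by rewrite lexx ler01.
have o1 : 0 <= (1 : R) <= 1 by rewrite lexx ler01.
(* [si] has to remain below the end of a vertical radius, and within the horizontal extent of any
   other. *)
exists (if D.1 == 0 then D.2 else `|D.1|).
  case: eqP => [d1|/eqP]; last by rewrite normr_gt0.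
  rewrite lt_neqAle D2 andbT eq_sym; apply: contra D0 => /eqP d2.
  by move: d1 d2; clear; case: D => a b /= -> ->.
move=> si cs hs n0 n1 hlO.
have hE y : Ee i si y = ind (fun u => cf i y - cf i (si u)).
  by rewrite /Ee asboolT // => u /hs[].
have csf : cont01 (fun u => cf i (l 1) - cf i (si u)).
  move=> u u01; apply: cvgB; first exact: cvg_cst.
  apply: (@continuous_comp _ _ _ si (cf i)); first exact: cs.
  by apply: Ocf; have [] := hs u u01.
have hI v : 0 <= v <= 1 -> (forall u : R, 0 <= u <= 1 -> l u <> si v) ->
    [/\ Ic i l (si v) = cr (- (cf i (si v) - p0)) (D - (cf i (si v) - p0)), 0 <= (cf i (si v) - p0).2 &
     forall u : R, 0 <= u <= 1 -> cf i (si v) - p0 <> u *: D].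
  move=> v01 nv; have [Ov _] := hs v v01.
  have nr (u : R) : 0 <= u <= 1 -> cf i (si v) - p0 <> u *: D.
    move=> u01 e; apply: (nv u u01); apply: (Oc_inj (hlO u u01) Ov).
    by rewrite hl // -e addrC subrK.
  have E := segN D (cf i (si v) - p0).
  split => //; last by rewrite /= p02 subr0; have [_ /andP[]] := oset_gf (cD i) Ov.
  rewrite Ic_in // -ind_seg.
    by apply: eq_ind => u u01; rewrite hl // E opprB addrA (addrC p0).
  by move=> u u01; rewrite E subr_eq0; apply/eqP => h; apply: (nr u u01).
have [I0 y0 r0] := hI 0 o0 n0; have [I1 y1 r1] := hI 1 o1 n1.
rewrite /kap I0 I1.
have [_ s0] := hs 0 o0; have [_ s1] := hs 1 o1.
have [d1|d1] := eqVneq D.1 0.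
  rewrite d1 eqxx in hs s0 s1.
  rewrite !rad_cr0 //=; congr addb.
  have cl1 : cf i (l 1) = p0 + D by rewrite hl // scale1r.
  rewrite hE (@ind_hp R true true) //; last first.
    move=> u u01; rewrite /sd /= cl1 /=; have [_] := hs u u01; rewrite nrm_lt => /andP[_].
    by rewrite ltr_norml /= => /andP[? ?]; lra.
  rewrite (@cr_sd R true true) /=; last 2 first.
  + rewrite /sd /= cl1 /=; move: s0; rewrite nrm_lt => /andP[_].
    by rewrite ltr_norml /= => /andP[? ?]; lra.
  + rewrite /sd /= cl1 /=; move: s1; rewrite nrm_lt => /andP[_].
    by rewrite ltr_norml /= => /andP[? ?]; lra.
  rewrite cl1 /= d1 addr0.
  have xd X : X != 0 -> 0 <= X.2 -> (xi D < xi X) = (0 < X.1).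
    move=> X0 X2; rewrite xi_lt // d1 normr0 add0r mul0r pmulr_lgt0 //.
    by have := den_gt0 D0 D2; rewrite d1 normr0 add0r.
  have nz v : (forall u : R, 0 <= u <= 1 -> cf i (si v) - p0 <> u *: D) -> cf i (si v) - p0 != 0.
    by move=> h; apply/eqP => e; apply: (h 0) => //; rewrite e scale0r.
  by rewrite !xd ?nz //= !subr_gt0 !subr_lt0.
rewrite (negbTE d1) in hs s0 s1.
have [t0 t1] : `|(cf i (si 0) - p0).1| < `|D.1| /\ `|(cf i (si 1) - p0).1| < `|D.1|.
  by move: s0 s1; rewrite !nrm_lt => /andP[? _] /andP[? _].
rewrite !rad_cr //.
have -> : Ee i si (l 1) = false.
  have cl1 : cf i (l 1) = p0 + D by rewrite hl // scale1r.
  rewrite hE; have [s hsd] : exists s, forall u : R, 0 <= u <= 1 -> sd false s (cf i (l 1) - cf i (si u)).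
    exists (0 < D.1) => u u01; rewrite /sd cl1 /=; have [_] := hs u u01; rewrite nrm_lt => /andP[+ _].
    rewrite ltr_norml /=; have [d0|d0|d0] := ltgtP D.1 0; last by move/eqP: d1.
      by rewrite ltr0_norm // => /andP[? ?]; lra.
    by rewrite gtr0_norm // => /andP[? ?]; lra.
  by rewrite (@ind_hp R false s) // (@cr_sd R false s) //=; exact: hsd.
move: (_ < xi (cf i (si 0) - p0)) (_ < xi (cf i (si 1) - p0)) (D.1 < 0) (Ee i si (l 0)).
by do 4 case.
Qed.

End KapRad.

End RadialOrder.

(** * The indicator of two loops of the same class *)

Module BasePoints.
Import Discs Embeddings Stars FlatDiscs CrossingParity TriangleParity LoopHomotopy BoundaryCharts PathParity Detours SegmentParity LoopPieces RadialOrder.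
Local Open Scope classical_set_scope.
Local Open Scope ring_scope.

Section Core.
Variables (R : realType) (T : topologicalType).
Hypothesis hT : hausdorff_space T.
Hypothesis hD : forall x : T, exists f g r, @disc R T f g (f x) r /\ g (f x) = x.
Variables (I Q : finType) (ch : I -> chart R T) (qc : Q -> chart R T) (qi qj : Q -> I).
Hypothesis subi : forall q y, Oc (qc q) y -> Kc (3 / 4) (ch (qi q)) y.
Hypothesis subj : forall q y, Oc (qc q) y -> Kc (3 / 4) (ch (qj q)) y.
Implicit Types (x y o : T) (si : R -> T).

Notation ldata := (ldata ch qc qi qj).

Lemma jn01 k m : (k < m)%N -> 0 < (k.+1%:R / m.+1%:R : R) < 1.
Proof. by move=> km; rewrite divr_gt0 ?ltr0n //= ltr_pdivrMr ?ltr0n // mul1r ltr_nat ltnS. Qed.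

Lemma pc01 k m (u : R) : (k <= m)%N -> 0 <= u <= 1 -> 0 <= (k%:R + u) / m.+1%:R <= 1.
Proof.
move=> km /andP[u0 u1]; rewrite divr_ge0 ?addr_ge0 ?ler0n //= ler_pdivrMr ?ltr0n // mul1r -natr1.
by rewrite lerD // ler_nat.
Qed.

Lemma Kmono i x : @Kc R T (1 / 2) i x -> Kc (3 / 4) i x.
Proof. by move=> [p /= hp <-]; exists p => //=; apply: hbox_le hp; have := disc_r (cD i); lra. Qed.

Lemma kap0 i0 a m idx lab k si : ldata i0 a m idx lab -> (k <= m)%N -> continuous si ->
  small_path (ch (idx k)) si -> (forall u v : R, 0 <= u <= 1 -> 0 <= v <= 1 -> piece a m k u <> si v) ->
  kap (ch (idx k)) (piece a m k) si = false.
Proof.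
move=> H km cs sp ha; rewrite /kap (@Ic_Ee _ _ _ (piece a m k) si) ?addbb //.
- move=> u _; apply: (@continuous_comp _ _ _ (fun u : R => (k%:R + u) / m.+1%:R) a); last exact: (ld_c H).
  by apply: cvgM; [apply: cvgD; [exact: cvg_cst|exact: cvg_id]|exact: cvg_cst].
- by move=> u _; exact: cs.
- by move=> u u01; apply: Kmono; exact: (ld_piece H).
Qed.

Lemma addb_big0 (F : nat -> bool) m : (forall k, (k <= m)%N -> F k = false) -> \big[addb/false]_(0 <= k < m.+1) F k = false.
Proof. by move=> h; rewrite big_nat_cond big1 // => k /andP[/andP[_ km] _]; exact: h. Qed.

Lemma closed_im (a : R -> T) (p q : R) : continuous a -> closed (a @` `[p, q]%classic).
Proof.
move=> ca; apply: compact_closed => //; apply: continuous_compact.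
  by apply: continuous_subspaceT.
exact: segment_compact.
Qed.

Variables (i0 : I) (o : T).
Variables (a : R -> T) (m : nat) (idx : nat -> I) (lab : nat -> Q).
Variables (a' : R -> T) (m' : nat) (idx' : nat -> I) (lab' : nat -> Q).
Hypotheses (H : ldata i0 a m idx lab) (H' : ldata i0 a' m' idx' lab').
Hypotheses (a0 : a 0 = o) (a1 : a 1 = o) (a0' : a' 0 = o) (a1' : a' 1 = o).
Hypotheses (hpar : forall q, \big[addb/false]_(0 <= k < m) (lab k == q) = \big[addb/false]_(0 <= k < m') (lab' k == q)).

(** The base points lie on the loops, at junctions, so that a point off the loops never coincides
    with one; both loops use the same choice. *)
Lemma base_ex : exists b : Q -> T, forall q, (exists2 k, (k < m)%N & lab k = q) \/ (exists2 k, (k < m')%N & lab' k = q) ->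
  Oc (qc q) (b q) /\ exists2 u : R, 0 < u < 1 & a u = b q \/ a' u = b q.
Proof.
have /choice[b hb] : forall q, exists b, (exists2 k, (k < m)%N & lab k = q) \/ (exists2 k, (k < m')%N & lab' k = q) ->
  Oc (qc q) b /\ exists2 u : R, 0 < u < 1 & a u = b \/ a' u = b.
  move=> q; have [[k km kq]|n1] := pselect (exists2 k, (k < m)%N & lab k = q).
    exists (a (k.+1%:R / m.+1%:R)) => _; split; first by rewrite -kq; exact: (ld_q H).
    by exists (k.+1%:R / m.+1%:R); [exact: jn01|left].
  have [[k km kq]|n2] := pselect (exists2 k, (k < m')%N & lab' k = q).
    exists (a' (k.+1%:R / m'.+1%:R)) => _; split; first by rewrite -kq; exact: (ld_q H').
    by exists (k.+1%:R / m'.+1%:R); [exact: jn01|right].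
  by exists o; case.
by exists b.
Qed.

(** In the sum over the two loops the label terms cancel by [hpar], and the end terms cancel because
    each loop is closed. *)
Lemma Wt_near b y : (forall q, (exists2 k, (k < m)%N & lab k = q) \/ (exists2 k, (k < m')%N & lab' k = q) ->
  Oc (qc q) (b q) /\ exists2 u : R, 0 < u < 1 & a u = b q \/ a' u = b q) ->
  (forall u : R, 0 < u < 1 -> a u <> y /\ a' u <> y) ->
  exists2 M : set T, nbhs y M & forall si, continuous si -> (forall u : R, 0 <= u <= 1 -> M (si u)) ->
   (forall i, small_path (ch i) si) ->
   (W ch qc qi qj a m idx lab b (si 0) (+) W ch qc qi qj a' m' idx' lab' b (si 0)) (+)
   (W ch qc qi qj a m idx lab b (si 1) (+) W ch qc qi qj a' m' idx' lab' b (si 1)) =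
  \big[addb/false]_(0 <= k < m.+1) kap (ch (idx k)) (piece a m k) si (+)
  \big[addb/false]_(0 <= k < m'.+1) kap (ch (idx' k)) (piece a' m' k) si.
Proof.
move=> hb hy.
have [|M nM hM] := W_near hT subi subj H (b := b) (o := y).
  move=> k km; have [h1 [u u01 h2]] := hb _ (or_introl (ex_intro2 _ _ k km erefl)).
  have [hyu hyu'] := hy u u01; split => //; first by case: h2 => <-.
  by have [] := hy _ (jn01 km).
have [|M' nM' hM'] := W_near hT subi subj H' (b := b) (o := y).
  move=> k km; have [h1 [u u01 h2]] := hb _ (or_intror (ex_intro2 _ _ k km erefl)).
  have [hyu hyu'] := hy u u01; split => //; first by case: h2 => <-.
  by have [] := hy _ (jn01 km).
exists (M `&` M'); first exact: filterI.
move=> si cs hs sp.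
have E := hM si cs (fun u u01 => proj1 (hs u u01)) sp.
have E' := hM' si cs (fun u u01 => proj2 (hs u u01)) sp.
move: E E'; rewrite a0 a1 a0' a1' !addbb !addbF.
rewrite (par_sum (fun q => EE ch qi qj si q (b q))) (par_sum (fun q => EE ch qi qj si q (b q)) lab').
have -> : \big[addb/false]_(q : Q) ((\big[addb/false]_(0 <= k < m) (lab k == q)) && EE ch qi qj si q (b q)) =
  \big[addb/false]_(q : Q) ((\big[addb/false]_(0 <= k < m') (lab' k == q)) && EE ch qi qj si q (b q)).
  by apply: eq_bigr => q _; rewrite hpar.
move: (\big[addb/false]_(q : Q) _) (W ch qc qi qj a m idx lab b (si 0)) (W ch qc qi qj a m idx lab b (si 1)).
move: (W ch qc qi qj a' m' idx' lab' b (si 0)) (W ch qc qi qj a' m' idx' lab' b (si 1)) => w1 w2 w3 w4 w5.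
move: (\big[addb/false]_(0 <= k < m.+1) _) (\big[addb/false]_(0 <= k < m'.+1) _) => w6 w7 E1 E2.
by rewrite addbACA E1 E2 addbACA addbb addbF.
Qed.

(** Two loops of the same class together bound mod 2: their common indicator is locally constant off
    them. Along [c] it is then a continuous function with values 0 and 1, and the intermediate value
    theorem applies. *)
Lemma Wt_cst b (c : R -> T) : (forall q, (exists2 k, (k < m)%N & lab k = q) \/ (exists2 k, (k < m')%N & lab' k = q) ->
  Oc (qc q) (b q) /\ exists2 u : R, 0 < u < 1 & a u = b q \/ a' u = b q) ->
  continuous c -> (forall u v : R, 0 < u < 1 -> 0 <= v <= 1 -> a v <> c u /\ a' v <> c u) ->
  forall s t : R, 0 < s -> s <= t -> t < 1 ->
   W ch qc qi qj a m idx lab b (c s) (+) W ch qc qi qj a' m' idx' lab' b (c s) =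
   W ch qc qi qj a m idx lab b (c t) (+) W ch qc qi qj a' m' idx' lab' b (c t).
Proof.
move=> hb cc hc s t s0 st t1.
set Wt := fun x => W ch qc qi qj a m idx lab b x (+) W ch qc qi qj a' m' idx' lab' b x.
rewrite -[LHS]/(Wt (c s)) -[RHS]/(Wt (c t)).
have loc (u : R) : 0 < u < 1 -> \forall v \near u, Wt (c v) = Wt (c u).
  move=> u01.
  have [|M nM hM] := Wt_near (y := c u) hb.
    by move=> v v01; apply: hc => //; lra.
  have nZ : nbhs (c u) (~` (a @` `[0, 1]%classic `|` a' @` `[0, 1]%classic)).
    apply: open_nbhs_nbhs; split.
      by apply: closed_openC; apply: closedU; apply: closed_im; [exact: (ld_c H)|exact: (ld_c H')].
    by case=> -[v /=]; rewrite in_itv /= => v01; have [] := hc u v u01 v01.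
  have [f [g [r [D gu sub hp]]]] := near_disc hT hD ch (filterI nM nZ).
  have nO : nbhs (c u) (oset g (f (c u)) r).
    apply: open_nbhs_nbhs; split; first exact: (oset_open D).
    by exists (f (c u)) => //=; rewrite /hboxo subrr normr0 (disc_r D) (disc_c D).
  have := cts_nbhs (cc u) nO; apply: filterS => v Ov.
  have [si [cs s0' s1' hs sp]] := hp _ _ Ov (nbhs_singleton nO).
  have := hM si cs (fun v v01 => proj1 (sub _ (hs v v01))) sp; rewrite s0' s1'.
  have nz (w u1 : R) : 0 <= w <= 1 -> 0 <= u1 <= 1 -> a w <> si u1 /\ a' w <> si u1.
    move=> w01 u101; have [_ nZs] := sub _ (hs u1 u101).
    by split => e; apply: nZs; [left|right]; exists w; rewrite //= in_itv.
  rewrite -/(Wt (c v)) -/(Wt (c u)) !addb_big0 //; last 2 first.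
  - by move=> k km; apply: (kap0 H') => // u1 u2 h1 h2; have [] := nz _ u2 (pc01 km h1) h2.
  - by move=> k km; apply: (kap0 H) => // u1 u2 h1 h2; have [] := nz _ u2 (pc01 km h1) h2.
  by case: (Wt _); case: (Wt _).
apply: contrapT => ne.
pose F (u : R) : R := if Wt (c (clampR s t u)) then 1 else 0.
have cF : continuous F.
  move=> u B; have /andP[h1 h2] := @clampR_in R s t u st.
  have := cts_nbhs (@clampR_cts R s t u) (loc _ _); rewrite (lt_le_trans s0 h1) (le_lt_trans h2 t1) => /(_ isT).
  suff hh : nbhs u (fun w => Wt (c (clampR s t w)) = Wt (c (clampR s t u))) -> nbhs (F u) B -> nbhs u (fun w => B (F w)) by move=> /hh k; exact: k.
  move=> h3 hB; move: h3; apply: filterS => w e.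
  by rewrite /F e; exact: (nbhs_singleton hB).
have h0 : (0 : R) <= 1 / 2 by lra.
have h1 : (1 / 2 : R) <= 1 by lra.
have [|u] := @IVT R F s t (1 / 2) st (continuous_subspaceT cF).
  rewrite /F !clampR_id ?lexx ?st //; move: ne; case: (Wt _); case: (Wt _) => // _.
    by rewrite ge_min le_max h0 h1 ?orbT.
  by rewrite ge_min le_max h0 h1 ?orbT.
by move=> _; rewrite /F; case: ifP => _; lra.
Qed.

End Core.

End BasePoints.

(** * Interlacing of loops at a boundary point *)

Module RadialParity.
Import Discs Embeddings Stars FlatDiscs CrossingParity TriangleParity LoopHomotopy BoundaryCharts PathParity Detours SegmentParity LoopPieces RadialOrder BasePoints.
Local Open Scope classical_set_scope.
Local Open Scope ring_scope.

Section Core2.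
Variables (R : realType) (T : topologicalType).
Hypothesis hT : hausdorff_space T.
Hypothesis hD : forall x : T, exists f g r, @disc R T f g (f x) r /\ g (f x) = x.
Variables (I Q : finType) (ch : I -> chart R T) (qc : Q -> chart R T) (qi qj : Q -> I).
Hypothesis subi : forall q y, Oc (qc q) y -> Kc (3 / 4) (ch (qi q)) y.
Hypothesis subj : forall q y, Oc (qc q) y -> Kc (3 / 4) (ch (qj q)) y.
Implicit Types (x y o : T) (si : R -> T).

Notation ldata := (ldata ch qc qi qj).

Variables (i0 : I) (o : T).
Variables (a : R -> T) (m : nat) (idx : nat -> I) (lab : nat -> Q).
Variables (a' : R -> T) (m' : nat) (idx' : nat -> I) (lab' : nat -> Q).
Hypotheses (H : ldata i0 a m idx lab) (H' : ldata i0 a' m' idx' lab').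
Hypotheses (a0 : a 0 = o) (a1 : a 1 = o) (a0' : a' 0 = o) (a1' : a' 1 = o).
Hypotheses (hpar : forall q, \big[addb/false]_(0 <= k < m) (lab k == q) = \big[addb/false]_(0 <= k < m') (lab' k == q)).

Variables (D0 D1 D0' D1' : R * R).
Hypotheses (m0 : (0 < m)%N) (m0' : (0 < m')%N).
Hypotheses (Oo : Oc (ch i0) o) (o2 : (cf (ch i0) o).2 = 0).
Hypotheses (ha : forall u : R, 0 < u < 1 -> a u <> o) (ha' : forall u : R, 0 < u < 1 -> a' u <> o).
Let f := cf (ch i0).
Definition radial (D : R * R) (l : R -> T) := [/\ D != 0, 0 <= D.2 &
  forall u : R, 0 <= u <= 1 -> f (l u) = f o + u *: D].
Hypotheses (r0 : radial D0 (piece a m 0)) (r1 : radial D1 (fun u => piece a m m (1 - u))).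
Hypotheses (r0' : radial D0' (piece a' m' 0)) (r1' : radial D1' (fun u => piece a' m' m' (1 - u))).

Lemma addb_ends (F : nat -> bool) n : (0 < n)%N -> (forall k, (0 < k < n)%N -> F k = false) ->
  \big[addb/false]_(0 <= k < n.+1) F k = F 0%N (+) F n.
Proof.
move=> n0 h; rewrite big_nat_recr //= big_ltn // big_nat_cond big1 ?addbF // => k /andP[kn _].
exact: h.
Qed.

(** Parity of the number of ends of the two loops to the left of the direction [X]. *)
Definition tt4 (X : R * R) := (xi D0 < xi X) (+) (xi D1 < xi X) (+) (xi D0' < xi X) (+) (xi D1' < xi X).

(** Close to [o] only the first and last pieces of the loops can be met; each obeys [kap_rad], and
    the four terms at [o] cancel. *)
Lemma root_near b : (forall q, (exists2 k, (k < m)%N & lab k = q) \/ (exists2 k, (k < m')%N & lab' k = q) ->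
  Oc (qc q) (b q) /\ exists2 u : R, 0 < u < 1 & a u = b q \/ a' u = b q) ->
  exists2 M : set T, nbhs o M & forall x x', M x -> M x' -> 
    (forall u : R, 0 <= u <= 1 -> [/\ a u <> x, a' u <> x, a u <> x' & a' u <> x']) ->
   (W ch qc qi qj a m idx lab b x (+) W ch qc qi qj a' m' idx' lab' b x) (+)
   (W ch qc qi qj a m idx lab b x' (+) W ch qc qi qj a' m' idx' lab' b x') =
   tt4 (f x - f o) (+) tt4 (f x' - f o).
Proof.
move=> hb; have [|M1 n1 h1] := Wt_near hT subi subj H H' a0 a1 a0' a1' hpar hb (y := o).
  by move=> u u01; split; [exact: ha|exact: ha'].
case: (r0) => p1 p2 p3; case: (r1) => p4 p5 p6; case: (r0') => p1' p2' p3'; case: (r1') => p4' p5' p6'.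
have [e1 e10 he1] := kap_rad p1 p2 p3 o2; have [e2 e20 he2] := kap_rad p4 p5 p6 o2.
have [e3 e30 he3] := kap_rad p1' p2' p3' o2; have [e4 e40 he4] := kap_rad p4' p5' p6' o2.
have nO : nbhs o (Oc (ch i0)) by apply: open_nbhs_nbhs; split => //; exact: oset_open (cD (ch i0)).
have ne e : 0 < e -> nbhs o [set x | `|f x - f o| < e].
  move=> e0; have B : nbhs (f o) [set q : R * R | `|q - f o| < e] by apply/nbhs2P; exists e.
  exact: (cts_nbhs (Ocf Oo) B).
pose mid (al : R -> T) n := al @` `[1 / n.+1%:R, n%:R / n.+1%:R]%classic.
have nmid (al : R -> T) n : (0 < n)%N -> continuous al -> (forall u : R, 0 < u < 1 -> al u <> o) -> nbhs o (~` mid al n).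
  move=> n0 cl hl; apply: open_nbhs_nbhs; split; first by apply: closed_openC; exact: (closed_im hT cl).
  case=> u /=; rewrite in_itv /= => /andP[u1 u2]; apply: hl; apply/andP; split.
    by apply: lt_le_trans u1; rewrite divr_gt0 ?ltr0n.
  by apply: le_lt_trans u2 _; rewrite ltr_pdivrMr ?ltr0n // mul1r ltr_nat.
have [g [g' [r [D go sub hp]]]] := near_disc hT hD ch (filterI n1 (filterI nO (filterI (filterI (ne _ e10) (ne _ e20))
  (filterI (filterI (ne _ e30) (ne _ e40)) (filterI (nmid _ _ m0 (ld_c H) ha) (nmid _ _ m0' (ld_c H') ha')))))).
exists (oset g' (g o) r).
  apply: open_nbhs_nbhs; split; first exact: (oset_open D).
  by exists (g o) => //=; rewrite /hboxo subrr normr0 (disc_r D) (disc_c D).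
move=> x x' Mx Mx' nz; have [si [cs s0 s1 hs sp]] := hp _ _ Mx Mx'.
have {}hs u (u01 : 0 <= u <= 1) := sub _ (hs u u01).
have := h1 si cs (fun u u01 => proj1 (hs u u01)) sp; rewrite s0 s1 => ->.
have midk (al : R -> T) n k (u : R) : (0 < k < n)%N -> 0 <= u <= 1 -> mid al n (piece al n k u).
  move=> /andP[k0 kn] /andP[u0 u1]; exists ((k%:R + u) / n.+1%:R) => //=; rewrite in_itv /=.
  rewrite !ler_wpM2r ?invr_ge0 ?ler0n //=.
    have : (k.+1%:R : R) <= n%:R by rewrite ler_nat.
    by rewrite -natr1; lra.
  have : (1 : R) <= k%:R by rewrite ler1n.
  by lra.
have pl (al : R -> T) n k (u : R) : (k <= n)%N -> 0 <= u <= 1 -> exists2 v : R, 0 <= v <= 1 & piece al n k u = al v.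
  by move=> kn u01; exists ((k%:R + u) / n.+1%:R) => //; exact: pc01.
have nz' (k : nat) (u : R) : (k <= m)%N -> 0 <= u <= 1 -> piece a m k u <> si 0 /\ piece a m k u <> si 1.
  by move=> km u01; have [v v01 ->] := pl a m k u km u01; rewrite s0 s1; have [] := nz v v01.
have nz'' (k : nat) (u : R) : (k <= m')%N -> 0 <= u <= 1 -> piece a' m' k u <> si 0 /\ piece a' m' k u <> si 1.
  by move=> km u01; have [v v01 ->] := pl a' m' k u km u01; rewrite s0 s1; have [] := nz v v01.
have u1 (u : R) : 0 <= u <= 1 -> 0 <= 1 - u <= 1 by move=> ?; lra.
have KO (x0 : T) : Kc (1 / 2) (ch i0) x0 -> Oc (ch i0) x0 by apply: KcO; lra.
rewrite !addb_ends //; last 2 first.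
- move=> k kn; have [k0 k1] := andP kn; apply: (kap0 H' _ cs (sp _)); first exact: ltnW.
  move=> u v u01 v01 e; have [_ [_ [_ [_ [_ nm]]]]] := hs v v01; apply: nm; rewrite -e.
  exact: midk.
- move=> k kn; have [k0 k1] := andP kn; apply: (kap0 H _ cs (sp _)); first exact: ltnW.
  move=> u v u01 v01 e; have [_ [_ [_ [_ [nm _]]]]] := hs v v01; apply: nm; rewrite -e.
  exact: midk.
rewrite -(kap_rev _ (piece a m m)) -(kap_rev _ (piece a' m' m')).
rewrite (ld_0 H) (ld_0 H') (ld_m H) (ld_m H').
rewrite he1 // ?he2 // ?he3 // ?he4 //.
- rewrite !subr0 !piece0 !piece1 !mul0r !divff ?pnatr_eq0 // a0 a1 a0' a1' s0 s1 /tt4 -/f.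
  move: (Ee _ _ _) => E.
  move: (xi D0 < xi (f x - f o)) (xi D1 < xi (f x - f o)) (xi D0' < xi (f x - f o)) (xi D1' < xi (f x - f o)).
  move: (xi D0 < xi (f x' - f o)) (xi D1 < xi (f x' - f o)) (xi D0' < xi (f x' - f o)) (xi D1' < xi (f x' - f o)).
  by case: E; do 8 case.
all: try (move=> u u01; have [? [? [[? ?] [[? ?] _]]]] := hs u u01; by split).
all: try (move=> u /u1 u01; have [? ?] := nz' m _ (leqnn _) u01; done).
all: try (move=> u /u1 u01; have [? ?] := nz'' m' _ (leqnn _) u01; done).
all: try (move=> u u01; have [? ?] := nz' 0%N _ (leq0n _) u01; done).
all: try (move=> u u01; have [? ?] := nz'' 0%N _ (leq0n _) u01; done).
all: try (move=> u u01; apply: KO; rewrite -(ld_0 H); exact: (ld_piece H)).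
all: try (move=> u u01; apply: KO; rewrite -(ld_0 H'); exact: (ld_piece H')).
all: try (move=> u /u1 u01; apply: KO; rewrite -(ld_m H); exact: (ld_piece H)).
all: try (move=> u /u1 u01; apply: KO; rewrite -(ld_m H'); exact: (ld_piece H')).
Qed.

(** The indicator takes the same value at the parameters [s] and [1 - s] of [c]; for small [s] both
    points are close to [o], where its variation is that of [tt4]. *)
Lemma core (c : R -> T) (C0 C1 : R * R) (al : R) : continuous c -> c 0 = o -> c 1 = o ->
  (forall u v : R, 0 < u < 1 -> 0 <= v <= 1 -> a v <> c u /\ a' v <> c u) -> 0 < al ->
  (forall u : R, 0 <= u <= al -> f (c u) = f o + u *: C0 /\ f (c (1 - u)) = f o + u *: C1) ->
  tt4 C0 = tt4 C1.
Proof.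
move=> cc c0 c1 hc al0 hr.
have [b hb] := base_ex o H H'.
have [M nM hM] := root_near hb.
have := cts_nbhs (cc 0); rewrite c0 => /(_ _ nM)/nbhsRP[e [e0 he]].
have := cts_nbhs (cc 1); rewrite c1 => /(_ _ nM)/nbhsRP[e' [e0' he']].
pose s := Num.min (Num.min e e') (Num.min al (1 / 2)) / 2.
have mn0 : 0 < Num.min (Num.min e e') (Num.min al (1 / 2)).
  by rewrite !lt_min e0 e0' al0 /=; lra.
have [s0 [se se' sa s2]] : 0 < s /\ [/\ s < e, s < e', s <= al & s < 1 / 2].
  have : s < Num.min (Num.min e e') (Num.min al (1 / 2)) by rewrite /s; lra.
  by rewrite !lt_min => /andP[/andP[h1 h2] /andP[h3 h4]]; rewrite divr_gt0 //; split => //; split => //; exact: ltW.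
have Ms : M (c s) by apply: he; rewrite subr0 gtr0_norm.
have Ms' : M (c (1 - s)) by apply: he'; rewrite addrAC subrr add0r normrN gtr0_norm.
have ss : s <= 1 - s by lra.
have ss' : 1 - s < 1 by lra.
have := hM _ _ Ms Ms'; rewrite (Wt_cst hT hD subi subj H H' a0 a1 a0' a1' hpar hb cc hc s0 ss ss').
rewrite addbb.
have ssa : 0 <= s <= al by rewrite sa ltW.
have [-> ->] := hr s ssa.
rewrite ![f o + _ - _]addrAC !subrr !add0r /tt4 !xiZ // => h.
have s01 : 0 < s < 1 by lra.
have s01' : 0 < 1 - s < 1 by lra.
have : false = tt4 C0 (+) tt4 C1.
  by apply: h => u u01; have [? ?] := hc _ u s01 u01; have [? ?] := hc _ u s01' u01; split.
by rewrite -/(tt4 C0) -/(tt4 C1); case: (tt4 C0); case: (tt4 C1).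
Qed.

End Core2.

End RadialParity.

(** * A finite atlas and the subdivision of loops *)

Module ChartCover.
Import Discs Embeddings Stars FlatDiscs CrossingParity TriangleParity LoopHomotopy BoundaryCharts PathParity Detours SegmentParity LoopPieces RadialOrder BasePoints RadialParity.
Local Open Scope classical_set_scope.
Local Open Scope ring_scope.

Section Cover.
Variables (R : realType) (T : topologicalType).
Hypothesis hT : hausdorff_space T.
Hypothesis cT : compact [set: T].
Hypothesis hD : forall x : T, exists f g r, @disc R T f g (f x) r /\ g (f x) = x.

Lemma fin_cover (K : set T) (U : T -> set T) : closed K -> (forall x, K x -> nbhs x (U x)) ->
  exists s : seq T, forall x, K x -> exists2 y, y \in s & K y /\ U y x.
Proof.
move=> cK hU; have /compact_near_coveringP cov := subclosed_compact cK cT (subsetT _).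
(* The filter generated by the finite sequences that extend a given one; compactness tested on it
   yields a finite subcover. *)
pose F (A : set (seq T)) := exists s0 : seq T, forall s, {subset s0 <= s} -> A s.
have FF : Filter F.
  split.
  - by exists [::].
  - move=> A B [s1 h1] [s2 h2]; exists (s1 ++ s2) => s hs; split; [apply: h1|apply: h2] => x xs; apply: hs;
    by rewrite mem_cat xs ?orbT.
  - by move=> A B AB [s1 h1]; exists s1 => s /h1; exact: AB.
have [] := cov (seq T) F (fun s x => exists2 y, y \in s & K y /\ U y x) FF.
  move=> x Kx; exists (U x, [set s : seq T | x \in s]) => /=.
    split; first exact: hU.
    by exists [:: x] => s; apply; rewrite inE.
  by move=> [y s] /= [Uy xs]; exists x.
by move=> s0 /(_ s0 (fun _ h => h)) h; exists s0.
Qed.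

Lemma fin_coverI (K : set T) (U : T -> set T) : closed K -> (forall x, K x -> nbhs x (U x)) ->
  exists n (p : 'I_n -> T), forall x, K x -> exists i, K (p i) /\ U (p i) x.
Proof.
move=> cK hU; have [s hs] := fin_cover cK hU.
exists (size s), (tnth (in_tuple s)) => x /hs[y ys h].
have ys' : (index y s < size s)%N by rewrite index_mem.
by exists (Ordinal ys'); rewrite (tnth_nth y) /= nth_index.
Qed.

Lemma chart_ex x (M : set T) : nbhs x M -> exists q : chart R T, Oc q x /\ forall y, Oc q y -> M y.
Proof.
move=> nM; have [f [g [r [D gx]]]] := hD x.
have Ox : oset g (f x) r x by exists (f x) => //=; rewrite /hboxo subrr normr0 (disc_r D) (disc_c D).
have [e [e0 he]] := chart_ball D Ox nM.
have D' : disc f g (f x) (Num.min e r).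
  by apply: (disc_le D); rewrite lt_min e0 (disc_r D) ge_min lexx orbT.
exists (Chart D'); split.
  by exists (f x) => //=; rewrite /hboxo subrr normr0 (disc_r D') (disc_c D').
move=> y [p /= /andP[]]; rewrite lt_min => /andP[h1 h2] h3 <-.
by have [] := he p (ltW h1) h3.
Qed.

Lemma K_nbhs (k : R) (i : chart R T) x : 0 < k <= 1 -> oset (cg i) (cc i) (k * crad i) x -> nbhs x (Kc k i).
Proof.
move=> k01 Ox; have D : disc (cf i) (cg i) (cc i) (k * crad i).
  by apply: (disc_le (cD i)); have := disc_r (cD i); nra.
have := open_nbhs_nbhs (conj (oset_open D) Ox); apply: filterS => y [p hp <-].
by exists p => //; exact: hboxoW.
Qed.

Lemma K_closed (k : R) (i : chart R T) : 0 < k <= 1 -> closed (Kc k i).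
Proof.
move=> k01; apply: disc_closed => //; apply: (disc_le (cD i)); have := disc_r (cD i); nra.
Qed.

(** The discs of ratio 1/2 cover the surface, and finitely many charts, each inside two discs of
    ratio 3/4, cover the overlaps. The number of these overlap charts determines the number of
    classes of loops. *)
Lemma cover_data : exists (I Q : finType) (ch : I -> chart R T) (qc : Q -> chart R T) (qi qj : Q -> I),
  [/\ forall q y, Oc (qc q) y -> Kc (3 / 4) (ch (qi q)) y,
      forall q y, Oc (qc q) y -> Kc (3 / 4) (ch (qj q)) y,
      forall x, exists i, oset (cg (ch i)) (cc (ch i)) (1 / 2 * crad (ch i)) x &
      forall i j x, Kc (1 / 2) (ch i) x -> Kc (1 / 2) (ch j) x -> exists q, [/\ qi q = i, qj q = j & Oc (qc q) x]].
Proof.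
have /choice[ch0 hch0] : forall x, exists q : chart R T, Oc q x /\ oset (cg q) (cc q) (1 / 2 * crad q) x.
  move=> x; have [f [g [r [D gx]]]] := hD x; exists (Chart D).
  have r0 := disc_r D; have c0 := disc_c D.
  split; exists (f x) => //=; rewrite /hboxo subrr normr0 c0 andbT //; lra.
have h12 : 0 < (1 / 2 : R) <= 1 by lra.
have h34 : 0 < (3 / 4 : R) <= 1 by lra.
have [n [p hp]] := @fin_coverI setT (fun x => oset (cg (ch0 x)) (cc (ch0 x)) (1 / 2 * crad (ch0 x))) closedT
  (fun x _ => open_nbhs_nbhs (conj (oset_open (disc_le (cD (ch0 x)) (r' := 1 / 2 * crad (ch0 x)) ltac:(by have := disc_r (cD (ch0 x)); lra))) (proj2 (hch0 x)))).
pose ch i := ch0 (p i).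
have pair (ij : 'I_n * 'I_n) : exists nq : {m : nat & 'I_m -> chart R T}, 
   (forall q y, Oc (projT2 nq q) y -> Kc (3 / 4) (ch ij.1) y /\ Kc (3 / 4) (ch ij.2) y) /\
   forall x, Kc (1 / 2) (ch ij.1) x -> Kc (1 / 2) (ch ij.2) x -> exists q, Oc (projT2 nq q) x.
  pose K := Kc (1 / 2) (ch ij.1) `&` Kc (1 / 2) (ch ij.2).
  have cK : closed K by apply: closedI; exact: K_closed.
  have nK x : K x -> nbhs x (Kc (3 / 4) (ch ij.1) `&` Kc (3 / 4) (ch ij.2)).
    have N i : Kc (1 / 2) (ch i) x -> nbhs x (Kc (3 / 4) (ch i)).
      move=> [q /= /andP[h1 h2] <-]; apply: K_nbhs => //; exists q => //=; rewrite /hboxo h2 andbT.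
      by have := disc_r (cD (ch i)); lra.
    by move=> [h1 h2]; apply: filterI; exact: N.
  have /choice[qq hqq] : forall x, exists q : chart R T, K x -> Oc q x /\ forall y, Oc q y -> (Kc (3 / 4) (ch ij.1) `&` Kc (3 / 4) (ch ij.2)) y.
    move=> x; have [Kx|nKx] := pselect (K x); last by exists (ch0 x).
    by have [q hq] := chart_ex (nK x Kx); exists q.
  have [|m [s hs]] := @fin_coverI K (fun x => [set y | K x -> Oc (qq x) y]) cK.
    move=> x Kx; have [Ox _] := hqq x Kx; have := open_nbhs_nbhs (conj (oset_open (cD (qq x))) Ox).
    by apply: filterS => y Oy _.
  have [m0|m0] := posnP m.
    exists (existT (fun m => 'I_m -> chart R T) 0%N (fun i => qq (s (cast_ord (esym m0) i)))); split => /=; first by case.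
    by move=> x h1 h2; have [[k km] _] := hs x (conj h1 h2); move: (km); rewrite {1}m0.
  have [[i0 Ki0]|nK0] := pselect (exists i, K (s i)); last first.
    exists (existT (fun m => 'I_m -> chart R T) 0%N (fun i : 'I_0 => ch0 (p ij.1))); split => /=; first by case.
    by move=> x h1 h2; have [k [Kk _]] := hs x (conj h1 h2); case: nK0; exists k.
  (* An index whose point is not in [K] carries a chart without properties and is redirected to
     [i0]. *)
  exists (existT (fun m => 'I_m -> chart R T) m (fun i => if `[< K (s i) >] then qq (s i) else qq (s i0))); split => /=.
    by move=> q y; case: asboolP => Kq; [have [_ h] := hqq _ Kq|have [_ h] := hqq _ Ki0] => /h [].
  by move=> x h1 h2; have [k [Kk Uk]] := hs x (conj h1 h2); exists k; rewrite (asboolT Kk); exact: Uk.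
have [nq hnq] := choice pair.
exists 'I_n, {ij : 'I_n * 'I_n & 'I_(projT1 (nq ij))}, ch, (fun q => projT2 (nq (tag q)) (tagged q)),
  (fun q => (tag q).1), (fun q => (tag q).2).
split.
- by move=> [ij q] y /=; have [h _] := hnq ij => /h[].
- by move=> [ij q] y /=; have [h _] := hnq ij => /h[].
- by move=> x; have [i [_ hi]] := hp x I; exists i.
- move=> i j x h1 h2; have [_ /(_ x h1 h2)[q hq]] := hnq (i, j).
  by exists (Tagged (fun ij => 'I_(projT1 (nq ij))) (q : 'I_(projT1 (nq (i, j))))).
Qed.

Variables (I Q : finType) (ch : I -> chart R T) (qc : Q -> chart R T) (qi qj : Q -> I).
Hypothesis hI : forall x, exists i, oset (cg (ch i)) (cc (ch i)) (1 / 2 * crad (ch i)) x.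
Hypothesis hQ : forall i j x, Kc (1 / 2) (ch i) x -> Kc (1 / 2) (ch j) x -> exists q, [/\ qi q = i, qj q = j & Oc (qc q) x].

(** The first and last pieces are assigned to the chart of the base point; [eta] makes them short
    enough to be radial. *)
Lemma ldata_ex i0 (a : R -> T) o (eta : R) : continuous a -> a 0 = o -> a 1 = o -> 
  oset (cg (ch i0)) (cc (ch i0)) (1 / 2 * crad (ch i0)) o -> 0 < eta ->
  exists m idx lab, [/\ ldata ch qc qi qj i0 a m idx lab, (0 < m)%N & 1 / m.+1%:R < eta].
Proof.
move=> ca a0 a1 Oo eta0.
have h12 : 0 < (1 / 2 : R) <= 1 by lra.
have near x i : oset (cg (ch i)) (cc (ch i)) (1 / 2 * crad (ch i)) (a x) -> exists e : R, 0 < e /\ forall y, `|y - x| < e -> Kc (1 / 2) (ch i) (a y).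
  by move=> /(K_nbhs h12) /(cts_nbhs (ca x)) /nbhsRP.
have [|d [d0 hd]] := @lebesgue_ball R R^o `[0, 1]%classic (fun x d => exists i, forall y : R, `|y - x| < d -> Kc (1 / 2) (ch i) (a y)) (@segment_compact R 0 1).
  move=> x0 _; have [i hi] := hI (a x0); have [e [e0 he]] := near x0 i hi.
  exists e; split => // x d xd; exists i => y yx; apply: he.
  by have := ler_distD x y x0; rewrite (distrC x); lra.
have [e1 [e10 he1]] : exists e : R, 0 < e /\ forall y, `|y - 0| < e -> Kc (1 / 2) (ch i0) (a y) by apply: near; rewrite a0.
have [e2 [e20 he2]] : exists e : R, 0 < e /\ forall y, `|y - 1| < e -> Kc (1 / 2) (ch i0) (a y) by apply: near; rewrite a1.
pose e := Num.min (Num.min d eta) (Num.min e1 e2).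
have e0 : 0 < e by rewrite !lt_min d0 eta0 e10 e20.
pose m := (Num.truncn e^-1).+1.
have me : 1 / m.+1%:R < e.
  have h : e^-1 < m.+1%:R.
    by apply: lt_trans (truncnS_gt e^-1) _; rewrite ltr_nat.
  by rewrite div1r -[e]invrK ltf_pV2 // posrE ?invr_gt0.
move: (me); rewrite !lt_min => /andP[/andP[md meta] /andP[me1 me2]].
have st k (u : R) : 0 <= u <= 1 -> `|(k%:R + u) / m.+1%:R - k%:R / m.+1%:R| <= 1 / m.+1%:R.
  move=> /andP[u0 u1]; rewrite -mulrBl addrAC subrr add0r ger0_norm ?divr_ge0 // ler_wpM2r // invr_ge0 //.
have /choice[ix hix] : forall k, exists i, (k <= m)%N -> forall u : R, 0 <= u <= 1 -> Kc (1 / 2) (ch i) (a ((k%:R + u) / m.+1%:R)).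
  move=> k; have [km|km] := leqP k m; last by exists i0.
  have [|i hi] := hd (k%:R / m.+1%:R); first by rewrite /= in_itv /= ndiv01 // ltnW.
  by exists i => _ u u01; apply: hi; exact: le_lt_trans (st k u u01) md.
pose idx k := if (k == 0%N) || (k == m) then i0 else ix k.
have hidx k : (k <= m)%N -> forall u : R, 0 <= u <= 1 -> Kc (1 / 2) (ch (idx k)) (a ((k%:R + u) / m.+1%:R)).
  move=> km u u01; rewrite /idx; case: eqP => [k0|_] /=.
    apply: he1; have := st 0%N u u01; rewrite k0 mul0r; move/le_lt_trans; exact.
  case: eqP => [kE|_]; last exact: hix.
  apply: he2; apply: le_lt_trans me2; rewrite kE distrC.
  have -> : 1 - (m%:R + u) / m.+1%:R = (1 - u) / m.+1%:R by rewrite -[m.+1%:R]natr1; field; rewrite natr1 pnatr_eq0.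
  move: u01 => /andP[u0 u1]; rewrite ger0_norm ?divr_ge0 ?subr_ge0 //.
  by rewrite ler_wpM2r // ?invr_ge0 //; lra.
have /choice[lab hlab] : forall k, exists q, (k < m)%N -> [/\ qi q = idx k, qj q = idx k.+1 & Oc (qc q) (a (k.+1%:R / m.+1%:R))].
  have o0 : 0 <= (0 : R) <= 1 by rewrite lexx ler01.
  have o1 : 0 <= (1 : R) <= 1 by rewrite lexx ler01.
  have ex k : (k < m)%N -> exists q, [/\ qi q = idx k, qj q = idx k.+1 & Oc (qc q) (a (k.+1%:R / m.+1%:R))].
    move=> km; apply: hQ.
      by have := hidx k (ltnW km) 1 o1; rewrite natr1.
    by have := hidx k.+1 km 0 o0; rewrite addr0.
  move=> k; have [km|km] := ltnP k m; first by have [q hq] := ex k km; exists q.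
  by have [q _] := ex 0%N isT; exists q.
exists m, idx, lab; split => //; split => //.
- by rewrite /idx eqxx orbT.
- by move=> k /hlab[].
- by move=> k /hlab[].
- by move=> k /hlab[].
Qed.

End Cover.

End ChartCover.

(** * The class of a loop of the drawing *)

Module Bouquets.
Import Discs Embeddings Stars FlatDiscs CrossingParity TriangleParity LoopHomotopy BoundaryCharts PathParity Detours SegmentParity LoopPieces RadialOrder BasePoints RadialParity ChartCover.
Local Open Scope classical_set_scope.
Local Open Scope ring_scope.

Section Bouquet.
Variables (R : realType) (T : topologicalType) (V E : finType).
Hypothesis hT : hausdorff_space T.
Hypothesis hD : forall x : T, exists f g r, @disc R T f g (f x) r /\ g (f x) = x.
Variables (I Q : finType) (ch : I -> chart R T) (qc : Q -> chart R T) (qi qj : Q -> I).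
Hypothesis subi : forall q y, Oc (qc q) y -> Kc (3 / 4) (ch (qi q)) y.
Hypothesis subj : forall q y, Oc (qc q) y -> Kc (3 / 4) (ch (qj q)) y.
Hypothesis hI : forall x, exists i, oset (cg (ch i)) (cc (ch i)) (1 / 2 * crad (ch i)) x.
Hypothesis hQ : forall i j x, Kc (1 / 2) (ch i) x -> Kc (1 / 2) (ch j) x -> exists q, [/\ qi q = i, qj q = j & Oc (qc q) x].
Implicit Types (s t : E -> V) (A : {set V}) (F : {set E}) (pos : V -> T) (path : E -> R -> T).

(** [par e] counts mod 2 the overlaps used along the loop [e]. For two loops of the same class,
    [core] is applied with the third loop as the curve [c]. *)
Lemma bouquet s t A F pos path u0 i0 r (dir : E -> bool -> R * R) :
  emb s t A F pos path -> u0 \in A ->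
  oset (cg (ch i0)) (cc (ch i0)) (1 / 2 * crad (ch i0)) (pos u0) -> (cf (ch i0) (pos u0)).2 = 0 ->
  flat s t A F pos path u0 (cf (ch i0)) (cg (ch i0)) (cf (ch i0) (pos u0)) r dir ->
  exists par : E -> {ffun Q -> bool}, forall e e' e'',
    (forall d, d \in [:: e; e'; e''] -> [/\ d \in F, s d = u0 & t d = u0]) -> e'' != e -> e'' != e' -> par e = par e' ->
    let x d b := xi (dir d b - cf (ch i0) (pos u0)) in
    (x e false < x e'' false) (+) (x e true < x e'' false) (+) (x e' false < x e'' false) (+) (x e' true < x e'' false) =
    (x e false < x e'' true) (+) (x e true < x e'' true) (+) (x e' false < x e'' true) (+) (x e' true < x e'' true).
Proof.
move=> H uA Oo c2 Fl; set f := cf (ch i0) in Fl c2 *; set g := cg (ch i0) in Fl Oo; set c := f (pos u0) in Fl c2 *.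
have D := flat_disc1 Fl; have r0 := fl_r Fl; have pg := fl_pos Fl.
have h0 : hbox c r c by rewrite /hbox subrr normr0 ltW // c2 lexx.
have end0 d : d \in F -> s d = u0 -> path d 0 = pos u0 by move=> dF sd; rewrite (emb_0 H dF) sd.
have end1 d : d \in F -> t d = u0 -> path d 1 = pos u0 by move=> dF td; rewrite (emb_1 H dF) td.
have rad d b : d \in F -> endp s t b d = u0 -> exists2 al : R, 0 < al < 1 & forall x : R, 0 <= x <= al ->
     f (hpath path b d x) = c + x *: (al^-1 *: (dir d b - c)).
  move=> dF hd; have [al al01 hal] := fl_rad Fl dF hd; exists al => // x x01; rewrite hal // scalerA.
  have al0 : 0 < al by case/andP: al01.
  rewrite (disc_fg D) //; have [/andP[hd1 hd2] hd3] := fl_dir Fl dF hd.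
  have k01 : 0 <= x / al <= 1.
    by case/andP: x01 => x0 xl; rewrite divr_ge0 ?(ltW al0) //= ler_pdivrMr // mul1r.
  apply/andP; split.
    rewrite addrAC subrr add0r nrm_le; move: hd1; rewrite nrm_le => /andP[n1 n2].
    have N z : `|z| <= r -> `|x / al * z| <= r.
      move=> zr; rewrite normrM ger0_norm; last by case/andP: k01.
      by case/andP: k01 => k0 k1; rewrite -[r]mul1r ler_pM.
    by apply/andP; split; apply: N.
  have -> : (c + (x / al) *: (dir d b - c)).2 = x / al * (dir d b).2 by rewrite /= c2 add0r subr0.
  by rewrite mulr_ge0 //; case/andP: k01.
pose good d p := exists al0 al1 m idx lab, [/\ 0 < al0 < 1, 0 < al1 < 1,
   forall x : R, 0 <= x <= al0 -> f (path d x) = c + x *: (al0^-1 *: (dir d false - c)),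
   forall x : R, 0 <= x <= al1 -> f (path d (1 - x)) = c + x *: (al1^-1 *: (dir d true - c)) &
   [/\ ldata ch qc qi qj i0 (path d) m idx lab, (0 < m)%N, 1 / m.+1%:R < al0, 1 / m.+1%:R < al1 &
   forall q : Q, (p : {ffun Q -> bool}) q = \big[addb/false]_(0 <= k < m) (lab k == q)]].
have /choice[par hpar] : forall d, exists p, [/\ d \in F, s d = u0 & t d = u0] -> good d p.
  move=> d; have [[dF sd td]|h] := pselect [/\ d \in F, s d = u0 & t d = u0]; last by exists [ffun=> false].
  have [al0 al01 h1] := rad d false dF sd; have [al1 al11 h2] := rad d true dF td.
  have eta0 : 0 < Num.min al0 al1 by rewrite lt_min; case/andP: al01 => ->; case/andP: al11 => ->.
  have [m [idx [lab [ld m0 me]]]] := ldata_ex hI hQ (emb_c H dF) (end0 d dF sd) (end1 d dF td) Oo eta0.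
  exists [ffun q => \big[addb/false]_(0 <= k < m) (lab k == q)] => _.
  move: me; rewrite lt_min => /andP[me1 me2].
  exists al0, al1, m, idx, lab; split => //; split => // q; by rewrite ffunE.
have n0 d b : d \in F -> endp s t b d = u0 -> dir d b - c != 0.
  by move=> dF hd; have [_ h] := fl_dir Fl dF hd; rewrite -normr_eq0 h gt_eqF.
have p2 d b : d \in F -> endp s t b d = u0 -> 0 <= (dir d b - c).2.
  by move=> dF hd; have [/andP[_ h] _] := fl_dir Fl dF hd; rewrite /= c2 subr0.
have sc (k : R) (X : R * R) : 0 < k -> X != 0 -> 0 <= X.2 -> k *: X != 0 /\ 0 <= (k *: X).2.
  move=> k0 X0 X2; split; first by rewrite scaler_eq0 negb_or X0 gt_eqF.
  by apply: mulr_ge0 => //; exact: ltW.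
exists par => e e' e'' hde n1 n2 pe x.
have he : [/\ e \in F, s e = u0 & t e = u0] by apply: hde; rewrite !inE eqxx.
have he' : [/\ e' \in F, s e' = u0 & t e' = u0] by apply: hde; rewrite !inE eqxx orbT.
have he'' : [/\ e'' \in F, s e'' = u0 & t e'' = u0] by apply: hde; rewrite !inE eqxx !orbT.
have [al0 [al1 [m [idx [lab [a01 a11 f0 f1 [ld m0 ma0 ma1 hp]]]]]]] := hpar e he.
have [al0' [al1' [m' [idx' [lab' [a01' a11' f0' f1' [ld' m0' ma0' ma1' hp']]]]]]] := hpar e' he'.
have [be0 [be1 [_ [_ [_ [b01 b11 g0 g1 _]]]]]] := hpar e'' he''.
case: he => eF se te; case: he' => eF' se' te'; case: he'' => eF'' se'' te''.
have radl d al n : d \in F -> s d = u0 -> 0 < al < 1 -> 1 / n.+1%:R < al -> 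
  (forall x : R, 0 <= x <= al -> f (path d x) = c + x *: (al^-1 *: (dir d false - c))) ->
  radial ch i0 (pos u0) ((n.+1%:R)^-1 *: (al^-1 *: (dir d false - c))) (piece (path d) n 0).
  move=> dF sd /andP[k0 k1] nl hf.
  have [q1 q2] := sc al^-1 _ ltac:(by rewrite invr_gt0) (n0 d false dF sd) (p2 d false dF sd).
  have ni : (0 : R) < n.+1%:R^-1 by rewrite invr_gt0 ltr0n.
  have [q3 q4] := sc _ _ ni q1 q2; split => // u /andP[u0' u1].
  have -> : piece (path d) n 0 u = path d (u / n.+1%:R) by rewrite /piece add0r.
  rewrite -/f -/c [u *: _]scalerA; apply: hf; apply/andP; split; first by rewrite divr_ge0.
  by apply: ltW; apply: le_lt_trans nl; rewrite ler_pM2r.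
have radr d al n : d \in F -> t d = u0 -> 0 < al < 1 -> 1 / n.+1%:R < al -> 
  (forall x : R, 0 <= x <= al -> f (path d (1 - x)) = c + x *: (al^-1 *: (dir d true - c))) ->
  radial ch i0 (pos u0) ((n.+1%:R)^-1 *: (al^-1 *: (dir d true - c))) (fun u => piece (path d) n n (1 - u)).
  move=> dF sd /andP[k0 k1] nl hf.
  have [q1 q2] := sc al^-1 _ ltac:(by rewrite invr_gt0) (n0 d true dF sd) (p2 d true dF sd).
  have ni : (0 : R) < n.+1%:R^-1 by rewrite invr_gt0 ltr0n.
  have [q3 q4] := sc _ _ ni q1 q2; split => // u /andP[u0' u1].
  have -> : piece (path d) n n (1 - u) = path d (1 - u / n.+1%:R).
    by rewrite /piece; congr (path d _); rewrite -[n.+1%:R]natr1; field; rewrite natr1 pnatr_eq0.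
  rewrite -/f -/c [u *: _]scalerA; apply: hf; apply/andP; split; first by rewrite divr_ge0.
  by apply: ltW; apply: le_lt_trans nl; rewrite ler_pM2r.
have int d u : d \in F -> 0 < u < 1 -> path d u <> pos u0 by move=> dF u01; exact: (emb_v H dF uA).
have parE q : \big[addb/false]_(0 <= k < m) (lab k == q) = \big[addb/false]_(0 <= k < m') (lab' k == q).
  by rewrite -hp -hp' pe.
have Oc0 : Oc (ch i0) (pos u0).
  case: Oo => p /= /andP[k1 k2] <-; exists p => //=; rewrite /hboxo k2 andbT.
  by apply: lt_trans k1 _; rewrite gtr_pMl ?(disc_r (cD (ch i0))) //; lra.
have be01 : 0 < Num.min be0 be1 by rewrite lt_min; case/andP: b01 => ->; case/andP: b11 => ->.
have := core hT hD subi subj ld ld' (end0 e eF se) (end1 e eF te) (end0 e' eF' se') (end1 e' eF' te') parE m0 m0' Oc0 c2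
  (fun u => int e u eF) (fun u => int e' u eF') (radl e al0 m eF se a01 ma0 f0) (radr e al1 m eF te a11 ma1 f1)
  (radl e' al0' m' eF' se' a01' ma0' f0') (radr e' al1' m' eF' te' a11' ma1' f1')
  (emb_c H eF'') (end0 e'' eF'' se'') (end1 e'' eF'' te'') _ be01 
  (C0 := be0^-1 *: (dir e'' false - c)) (C1 := be1^-1 *: (dir e'' true - c)).
have V0 (z : R) : 0 < z < 1 -> 0 < z^-1 by case/andP => ? _; rewrite invr_gt0.
have VN n : (0 : R) < n.+1%:R^-1 by rewrite invr_gt0 ltr0n.
rewrite /tt4 !xiZ //; try (by apply: V0).
apply.
  move=> u v u01 v01; split => h.
    by have [h1 _] := emb_i H eF'' eF u01 v01 (esym h); move: n1; rewrite h1 eqxx.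
  by have [h1 _] := emb_i H eF'' eF' u01 v01 (esym h); move: n2; rewrite h1 eqxx.
move=> u /andP[u0' ul]; move: ul; rewrite le_min => /andP[ul1 ul2].
by split; [apply: g0; rewrite u0'|apply: g1; rewrite u0'].
Qed.

End Bouquet.

End Bouquets.

(** * Counting classes of minimal cuts *)

Module DualWalks.

Section Dual.
Variables (E O : finType) (l r : E -> O).
Implicit Types (Y Z : {set E}) (e f : E) (x y : O).

(** The edge [e] is read as a dual edge between [l e] and [r e], and this is the boundary mod 2 of a
    set of dual edges. *)
Definition bd Y x : bool := \big[addb/false]_(f in Y) ((l f == x) (+) (r f == x)).
Definition sdiff Y Z : {set E} := [set e | (e \in Y) (+) (e \in Z)].
Definition inc e x y := ((l e == x) && (r e == y)) || ((l e == y) && (r e == x)).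

Lemma big_set_addb (g : E -> bool) Y : \big[addb/false]_(f in Y) g f = \big[addb/false]_f ((f \in Y) && g f).
Proof. by rewrite big_mkcond; apply: eq_bigr => f _; case: (f \in Y). Qed.

Lemma sdiff_sum (g : E -> bool) Y Z : \big[addb/false]_(f in sdiff Y Z) g f =
  \big[addb/false]_(f in Y) g f (+) \big[addb/false]_(f in Z) g f.
Proof. by rewrite !big_set_addb -big_split /=; apply: eq_bigr => f _; rewrite inE andb_addl. Qed.

Lemma bd_sdiff Y Z x : bd (sdiff Y Z) x = bd Y x (+) bd Z x.
Proof. exact: sdiff_sum. Qed.

Lemma inc_sum e x y z : inc e x y -> (l e == z) (+) (r e == z) = (x == z) (+) (y == z).
Proof. by case/orP => /andP[/eqP -> /eqP ->] //; rewrite addbC. Qed.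

(** Inner nodes are visited once, while the first and last nodes may coincide, so simple closed
    walks are included. *)
Record walk Y n (x : nat -> O) (ed : nat -> E) : Prop := Walk {
  wk_in : forall i, i < n -> ed i \in Y;
  wk_inc : forall i, i < n -> inc (ed i) (x i) (x i.+1);
  wk_inj : forall i j, i < n -> j < n -> ed i = ed j -> i = j;
  wk_nodes : forall i j, 0 < i < n -> j <= n -> x i = x j -> i = j }.

Definition adj Y x y := [exists f in Y, inc f x y].

Lemma inc_sym e x y : inc e x y = inc e y x.
Proof. by rewrite /inc orbC. Qed.

Lemma adj_sym Y : symmetric (adj Y).
Proof. by move=> x y; apply: eq_existsb => f; rewrite inc_sym. Qed.

Lemma conn_sym Y : connect_sym (adj Y).
Proof. exact/sym_connect_sym/adj_sym. Qed.

Lemma inc_uniq e (x : nat -> O) n i j : (forall i j, i <= n -> j <= n -> x i = x j -> i = j) ->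
  i < n -> j < n -> inc e (x i) (x i.+1) -> inc e (x j) (x j.+1) -> i = j.
Proof.
move=> hx ni nj; rewrite /inc => h1 h2.
have : (x i = x j /\ x i.+1 = x j.+1) \/ (x i = x j.+1 /\ x i.+1 = x j).
  by case/orP: h1 => /andP[/eqP a1 /eqP a2]; case/orP: h2 => /andP[/eqP a3 /eqP a4]; 
    rewrite -?a1 -?a2 -?a3 -?a4; auto.
case=> [[/hx h _]|[/hx h3 /hx h4]]; first by apply: h; exact: ltnW.
have := h3 (ltnW ni) nj; have := h4 ni (ltnW nj); lia.
Qed.

Lemma addb_only (P : pred O) Y e : e \in Y -> (forall f, f \in Y -> f != e -> P (l f) = P (r f)) ->
  \big[addb/false]_(x | P x) bd Y x = P (l e) (+) P (r e).
Proof.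
move=> eY h; rewrite /bd exchange_big /= (bigD1 e) //= [X in _ (+) X]big1 ?addbF.
  rewrite big_split /=.
  have E1 z : \big[addb/false]_(i | P i) (z == i) = P z.
    rewrite big_mkcond (bigD1 z) //= eqxx big1 ?addbF; first by case: (P z).
    by move=> i; rewrite eq_sym => /negbTE ->; case: ifP.
  by rewrite !E1.
move=> f /andP[fY fe]; rewrite big_split /=.
have E1 z : \big[addb/false]_(i | P i) (z == i) = P z.
  rewrite big_mkcond (bigD1 z) //= eqxx big1 ?addbF; first by case: (P z).
  by move=> i; rewrite eq_sym => /negbTE ->; case: ifP.
by rewrite !E1 (h f) // addbb.
Qed.

(** Parity count in the component of [u] after the removal of [e]: the component is left by the
    single edge [e], so it contains an odd node. *)
Lemma reach_apex (Ap : {set O}) Y e (u v : O) : e \in Y -> inc e u v -> (forall x, bd Y x -> x \in Ap) ->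
  ~~ connect (adj (Y :\ e)) u v -> exists2 a, a \in Ap & connect (adj (Y :\ e)) u a.
Proof.
move=> eY iuv odd nc.
suff /existsP[a /andP[aA ca]] : [exists a, (a \in Ap) && connect (adj (Y :\ e)) u a] by exists a.
apply: contraNT nc; rewrite negb_exists => /forallP h.
have := @addb_only (fun x => connect (adj (Y :\ e)) u x) Y e eY.
rewrite big1 => [|x ux]; last first.
  by apply: contraTF (h x) => /odd ->; rewrite ux.
have -> : connect (adj (Y :\ e)) u (l e) (+) connect (adj (Y :\ e)) u (r e) = ~~ connect (adj (Y :\ e)) u v.
  by case/orP: iuv => /andP[/eqP -> /eqP ->]; rewrite connect0 // addbC.
move=> /(_ _)/esym/negbFE; apply => f fY fe.
have af : adj (Y :\ e) (l f) (r f).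
  by apply/existsP; exists f; rewrite !inE fe fY /inc !eqxx.
apply/idP/idP => h1; apply: connect_trans h1 _; apply: connect1 => //.
by rewrite adj_sym.
Qed.

Lemma node_walk (Y : {set E}) (e0 : E) (ec : O -> O -> E) (x0 : O) (p : seq O) :
  (forall x y, adj Y x y -> ec x y \in Y /\ inc (ec x y) x y) ->
  path (adj Y) x0 p -> uniq (x0 :: p) ->
  let x i := nth x0 (x0 :: p) i in let ed i := ec (x i) (x i.+1) in
  [/\ forall i, i < size p -> ed i \in Y /\ inc (ed i) (x i) (x i.+1),
      forall i j, i < size p -> j < size p -> ed i = ed j -> i = j &
      forall i j, i <= size p -> j <= size p -> x i = x j -> i = j].
Proof.
move=> hec pp up x ed.
have ix i j : i <= size p -> j <= size p -> x i = x j -> i = j.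
  by move=> hi hj /eqP; rewrite /x nth_uniq //= ?ltnS // => /eqP.
have he i : i < size p -> ed i \in Y /\ inc (ed i) (x i) (x i.+1).
  by move=> hi; apply: hec; exact: (pathP x0 pp).
split => // i j hi hj e; apply: (@inc_uniq (ed i) x (size p)) => //; first by have [] := he i hi.
by rewrite e; have [] := he j hj.
Qed.

(** If [e] is not a bridge, a simple path between its ends closes it to a cycle. If it is, each side
    contains an odd node, and simple paths to these two nodes are disjoint. *)
Lemma piece_ex (Ap : {set O}) Y e : e \in Y -> (forall x, bd Y x -> x \in Ap) ->
  exists n (x : nat -> O) (ed : nat -> E), [/\ walk Y n x ed, exists2 i, i < n & ed i = e &
    x 0 = x n \/ (x 0 \in Ap /\ x n \in Ap)].
Proof.
move=> eY odd.
have [c|nc] := boolP (connect (adj (Y :\ e)) (r e) (l e)).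
  case/connectP: c => p0 pp0 lp0; case/shortenP: pp0 lp0 => p pp up _ lp.
  pose ec x y := odflt e [pick f in Y :\ e | inc f x y].
  have hec x y : adj (Y :\ e) x y -> ec x y \in Y :\ e /\ inc (ec x y) x y.
    move=> /existsP[f /andP[fY fi]]; rewrite /ec; case: pickP => [g /andP[]//|/(_ f)].
    by rewrite fY fi.
  pose x i := nth (r e) (r e :: p) i.
  have [h1 h2 h3] := node_walk e hec pp up; rewrite -/x in h1 h2 h3.
  have xn : x (size p) = l e by rewrite lp (last_nth (r e)).
  exists (size p).+1, (fun i => if i is j.+1 then x j else l e), (fun i => if i is j.+1 then ec (x j) (x j.+1) else e).
  split; last by left; rewrite xn.
    split.
    - by move=> [|i] // /h1[]; rewrite inE => /andP[].
    - move=> [|i] hi; first by rewrite /inc /x /= !eqxx.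
      by have [] := h1 i hi.
    - move=> [|i] [|j] // hi hj.
      + by have [] := h1 j hj; rewrite !inE => + _ ee; rewrite -ee eqxx.
      + by have [] := h1 i hi; rewrite !inE => + _ ee; rewrite ee eqxx.
      + by move=> /h2 ->.
    - move=> [|i] [|j] // /=; rewrite ltnS => hi hj.
        by rewrite -xn => /h3 ee; move: (hi); rewrite (ee (ltnW hi) (leqnn _)) ltnn.
      by move=> /h3 -> //; exact: ltnW.
  by exists 0.
have ncs : ~~ connect (adj (Y :\ e)) (l e) (r e) by rewrite conn_sym.
have [|b bA cb] := reach_apex eY _ odd nc; first by rewrite /inc !eqxx orbT.
have [|a aA ca] := reach_apex eY _ odd ncs; first by rewrite /inc !eqxx.
rewrite conn_sym in ca.
case/connectP: ca => p0 pp0 lp0; case/shortenP: pp0 lp0 => p pp up _ lp.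
case/connectP: cb => q0 pq0 lq0; case/shortenP: pq0 lq0 => q pq uq _ lq.
pose ec x y := if inc e x y then e else odflt e [pick f in Y | inc f x y].
have hec x y : adj Y x y -> ec x y \in Y /\ inc (ec x y) x y.
  move=> /existsP[f /andP[fY fi]]; rewrite /ec; case: ifP => // _; case: pickP => [g /andP[]//|/(_ f)].
  by rewrite fY fi.
have sub : subrel (adj (Y :\ e)) (adj Y).
  by move=> x y /existsP[f /andP[fY fi]]; apply/existsP; exists f; rewrite fi andbT; move: fY; rewrite inE => /andP[].
pose z := p ++ r e :: q.
have pz : path (adj Y) a z.
  rewrite cat_path (sub_path sub pp) /= -lp (sub_path sub pq) andbT.
  by apply/existsP; exists e; rewrite eY /inc !eqxx.
have uz : uniq (a :: z).
  rewrite /z -cat_cons cat_uniq; apply/and3P; split => //.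
  apply/hasPn => y yq; apply/negP => yp.
  move: ncs => /negP; apply.
  have h1 : connect (adj (Y :\ e)) a y by apply: (@path_connect _ _ a p pp).
  have h2 : connect (adj (Y :\ e)) (r e) y by apply: (@path_connect _ _ (r e) q pq).
  have h3 : connect (adj (Y :\ e)) a (l e) by apply/connectP; exists p.
  rewrite conn_sym in h3; apply: connect_trans h3 _; apply: connect_trans h1 _; by rewrite conn_sym.
pose x i := nth a (a :: z) i.
have [h1 h2 h3] := node_walk e hec pz uz; rewrite -/x in h1 h2 h3.
have sz : size z = (size p + (size q).+1)%N by rewrite size_cat.
exists (size z), x, (fun i => ec (x i) (x i.+1)); split.
- by split => [i /h1[]|i /h1[]|i j|i j /andP[_ hi] hj] //; [exact: h2|apply: h3 => //; exact: ltnW].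
- exists (size p); first by rewrite sz -addSnnS leq_addr.
  have -> : x (size p) = l e by rewrite /x -cat_cons nth_cat /= ltnS leqnn lp (last_nth a).
  have -> : x (size p).+1 = r e by rewrite /x -cat_cons nth_cat /= ltnn subnn.
  by rewrite /ec /inc !eqxx.
- right; split => //.
  have -> : x (size z) = b by rewrite /x -last_nth last_cat /= lq.
  by [].
Qed.

End Dual.

End DualWalks.

(** * Generic weights and equivalence of dual walks *)

Module MinimalCuts.
Import DualWalks.

Section Generic.
Variable R : realType.

(** The weights are powers of two, so a sum determines its set. *)
Lemma code_ex (E : finType) (sq : seq E) : uniq sq -> exists c : E -> nat, (forall e, 0 < c e)%N /\
  forall Y Z : {set E}, \sum_(e <- sq | e \in Y) c e = \sum_(e <- sq | e \in Z) c e :> nat -> {in sq, Y =i Z}.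
Proof.
elim: sq => [|x sq IH] /=; first by move=> _; exists (fun=> 1%N); split.
move=> /andP[xs us]; have [c [c0 hc]] := IH us.
exists (fun e => if e == x then 1 else (c e).*2)%N; split; first by move=> e; case: eqP => // _; rewrite double_gt0.
have E1 (Y : {set E}) : \sum_(e <- sq | e \in Y) (if e == x then 1 else (c e).*2)%N = (\sum_(e <- sq | e \in Y) c e).*2.
  rewrite -mul2n big_distrr /= big_seq_cond [RHS]big_seq_cond; apply: eq_bigr => e /andP[es _].
  by rewrite mul2n; case: eqP => // ex; rewrite -ex es in xs.
have E2 (Y : {set E}) : \sum_(e <- x :: sq | e \in Y) (if e == x then 1 else (c e).*2)%N =
   ((x \in Y) + (\sum_(e <- sq | e \in Y) c e).*2)%N.
  by rewrite big_cons E1 eqxx; case: (x \in Y).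
move=> Y Z; rewrite !E2 => h.
have hx : (x \in Y) = (x \in Z).
  by have := congr1 odd h; rewrite !oddD !odd_double !addbF !oddb.
move: h; rewrite hx => /addnI/double_inj/hc h e; rewrite inE => /orP[/eqP ->//|]; exact: h.
Qed.

Lemma le_cancel (a b c d : R) : (a <= d -> d <= a - b + c -> b <= c)%R.
Proof. lra. Qed.

Lemma gap_ex (I : finType) (g : I -> R) : exists d : R, (0 < d)%R /\ forall i, (0 < g i)%R -> (d <= g i)%R.
Proof.
exists (\big[Num.min/1%R]_(i | (0 < g i)%R) g i); split.
  by elim/big_ind: _ => // x y x0 y0; rewrite lt_min x0.
by move=> i gi; rewrite (bigD1 i) //= ge_min lexx.
Qed.

(** The weights are perturbed by [ep] times a binary code, where [ep] is so small that the total
    perturbation is below the least positive difference of two sums of [w]. *)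
Lemma generic_weight (E : finType) (w : E -> R) : (forall e, 0 <= w e)%R -> exists mu : E -> R,
  [/\ forall e, (0 < mu e)%R,
      forall Y Z : {set E}, (\sum_(e in Y) mu e = \sum_(e in Z) mu e)%R -> Y = Z &
      forall Y Z : {set E}, (\sum_(e in Y) mu e <= \sum_(e in Z) mu e)%R -> (\sum_(e in Y) w e <= \sum_(e in Z) w e)%R].
Proof.
move=> w0; have [c [c0 hc]] := code_ex (index_enum_uniq E).
have [d [d0 hd]] := gap_ex (fun YZ : {set E} * {set E} => (\sum_(e in YZ.2) w e - \sum_(e in YZ.1) w e)%R).
pose M := (\sum_e c e).+1.
pose ep := (d / M%:R)%R.
have M0 : (0 < M%:R :> R)%R by rewrite ltr0n.
have ep0 : (0 < ep)%R by rewrite divr_gt0.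
pose cs (Y : {set E}) := (\sum_(e in Y) c e)%N.
have S (Y : {set E}) : (\sum_(e in Y) (w e + ep * (c e)%:R) = \sum_(e in Y) w e + ep * (cs Y)%:R)%R.
  by rewrite big_split /= -mulr_sumr -natr_sum.
have csM (Y : {set E}) : (ep * (cs Y)%:R < d)%R.
  rewrite /ep mulrAC ltr_pdivrMr // ltr_pM2l // ltr_nat ltnS /cs [X in (_ <= X)%N](bigID (mem Y)) /=.
  exact: leq_addr.
have le (Y Z : {set E}) : (\sum_(e in Y) (w e + ep * (c e)%:R) <= \sum_(e in Z) (w e + ep * (c e)%:R))%R -> (\sum_(e in Y) w e <= \sum_(e in Z) w e)%R.
  rewrite !S => h; rewrite leNgt; apply/negP => lt.
  have := hd (Z, Y); rewrite /= subr_gt0 => /(_ lt) h1.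
  have h2 := csM Z; have h3 : (0 <= ep * (cs Y)%:R)%R by rewrite mulr_ge0 ?ler0n // ltW.
  by move: h h1 h2 h3; clear; lra.
exists (fun e => (w e + ep * (c e)%:R)%R); split => //.
- by move=> e; rewrite ltr_wpDl // mulr_gt0 // ltr0n.
- move=> Y Z h; have h1 : (\sum_(e in Y) w e = \sum_(e in Z) w e)%R.
    by apply/eqP; rewrite eq_le !le // h.
  move: h; rewrite !S h1 => /addrI/(mulfI (lt0r_neq0 ep0))/eqP; rewrite eqr_nat => /eqP/hc h.
  by apply/setP => e; apply: h; rewrite mem_index_enum.
Qed.

End Generic.

Section Count.
Variables (R : realType) (V E O KI : finType) (s t : E -> V) (l r : E -> O).
Variables (E0 : {set E}) (N k : nat) (tau : 'I_N -> V) (circ : 'I_N -> 'I_k) (S : KI -> {set E}).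
Implicit Types (Y Z p : {set E}) (si : {ffun V -> bool}).

Definition cut si : {set E} := [set e | si (s e) != si (t e)].

(** The duality in combinatorial form, established for drawings in [few_comps]: cuts are dual
    cycles, and dual cycles are cuts up to combinations of the sets [S q]. [E0] will hold the
    boundary arcs, which are not counted in the weight of a cut. *)
Hypothesis bd_cut : forall si x, bd l r (cut si) x = false.
Hypothesis star : forall Y, (forall x, bd l r Y x = false) -> exists (si : {ffun V -> bool}) (y : {ffun KI -> bool}),
  forall e, (e \in Y) = (e \in cut si) (+) \big[addb/false]_q (y q && (e \in S q)).
Hypothesis hcirc : forall si, (forall e, e \in E0 -> e \notin cut si) -> forall i j, circ i = circ j -> si (tau i) = si (tau j).
Hypothesis hconn : forall si, cut si = finset.set0 -> (forall i, si (tau i) = false) -> forall v, si v = false.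
Hypothesis cE0 : #|E0| <= N.
Hypothesis tauI : injective tau.

Definition sxor si si' : {ffun V -> bool} := [ffun v => si v (+) si' v].

Lemma cut_xor si si' : cut (sxor si si') = sdiff (cut si) (cut si').
Proof.
apply/setP => e; rewrite !inE !ffunE.
by move: (si (s e)) (si (t e)) (si' (s e)) (si' (t e)); do 4 case.
Qed.

(** Homology relative to the terminals: the difference is a cut with all terminals on one side, so
    one set can replace the other in a cut for a given region. *)
Definition sim Y Z := exists2 si : {ffun V -> bool}, (forall i, si (tau i) = false) & sdiff Y Z = cut si.

Definition TB : finType := ({ffun KI -> bool} * {ffun 'I_k -> bool})%type.

(** Sets with the same dual boundary are compared with a reference set: first by the coefficients on
    the [S q], then by the values of the remaining potential at the terminals. These values are
    constant on a circle because the sets avoid [E0], so the number of classes does not involve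
    [N]. *)
Lemma classes (b : O -> bool) : exists ka : {set E} -> TB, forall Y Z,
  Y \subset ~: E0 -> Z \subset ~: E0 -> (forall x, bd l r Y x = b x) -> (forall x, bd l r Z x = b x) ->
  ka Y = ka Z -> sim Y Z.
Proof.
pose P Y := Y \subset ~: E0 /\ forall x, bd l r Y x = b x.
have [[Y0 PY0]|nP] := pselect (exists Y : {set E}, P Y); last first.
  by exists (fun=> ([ffun=> false], [ffun=> false])) => Y Z Y1 _ Yb; case: nP; exists Y.
have /choice[sg hsg] : forall Y : {set E}, exists y : {ffun KI -> bool}, P Y -> exists si : {ffun V -> bool}, forall e,
    (e \in sdiff Y0 Y) = (e \in cut si) (+) \big[addb/false]_q (y q && (e \in S q)).
  move=> Y; have [PY|nPY] := pselect (P Y); last by exists [ffun=> false].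
  have [|si [y hy]] := star (Y := sdiff Y0 Y).
    by move=> x; rewrite bd_sdiff (proj2 PY0) (proj2 PY) addbb.
  by exists y => _; exists si.
have /choice[ref href] : forall y : {ffun KI -> bool}, exists Z : {set E}, (exists2 Y : {set E}, P Y & sg Y = y) -> P Z /\ sg Z = y.
  move=> y; have [[Y PY Yy]|h] := pselect (exists2 Y : {set E}, P Y & sg Y = y); last by exists Y0.
  by exists Y.
have /choice[fc hfc] : forall Y : {set E}, exists f : {ffun 'I_k -> bool}, P Y -> exists2 si : {ffun V -> bool}, sdiff (ref (sg Y)) Y = cut si &
    forall i, si (tau i) = f (circ i).
  move=> Y; have [PY|nPY] := pselect (P Y); last by exists [ffun=> false].
  have [PZ sZ] := href (sg Y) (ex_intro2 _ _ Y PY erefl).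
  have [si1 h1] := hsg Y PY; have [si2 h2] := hsg _ PZ; rewrite sZ in h2.
  have E1 : sdiff (ref (sg Y)) Y = cut (sxor si2 si1).
    rewrite cut_xor; apply/setP => e; move: (h1 e) (h2 e); rewrite !inE.
    by move: (\big[_/_]_q _) (e \in Y0) (e \in Y) (e \in ref _) (_ != _) (si2 _ != _); do 6 case.
  have nE e : e \in E0 -> e \notin cut (sxor si2 si1).
    move=> e0; rewrite -E1 inE; have := fintype.subsetP (proj1 PY) e; have := fintype.subsetP (proj1 PZ) e; rewrite !inE e0 /=.
    by case: (e \in Y) => [_ /(_ isT)//|]; case: (e \in ref _) => [/(_ isT)|].
  exists [ffun c => [exists i, (circ i == c) && sxor si2 si1 (tau i)]] => _.
  exists (sxor si2 si1) => // i; rewrite [RHS]ffunE; apply/idP/existsP => [h|[j /andP[/eqP cj h]]].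
    by exists i; rewrite eqxx.
  by rewrite (hcirc nE (esym cj)).
exists (fun Y => (sg Y, fc Y)) => Y Z Y1 Z1 Y2 Z2 [e1 e2].
have [si1 h1 h2] := hfc Y (conj Y1 Y2); have [si2 h3 h4] := hfc Z (conj Z1 Z2).
exists (sxor si1 si2); first by move=> i; rewrite ffunE h2 h4 e2 addbb.
rewrite cut_xor -h1 -h3 e1; apply/setP => e; rewrite !inE.
by case: (e \in Y); case: (e \in Z); case: (e \in ref _).
Qed.

Definition seg_ (ed : nat -> E) a b : {set E} := [set e | [exists i : 'I_b, (a <= i) && (ed i == e)]].

Lemma segP ed a b e : reflect (exists i, a <= i < b /\ ed i = e) (e \in seg_ ed a b).
Proof.
rewrite inE; apply: (iffP existsP) => [[i /andP[ai /eqP ei]]|[i [/andP[ai ib] ei]]].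
  by exists i; rewrite ai ltn_ord.
by exists (Ordinal ib); rewrite ai /= ei eqxx.
Qed.

Lemma seg_nil ed a : seg_ ed a a = finset.set0.
Proof. by apply/setP => e; rewrite finset.in_set0; apply/negP => /segP[i [/andP[h1 h2] _]]; move: (leq_ltn_trans h1 h2); rewrite ltnn. Qed.

Lemma seg_S Y n x ed a b : walk l r Y n x ed -> a <= b -> b < n ->
  seg_ ed a b.+1 = sdiff (seg_ ed a b) [set ed b].
Proof.
move=> w ab bn; apply/setP => e; rewrite [RHS]inE finset.in_set1.
have nb : ed b \notin seg_ ed a b.
  by apply/segP => -[i [/andP[_ ib] /(wk_inj w (ltn_trans ib bn) bn) e']]; rewrite e' ltnn in ib.
apply/segP/idP => [[i [/andP[ai ib] ei]]|].
  move: ib; rewrite ltnS leq_eqVlt => /orP[/eqP ib|ib].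
    by rewrite -ei ib (negbTE nb) eqxx.
  have ee : e \in seg_ ed a b by apply/segP; exists i; rewrite ai ib.
  by rewrite ee; case: eqP => // eb; rewrite -eb ee in nb.
have [->|_] := eqVneq e (ed b); first by move=> _; exists b; rewrite ab ltnSn.
by rewrite addbF => /segP[i [/andP[ai ib] ei]]; exists i; rewrite ai ltnS ltnW.
Qed.

Lemma bd1 e x : bd l r [set e] x = (l e == x) (+) (r e == x).
Proof. by rewrite /bd big_set1. Qed.

Lemma bd_seg Y n x ed a b z : walk l r Y n x ed -> a <= b -> b <= n ->
  bd l r (seg_ ed a b) z = (x a == z) (+) (x b == z).
Proof.
move=> w; elim: b => [|b IH].
  by rewrite leqn0 => /eqP -> _; rewrite seg_nil addbb /bd big_set0.
rewrite leq_eqVlt => /orP[/eqP <- _|]; first by rewrite seg_nil addbb /bd big_set0.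
rewrite ltnS => ab bn; rewrite (seg_S w ab bn) bd_sdiff IH //; last exact: ltnW.
rewrite bd1 (inc_sum _ (wk_inc w bn)).
by case: (x a == z); case: (x b == z); case: (_ == z).
Qed.

Lemma seg_sub Y n x ed a b : walk l r Y n x ed -> b <= n -> seg_ ed a b \subset Y.
Proof. by move=> w bn; apply/fintype.subsetP => e /segP[i [/andP[_ ib] <-]]; apply: (wk_in w); exact: leq_trans ib bn. Qed.

Lemma seg_split Y n x ed a b : walk l r Y n x ed -> a <= b -> b <= n ->
  sdiff (seg_ ed 0 a) (seg_ ed 0 b) = seg_ ed a b.
Proof.
move=> w; elim: b => [|b IH].
  by rewrite leqn0 => /eqP -> _; apply/setP => e; rewrite inE addbb seg_nil inE.
rewrite leq_eqVlt => /orP[/eqP <- _|]; first by apply/setP => e; rewrite inE addbb seg_nil inE.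
rewrite ltnS => ab bn; rewrite (seg_S w ab bn) (seg_S w (leq0n b) bn) -IH //; last exact: ltnW.
by apply/setP => e; rewrite !inE addbA.
Qed.

Variable w : E -> R.
Hypothesis w0 : forall e, (0 <= w e)%R.
Variable mu : E -> R.
Hypothesis mu0 : forall e, (0 < mu e)%R.
Hypothesis muI : forall Y Z : {set E}, (\sum_(e in Y) mu e = \sum_(e in Z) mu e)%R -> Y = Z.

Definition minim p := p \subset ~: E0 /\ forall p', p' \subset ~: E0 -> sim p p' ->
  (\sum_(e in p) mu e <= \sum_(e in p') mu e)%R.

Lemma sim_sym Y Z : sim Y Z -> sim Z Y.
Proof. by move=> [si h1 h2]; exists si => //; rewrite -h2; apply/setP => e; rewrite !inE addbC. Qed.

Lemma minim_eq p p' : minim p -> minim p' -> sim p p' -> p = p'.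
Proof.
move=> [h1 h2] [h3 h4] h; apply: muI; apply/eqP; rewrite eq_le h2 //= h4 //; exact: sim_sym.
Qed.

Definition Fs si := cut si :\: E0.
Definition optimal si := forall si', (forall i, si' (tau i) = si (tau i)) ->
  (\sum_(e in Fs si) mu e <= \sum_(e in Fs si') mu e)%R.

(** A cheaper equivalent [p'] put in place of [p] would make the optimal cut cheaper for the same
    region. *)
Lemma sub_minim si p : optimal si -> p \subset Fs si -> minim p.
Proof.
move=> op pF; have pE : p \subset ~: E0.
  by apply: fintype.subset_trans pF _; apply/fintype.subsetP => e; rewrite !inE => /andP[].
split => // p' pE' [si' t0 d].
have := op (sxor si si'); have -> : Fs (sxor si si') = sdiff (Fs si) (sdiff p p').
  rewrite d /Fs cut_xor; apply/setP => e; rewrite !inE; case e0 : (e \in E0) => //=.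
  have := fintype.subsetP pE e; have := fintype.subsetP pE' e; rewrite !inE e0 /=.
  have : e \in sdiff p p' = (e \in cut si') by rewrite d.
  by rewrite !inE; case: (e \in p) => [_ _ /(_ isT)//|]; case: (e \in p') => [_ /(_ isT)//|] <-.
move=> /(_ _) h; have {h} : (\sum_(e in Fs si) mu e <= \sum_(e in sdiff (Fs si) (sdiff p p')) mu e)%R.
  by apply: h => i; rewrite ffunE t0 addbF.
move=> h; have : (\sum_(e in sdiff (Fs si) (sdiff p p')) mu e <= \sum_(e in Fs si) mu e - \sum_(e in p) mu e + \sum_(e in p') mu e)%R.
  rewrite big_mkcond [X in (_ <= X - _ + _)%R]big_mkcond [X in (_ <= _ - X + _)%R]big_mkcond [X in (_ <= _ + X)%R]big_mkcond /=.
  rewrite -sumrB -big_split /=; apply: ler_sum => e _; rewrite !inE.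
  have := fintype.subsetP pF e; rewrite !inE; have := ltW (mu0 e).
  case: (e \in p) => m0; last by case: (e \in p') => _; case: (_ && _) => /=; lra.
  by move=> /(_ isT) ->; case: (e \in p') => /=; lra.
exact: le_cancel h.
Qed.

End Count.

End MinimalCuts.

(** * Counting the pieces and the cuts inside their union *)

Module CutCount.
Import DualWalks MinimalCuts.

Lemma card_bigcup_le (I T : finType) (P : {set I}) (F : I -> {set T}) m : (forall i, i \in P -> #|F i| <= m) ->
  #|\bigcup_(i in P) F i| <= #|P| * m.
Proof.
move=> h; rewrite -sum_nat_const.
apply: (@leq_trans (\sum_(i in P) #|F i|)); last exact: leq_sum.
elim/big_rec2: _ => [|i n A _ hA]; first by rewrite cards0.
by rewrite cardsU; apply: leq_trans (leq_subr _ _) _; rewrite leq_add2l.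
Qed.

Lemma in_sdiff (E : finType) (Y Z : {set E}) e : (e \in sdiff Y Z) = (e \in Y) (+) (e \in Z).
Proof. by rewrite inE. Qed.

Section Count2.
Variables (R : realType) (V E O KI : finType) (s t : E -> V) (l r : E -> O).
Variables (E0 : {set E}) (N k : nat) (tau : 'I_N -> V) (circ : 'I_N -> 'I_k) (S : KI -> {set E}).
Implicit Types (Y Z p : {set E}) (si : {ffun V -> bool}).
Local Notation cut := (cut s t).
Local Notation bd := (bd l r).
Local Notation walk := (walk l r).
Local Notation sim := (sim s t tau).
Local Notation TB := (TB KI k).

Hypothesis bd_cut : forall si x, bd (cut si) x = false.
Hypothesis star : forall Y, (forall x, bd Y x = false) -> exists si (y : {ffun KI -> bool}),
  forall e, (e \in Y) = (e \in cut si) (+) \big[addb/false]_q (y q && (e \in S q)).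
Hypothesis hcirc : forall si, (forall e, e \in E0 -> e \notin cut si) -> forall i j, circ i = circ j -> si (tau i) = si (tau j).
Hypothesis hconn : forall si, cut si = finset.set0 -> (forall i, si (tau i) = false) -> forall v, si v = false.
Hypothesis cE0 : #|E0| <= N.
Hypothesis tauI : injective tau.
Variables (w mu : E -> R).
Hypothesis mu0 : forall e, (0 < mu e)%R.
Hypothesis muI : forall Y Z : {set E}, (\sum_(e in Y) mu e = \sum_(e in Z) mu e)%R -> Y = Z.
Local Notation Fs := (Fs s t E0).
Local Notation optimal := (optimal s t E0 tau mu).
Local Notation minim := (minim s t E0 tau mu).

Lemma opt_ex (Rr : {set 'I_N}) : exists si, (forall i, si (tau i) = (i \in Rr)) /\ optimal si.
Proof.
pose si0 : {ffun V -> bool} := [ffun v => [exists i, (tau i == v) && (i \in Rr)]].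
have h0 : [forall i, si0 (tau i) == (i \in Rr)].
  apply/forallP => i; apply/eqP; rewrite ffunE; apply/existsP/idP => [[j /andP[/eqP/tauI -> //]]|iR].
  by exists i; rewrite eqxx.
pose si := [arg min_(si < si0 | [forall i, si (tau i) == (i \in Rr)]) (\sum_(e in Fs si) mu e)%R]%O.
have [si1 /forallP h1 h2] := (@arg_minP _ _ _ si0 (fun si : {ffun V -> bool} => [forall i, si (tau i) == (i \in Rr)]) (fun si => \sum_(e in Fs si) mu e)%R h0).
exists si1; split; first by move=> i; apply/eqP/h1.
move=> si' h'; apply: h2; apply/forallP => i; rewrite h'; exact: h1.
Qed.

Variable opt : {set 'I_N} -> {ffun V -> bool}.
Hypothesis optP : forall Rr, (forall i, opt Rr (tau i) = (i \in Rr)) /\ optimal (opt Rr).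

(** The faces next to the boundary arcs; a cut from which [E0] is removed can have odd degree only
    there. *)
Definition Ap : {set O} := (l @: E0) :|: (r @: E0).

Lemma card_Ap : #|Ap| <= 2 * N.
Proof.
rewrite cardsU; apply: leq_trans (leq_subr _ _) _; rewrite mul2n -addnn leq_add //.
  by apply: leq_trans (leq_imset_card _ _) _.
by apply: leq_trans (leq_imset_card _ _) _.
Qed.

Definition data := (nat * (nat -> O) * (nat -> E) * {set 'I_N})%type.
Definition isP p (d : data) := let: (n, x, ed, Rr) := d in
  [/\ 0 < n, walk (Fs (opt Rr)) n x ed, p = seg_ ed 0 n & x 0 = x n \/ (x 0 \in Ap /\ x n \in Ap)].
Definition PP : {set {set E}} := [set p | `[< exists d, isP p d >]].

Lemma PP_minim p Rr : p \subset Fs (opt Rr) -> minim p.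
Proof. by have [_ o] := optP Rr; apply: sub_minim. Qed.

Lemma isP_sub p n x ed Rr : isP p (n, x, ed, Rr) -> p \subset Fs (opt Rr).
Proof. by move=> [_ wk -> _]; apply: seg_sub wk (leqnn _). Qed.

Definition bdk (o : option (O * O)) z := if o is Some (u, v) then (u == z) (+) (v == z) else false.

(** Pieces are minimal in their class, so a piece is determined by its ends, [None] for a closed
    one, and its class. *)
Lemma card_PP : #|PP| <= (1 + #|Ap| ^ 2) * #|{: TB}|.
Proof.
have /choice[ka hka] : forall o, exists ka : {set E} -> TB, forall Y Z,
  Y \subset ~: E0 -> Z \subset ~: E0 -> (forall x, bd Y x = bdk o x) -> (forall x, bd Z x = bdk o x) ->
  ka Y = ka Z -> sim Y Z by move=> o; exact: (classes star hcirc).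
have /choice[key hkey] : forall p, exists o, p \in PP -> [/\ forall z, bd p z = bdk o z, 
    o \in None |: [set Some u | u in finset.setX Ap Ap] & minim p].
  move=> p; have [pP|_] := boolP (p \in PP); last by exists None.
  move: (pP); rewrite inE => /asboolP[[[[n x] ed] Rr] hp].
  have mp := PP_minim (isP_sub hp); case: hp => n0 wk pE h.
  have B z : bd p z = (x 0 == z) (+) (x n == z) by rewrite pE (bd_seg z wk).
  have [e|ne] := eqVneq (x 0) (x n).
    by exists None => _; split => //; [move=> z; rewrite B e addbb|rewrite !inE].
  exists (Some (x 0, x n)) => _; split => //; rewrite !inE /=; apply/finset.imsetP; exists (x 0, x n) => //.
  by rewrite inE /=; case: h => [e|[-> ->]//]; rewrite e eqxx in ne.
pose F p := (key p, ka (key p) p).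
have FI : {in PP &, injective F}.
  move=> p p' pP pP' [e1 e2]; have [b1 _ m1] := hkey p pP; have [b2 _ m2] := hkey p' pP'.
  apply: (minim_eq muI m1 m2); apply: (hka (key p)).
  - by case: m1.
  - by case: m2.
  - exact: b1.
  - by rewrite e1.
  - by rewrite e2 e1.
rewrite -(card_in_imset FI).
apply: (@leq_trans #|finset.setX (None |: [set Some u | u in finset.setX Ap Ap]) (finset.setTfor TB)|).
  apply: subset_leq_card; apply/fintype.subsetP => z /imsetP[p pP ->].
  by rewrite inE /= finset.in_setT andbT; have [] := hkey p pP.
rewrite cardsX cardsT leq_mul2r; apply/orP; right.
rewrite cardsU1 leq_add ?leq_b1 //.
by apply: leq_trans (leq_imset_card _ _) _; rewrite cardsX -mulnn.
Qed.

Variables (pd : {set E} -> data).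
Hypothesis pdP : forall p, p \in PP -> isP p (pd p).

Definition pn p := (pd p).1.1.1.
Definition px p := (pd p).1.1.2.
Definition ped p := (pd p).1.2.
Definition pR p := (pd p).2.

Lemma pdE p : p \in PP -> [/\ 0 < pn p, walk (Fs (opt (pR p))) (pn p) (px p) (ped p), p = seg_ (ped p) 0 (pn p) &
   p \subset Fs (opt (pR p))].
Proof.
move=> pP; have := pdP pP; rewrite /pn /px /ped /pR; case: (pd p) => [[[n x] ed] Rr] /= h.
by have := isP_sub h; case: h.
Qed.

Definition nodes p : {set O} := [set y | [exists c : 'I_(pn p).+1, px p c == y]].
(** The places where [p], followed in its direction, departs from [p']. *)
Definition stt p p' : {set E} := [set e | (e \notin p') && [exists i : 'I_(pn p), (ped p i == e) && (px p i \in nodes p')]].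

(** To a departure belongs the sum of the initial parts of [p] and [p'] up to it. If two departures
    gave the same class, the part of [p] between them would be equivalent to a part of [p']; both
    are minimal, hence equal, and the first departing edge would lie in [p']. *)
Lemma card_stt p p' : p \in PP -> p' \in PP -> #|stt p p'| <= #|{: TB}|.
Proof.
move=> pP pP'; have [n0 wk pE pF] := pdE pP; have [n0' wk' pE' pF'] := pdE pP'.
have [ka hka] := classes star hcirc (fun z => (px p 0 == z) (+) (px p' 0 == z)).
have /choice[pc hpc] : forall e, exists ic : nat * nat, e \in stt p p' ->
   [/\ ic.1 < pn p, ped p ic.1 = e, ic.2 <= pn p' & px p ic.1 = px p' ic.2].
  move=> e; have [|_] := boolP (e \in stt p p'); last by exists (0, 0).
  rewrite inE => /andP[_ /existsP[i /andP[/eqP ei]]]; rewrite inE => /existsP[c /eqP ec].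
  by exists (i : nat, c : nat) => _; split; rewrite /= ?ec ?ei ?ltn_ord // -ltnS ltn_ord.
pose Y e := sdiff (seg_ (ped p) 0 (pc e).1) (seg_ (ped p') 0 (pc e).2).
have subE Rr (q : {set E}) : q \subset Fs (opt Rr) -> q \subset ~: E0 by move=> h; case: (PP_minim h).
have Ysub e : e \in stt p p' -> Y e \subset ~: E0.
  move=> /hpc[h1 _ h2 _].
  have /subE/fintype.subsetP s1 := seg_sub 0 wk (ltnW h1); have /subE/fintype.subsetP s2 := seg_sub 0 wk' h2.
  apply/fintype.subsetP => f; rewrite inE; case: (boolP (f \in seg_ (ped p) _ _)) => [/s1//|_] /=; exact: s2.
have Ybd e z : e \in stt p p' -> bd (Y e) z = (px p 0 == z) (+) (px p' 0 == z).
  move=> /hpc[h1 _ h2 h3]; rewrite bd_sdiff (bd_seg z wk (leq0n _) (ltnW h1)) (bd_seg z wk' (leq0n _) h2) h3.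
  by rewrite addbACA addbb addbF.
apply: (@leq_card_in _ _ (fun e => ka (Y e))) => //.
suff K e e' : e \in stt p p' -> e' \in stt p p' -> ka (Y e) = ka (Y e') -> ~ ((pc e).1 < (pc e').1).
  move=> e e' es es' kk; have [_ e1 _ _] := hpc e es; have [_ e2 _ _] := hpc e' es'.
  have [lt|lt|eq] := ltngtP (pc e).1 (pc e').1; [case: (K e e')|case: (K e' e)|] => //.
  by rewrite -e1 -e2 eq.
move=> es es' kk lt; have [h1 h2 h3 h4] := hpc e es; have [h1' h2' h3' h4'] := hpc e' es'.
have sm := hka _ _ (Ysub e es) (Ysub e' es') (fun z => Ybd e z es) (fun z => Ybd e' z es') kk.
pose D := sdiff (seg_ (ped p') 0 (pc e).2) (seg_ (ped p') 0 (pc e').2).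
have sp := seg_split wk (ltnW lt) (ltnW h1').
have Dsub : D \subset p'.
  rewrite pE'; apply/fintype.subsetP => f; rewrite inE.
  have M b : b <= pn p' -> f \in seg_ (ped p') 0 b -> f \in seg_ (ped p') 0 (pn p').
    by move=> bn /segP[i [/andP[_ ib] <-]]; apply/segP; exists i; rewrite (leq_trans ib bn).
  case: (boolP (f \in seg_ (ped p') 0 (pc e).2)) => [/M -> //|_] /=; exact: M.
have sm' : sim (seg_ (ped p) (pc e).1 (pc e').1) D.
  case: sm => si t0 d; exists si => //; rewrite -d -sp; apply/setP => f; rewrite /D /Y !in_sdiff.
  by case: (f \in seg_ (ped p) 0 (pc e).1); case: (f \in seg_ (ped p) 0 (pc e').1);
    case: (f \in seg_ (ped p') 0 (pc e).2); case: (f \in seg_ (ped p') 0 (pc e').2).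
have m1 : minim (seg_ (ped p) (pc e).1 (pc e').1) by apply: PP_minim (seg_sub _ wk (ltnW h1')).
have m2 : minim D by apply: PP_minim (fintype.subset_trans Dsub pF').
have DE := minim_eq muI m1 m2 sm'.
have : e \in seg_ (ped p) (pc e).1 (pc e').1 by apply/segP; exists (pc e).1; rewrite leqnn lt.
rewrite DE => /(fintype.subsetP Dsub); apply/negP.
by move: es; rewrite inE => /andP[].
Qed.

Definition St : {set E} := \bigcup_(p in PP) (ped p 0 |: \bigcup_(p' in PP) stt p p').

Lemma card_St : #|St| <= #|PP| * (1 + #|PP| * #|{: TB}|).
Proof.
apply: card_bigcup_le => p pP; rewrite cardsU1 leq_add ?leq_b1 //.
by apply: card_bigcup_le => p' pP'; exact: card_stt.
Qed.

Lemma bd_witness Y f x : f \in Y -> ((l f == x) (+) (r f == x)) -> bd Y x = false ->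
  exists2 g, g \in Y & g != f /\ ((l g == x) (+) (r g == x)).
Proof.
move=> fY fx b; suff /existsP[g /and3P[h1 h2 h3]] : [exists g, [&& g \in Y, g != f & (l g == x) (+) (r g == x)]] by exists g.
move: b; rewrite /bd (bigD1 f) //= fx; apply: contraFT; rewrite negb_exists => /forallP h.
rewrite big1 // => g /andP[gY gf]; have := h g; rewrite gY gf /=; exact: negbTE.
Qed.

Lemma walk_cross p n x ed f i : walk p n x ed -> 0 < i < n -> f \in seg_ ed 0 n -> (l f == x i) (+) (r f == x i) ->
  f = ed i \/ f = ed i.-1.
Proof.
move=> wk /andP[i0 hi] /segP[j [jn fj]]; rewrite -fj (inc_sum _ (wk_inc wk jn)) => h.
have : (x i == x j) || (x i == x j.+1) by move: h; rewrite (eq_sym (x j)) (eq_sym (x j.+1)); case: (_ == _).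
case/orP => /eqP; move=> /(wk_nodes wk _ _) e.
  by left; rewrite (e _ (ltnW jn)) // i0 hi.
by right; rewrite (e _ jn) // i0 hi.
Qed.

(** Pieces are discarded one by one. Suppose an edge of [p] in [Y], not the first of [p], is in no
    remaining piece. It is not a departure, so its starting node is on none of them. [Y] has even
    degree there, so the preceding edge of [p] is in [Y], and by induction in a remaining piece,
    which then contains the node. *)
Lemma kill Y : Y \subset \bigcup_(p in PP) p -> (forall x, bd Y x = false) -> (forall e, e \in St -> e \notin Y) -> Y = finset.set0.
Proof.
move=> hY b nS.
suff H : forall sq : seq {set E}, {subset sq <= PP} -> (forall e, e \in Y -> exists2 p, p \in sq & e \in p) -> Y = finset.set0.
  apply: (H (enum PP)); first by move=> p; rewrite mem_enum.
  by move=> e /(fintype.subsetP hY)/bigcupP[p pP ep]; exists p; rewrite // mem_enum.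
elim=> [|p sq IH] sub h; first by apply/setP => e; rewrite finset.in_set0; apply/negP => /h[].
have pP : p \in PP by apply: sub; rewrite inE eqxx.
have sP q : q \in sq -> q \in PP by move=> qs; apply: sub; rewrite inE qs orbT.
have [n0 wk pE pF] := pdE pP.
apply: IH => // e eY; have [q] := h e eY; rewrite inE => /orP[/eqP -> ep|qs eq]; last by exists q.
suff H m : m < pn p -> ped p m \in Y -> exists2 q, q \in sq & ped p m \in q.
  by move: ep eY; rewrite {1}pE => /segP[m [mn <-]]; exact: H.
elim: m => [|m IHm] mn mY.
  suff sS : ped p 0 \in St by have := nS _ sS; rewrite mY.
  apply/bigcupP; exists p => //; by rewrite !inE eqxx.
have [[q1 qs1 eq1]|nq] := pselect (exists2 q1, q1 \in sq & ped p m.+1 \in q1); first by exists q1.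
exfalso.
have nn (q1 : {set E}) : q1 \in sq -> px p m.+1 \notin nodes q1.
  move=> qs; apply/negP => xn; suff sS : ped p m.+1 \in St by have := nS _ sS; rewrite mY.
  apply/bigcupP; exists p => //.
  rewrite inE; apply/orP; right; apply/bigcupP; exists q1; first exact: sP.
  rewrite inE; apply/andP; split; first by apply/negP => h1; apply: nq; exists q1.
  by apply/existsP; exists (Ordinal mn); rewrite /= eqxx.
have inq (q1 : {set E}) f : q1 \in sq -> f \in q1 -> (l f == px p m.+1) (+) (r f == px p m.+1) -> False.
  move=> qs fq hf; have [_ wq qE _] := pdE (sP q1 qs); move: fq; rewrite qE => /segP[j [jn fj]].
  move: hf; rewrite -fj (inc_sum _ (wk_inc wq jn)) => hf; case/negP: (nn q1 qs); rewrite inE; apply/existsP.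
  have [e1|e1] := eqVneq (px q1 j) (px p m.+1); first by exists (inord j); rewrite inordK ?e1 // ltnS ltnW.
  by exists (inord j.+1); rewrite inordK ?ltnS //; move: hf; rewrite (negbTE e1).
have i1 : inc l r (ped p m.+1) (px p m.+1) (px p m.+2) := wk_inc wk mn.
have x12 : px p m.+1 != px p m.+2.
  by apply/eqP => /(wk_nodes wk _ _) e'; have := e' _ mn; rewrite /= mn => /(_ isT) /eqP; rewrite eqn_leq ltnn andbF.
have c1 : (l (ped p m.+1) == px p m.+1) (+) (r (ped p m.+1) == px p m.+1).
  by rewrite (inc_sum _ i1) eqxx eq_sym (negbTE x12).
have [g gY [gf gx]] := bd_witness mY c1 (b _).
have [q2] := h g gY; rewrite inE => /orP[/eqP qp gp|qs gq]; last exact: (inq q2 g).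
have := walk_cross wk (i := m.+1) _ _ gx; rewrite /= mn qp in gp *; rewrite -pE => /(_ isT gp)[ge|ge].
  by rewrite ge eqxx in gf.
rewrite ge in gY gx; have [q' qs' gq'] := IHm (ltnW mn) gY.
exact: (inq q' _ qs' gq' gx).
Qed.

(** A cut is a dual cycle, so outside [E0] its odd nodes are those of its part in [E0], all of them
    apices. *)
Lemma Fs_cover Rr : Fs (opt Rr) \subset \bigcup_(p in PP) p.
Proof.
apply/fintype.subsetP => e eF.
have odd x : bd (Fs (opt Rr)) x -> x \in Ap.
  have E1 : cut (opt Rr) = sdiff (Fs (opt Rr)) (cut (opt Rr) :&: E0).
    by apply/setP => f; rewrite !inE; case: (f \in E0); case: (_ != _).
  have : bd (Fs (opt Rr)) x = bd (cut (opt Rr) :&: E0) x.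
    have := bd_cut (opt Rr) x; rewrite {1}E1 bd_sdiff.
    by move: (bd (Fs _) x) (bd (_ :&: _) x) => [] [].
  move=> -> h.
  have : exists2 f, f \in cut (opt Rr) :&: E0 & (l f == x) (+) (r f == x).
    suff /existsP[f /andP[h1 h2]] : [exists f, (f \in cut (opt Rr) :&: E0) && ((l f == x) (+) (r f == x))] by exists f.
    apply: contraLR h; rewrite negb_exists => /forallP h; rewrite /bd big1 // => f fi.
    by have := h f; rewrite fi /=; exact: negbTE.
  move=> [f]; rewrite !inE => /andP[_ f0] hf.
  have [<-|e1] := eqVneq (l f) x; first by rewrite imset_f.
  by move: hf; rewrite (negbTE e1) /= => /eqP <-; rewrite (imset_f _ f0) orbT.
have [n [x [ed [wk [i hi ei] h]]]] := piece_ex eF odd.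
apply/bigcupP; exists (seg_ ed 0 n); last by apply/segP; exists i.
rewrite inE; apply/asboolP; exists (n, x, ed, Rr); split => //; exact: leq_ltn_trans hi.
Qed.

(** Two cuts with the same trace on [St] and [E0] differ by a cycle in [X] that avoids [St], which
    is empty by [kill]; equal values at the terminals then make the potentials equal. *)
Lemma count_cuts (X : {set E}) : X = \bigcup_(p in PP) p ->
  #|[set si | Fs si \subset X]| <= 2 ^ (#|St| + 2 * N).
Proof.
move=> XE; pose G si : {set E} * {set 'I_N} := (cut si :&: (St :|: E0), [set i | si (tau i)]).
have GI : {in [set si | Fs si \subset X] &, injective G}.
  move=> si si'; rewrite !inE => h h' [/setP e1 /setP e2].
  have z : cut (sxor si si') = finset.set0.
    apply: kill.
    - rewrite -XE; apply/fintype.subsetP => e; rewrite cut_xor inE => ee.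
      have eE : e \notin E0.
        by apply/negP => e0; have := e1 e; move: ee; rewrite !finset.in_setI finset.in_setU e0 orbT !andbT; case: (_ \in _); case: (_ \in _).
      have := fintype.subsetP h e; have := fintype.subsetP h' e; rewrite !finset.in_setD eE /=.
      by case: (e \in cut si) ee => /= ee; [move=> _; apply|move=> + _; apply].
    - by move=> x; exact: bd_cut.
    - move=> e eS; rewrite cut_xor inE; have := e1 e; rewrite !finset.in_setI finset.in_setU eS !andbT => ->; by rewrite addbb.
  have t0 i : sxor si si' (tau i) = false.
    by rewrite ffunE; have := e2 i; rewrite !inE => ->; rewrite addbb.
  apply/ffunP => v; have := hconn z t0 v; rewrite ffunE; by case: (si v); case: (si' v).
rewrite -(card_in_imset GI).
apply: (@leq_trans #|finset.setX (powerset (St :|: E0)) (finset.setTfor {set 'I_N})|).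
  apply: subset_leq_card; apply/fintype.subsetP => y /imsetP[si _ ->].
  by rewrite inE /= powersetE subsetIr finset.in_setT.
rewrite cardsX card_powerset -powersetT card_powerset cardsT card_ord -expnD leq_exp2l //.
rewrite mul2n -addnn addnA leq_add2r cardsU; apply: leq_trans (leq_subr _ _) _; by rewrite leq_add2l.
Qed.

End Count2.

End CutCount.

(** * Linear duality mod 2 and the numerical bound *)

Module CutDuality.
Import DualWalks MinimalCuts CutCount.

(** [bool] is the field with two elements; a vector orthogonal to the null space of a matrix is in
    its row space. *)
Lemma duality (J E : finType) (M : J -> E -> bool) (Y : E -> bool) :
  (forall z : E -> bool, (forall j, \big[addb/false]_e (M j e && z e) = false) -> \big[addb/false]_e (Y e && z e) = false) ->
  exists u : {ffun J -> bool}, forall e, Y e = \big[addb/false]_j (u j && M j e).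
Proof.
move=> h.
pose MM : 'M[bool]_(#|J|, #|E|) := (\matrix_(i, j) M (enum_val i) (enum_val j))%R.
pose YY : 'rV[bool]_#|E| := (\row_j Y (enum_val j))%R.
have sum_enum (F : finType) (g : F -> bool) : \big[addb/false]_x g x = (\sum_(i < #|F|) g (enum_val i))%R.
  by rewrite -(big_enum_val (fun x => g x)) /=; apply: eq_bigl => x; rewrite inE.
have : (YY <= MM)%MS.
  rewrite submxE; apply/eqP/matrixP => i0 j; rewrite mxE [RHS]mxE.
  have := h (fun e => cokermx MM (enum_rank e) j) _.
  rewrite sum_enum => H; rewrite -[RHS]/false -[RHS]H.
    by apply: eq_bigr => k _; rewrite !mxE enum_valK.
  move=> x; rewrite sum_enum.
  have /matrixP/(_ (enum_rank x) j) := mulmx_coker MM; rewrite !mxE => E1.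
  rewrite -[RHS]/(0%R : bool) -[RHS]E1; apply: eq_bigr => k _.
  by rewrite !mxE enum_valK enum_rankK.
move=> /submxP[D hD]; exists [ffun x => D ord0 (enum_rank x)] => e.
have /matrixP/(_ ord0 (enum_rank e)) := hD; rewrite !mxE enum_rankK => ->.
rewrite sum_enum; apply: eq_bigr => k _.
by rewrite !mxE ffunE enum_valK enum_rankK.
Qed.

Section Star.
Variables (V E O KI : finType) (s t : E -> V) (l r : E -> O) (S : KI -> {set E}).
Implicit Types (Y : {set E}) (si : {ffun V -> bool}).

Lemma delta_sum (F : finType) (g : F -> bool) x : \big[addb/false]_y (g y && (x == y)) = g x.
Proof.
rewrite (bigD1 x) //= eqxx andbT big1 ?addbF // => y; rewrite eq_sym => /negbTE ->; exact: andbF.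
Qed.

(** Summation by parts on the dual graph. *)
Lemma phi_bd Y (phi : O -> bool) : \big[addb/false]_(e in Y) (phi (l e) (+) phi (r e)) =
  \big[addb/false]_x (phi x && bd l r Y x).
Proof.
rewrite /bd; under [RHS]eq_bigr => x _ do rewrite big_distrr.
rewrite exchange_big /=; apply: eq_bigr => e _.
under [RHS]eq_bigr => x _ do rewrite andb_addr.
by rewrite big_split /= !delta_sum.
Qed.

Lemma cut_sum si e : (e \in cut s t si) = \big[addb/false]_v (si v && ((s e == v) (+) (t e == v))).
Proof.
under eq_bigr => x _ do rewrite andb_addr.
by rewrite big_split /= !delta_sum inE; case: (si _); case: (si _).
Qed.

(** Moves the hypothesis [star] to the primal side: a cycle [z] that meets each [S q] evenly has to
    be a coboundary on the dual. *)
Lemma star_of Y :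
  (forall z : E -> bool, (forall si, \big[addb/false]_e (z e && (e \in cut s t si)) = false) ->
     (forall q, \big[addb/false]_e (z e && (e \in S q)) = false) -> exists phi : O -> bool, forall e, z e = phi (l e) (+) phi (r e)) ->
  (forall x, bd l r Y x = false) -> exists si (y : {ffun KI -> bool}),
  forall e, (e \in Y) = (e \in cut s t si) (+) \big[addb/false]_q (y q && (e \in S q)).
Proof.
move=> h2 hY.
pose M (j : V + KI) e := match j with inl v => (s e == v) (+) (t e == v) | inr q => e \in S q end.
have [|u hu] := @duality _ E M (fun e => e \in Y).
  move=> z hz; have [||phi hphi] := h2 z.
  - move=> si; transitivity (\big[addb/false]_v (si v && \big[addb/false]_e (M (inl v) e && z e))); last first.
      by rewrite big1 // => v _; rewrite hz andbF.
    under [RHS]eq_bigr => v _ do rewrite big_distrr.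
    rewrite exchange_big /=; apply: eq_bigr => e _; rewrite cut_sum big_distrr /=.
    by apply: eq_bigr => v _; case: (z e); rewrite /= ?andbT ?andbF.
  - by move=> q; rewrite -[RHS](hz (inr q)); apply: eq_bigr => e _; rewrite andbC.
  rewrite -big_set_addb; under eq_bigr => e _ do rewrite hphi.
  by rewrite phi_bd big1 // => x _; rewrite hY andbF.
exists [ffun v => u (inl v)], [ffun q => u (inr q)] => e.
rewrite hu big_sumType /= cut_sum; congr addb; by apply: eq_bigr => i _; rewrite ffunE.
Qed.

End Star.

Section Few.
Variables (R : realType) (V E O KI : finType) (s t : E -> V) (l r : E -> O).
Variables (E0 : {set E}) (N k : nat) (tau : 'I_N -> V) (circ : 'I_N -> 'I_k) (S : KI -> {set E}).
Local Notation cut := (cut s t).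
Hypothesis bd_cut : forall si x, bd l r (cut si) x = false.
Hypothesis star : forall Y : {set E}, (forall x, bd l r Y x = false) -> exists si (y : {ffun KI -> bool}),
  forall e, (e \in Y) = (e \in cut si) (+) \big[addb/false]_q (y q && (e \in S q)).
Hypothesis hcirc : forall si, (forall e, e \in E0 -> e \notin cut si) -> forall i j, circ i = circ j -> si (tau i) = si (tau j).
Hypothesis hconn : forall si, cut si = finset.set0 -> (forall i, si (tau i) = false) -> forall v, si v = false.
Hypothesis cE0 : #|E0| <= N.
Hypothesis tauI : injective tau.
Variable w : E -> R.
Hypothesis w0 : forall e, (0 <= w e)%R.

(** [32 = 5 + 25 + 2]: from [M <= 5 n^2 B] the product is at most [5 n^2 B + 25 n^4 B^3], and [2 n]
    accounts for the last summand. *)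
Lemma bound_arith (B n M St : nat) : 0 < n -> 0 < B -> M <= (1 + (2 * n) ^ 2) * B -> St <= M * (1 + M * B) ->
  St + 2 * n <= 32 * B ^ 3 * n ^ 4.
Proof.
move=> n0 B0 hM hS.
have n2 : n <= n ^ 2 by rewrite expnS expn1 leq_pmulr.
have n4 : n ^ 2 <= n ^ 4 by apply: leq_pexp2l.
have M5 : M <= 5 * n ^ 2 * B.
  apply: leq_trans hM _; rewrite leq_mul2r; apply/orP; right.
  by rewrite expnMn; move: n0 n2; move: (n ^ 2); lia.
have M1 : M * (1 + M * B) <= 5 * n ^ 2 * B * (1 + 5 * n ^ 2 * B * B).
  by apply: leq_mul => //; rewrite leq_add2l leq_mul2r M5 orbT.
have E1 : 5 * n ^ 2 * B * (1 + 5 * n ^ 2 * B * B) = 5 * (n ^ 2 * B) + 25 * (n ^ 4 * B ^ 3).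
  by ring.
have b1 : n ^ 2 * B <= n ^ 4 * B ^ 3.
  by apply: leq_mul => //; rewrite -{1}[B]expn1; apply: leq_pexp2l.
have b2 : n <= n ^ 4 * B ^ 3.
  apply: leq_trans n2 _; apply: leq_trans n4 _; by rewrite leq_pmulr // expn_gt0 B0.
have := leq_trans hS M1; rewrite E1 -mulnA (mulnC (B ^ 3)).
by move: b1 b2; move: (n ^ 4 * B ^ 3) (n ^ 2 * B) => a b; lia.
Qed.

Lemma few_cuts (e00 : E) : 0 < N -> exists X : {set E}, 
  (forall Rr : {set 'I_N}, exists si : {ffun V -> bool}, [/\ forall i, si (tau i) = (i \in Rr), cut si :\: E0 \subset X &
     forall si' : {ffun V -> bool}, (forall i, si' (tau i) = (i \in Rr)) -> (\sum_(e in cut si :\: E0) w e <= \sum_(e in cut si' :\: E0) w e)%R]) /\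
  #|[set si : {ffun V -> bool} | cut si :\: E0 \subset X]| <= 2 ^ (32 * (2 ^ (#|KI| + k)) ^ 3 * N ^ 4).
Proof.
move=> N0.
have [mu [mu0 muI muw]] := generic_weight w0.
have /choice[opt optP] := opt_ex s t E0 tauI mu.
have /choice[pd pdP] : forall p : {set E}, exists d, p \in PP s t l r E0 opt -> isP s t l r E0 opt p d.
  move=> p; have [|_] := boolP (p \in PP s t l r E0 opt); last by exists (0, (fun=> l e00), (fun=> e00), finset.set0).
  by rewrite inE => /asboolP[d hd]; exists d.
exists (\bigcup_(p in PP s t l r E0 opt) p); split.
  move=> Rr; exists (opt Rr); have [h1 h2] := optP Rr; split => //.
    exact: Fs_cover.
  by move=> si' h; apply: muw; apply: h2 => i; rewrite h h1.
have CC := count_cuts bd_cut hconn cE0 pdP erefl.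
apply: leq_trans CC _.
rewrite leq_exp2l //.
have cPP := card_PP star hcirc mu0 muI optP.
have cTB : #|{: TB KI k}| = 2 ^ (#|KI| + k).
  by rewrite card_prod !card_ffun card_bool card_ord expnD.
rewrite cTB in cPP.
have cSt := card_St star hcirc mu0 muI optP pdP; rewrite cTB in cSt.
apply: (bound_arith N0 _ _ cSt); first by rewrite expn_gt0.
apply: leq_trans cPP _; rewrite leq_mul2r leq_add2l; apply/orP; right.
by rewrite leq_exp2r //; exact: card_Ap.
Qed.

End Few.

End CutDuality.

(** * Comparison of potentials with crossing parities *)

Module HalfEdges.
Import FlatDiscs Merging.
Local Open Scope ring_scope.

Section Arith.
Variable R : realType.
Implicit Types a b d y : R.
Lemma ar_lo a b d y : - d < a - b -> a < y -> y <= b - d -> False. Proof. lra. Qed.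
Lemma ar_hi a b d y : a - b < d -> b + d <= y -> a < y. Proof. lra. Qed.
Lemma ar_l a b d y y' : d < - (a - b) -> b - d <= y <= b + d -> b - d <= y' <= b + d -> (a < y) = (a < y').
Proof. by move=> *; apply/idP/idP; lra. Qed.
Lemma ar_r a b d y y' : d < a - b -> b - d <= y <= b + d -> b - d <= y' <= b + d -> (a < y) = (a < y').
Proof. by move=> *; apply/idP/idP; lra. Qed.
Lemma ar_0 b d : 0 < d -> b - d <= b - d <= b + d. Proof. lra. Qed.
Lemma ar_1 b d : 0 < d -> b - d <= b + d <= b + d. Proof. lra. Qed.
Lemma ar_2 b d y : 0 < d -> y <= b - d -> y <= b. Proof. lra. Qed.
Lemma ar_3 b d y : 0 < d -> b - d < y -> y <= b -> b - d <= y <= b + d. Proof. by move=> *; lra. Qed.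
Lemma ar_4 b d y : 0 < d -> b < y -> y < b + d -> b - d <= y <= b + d. Proof. by move=> *; lra. Qed.
End Arith.

Section Rotation.
Variables (R : realType) (V E KI : finType).
Implicit Types (s t : E -> V) (F : {set E}) (x : E -> bool -> R).

(* Partial sum, from the left, of the jumps of a potential across the half-edges at [u0]. *)
Definition jumps s t F (u0 : V) x (D : E -> bool) (y : R) : bool :=
  \big[addb/false]_(h : E * bool | [&& h.1 \in F, endp s t h.2 h.1 == u0 & x h.1 h.2 < y]) D h.1.

(** An abstract dual with a marked vertex: [l e] and [r e] are the faces beside [e], and [ga y] is
    the face seen from [u0] in direction [y]. When one turns around [u0], a function on the faces
    changes by its jumps across the half-edges ([dd_gap]). Cuts are dual cycles ([dd_cut]), and
    cycles that meet each [S q] evenly are coboundaries ([dd_cyc]). *)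
Record dd s t F (u0 : V) x (O : finType) (l r : E -> O) (ga : R -> O) (S : KI -> {set E}) : Prop := DD {
  dd_sub : forall q, S q \subset F;
  dd_gap : forall (phi : O -> bool) y y',
    phi (ga y) (+) jumps s t F u0 x (fun e => phi (l e) (+) phi (r e)) y =
    phi (ga y') (+) jumps s t F u0 x (fun e => phi (l e) (+) phi (r e)) y';
  dd_cut : forall (si : V -> bool) (phi : O -> bool),
    \big[addb/false]_(e in F) ((si (s e) (+) si (t e)) && (phi (l e) (+) phi (r e))) = false;
  dd_cyc : forall z : E -> bool,
    (forall si : V -> bool, \big[addb/false]_(e in F) (z e && (si (s e) (+) si (t e))) = false) ->
    (forall q, \big[addb/false]_(e in S q) z e = false) ->
    exists phi : O -> bool, forall e, e \in F -> z e = phi (l e) (+) phi (r e) }.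

Lemma sum_half (P : pred E) (w : E -> bool -> bool) (D : E -> bool) :
  \big[addb/false]_(h : E * bool | P h.1 && w h.1 h.2) D h.1 =
  \big[addb/false]_(e | P e) ((w e false (+) w e true) && D e).
Proof.
rewrite big_mkcond -(pair_bigA _ (fun e b => if P e && w e b then D e else false)) /= [RHS]big_mkcond.
apply: eq_bigr => e _; rewrite big_bool; case: (P e) => //=.
by case: (w e false); case: (w e true); case: (D e).
Qed.

(** Undoes the contraction of [e0]. In the contracted drawing the half-edges of [v] are in the
    window of radius [d] around the direction [x0] of [e0] and the others are outside, so the faces
    beside [e0] are the gaps at the ends of the window. The total jump in the window is the jump
    across [e0]. *)
Lemma dd_step s t F u0 v e0 b0 x x' (x0 d : R) (O : finType) (l r : E -> O) ga S :
  v != u0 -> e0 \in F -> endp s t b0 e0 = u0 -> endp s t (~~ b0) e0 = v -> 0 < d -> x e0 b0 = x0 ->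
  (forall e b, e \in F :\ e0 -> endp s t b e = u0 -> x' e b = x e b /\ d < `|x e b - x0|) ->
  (forall e b, e \in F :\ e0 -> endp s t b e = v -> `|x' e b - x0| < d) ->
  dd (fun e => mg v u0 (s e)) (fun e => mg v u0 (t e)) (F :\ e0) u0 x' l r ga S ->
  exists l2 r2 ga2, dd s t F u0 x (O := O) l2 r2 ga2 S.
Proof.
move=> vu eF hu hv d0 xe hold hnew H.
set s' := fun e => mg v u0 (s e) in H; set t' := fun e => mg v u0 (t e) in H.
have en' b e : endp s' t' b e = mg v u0 (endp s t b e) by case: b.
have enu b e : (endp s' t' b e == u0) = (endp s t b e == u0) || (endp s t b e == v).
  rewrite en' /mg; case: (eqVneq (endp s t b e) v) => [->|_]; first by rewrite eqxx orbT.
  by rewrite orbF.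
pose l2 e := if e == e0 then ga (x0 - d) else l e.
pose r2 e := if e == e0 then ga (x0 + d) else r e.
(* Once [v] is out again, only [e0] remains in the window, and each half of the window is a single
   face. *)
pose ga2 (y : R) := if (x0 - d < y) && (y <= x0) then ga (x0 - d) else
              if (x0 < y) && (y < x0 + d) then ga (x0 + d) else ga y.
exists l2, r2, ga2.
pose D (phi : O -> bool) e := phi (l e) (+) phi (r e).
pose D2 (phi : O -> bool) e := phi (l2 e) (+) phi (r2 e).
have D2n phi e : e != e0 -> D2 phi e = D phi e by rewrite /D2 /l2 /r2 => /negbTE ->.
have D2e phi : D2 phi e0 = phi (ga (x0 - d)) (+) phi (ga (x0 + d)) by rewrite /D2 /l2 /r2 eqxx.
pose OLD phi y := \big[addb/false]_(h : E * bool | [&& h.1 \in F :\ e0, endp s t h.2 h.1 == u0 & x h.1 h.2 < y]) D phi h.1.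
pose JJ phi y := \big[addb/false]_(h : E * bool | [&& h.1 \in F :\ e0, endp s t h.2 h.1 == v & x' h.1 h.2 < y]) D phi h.1.
pose J phi := \big[addb/false]_(h : E * bool | (h.1 \in F :\ e0) && (endp s t h.2 h.1 == v)) D phi h.1.
have sum' phi (y : R) : jumps s' t' (F :\ e0) u0 x' (D phi) y = OLD phi y (+) JJ phi y.
  rewrite /jumps (bigID (fun h : E * bool => endp s t h.2 h.1 == v)) /= addbC; congr addb; apply: eq_bigl => -[e b] /=.
    rewrite enu; case: (boolP (e \in F :\ e0)) => //= eFe; case: (eqVneq (endp s t b e) v) => [->|ne] /=.
      by rewrite !andbF (negbTE vu).
    rewrite orbF andbT; case: (eqVneq (endp s t b e) u0) => //= eu.
    by have [-> _] := hold e b eFe eu.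
  by rewrite enu; case: (endp s t b e == v); rewrite ?orbT ?andbT ?andbF //= !andbF.
have sum2 phi (y : R) : jumps s t F u0 x (D2 phi) y = OLD phi y (+) ((x0 < y) && D2 phi e0).
  rewrite /jumps (bigID (fun h : E * bool => h.1 == e0)) /= addbC; congr addb.
    rewrite /OLD (eq_bigr (fun h => D phi h.1)) => [|h /andP[_ /D2n //]].
    apply: eq_bigl => -[e b] /=; rewrite in_setD1; case: (e == e0); rewrite ?andbT ?andbF //=.
  have E1 h : (h.1 \in F) && ((endp s t h.2 h.1 == u0) && (x h.1 h.2 < y)) && (h.1 == e0) = (h == (e0, b0)) && (x0 < y).
    case: h => e b /=; rewrite xpair_eqE; case: (eqVneq e e0) => [->|_]; rewrite ?andbF //= andbT eF /=.
    have [->|nb] := eqVneq b b0; first by rewrite hu eqxx xe.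
    have -> : b = ~~ b0 by move: nb; case: (b); case: (b0).
    by rewrite hv (negbTE vu).
  under eq_bigl => h do rewrite E1.
  case: (x0 < y); last by rewrite big_pred0 // => h; rewrite andbF.
  by rewrite (big_pred1 (e0, b0)) // => h; rewrite andbT.
have JJlo phi (y : R) : y <= x0 - d -> JJ phi y = false.
  move=> yl; rewrite /JJ big_pred0 // => -[e b] /=; apply/negP => /and3P[h1 /eqP h2 h3].
  by have := hnew e b h1 h2; rewrite ltr_norml => /andP[h4 _]; exact: (ar_lo h4 h3 yl).
have JJhi phi (y : R) : x0 + d <= y -> JJ phi y = J phi.
  move=> yl; apply: eq_bigl => -[e b] /=; case: (boolP (e \in F :\ e0)) => //= h1; case: eqP => //= h2.
  by have := hnew e b h1 h2; rewrite ltr_norml => /andP[_ h4]; exact: (ar_hi h4 yl).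
have OLDc phi (y y' : R) : x0 - d <= y <= x0 + d -> x0 - d <= y' <= x0 + d -> OLD phi y = OLD phi y'.
  move=> hy hy'; apply: eq_bigl => -[e b] /=; case: (boolP (e \in F :\ e0)) => //= h1; case: eqP => //= h2.
  have [_] := hold e b h1 h2; rewrite lter_normr => /orP[h3|h3].
    exact: (ar_r h3 hy hy').
  exact: (ar_l h3 hy hy').
have G phi := dd_gap H phi.
have KJ phi : D2 phi e0 = J phi.
  have := G phi (x0 - d) (x0 + d); rewrite -/(D phi) !sum' JJlo // JJhi // D2e.
  rewrite (OLDc phi (x0 - d) (x0 + d) (ar_0 x0 d0) (ar_1 x0 d0)).
  by case: (phi _); case: (phi _); case: (OLD _ _); case: (J _).
have JE phi (w : E -> bool) : \big[addb/false]_(e in F :\ e0) (((s e == v) (+) (t e == v)) && D phi e) = J phi.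
  by rewrite /J (sum_half (fun e => e \in F :\ e0) (fun e b => endp s t b e == v)).
split.
- by move=> q; apply: fintype.subset_trans (dd_sub H q) _; apply/fintype.subsetP => e; rewrite in_setD1 => /andP[].
- move=> phi.
  suff K (y : R) : exists y1 : R, phi (ga2 y) (+) jumps s t F u0 x (D2 phi) y = phi (ga y1) (+) jumps s' t' (F :\ e0) u0 x' (D phi) y1.
    by move=> y y'; have [y1 ->] := K y; have [y2 ->] := K y'; exact: G.
  rewrite sum2 KJ /ga2; have [h1|h1] := leP y (x0 - d).
    by exists y; rewrite sum' JJlo //= (ltNge x0 y) (ar_2 d0 h1) /=.
  have [h2|h2] /= := leP y x0.
    exists (x0 - d); rewrite sum' JJlo // !addbF; congr addb.
    exact: (OLDc _ _ _ (ar_3 d0 h1 h2) (ar_0 x0 d0)).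
  have [h3|h3] := ltP y (x0 + d).
    exists (x0 + d); rewrite sum' JJhi // ?andbF; congr (_ (+) (_ (+) _)).
    exact: (OLDc _ _ _ (ar_4 d0 h2 h3) (ar_1 x0 d0)).
  by exists y; rewrite sum' JJhi // ?andbF.
- move=> si phi; rewrite (big_setD1 e0) //= -/(D2 phi e0) KJ.
  have -> : si (s e0) (+) si (t e0) = si u0 (+) si v.
    by rewrite -hu -hv; case: (b0) => //=; rewrite addbC.
  have := dd_cut H si phi; rewrite -(JE phi (fun=> true)).
  rewrite big_distrr /= -big_split /= => E1; rewrite -[RHS]E1; apply: eq_bigr => e eFe.
  have ee : e != e0 by move: eFe; rewrite in_setD1 => /andP[].
  rewrite -/(D2 phi e) -/(D phi e) D2n // /s' /t' /mg.
  case: (eqVneq (s e) v) => [->|_]; case: (eqVneq (t e) v) => [->|_];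
    case: (D phi e); rewrite ?andbT ?andbF //=; by repeat (match goal with |- context [si ?a] => case: (si a) => //= end).
- move=> z hz hS; have [|phi hphi] := dd_cyc H (z := z) _ hS.
    move=> si; have := hz (fun w => si (mg v u0 w)); rewrite (big_setD1 e0) //=.
    have -> : si (mg v u0 (s e0)) (+) si (mg v u0 (t e0)) = false; last by rewrite andbF.
    have m1 : mg v u0 u0 = u0 by rewrite /mg eq_sym (negbTE vu).
    have m2 : mg v u0 v = u0 by rewrite /mg eqxx.
    by case: (b0) hu hv => /= -> ->; rewrite m1 m2 addbb.
  exists phi => e eFe; rewrite -/(D2 phi e); have [->|ee] := eqVneq e e0; last first.
    by rewrite D2n //; apply: hphi; rewrite in_setD1 ee.
  (* The value of [z] on [e0] is forced by its evenness on the cut around [v]. *)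
  rewrite KJ -(JE phi (fun=> true)); have := hz (fun w => w == v); rewrite (big_setD1 e0) //=.
  have -> : (s e0 == v) (+) (t e0 == v).
    by case: (b0) hu hv => /= -> ->; rewrite eqxx eq_sym (negbTE vu).
  rewrite andbT => /eqP; rewrite -[X in X -> _]/(is_true (_ (+) _ == false)) => h; apply/eqP; move: h.
  rewrite (eq_bigr (fun e => ((s e == v) (+) (t e == v)) && D phi e)) => [|f fF]; last by rewrite (hphi f fF) andbC.
  by case: (z e0); case: (\big[addb/false]_(_ in _) _).
Qed.

End Rotation.

End HalfEdges.

(** * Faces of a graph with a single vertex *)

Module CyclicJumps.
Import FlatDiscs Merging HalfEdges.
Local Open Scope ring_scope.

Section Base.
Variables (R : realType) (V E KI : finType).
Variables (s t : E -> V) (F : {set E}) (u0 : V) (x : E -> bool -> R) (par : E -> KI).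
Hypothesis loops : forall e, e \in F -> s e = u0 /\ t e = u0.
Hypothesis xI : forall e e' b b', e \in F -> e' \in F -> x e b = x e' b' -> e = e' /\ b = b'.

(** [B e y] tells whether [y] lies between the two ends of [e], so [m] is the interlacing parity of
    two loops; by [hm] it depends only on the class of the first, as long as the second is a
    different loop. *)
Let B e (y : R) := (x e false < y) (+) (x e true < y).
Let m e e'' := B e (x e'' false) (+) B e (x e'' true).
Hypothesis hm : forall e e' e'', e \in F -> e' \in F -> e'' \in F -> e'' != e -> e'' != e' -> par e = par e' -> m e e'' = m e' e''.

Let O : finType := {set E * bool}.
(** A gap between half-edges is encoded as the set of half-edges to its left. *)
Let g0 (y : R) : O := [set h : E * bool | (h.1 \in F) && (x h.1 h.2 < y)].
Let g1 (y : R) : O := [set h : E * bool | (h.1 \in F) && (x h.1 h.2 <= y)].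
Let Lg e b := g0 (x e b).
Let Rg e b := g1 (x e b).
(** Whether the band of [e] is twisted, which is the self-intersection parity of its class, read off
    another loop of that class. If there is none, the cycles considered below vanish on [e] and the
    choice is free. *)
Let dt e : bool := if [pick e' in F | (e' != e) && (par e' == par e)] is Some e' then m e' e else false.

(** Gaps are glued along the sides of each loop, equal sides for a twisted band and opposite sides
    otherwise. The classes are the boundary components of a ribbon graph with one vertex. *)
Let gl (C D : O) : bool := [exists e in F, if dt e then ((C == Lg e false) && (D == Lg e true)) || ((C == Rg e false) && (D == Rg e true))
   else ((C == Rg e false) && (D == Lg e true)) || ((C == Lg e false) && (D == Rg e true))].
Let gs (C D : O) := gl C D || gl D C.

Let gs_sym : connect_sym gs.
Proof. by apply: sym_connect_sym => C D; rewrite /gs orbC. Qed.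

Let rt (C : O) := fingraph.root gs C.

Let rt_gl C D : gl C D -> rt C = rt D.
Proof. by move=> h; apply/eqP; rewrite /rt root_connect //; apply: connect1; rewrite /gs h. Qed.

Let D2 (phi : O -> bool) e := phi (rt (Lg e false)) (+) phi (rt (Rg e false)).

Let D2b phi e b : e \in F -> phi (rt (Lg e b)) (+) phi (rt (Rg e b)) = D2 phi e.
Proof.
case: b => // eF; rewrite /D2; case d : (dt e).
  have -> : rt (Lg e true) = rt (Lg e false).
    by apply/esym/rt_gl/existsP; exists e; rewrite eF d !eqxx.
  by congr (_ (+) phi _); apply/esym/rt_gl/existsP; exists e; rewrite eF d !eqxx orbT.
have -> : rt (Lg e true) = rt (Rg e false).
  by apply/esym/rt_gl/existsP; exists e; rewrite eF d !eqxx.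
have -> : rt (Rg e true) = rt (Lg e false).
  by apply/esym/rt_gl/existsP; exists e; rewrite eF d !eqxx orbT.
exact: addbC.
Qed.

Let endu h : h.1 \in F -> endp s t h.2 h.1 = u0.
Proof. by case: h => e [|] /= /loops[h1 h2]; rewrite /endp. Qed.

Let jumpsE D y : jumps s t F u0 x D y = \big[addb/false]_(h in g0 y) D h.1.
Proof.
apply: eq_bigl => h; rewrite inE; case: (boolP (h.1 \in F)) => //= hF.
by rewrite endu // eqxx.
Qed.

(** Induction on the number of half-edges to the left of [y]: the last of them is removed, which
    changes both terms by the jump across it. *)
Let gap phi y : phi (rt (g0 y)) (+) jumps s t F u0 x (D2 phi) y = phi (rt finset.set0).
Proof.
have [n] := ubnP #|g0 y|; elim: n y => // n IH y; rewrite ltnS => hn.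
rewrite jumpsE; have [->|[h0 h0y]] := set_0Vmem (g0 y); first by rewrite big_set0 addbF.
have [h hy hmax] := @arg_maxP _ _ _ h0 (mem (g0 y)) (fun h => x h.1 h.2) h0y.
have hy' : h \in g0 y := hy.
have hF : h.1 \in F by move: hy'; rewrite inE => /andP[].
have hlt : x h.1 h.2 < y by move: hy'; rewrite inE => /andP[].
have e1 : g0 y = g1 (x h.1 h.2).
  apply/setP => h'; apply/idP/idP => h'y; last first.
    by move: h'y; rewrite !inE => /andP[-> /= h1]; exact: le_lt_trans h1 hlt.
  have := hmax h' h'y; move: h'y; rewrite !inE => /andP[-> _] //.
have e2 : g0 y = h |: g0 (x h.1 h.2).
  rewrite e1; apply/setP => h'; rewrite !inE le_eqVlt.
  case: (boolP (h'.1 \in F)) => h'F /=; last by rewrite orbF; apply/esym/negbTE; apply: contra h'F => /eqP ->.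
  congr (_ || _); apply/eqP/eqP => [/(xI h'F hF)[]|-> //].
  by case: h h' {hy hy' hmax hF hlt e1 h'F} => [? ?] [? ?] /= -> ->.
have nh : h \notin g0 (x h.1 h.2) by rewrite inE ltxx andbF.
have := IH (x h.1 h.2); rewrite jumpsE; move: hn; rewrite {1}e2 cardsU1 nh => hn /(_ hn) <-.
rewrite {2}e2 big_setU1 //= e1 -(D2b phi h.2 hF) /Lg /Rg.
by move: (phi _) (phi (rt (g1 _))) (\big[addb/false]_(_ in _) _) => [] [] [].
Qed.

Section Cyc.
Variable z : E -> bool.
Hypothesis zS : forall q, \big[addb/false]_(e in [set e in F | par e == q]) z e = false.

(** The sum of [z] over the half-edges to the left of a gap. It jumps by [z e] across [e], and it
    descends to the faces because it respects the gluing, by [psiL]. *)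
Let psi (C : O) := \big[addb/false]_(h in C) z h.1.

Let psi0 y : psi (g0 y) = \big[addb/false]_(e in F) (B e y && z e).
Proof.
rewrite /psi (eq_bigl (fun h : E * bool => (h.1 \in F) && (x h.1 h.2 < y))) => [|h]; last by rewrite inE.
exact: (sum_half (fun e => e \in F) (fun e b => x e b < y)).
Qed.

Let psi1 e b : e \in F -> psi (Rg e b) = psi (Lg e b) (+) z e.
Proof.
move=> eF; have -> : Rg e b = (e, b) |: Lg e b.
  apply/setP => h; rewrite !inE le_eqVlt.
  case: (boolP (h.1 \in F)) => hF /=; last by rewrite orbF; apply/esym/negbTE; apply: contra hF => /eqP ->.
  congr (_ || _); apply/eqP/eqP => [/(xI hF eF)[]|-> //].
  by case: h {hF} => [? ?] /= -> ->.
by rewrite /psi big_setU1 ?inE ?ltxx ?andbF //= addbC.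
Qed.

Let mee e : e \in F -> m e e = true.
Proof.
move=> eF; rewrite /m /B !ltxx addFb addbF; have [h|h|h] := ltgtP (x e false) (x e true) => //.
by have [] := xI eF eF h.
Qed.

(** The sum is grouped by class. A class other than that of [e] contributes a multiple of the sum of
    [z] over it, which is zero; within the class of [e], the other loops have total [z e]. *)
Let K e : e \in F -> \big[addb/false]_(e' in F :\ e) (m e' e && z e') = dt e && z e.
Proof.
move=> eF; rewrite (partition_big par xpredT) //= (bigD1 (par e)) //= [X in _ (+) X = _]big1 ?addbF => [|q qe]; last first.
  have [[e1 /andP[e1F /eqP e1q]]|no] := pselect (exists e1, (e1 \in F :\ e) && (par e1 == q)); last first.
    by rewrite big_pred0 // => e'; apply/negP => h; apply: no; exists e'.
  rewrite (eq_bigr (fun e' => m e1 e && z e')); last first.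
    move=> e' /andP[]; move: e1F; rewrite !in_setD1 => /andP[n1 F1] /andP[n2 F2] /eqP pe.
    by rewrite (hm F2 F1 eF) // 1?eq_sym // pe e1q.
  rewrite -big_distrr /=.
  have -> : \big[addb/false]_(i in F :\ e | par i == q) z i = \big[addb/false]_(e in [set e in F | par e == q]) z e.
    apply: eq_bigl => e'; rewrite inE in_setD1; case: (eqVneq e' e) => [->|_] //=.
    by rewrite eq_sym (negbTE qe) andbF.
  by rewrite zS andbF.
rewrite /dt; case: pickP => [e1 /andP[e1F /andP[e1e /eqP pe]]|no]; last first.
  rewrite big_pred0 // => e'; rewrite in_setD1; have := no e'; by case: (e' \in F) => //=; rewrite ?andbF // andbT.
rewrite (eq_bigr (fun e' => m e1 e && z e')); last first.
  move=> e' /andP[]; rewrite !in_setD1 => /andP[n2 F2] /eqP pe'.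
  by rewrite (hm F2 e1F eF) // 1?eq_sym // pe' pe.
rewrite -big_distrr /=; congr andb; have := zS (par e).
rewrite (bigD1 e) /= ?inE ?eF ?eqxx // => h.
have {h} : z e = \big[addb/false]_(i in [set e0 in F | par e0 == par e] | i != e) z i by move: h; case: (z e); case: (\big[_/_]_(_ | _) _).
by move=> ->; apply: eq_bigl => e'; rewrite in_setD1 inE; case: (e' != e); case: (e' \in F) => /=; rewrite ?andbT ?andbF.
Qed.

Let psiL e : e \in F -> psi (Lg e false) (+) psi (Lg e true) = z e (+) (dt e && z e).
Proof.
move=> eF; rewrite !psi0 -big_split /= -K // (big_setD1 e) //=; congr addb.
  by have := mee eF; rewrite /m; case: (B _ _); case: (B _ _) => //=; case: (z e).
by apply: eq_bigr => e' _; rewrite /m andb_addl.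
Qed.

Let psi_gl C D : gl C D -> psi C = psi D.
Proof.
move=> /existsP[e /andP[eF]]; have := psiL eF; case: (dt e) => /= h /orP[] /andP[/eqP -> /eqP ->]; rewrite ?psi1 //.
all: by move: h; move: (psi _) (psi (Lg e true)) (z e) => [] [] [].
Qed.

Let psi_rt C : psi (rt C) = psi C.
Proof.
have /connectP[p pp ->] : connect gs C (rt C) by exact: connect_root.
elim: p C pp => //= D p IH C /andP[/orP[h|h] pp]; rewrite IH //; first by rewrite (psi_gl h).
by rewrite (psi_gl h).
Qed.

Lemma cyc_base e : e \in F -> z e = psi (rt (Lg e false)) (+) psi (rt (Rg e false)).
Proof. by move=> eF; rewrite !psi_rt psi1 // addbA addbb. Qed.

End Cyc.

Lemma dd_base : exists (l r : E -> {set E * bool}) ga, dd s t F u0 x l r ga (fun q => [set e in F | par e == q]).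
Proof.
exists (fun e => rt (Lg e false)), (fun e => rt (Rg e false)), (fun y => rt (g0 y)); split.
- by move=> q; apply/fintype.subsetP => e; rewrite inE => /andP[].
- by move=> phi y y'; rewrite !gap.
- move=> si phi; rewrite big1 // => e /loops[-> ->]; by rewrite addbb.
- move=> z _ zS; exists (fun C : {set E * bool} => \big[addb/false]_(h in C) z h.1) => e eF; exact: cyc_base.
Qed.

End Base.

End CyclicJumps.

(** * The dual of a connected drawing with a boundary vertex *)

Module ParityComparison.
Import Discs Embeddings Stars FlatDiscs CrossingParity TriangleParity Merging LoopHomotopy BoundaryCharts PathParity Detours SegmentParity LoopPieces RadialOrder BasePoints RadialParity ChartCover Bouquets MinimalCuts HalfEdges CyclicJumps.
Local Open Scope classical_set_scope.
Local Open Scope ring_scope.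

Section XiInj.
Variable R : realType.
Implicit Types p q D : R * R.

Lemma xi_inj p q (r : R) : 0 < r -> `|p| = r -> `|q| = r -> 0 <= p.2 -> 0 <= q.2 -> xi p = xi q -> p = q.
Proof.
move=> r0 pr qr p2 q2 e.
have n0 (z : R * R) : `|z| = r -> z != 0 by move=> h; rewrite -normr_eq0 h gt_eqF.
have dp := den_gt0 (n0 _ pr) p2; have dq := den_gt0 (n0 _ qr) q2.
(* [xi z] is the abscissa of the point of the unit rhombus on the ray through [z]. *)
have E (z : R * R) : 0 < `|z.1| + z.2 -> z = (`|z.1| + z.2) *: ((xi z, 1 - `|xi z|) : R * R).
  move=> dz; rewrite [LHS]surjective_pairing; congr (_, _).
    by rewrite -[RHS]/(_ * _) /xi mulrC divfK // gt_eqF.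
  rewrite -[RHS]/(_ * _) /xi normrM normfV (gtr0_norm dz) mulrBr mulr1 mulrC divfK ?gt_eqF //.
  by rewrite addrAC subrr add0r.
have Ep := E p dp; have Eq := E q dq; rewrite e in Ep.
have N : `|p.1| + p.2 = `|q.1| + q.2.
  set w : R * R := (xi q, 1 - `|xi q|) in Ep Eq.
  have np : `|p| = (`|p.1| + p.2) * `|w| by rewrite {1}Ep normrZ gtr0_norm.
  have nq : `|q| = (`|q.1| + q.2) * `|w| by rewrite {1}Eq normrZ gtr0_norm.
  have w0 : `|w| != 0 by apply/eqP => h0; move: nq; rewrite h0 mulr0 qr => h'; rewrite h' ltxx in r0.
  by apply: (mulIf w0); rewrite -np -nq pr qr.
by rewrite Ep N -Eq.
Qed.

Lemma xi_cts D (d : R) : D != 0 -> 0 <= D.2 -> 0 < d -> exists delta : R, 0 < delta /\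
  forall D', `|D' - D| <= delta -> `|xi D' - xi D| < d.
Proof.
move=> D0 D2 d0.
have c : {for D, continuous (@xi R)}.
  apply: cvgM; first exact: fst_cts.
  apply: cvgV; first by rewrite gt_eqF // den_gt0.
  by apply: cvgD; [apply: cvg_norm; exact: fst_cts|exact: snd_cts].
have nb : nbhs (xi D) [set y : R | `|y - xi D| < d] by apply/nbhsRP; exists d.
have /nbhs2P[e [e0 he]] := cts_nbhs c nb.
exists (e / 2); split; first by rewrite divr_gt0.
by move=> D' h; apply: he; apply: le_lt_trans h _; lra.
Qed.

End XiInj.

Section Comp.
Variables (R : realType) (T : topologicalType) (V E : finType).
Hypothesis hT : hausdorff_space T.
Hypothesis hD : forall x : T, exists f g r, @disc R T f g (f x) r /\ g (f x) = x.
Variables (I Q : finType) (ch : I -> chart R T) (qc : Q -> chart R T) (qi qj : Q -> I).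
Hypothesis subi : forall q y, Oc (qc q) y -> Kc (3 / 4) (ch (qi q)) y.
Hypothesis subj : forall q y, Oc (qc q) y -> Kc (3 / 4) (ch (qj q)) y.
Hypothesis hI : forall x, exists i, oset (cg (ch i)) (cc (ch i)) (1 / 2 * crad (ch i)) x.
Hypothesis hQ : forall i j x, Kc (1 / 2) (ch i) x -> Kc (1 / 2) (ch j) x -> exists q, [/\ qi q = i, qj q = j & Oc (qc q) x].
Implicit Types (s t : E -> V) (A : {set V}) (F : {set E}) (pos : V -> T) (path : E -> R -> T).

Lemma half3 (al al' : R) : 0 < al < 1 -> 0 < al' < 1 -> [/\ 0 < al / 3 < 1, 0 < 1 - al / 3 < 1,
   0 <= 1 / 3 * al <= al, al / 3 <> 1 - al' / 3 & al / 3 = 1 / 3 * al].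
Proof. by move=> h1 h2; split; lra. Qed.

(** Half-edges with the same direction would share the point at a third of their radial parts. *)
Lemma dir_inj s t A F pos path u0 f g c r dir e e' b b' : emb s t A F pos path ->
  flat s t A F pos path u0 f g c r dir -> e \in F -> e' \in F -> endp s t b e = u0 -> endp s t b' e' = u0 ->
  dir e b = dir e' b' -> e = e' /\ b = b'.
Proof.
move=> H Fl eF eF' hb hb' ed.
have [al al01 hal] := fl_rad Fl eF hb; have [al' al01' hal'] := fl_rad Fl eF' hb'.
have [x1 x2 x3 x4 x5] := half3 al01 al01'; have [y1 y2 y3 y4 y5] := half3 al01' al01.
have k1 : al / 3 / al = al' / 3 / al'.
  by rewrite x5 y5 !mulfK // gt_eqF //; [case/andP: al01'|case/andP: al01].
have E1 : hpath path b e (al / 3) = hpath path b' e' (al' / 3).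
  by rewrite hal ?hal' ?k1 ?ed // ?x5 ?y5.
have i01 : 0 <= (if b' then 1 - al' / 3 else al' / 3) <= 1.
  by case: (b'); [case/andP: y2|case/andP: y1] => ? ?; apply/andP; split; exact: ltW.
have i01' : 0 < (if b then 1 - al / 3 else al / 3) < 1 by case: (b).
have [ee eu] := emb_i H eF eF' i01' i01 E1; split => //.
move: eu; case: (b); case: (b') => // eu; first by case: y4.
Qed.

(** Edges at [u0] that are not loops are contracted one after another until a bouquet is left, for
    which [dd_base] applies; [dd_step] leads back. Each contraction keeps the new directions closer
    to that of the contracted edge than any other direction is. *)
Lemma comp_dd n s t A F pos path u0 i0 r (dir : E -> bool -> R * R) : (#|A| <= n)%N ->
  emb s t A F pos path -> u0 \in A ->
  oset (cg (ch i0)) (cc (ch i0)) (1 / 2 * crad (ch i0)) (pos u0) -> (cf (ch i0) (pos u0)).2 = 0 ->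
  flat s t A F pos path u0 (cf (ch i0)) (cg (ch i0)) (cf (ch i0) (pos u0)) r dir ->
  (forall e, e \in F -> s e = t e -> s e = u0) ->
  (forall si : V -> bool, (forall e, e \in F -> si (s e) = si (t e)) -> forall v, v \in A -> si v = si u0) ->
  exists (l r : E -> {set E * bool}) ga (S : {ffun Q -> bool} -> {set E}),
    dd s t F u0 (fun e b => xi (dir e b - cf (ch i0) (pos u0))) l r ga S.
Proof.
elim: n s t A F path dir => [|n IH] s t A F path dir; first by rewrite leqn0 cards_eq0 => /eqP -> _; rewrite inE.
move=> cA H uA Oo c2 Fl nl conn.
set c := cf (ch i0) (pos u0) in c2 Fl *.
have r0 := fl_r Fl.
have dn e b : e \in F -> endp s t b e = u0 -> `|dir e b - c| = r /\ 0 <= (dir e b - c).2.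
  by move=> eF hb; have [/andP[_ h1] h2] := fl_dir Fl eF hb; rewrite /= c2 subr0.
have dn0 e b : e \in F -> endp s t b e = u0 -> dir e b - c != 0.
  by move=> eF hb; have [h _] := dn e b eF hb; rewrite -normr_eq0 h gt_eqF.
have xI e e' b b' : e \in F -> e' \in F -> endp s t b e = u0 -> endp s t b' e' = u0 ->
    xi (dir e b - c) = xi (dir e' b' - c) -> e = e' /\ b = b'.
  move=> eF eF' hb hb' ex; have [h1 h2] := dn e b eF hb; have [h3 h4] := dn e' b' eF' hb'.
  by apply: (dir_inj H Fl eF eF' hb hb'); have /addIr := xi_inj r0 h1 h3 h2 h4 ex.
have [[e0 [b0 [e0F hu hv]]]|no] := pselect (exists e0 b0, [/\ e0 \in F, endp s t b0 e0 = u0 & endp s t (~~ b0) e0 != u0]).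
  set v := endp s t (~~ b0) e0 in hv.
  have vA : v \in A by rewrite /v; case: (b0) => /=; [exact: (emb_s H e0F)|exact: (emb_t H e0F)].
  have hv' : endp s t (~~ b0) e0 = v by [].
  clearbody v.
  have nlv e : e \in F -> ~ (s e = v /\ t e = v).
    by move=> eF [h1 h2]; move: hv; rewrite -h1 (nl e eF) ?eqxx // h1 h2.
  pose x0 := xi (dir e0 b0 - c).
  (* [d1] is a lower bound for the distance from [x0] to every other direction; half of it leaves
     the strict gap required by [dd_step]. *)
  have [d1 [d10 hd1]] := @gap_ex R (E * bool)%type (fun h => `|xi (dir h.1 h.2 - c) - x0|).
  pose d := d1 / 2.
  have d0 : 0 < d by rewrite /d divr_gt0.
  have dd1 : d < d1 by rewrite /d ltr_pdivrMr // ltr_pMr // ltr1n.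
  have [de [de0 hde]] := xi_cts (dn0 _ _ e0F hu) (proj2 (dn _ _ e0F hu)) d0.
  have [path' [dir' [H' Fl' hold hnew]]] := absorb hT hD H Fl uA vA hv nlv e0F hu hv' de0.
  have m1 : mg v u0 u0 = u0 by rewrite /mg eq_sym (negbTE hv).
  have m2 : mg v u0 v = u0 by rewrite /mg eqxx.
  have m3 w : w != v -> mg v u0 w = w by rewrite /mg => /negbTE ->.
  have [||||l [rr [ga [S HS]]]] := IH _ _ _ _ _ dir' _ H' _ Oo c2 Fl'.
  - by move: cA; rewrite (cardsD1 v A) vA.
  - by rewrite in_setD1 uA eq_sym hv.
  - move=> e; rewrite in_setD1 => /andP[_ eF]; rewrite /mg.
    case: eqP => // _; case: eqP => // _; exact: nl.
  - move=> si hsi w; rewrite in_setD1 => /andP[wv wA].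
    have := conn (fun w => si (mg v u0 w)) _ w wA; rewrite m1 m3 //; apply => e eF.
    have [->|ee] := eqVneq e e0; last by apply: hsi; rewrite in_setD1 ee.
    by case: (b0) hu hv' => /= -> ->; rewrite m1 m2.
  have [||l2 [r2 [ga2 H2]]] := @dd_step R V E _ s t F u0 v e0 b0 (fun e b => xi (dir e b - c)) (fun e b => xi (dir' e b - c)) x0 d _ l rr ga S hv e0F hu hv' d0 erefl _ _ HS.
  - move=> e b eFe hb; have := eFe; rewrite in_setD1 => /andP[ee eF].
    rewrite (hold e b eFe hb); split => //; apply: lt_le_trans dd1 _; apply: (hd1 (e, b)).
    rewrite normr_gt0 subr_eq0; apply/eqP => /(xI _ _ _ _ eF e0F hb hu)[h _].
    by rewrite h eqxx in ee.
  - move=> e b eFe hb; apply: hde; have := hnew e b eFe hb.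
    by rewrite opprB addrA subrK.
  by exists l2, r2, ga2, S.
have loops e : e \in F -> s e = u0 /\ t e = u0.
  move=> eF; have h v : v \in A -> v = u0.
    move=> vA; have := conn (fun w => w == u0) _ v vA; rewrite eqxx => hc; apply/eqP; apply: hc => e' eF'.
    apply/eqP/eqP => h; apply: contrapT => /eqP h'; apply: no; first by exists e', false; split.
    by exists e', true; split.
  by split; apply: h; [exact: (emb_s H eF)|exact: (emb_t H eF)].
have endu e b : e \in F -> endp s t b e = u0 by move=> /loops[h1 h2]; case: b.
have [par hpar] := bouquet hT hD subi subj hI hQ H uA Oo c2 Fl.
have [|e e' e'' eF eF' eF'' n1 n2 pe|l [rr [ga Hb]]] := @dd_base R V E _ s t F u0 (fun e b => xi (dir e b - c)) par loops.
- by move=> e e' b b' eF eF'; apply: xI => //; exact: endu.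
- have hde : forall d, d \in [:: e; e'; e''] -> [/\ d \in F, s d = u0 & t d = u0].
    by move=> d; rewrite !inE => /or3P[] /eqP ->; [have [] := loops e eF|have [] := loops e' eF'|have [] := loops e'' eF''].
  have := hpar e e' e'' hde n1 n2 pe; rewrite -/c /=.
  by do 8 case: (_ < _).
by exists l, rr, ga, (fun q => [set e in F | par e == q]%SET).
Qed.

End Comp.

End ParityComparison.

(** * Boundary arcs *)

Module BoundaryPushing.
Import Discs Embeddings Stars FlatDiscs CrossingParity TriangleParity Merging LoopHomotopy BoundaryCharts PathParity Detours SegmentParity LoopPieces RadialOrder BasePoints RadialParity ChartCover.
Local Open Scope classical_set_scope.
Local Open Scope ring_scope.

Section Push.
Variables (R : realType) (T : topologicalType).
Hypothesis hT : hausdorff_space T.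
Implicit Types (x y b : T).
Local Notation bd := (@surface_boundary R T).

Lemma within_comp (S U W : topologicalType) (A : set U) (f : U -> W) (h : S -> U) :
  {within A, continuous f} -> continuous h -> (forall z : S, A (h z)) -> continuous (fun z : S => f (h z)).
Proof.
move=> cf ch hA x B nB; move/subspace_continuousP: cf => /(_ (h x) (hA x) B nB) h1.
have h2 : nbhs (h x) [set z | A z -> B (f z)] := h1.
have := cts_nbhs (ch x) h2; apply: filterS => y hy; exact: hy (hA y).
Qed.

Lemma cts_within (U W : topologicalType) (A : set U) (f : U -> W) :
  (forall z : U, A z -> {for z, continuous f}) -> {within A, continuous f}.
Proof.
move=> h; apply/subspace_continuousP => x Ax B nB.
have h1 : nbhs x (fun w : U => B (f w)) := cts_nbhs (h x Ax) nB.
by apply: filterS h1 => y hy _.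
Qed.

Lemma surf_disc : is_surface R T -> forall x : T, exists f g r, @disc R T f g (f x) r /\ g (f x) = x.
Proof.
move=> [_ _ _ h] x; have [U [oU Ux [W [oW hW]]]] := h x.
by have [f [g [r [D gx _]]]] := chart_disc oU Ux oW hW; exists f, g, r.
Qed.

(** A point with positive second coordinate in a chart has a full box around it. *)
Lemma bd_zero (i : chart R T) x : bd x -> Oc i x -> (cf i x).2 = 0.
Proof.
move=> bx Ox; apply: contrapT => n0; apply: bx.
have D := cD i; have [gx hx _] := oset_gf D Ox; have /andP[h1 h2] := hx.
have p2 : 0 < (cf i x).2 by rewrite lt_neqAle eq_sym h2 andbT; apply/eqP.
pose e := Num.min (crad i - `|cf i x - cc i|) (cf i x).2.
have e0 : 0 < e by rewrite lt_min subr_gt0 h1.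
have e2 : e <= (cf i x).2 by rewrite ge_min lexx orbT.
have D' : disc (cf i) (cg i) (cf i x) e.
  by apply: (sub_disc D) => //; rewrite -lerBrDl ge_min lexx.
exists (oset (cg i) (cf i x) e); split; first exact: (oset_open D').
  by exists (cf i x) => //=; rewrite /hboxo subrr normr0 e0 ltW.
have hbE q : hboxo (cf i x) e q = (`|q - cf i x| < e).
  rewrite /hboxo; case: (boolP (_ < e)) => //= h; move: h; rewrite nrm_lt => /andP[_]; rewrite ltr_norml /= => /andP[? ?].
  by change (is_true (0 <= q.2)); lra.
exists [set q : R * R | `|q - cf i x| < e]; split.
  rewrite openE => q /= hq; apply/nbhs2P; exists (e - `|q - cf i x|); split; first by rewrite subr_gt0.
  by move=> q' hq' /=; have := ler_distD q q' (cf i x); lra.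
exists (cf i), (cg i); split.
- by apply: cts_within => y Oy; have [] := oset_gf D' Oy.
- by apply: continuous_subspaceT; exact: (disc_g D).
- apply/seteqP; split => [q [y Oy <-]|q hq] /=.
    by have [_ + _] := oset_gf D' Oy; rewrite hbE.
  have hq' : hboxo (cf i x) e q by rewrite hbE.
  by exists (cg i q); [exists q|rewrite (disc_fg D') //; exact: hboxoW].
- by move=> y Oy; have [] := oset_gf D' Oy.
- by move=> q hq; rewrite (disc_fg D') //; apply: hboxoW; rewrite hbE.
Qed.

Lemma nbd_open x : ~ bd x -> nbhs x [set y | ~ bd y].
Proof.
rewrite /surface_boundary /= => /contrapT[U [oU Ux hU]].
have nU := open_nbhs_nbhs (conj oU Ux); apply: filterS nU => y Uy.
by apply; exists U.
Qed.

Lemma prod_cts (I : Type) (sq : seq I) (F : I -> R -> R) : (forall i, continuous (F i)) ->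
  continuous (fun a => \prod_(i <- sq) F i a).
Proof.
move=> cF; elim: sq => [|i sq IH] a; first by under eq_fun do rewrite big_nil; exact: cvg_cst.
under eq_fun do rewrite big_cons.
by apply: cvgM; [exact: cF|exact: IH].
Qed.

Lemma ar_max (b h : R) : 0 <= b -> 0 <= h -> b <= Num.max b ((b + h) / 2) /\ (b < h -> Num.max b ((b + h) / 2) <= h) /\ (h <= b -> Num.max b ((b + h) / 2) = b).
Proof.
move=> b0 h0; split; first by rewrite le_max lexx.
split => hb; first by rewrite ge_max; apply/andP; split; lra.
by apply/max_idPl; lra.
Qed.

Lemma ar_inj (b b' h : R) : Num.max b ((b + h) / 2) = Num.max b' ((b' + h) / 2) -> b = b'.
Proof.
have K (x y : R) : x < y -> Num.max x ((x + h) / 2) < Num.max y ((y + h) / 2).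
  by move=> xy; rewrite gt_max !lt_max xy /=; apply/orP; right; lra.
by move=> e; case: (ltgtP b b') => // /K; rewrite e ltxx.
Qed.

Lemma ar_pos (b h : R) : 0 < h -> 0 <= b -> 0 < Num.max b ((b + h) / 2).
Proof. by move=> h0 b0; rewrite lt_max; apply/orP; right; lra. Qed.

Variables (N : nat) (tm : 'I_N -> T).
Hypothesis tbd : forall i, bd (tm i).
Hypothesis hD : forall x : T, exists f g r, @disc R T f g (f x) r /\ g (f x) = x.

(** Such a map carries a drawing to a drawing and frees the boundary for the arcs. *)
Record pusher (P : T -> T) : Prop := Pusher {
  pu_c : continuous P;
  pu_i : injective P;
  pu_t : forall i, P (tm i) = tm i;
  pu_n : forall x, P x = x \/ ~ bd (P x) }.

(** In a chart at [b], low points are raised half way to the height [h], a bump that vanishes at the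
    abscissas of the terminals. The new height, the maximum of the old one and the average, is
    strictly increasing in the old one, so the map is injective. *)
Lemma push1 b : bd b -> exists (P : T -> T) (M : set T), [/\ pusher P, nbhs b M & forall x, M x -> (forall i, x <> tm i) -> ~ bd (P x)].
Proof.
move=> bb; have [f [g [r [D gb]]]] := hD b; set c := f b in D gb.
pose q := Chart D; have r0 := disc_r D.
have rr : r / 2 < r by rewrite ltr_pdivrMr // ltr_pMr // ltr1n.
have Ob : Oc q b by exists c => //=; rewrite /hboxo subrr normr0 r0 (disc_c D).
have c2 : c.2 = 0 by exact: (bd_zero bb Ob).
(* A terminal outside the chart gets an abscissa beyond the support of the bump, where its factor
   does no harm. *)
pose z i := if `[< Oc q (tm i) >] then (f (tm i)).1 else c.1 + r.
pose h (a : R) := Num.max 0 (r / 2 - `|a - c.1|) * \prod_(i <- index_enum 'I_N) Num.min 1 `|a - z i|.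
have p01 a : 0 <= \prod_(i <- index_enum 'I_N) Num.min 1 `|a - z i| <= 1.
  apply/andP; split; first by apply: prodr_ge0 => i _; rewrite le_min ler01 normr_ge0.
  by apply: prodr_ile1 => i _; rewrite le_min ler01 normr_ge0 ge_min lexx.
have m0 a : 0 <= Num.max 0 (r / 2 - `|a - c.1|) <= r / 2.
  by rewrite le_max lexx /= ge_max gerBl normr_ge0 andbT divr_ge0 // ltW.
have h0 a : 0 <= h a <= r / 2.
  have /andP[a1 a2] := m0 a; have /andP[a3 a4] := p01 a; rewrite mulr_ge0 //=.
  by rewrite -[r / 2]mulr1 ler_pM.
have hout a : r / 2 <= `|a - c.1| -> h a = 0.
  by move=> ha; rewrite /h (_ : Num.max _ _ = 0) ?mul0r //; apply/max_idPl; lra.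
have ch : continuous h.
  move=> a; apply: cvgM.
    apply: (@continuous_max R R (cst 0) (fun a => r / 2 - `|a - c.1|) a); first exact: cvg_cst.
    by apply: cvgB; [exact: cvg_cst|apply: cvg_norm; apply: cvgB; [exact: cvg_id|exact: cvg_cst]].
  apply: prod_cts => i a'; apply: (@continuous_min R R (cst 1) (fun a => `|a - z i|) a'); first exact: cvg_cst.
  by apply: cvg_norm; apply: cvgB; [exact: cvg_id|exact: cvg_cst].
pose mv (p : R * R) : R * R := (p.1, Num.max p.2 ((p.2 + h p.1) / 2)).
have cm : continuous mv.
  apply: pair_cts; first exact: fst_cts.
  move=> p; apply: (@continuous_max R _ snd (fun p : R * R => (p.2 + h p.1) / 2) p); first exact: snd_cts.
  apply: cvgM; last exact: cvg_cst.
  apply: cvgD; first exact: snd_cts.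
  by apply: (@continuous_comp _ _ _ fst h); [exact: fst_cts|exact: ch].
have mvid p : 0 <= p.2 -> ~ hbox c (r / 2) p -> mv p = p.
  move=> p2 np; have [_ [_ hm]] := ar_max p2 (proj1 (andP (h0 p.1))).
  rewrite /mv hm -?surjective_pairing // leNgt; apply/negP => lt; apply: np.
  rewrite /hbox p2 andbT nrm_le /= c2 subr0 (ger0_norm p2); apply/andP; split.
    by rewrite leNgt; apply/negP => /ltW/hout h'; move: lt; rewrite h' ltNge p2.
  by apply: ltW; apply: lt_le_trans lt _; case/andP: (h0 p.1).
have mvin p : hboxo c r p -> hboxo c r (mv p).
  move=> hp; have /andP[_ p2] := hp; have [hb|nb] := boolP (hbox c (r / 2) p); last by rewrite mvid //; exact/negP.
  have [q1 [q2 q3]] := ar_max p2 (proj1 (andP (h0 p.1))).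
  move: hp hb; rewrite /hboxo /hbox !nrm_lt !nrm_le /= c2 !subr0 => /andP[/andP[h1 h2] _] /andP[/andP[h3 h4] _].
  have q0 := le_trans p2 q1; rewrite h1 q0 andbT /= (ger0_norm q0).
  have [lt|ge] := ltP p.2 (h p.1).
    apply: le_lt_trans (q2 lt) _; apply: le_lt_trans (proj2 (andP (h0 p.1))) rr.
  by rewrite q3 //; move: h2; rewrite ger0_norm.
have mvI p p' : mv p = mv p' -> p = p'.
  by case: p p' => [a1 a2] [a3 a4] [/= e1]; rewrite e1 => /ar_inj ->.
pose P x := if `[< Oc q x >] then g (mv (f x)) else x.
have PO x : Oc q x -> P x = g (mv (f x)) /\ Oc q (P x).
  move=> Ox; rewrite /P (asboolT Ox); split => //; have [_ hx _] := oset_gf D Ox.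
  by exists (mv (f x)) => //; exact: mvin.
have PnO x : ~ Oc q x -> P x = x by move=> nO; rewrite /P asboolF.
have fP x : Oc q x -> f (P x) = mv (f x).
  move=> Ox; have [-> _] := PO x Ox; rewrite (disc_fg D) //; apply: hboxoW; apply: mvin.
  by have [] := oset_gf D Ox.
have Pid x : ~ Kc (1 / 2) q x -> P x = x.
  move=> nK; have [Ox|/PnO //] := pselect (Oc q x).
  have [gx hx _] := oset_gf D Ox; have [-> _] := PO x Ox; rewrite mvid ?gx //; first by case/andP: hx.
  move=> hb; apply: nK; exists (f x) => //=; move: hb; by rewrite mulrC mul1r.
have zE x i : Oc q x -> (f x).2 = 0 -> x <> tm i -> `|(f x).1 - c.1| < r -> 0 < `|(f x).1 - z i|.
  move=> Ox x2 xt xr; rewrite normr_gt0 subr_eq0; apply/eqP; rewrite /z.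
  case: asboolP => [Ot e|_ e]; last by move: xr; rewrite e addrAC subrr add0r gtr0_norm // ltxx.
  apply: xt; apply: (Oc_inj (i := q) Ox Ot) => /=; rewrite [LHS]surjective_pairing [RHS]surjective_pairing e.
  by rewrite x2 (bd_zero (@tbd i) Ot).
have nbdP x : Oc q x -> 0 < (mv (f x)).2 -> ~ bd (P x).
  move=> Ox hm hb; have [_ OP] := PO x Ox; have := bd_zero hb OP; rewrite /= fP // => e.
  by rewrite e ltxx in hm.
exists P; exists (oset g c (r / 2)); split.
- split.
  + move=> x; have [Ox|nO] := pselect (Oc q x).
      have nO : nbhs x (Oc q) by apply: open_nbhs_nbhs; split => //; exact: (oset_open D).
      have cx : {for x, continuous (fun y => g (mv (f y)))}.
        apply: (@continuous_comp _ _ _ (fun y => mv (f y)) g); last exact: (disc_g D).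
        by apply: (@continuous_comp _ _ _ f mv); [exact: (Ocf Ox)|exact: cm].
      move=> B; have [-> _] := PO x Ox => nB.
      have := cx B nB => nB'; apply: (filterS _ (filterI nO nB')) => y [Oy By].
      by rewrite /=; have [-> _] := PO y Oy.
    have nK : ~ Kc (1 / 2) q x by move=> K; apply: nO; apply: KcO K; lra.
    have nK' : nbhs x (~` Kc (1 / 2) q).
      apply: open_nbhs_nbhs; split => //; apply: closed_openC; apply: (K_closed hT); lra.
    move=> B; rewrite Pid // => nB; apply: (filterS _ (filterI nK' nB)) => y [Ky By].
    by rewrite /= Pid.
  + move=> x y; have [Ox|nO] := pselect (Oc q x); have [Oy|nO'] := pselect (Oc q y).
    * by move=> e; have := fP x Ox; rewrite e fP // => /mvI /esym; exact: (Oc_inj (i := q)).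
    * by rewrite (PnO _ nO') => e; case: nO'; rewrite -e; have [] := PO x Ox.
    * by rewrite (PnO _ nO) => e; case: nO; rewrite e; have [] := PO y Oy.
    * by rewrite !PnO.
  + move=> i; have [Ot|nO] := pselect (Oc q (tm i)); last exact: PnO.
    have [gt ht _] := oset_gf D Ot; have [-> _] := PO _ Ot.
    have hz : h (f (tm i)).1 = 0.
      rewrite /h (bigD1_seq i) ?mem_index_enum ?index_enum_uniq //= /z (asboolT Ot) subrr normr0.
      by rewrite (_ : Num.min 1 0 = 0) ?mul0r ?mulr0 //; apply/min_idPr; exact: ler01.
    have t2 : 0 <= (f (tm i)).2 by case/andP: ht.
    have [_ [_ hm]] := ar_max t2 (lexx 0); rewrite /mv hz hm // -surjective_pairing //.
  + move=> x; have [Ox|nO] := pselect (Oc q x); last by left; exact: PnO.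
    have [gx hx _] := oset_gf D Ox; have x2 : 0 <= (f x).2 by case/andP: hx.
    have [hx0|hx0] := ltP 0 (h (f x).1); first by right; apply: nbdP => //; exact: ar_pos.
    left; have [-> _] := PO x Ox; have [_ [_ hm]] := ar_max x2 (proj1 (andP (h0 (f x).1))).
    by rewrite /mv hm ?(le_trans hx0) // -surjective_pairing.
- have D' : disc f g c (r / 2) by apply: (disc_le D); rewrite divr_gt0 //= ltW.
  apply: open_nbhs_nbhs; split; first exact: (oset_open D').
  by exists c => //=; rewrite /hboxo subrr normr0 c2 lexx divr_gt0.
- move=> x [p /= /andP[hp p2] gp] nt.
  have hpr : hboxo c r p by rewrite /hboxo p2 andbT; exact: lt_trans hp rr.
  have fx : f x = p by rewrite -gp (disc_fg D) //; exact: hboxoW.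
  have Ox : Oc q x by exists p.
  have [p20|p20] := ltP 0 p.2.
    apply: nbdP => //; rewrite fx /=; have [l _] := ar_max p2 (proj1 (andP (h0 p.1))); exact: lt_le_trans l.
  have {}p20 : p.2 = 0 by apply/eqP; rewrite eq_le p20.
  apply: nbdP => //; rewrite fx /=; apply: ar_pos => //; rewrite /h mulr_gt0 //.
    rewrite lt_max subr_gt0; move: hp; rewrite nrm_lt => /andP[-> _]; by rewrite orbT.
  apply: prodr_gt0 => i _; rewrite lt_min ltr01 /=.
  have := zE x i Ox; rewrite fx; apply => //; move: hpr; rewrite /hboxo nrm_lt => /andP[/andP[]] //.
Qed.

(** Finitely many local pushes are composed; by [pu_n] a point that has left the boundary does not
    return to it. *)
Lemma push_all : compact [set: T] -> exists P, pusher P /\ forall x, (forall i, x <> tm i) -> ~ bd (P x).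
Proof.
move=> cT.
have /choice[PM hPM] : forall b, exists PM : (T -> T) * set T, [/\ pusher PM.1, nbhs b PM.2 & forall x, PM.2 x -> (forall i, x <> tm i) -> ~ bd (PM.1 x)].
  move=> b; have [bb|nb] := pselect (bd b); first by have [P [M h]] := push1 bb; exists (P, M).
  exists (id, [set y | ~ bd y]); split => //=; last exact: nbd_open.
  by split => //; [move=> x; exact: cvg_id|left].
have [sq hsq] := @fin_cover _ cT setT (fun b => (PM b).2) closedT (fun b _ => let: And3 _ h _ := hPM b in h).
suff [P [hP h]] : exists P, pusher P /\ forall x, (forall i, x <> tm i) -> (exists2 b, b \in sq & (PM b).2 x) -> ~ bd (P x).
  exists P; split => // x nt; apply: h => //; have [y ys [_ hy]] := hsq x I; by exists y.
elim: sq {hsq} => [|b sq [P [hP h]]].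
  exists id; split; last by move=> x _ [].
  by split => //; [move=> x; exact: cvg_id|left].
have [hb nb hbM] := hPM b.
have nt' x : (forall i, x <> tm i) -> forall i, P x <> tm i.
  by move=> nt i; rewrite -(pu_t hP i) => /(pu_i hP); exact: nt.
exists ((PM b).1 \o P); split.
  split.
  - by move=> x; apply: continuous_comp; [exact: (pu_c hP)|exact: (pu_c hb)].
  - by move=> x y /= /(pu_i hb)/(pu_i hP).
  - by move=> i /=; rewrite (pu_t hP) (pu_t hb).
  - move=> x /=; have [e|?] := pu_n hb (P x); last by right.
    by rewrite e; exact: pu_n hP x.
move=> x nt [y]; rewrite inE => /orP[/eqP -> Mx|ys My] /=.
  have [e|n] := pu_n hP x; first by rewrite e; exact: hbM.
  by have [e|?] := pu_n hb (P x) => //; rewrite e.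
have n := h x nt (ex_intro2 _ _ y ys My).
by have [e|?] := pu_n hb (P x) => //; rewrite e.
Qed.

End Push.

End BoundaryPushing.

(** * Arcs between consecutive terminals of a circle *)

Module CircleArcs.
Import Discs Embeddings Stars FlatDiscs CrossingParity TriangleParity Merging LoopHomotopy BoundaryCharts PathParity Detours SegmentParity LoopPieces RadialOrder BasePoints RadialParity ChartCover BoundaryPushing.
Local Open Scope classical_set_scope.
Local Open Scope ring_scope.

Section Circle.
Variables (R : realType) (T : topologicalType).

(** Rational parametrization of the unit circle without [(-1, 0)]; [rot] is complex
    multiplication. *)
Definition rp (u : R) : R * R := ((1 - u ^+ 2) / (1 + u ^+ 2), 2 * u / (1 + u ^+ 2)).
Definition rot (q p : R * R) : R * R := (q.1 * p.1 - q.2 * p.2, q.2 * p.1 + q.1 * p.2).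

Lemma rpd (u : R) : 0 < 1 + u ^+ 2.
Proof. by rewrite ltr_wpDr // sqr_ge0. Qed.

Lemma rp_circle (u : R) : (rp u).1 ^+ 2 + (rp u).2 ^+ 2 = 1.
Proof. by have := rpd u => h; rewrite /rp /=; field; rewrite gt_eqF. Qed.

Lemma rp_inj : injective rp.
Proof.
move=> u v [e1 e2]; have hu := rpd u; have hv := rpd v.
have k (w : R) : (1 - w ^+ 2) / (1 + w ^+ 2) = 2 / (1 + w ^+ 2) - 1 by have h := rpd w; field; rewrite gt_eqF.
have e3 : (1 + u ^+ 2)^-1 = (1 + v ^+ 2)^-1.
  by move: e1; rewrite !k => /addIr /(mulfI _); apply; rewrite pnatr_eq0.
move: e2; rewrite e3 => /mulIf h; have {}h := h (invr_neq0 (lt0r_neq0 hv)).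
by move: h => /mulfI; apply; rewrite pnatr_eq0.
Qed.

Lemma rp_cts : continuous rp.
Proof.
have cs : continuous (fun u : R => u ^+ 2) by move=> u; apply: cvgM; exact: cvg_id.
have ci : continuous (fun u : R => (1 + u ^+ 2)^-1).
  move=> u; apply: cvgV; first by rewrite gt_eqF // rpd.
  by apply: cvgD; [exact: cvg_cst|exact: cs].
apply: pair_cts => u.
  by apply: cvgM; [apply: cvgB; [exact: cvg_cst|exact: cs]|exact: ci].
by apply: cvgM; [apply: cvgM; [exact: cvg_cst|exact: cvg_id]|exact: ci].
Qed.

Lemma rot_circle q p : q.1 ^+ 2 + q.2 ^+ 2 = 1 -> p.1 ^+ 2 + p.2 ^+ 2 = 1 ->
  (rot q p).1 ^+ 2 + (rot q p).2 ^+ 2 = 1.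
Proof.
move=> hq hp; rewrite /rot /=.
have -> : (q.1 * p.1 - q.2 * p.2) ^+ 2 + (q.2 * p.1 + q.1 * p.2) ^+ 2 = (q.1 ^+ 2 + q.2 ^+ 2) * (p.1 ^+ 2 + p.2 ^+ 2) by ring.
by rewrite hq hp mulr1.
Qed.

Lemma rot_surj q p : q.1 ^+ 2 + q.2 ^+ 2 = 1 -> p.1 ^+ 2 + p.2 ^+ 2 = 1 -> p <> (- q.1, - q.2) ->
  exists u, rot q (rp u) = p.
Proof.
move=> hq hp np.
pose c := q.1 * p.1 + q.2 * p.2; pose d := - q.2 * p.1 + q.1 * p.2.
have cd : c ^+ 2 + d ^+ 2 = 1.
  have -> : c ^+ 2 + d ^+ 2 = (q.1 ^+ 2 + q.2 ^+ 2) * (p.1 ^+ 2 + p.2 ^+ 2) by rewrite /c /d; ring.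
  by rewrite hq hp mulr1.
have p1 : p.1 = q.1 * c - q.2 * d.
  have -> : q.1 * c - q.2 * d = (q.1 ^+ 2 + q.2 ^+ 2) * p.1 by rewrite /c /d; ring.
  by rewrite hq mul1r.
have p2 : p.2 = q.2 * c + q.1 * d.
  have -> : q.2 * c + q.1 * d = (q.1 ^+ 2 + q.2 ^+ 2) * p.2 by rewrite /c /d; ring.
  by rewrite hq mul1r.
have c1 : 1 + c != 0.
  apply/eqP => h; apply: np; have c1 : c = - 1 by lra.
  have d0 : d = 0 by move: cd; rewrite c1 sqrrN expr1n => h'; apply/eqP; rewrite -sqrf_eq0; apply/eqP; lra.
  by rewrite [LHS]surjective_pairing p1 p2 c1 d0 !mulr0 subr0 addr0 !mulrN1.
have cpos : 0 < 1 + c.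
  rewrite lt_neqAle eq_sym c1 /=; have : c ^+ 2 <= 1 by have := sqr_ge0 d; lra.
  move=> h; rewrite leNgt; apply/negP => h'; have h2 : 1 < c ^+ 2 by nra.
  by move: (lt_le_trans h2 h); rewrite ltxx.
exists (d / (1 + c)); have E : 1 + (d / (1 + c)) ^+ 2 = 2 / (1 + c).
  have -> : 2 / (1 + c) = (1 + 2 * c + (c ^+ 2 + d ^+ 2)) / (1 + c) ^+ 2 by rewrite cd; field.
  by field.
have n0 : 2 / (1 + c) != 0 by rewrite mulf_neq0 ?invr_neq0 ?pnatr_eq0.
have r1 : (rp (d / (1 + c))).1 = c.
  rewrite /rp /= E; have -> : 1 - (d / (1 + c)) ^+ 2 = 2 - 2 / (1 + c) by rewrite -E; ring.
  by field.
have r2 : (rp (d / (1 + c))).2 = d by rewrite /rp /= E; field.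
by rewrite /rot r1 r2 -p1 -p2 -surjective_pairing.
Qed.

Lemma rot_inj q : q.1 ^+ 2 + q.2 ^+ 2 = 1 -> injective (rot q).
Proof.
move=> hq p p' [e1 e2].
have f1 z : z.1 = q.1 * (q.1 * z.1 - q.2 * z.2) + q.2 * (q.2 * z.1 + q.1 * z.2).
  have -> : q.1 * (q.1 * z.1 - q.2 * z.2) + q.2 * (q.2 * z.1 + q.1 * z.2) = (q.1 ^+ 2 + q.2 ^+ 2) * z.1 by ring.
  by rewrite hq mul1r.
have f2 z : z.2 = - q.2 * (q.1 * z.1 - q.2 * z.2) + q.1 * (q.2 * z.1 + q.1 * z.2).
  have -> : - q.2 * (q.1 * z.1 - q.2 * z.2) + q.1 * (q.2 * z.1 + q.1 * z.2) = (q.1 ^+ 2 + q.2 ^+ 2) * z.2 by ring.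
  by rewrite hq mul1r.
have h1 : p.1 = p'.1 by rewrite (f1 p) e1 e2 -f1.
have h2 : p.2 = p'.2 by rewrite (f2 p) e1 e2 -f2.
by rewrite [LHS]surjective_pairing h1 h2 -surjective_pairing.
Qed.

Lemma rot_cts q : continuous (rot q).
Proof.
have c1 : continuous (fun p : R * R => p.1) by exact: fst_cts.
have c2 : continuous (fun p : R * R => p.2) by exact: snd_cts.
apply: pair_cts => p; [apply: cvgB|apply: cvgD];
  by apply: cvgM; (exact: cvg_cst || exact: c1 || exact: c2).
Qed.

(** The circle is cut open at one of the infinitely many points [rp n], chosen away from the
    finitely many terminals. *)
Lemma circle_param (C : set T) N (tm : 'I_N -> T) : homeo_sets C (@unit_circle R) ->
  exists ga : R -> T, [/\ continuous ga, injective ga, forall u, C (ga u) & forall i, C (tm i) -> exists u, ga u = tm i].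
Proof.
move=> [f [g [cf cg fC gf fg]]].
have [n hn] : exists n : nat, forall i, f (tm i) <> rp n%:R.
  apply: contrapT => no.
  have /choice[io hio] : forall n : nat, exists i, f (tm i) = rp n%:R.
    by move=> n; apply: contrapT => ni; apply: no; exists n => i e; apply: ni; exists i.
  have : injective (fun n : 'I_N.+1 => io n).
    move=> a b e; have := hio a; rewrite e hio => /rp_inj /eqP; rewrite eqr_nat => /eqP h; exact/val_inj/esym.
  by move=> /leq_card; rewrite !card_ord ltnn.
pose q : R * R := (- (rp n%:R).1, - (rp n%:R).2).
have hq : q.1 ^+ 2 + q.2 ^+ 2 = 1 by rewrite /q /= !sqrrN rp_circle.
have hc u : unit_circle (rot q (rp u)) by apply: rot_circle => //; exact: rp_circle.
exists (fun u => g (rot q (rp u))); split.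
- apply: (within_comp (A := @unit_circle R) cg) => // u.
  by apply: (@continuous_comp _ _ _ rp (rot q)); [exact: rp_cts|exact: rot_cts].
- move=> u v e; apply: rp_inj; apply: (rot_inj hq); by rewrite -(fg _ (hc u)) e fg.
- by move=> u; have := hc u; rewrite -fC => -[y Cy yE]; rewrite -yE gf.
- move=> i Ci; have hf : unit_circle (f (tm i)) by rewrite -fC; exists (tm i).
  have [|u hu] := rot_surj hq hf; last by exists u; rewrite hu gf.
  by change (f (tm i) <> (- - (rp n%:R).1, - - (rp n%:R).2)); rewrite !opprK -surjective_pairing.
Qed.

End Circle.

Section Arcs.
Variables (R : realType) (T : topologicalType) (V E : finType) (N k : nat).
Hypothesis hT : hausdorff_space T.
Local Notation bd := (@surface_boundary R T).
Variable C : 'I_k -> set T.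
Hypothesis hC : forall i, homeo_sets (C i) (@unit_circle R).
Hypothesis dC : forall i j, i != j -> C i `&` C j = set0.
Hypothesis bC : [set x | exists i, C i x] = bd.
Variables (s t : E -> V) (A : {set V}) (F : {set E}) (pos : V -> T) (path : E -> R -> T) (tau : 'I_N -> V).
Hypothesis H : emb s t A F pos path.
Hypothesis tauI : injective tau.
Hypothesis tauA : forall i, tau i \in A.
Variables (P : T -> T) (circ : 'I_N -> 'I_k).
Hypothesis hP : pusher R (fun i => pos (tau i)) P.
Hypothesis hPn : forall x, (forall i, x <> pos (tau i)) -> ~ bd (P x).
Hypothesis hcirc : forall i, C (circ i) (pos (tau i)).

(** Each terminal is joined to the next one in the parameter of its cut circle, and the last one to
    none, whence [act]. The arcs of a circle form a path through all its terminals, so a potential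
    constant along the arcs is constant on these terminals. *)
Lemma arcs : exists (act : {set 'I_N}) (nx : 'I_N -> 'I_N) (arc : 'I_N -> R -> T),
  [/\ forall i, i \in act -> nx i != i,
     forall (si : V -> bool), (forall i, i \in act -> si (tau i) = si (tau (nx i))) -> forall i j, circ i = circ j -> si (tau i) = si (tau j) &
     emb (fun e : E + 'I_N => match e with inl e => s e | inr i => tau i end)
         (fun e : E + 'I_N => match e with inl e => t e | inr i => tau (nx i) end) A
         [set e : E + 'I_N | match e with inl e => e \in F | inr i => i \in act end]%SET (P \o pos)
         (fun e : E + 'I_N => match e with inl e => P \o path e | inr i => arc i end)].
Proof.
have /choice[ga hga] : forall c, exists ga : R -> T, [/\ continuous ga, injective ga, forall u, C c (ga u) & forall i, C c (pos (tau i)) -> exists u, ga u = pos (tau i)].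
  by move=> c; exact: (circle_param (fun i => pos (tau i)) (hC c)).
have /choice[th hth] : forall i, exists u, ga (circ i) u = pos (tau i) by move=> i; have [_ _ _ h] := hga (circ i); exact: h.
have posI i j : pos (tau i) = pos (tau j) -> i = j by move=> /(emb_inj H (tauA i) (tauA j)) /tauI.
have thI i j : circ i = circ j -> th i = th j -> i = j by move=> e e'; apply: posI; rewrite -(hth i) -(hth j) e e'.
pose isn i j := [&& circ j == circ i, th i < th j & [forall l, (circ l == circ i) ==> (th i < th l) ==> (th j <= th l)]].
pose nx i := odflt i [pick j | isn i j].
pose act : {set 'I_N} := [set i | [exists j, isn i j]]%SET.
have nxP i : i \in act -> isn i (nx i).
  by rewrite inE /nx => /existsP[j hj]; case: pickP => [//|/(_ j)]; rewrite hj.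
have nxE i : i \in act -> [/\ circ (nx i) = circ i, th i < th (nx i) & forall l, circ l = circ i -> th i < th l -> th (nx i) <= th l].
  move=> /nxP /and3P[/eqP h1 h2 /forallP h3]; split => // l /eqP h4 h5.
  by have := h3 l; rewrite h4 h5.
pose arc i (u : R) := ga (circ i) ((1 - u) * th i + u * th (nx i)).
have sc i (u : R) : i \in act -> 0 < u < 1 -> th i < (1 - u) * th i + u * th (nx i) < th (nx i).
  by move=> /nxE[_ h _] /andP[u0 u1]; apply/andP; split; rewrite -subr_gt0;
    [have -> : (1 - u) * th i + u * th (nx i) - th i = u * (th (nx i) - th i) by ring|
     have -> : th (nx i) - ((1 - u) * th i + u * th (nx i)) = (1 - u) * (th (nx i) - th i) by ring];
    rewrite mulr_gt0 // ?subr_gt0.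
have arcC i u : C (circ i) (arc i u) by have [_ _ h _] := hga (circ i); exact: h.
have arcb i u : bd (arc i u) by rewrite -bC; exists (circ i).
have Cuniq c c' x : C c x -> C c' x -> c = c'.
  move=> h1 h2; apply/eqP; apply: contraPT (conj h1 h2) => ne h; have : (C c `&` C c') x by [].
  by rewrite dC.
have nterm i u j : i \in act -> 0 < u < 1 -> arc i u <> pos (tau j).
  move=> ia u01 e; have ce : circ i = circ j by apply: (Cuniq _ _ (arc i u)) => //; rewrite e.
  have [_ gI _ _] := hga (circ i).
  have : (1 - u) * th i + u * th (nx i) = th j by apply: gI; rewrite -[LHS]/(arc i u) e -hth ce.
  have /andP[h1 h2] := sc i u ia u01; have [_ _ h3] := nxE i ia => h4.
  rewrite h4 in h1 h2; have := h3 j (esym ce) h1; by rewrite leNgt h2.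
have arc0 i : arc i 0 = pos (tau i) by rewrite /arc subr0 mul1r mul0r addr0 hth.
have arc1 i : i \in act -> arc i 1 = pos (tau (nx i)).
  by move=> /nxE[h _ _]; rewrite /arc subrr mul0r add0r mul1r -h hth.
have Pb x : bd (P x) -> exists i, x = pos (tau i).
  by move=> hb; apply: contrapT => no; apply: (hPn _ hb) => i e; apply: no; exists i.
have noP i u x : i \in act -> 0 < u < 1 -> arc i u <> P x.
  move=> ia u01 e; have [j xj] : exists j, x = pos (tau j) by apply: Pb; rewrite -e; exact: arcb.
  by apply: (nterm i u j ia u01); rewrite e xj (pu_t hP).
have puT i : P (pos (tau i)) = pos (tau i) by exact: (pu_t hP i).
exists act, nx, arc; split.
- by move=> i /nxE[_ h _]; apply/eqP => e; move: h; rewrite e ltxx.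
- move=> si hsi.
  suff K n i j : (#|[set l | (circ l == circ i) && (th i < th l <= th j)%R]%SET| <= n)%N -> circ i = circ j -> th i <= th j -> si (tau i) = si (tau j).
    move=> i j e; have [h|h] := leP (th i) (th j); first exact: K (leqnn _) e h.
    by apply/esym; apply: K (leqnn _) (esym e) (ltW h).
  elim: n i j => [|n IH] i j hn ce; rewrite le_eqVlt => /orP[/eqP/(thI i j ce) -> //|lt].
    by move: hn; rewrite leqn0 cards_eq0 => /eqP/setP/(_ j); rewrite !inE ce eqxx lt lexx.
  have ia : i \in act.
    have hj : (circ j == circ i) && (th i < th j) by rewrite ce eqxx lt.
    have [m /andP[/eqP m1 m2] m3] := @arg_minP _ _ _ j (fun l => (circ l == circ i) && (th i < th l)) th hj.
    rewrite inE; apply/existsP; exists m; rewrite /isn m1 eqxx m2 /=; apply/forallP => l.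
    by apply/implyP => h1; apply/implyP => h2; apply: m3; rewrite h1.
  have [c1 c2 c3] := nxE i ia; rewrite (hsi i ia); apply: IH; last exact: c3 (esym ce) lt; last by rewrite c1.
  rewrite -ltnS; apply: leq_trans hn; apply: proper_card; apply/properP; split.
    apply/fintype.subsetP => l; rewrite !inE c1 => /andP[-> /andP[h1 h2]] /=; by rewrite (lt_trans c2 h1).
  exists (nx i); rewrite !inE ?ltxx ?andbF // c1 eqxx c2 /=; exact: c3 (esym ce) lt.
clearbody act; split.
- by move=> v w vA wA /= /(pu_i hP); exact: (emb_inj H vA wA).
- by move=> [e|i]; rewrite inE; [exact: (emb_s H)|move=> _; exact: tauA].
- by move=> [e|i]; rewrite inE; [exact: (emb_t H)|move=> _; exact: tauA].
- move=> [e|i]; rewrite inE => ha x.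
    by apply: continuous_comp; [exact: (emb_c H ha)|exact: (pu_c hP)].
  apply: (@continuous_comp _ _ _ (fun u : R => (1 - u) * th i + u * th (nx i)) (ga (circ i))).
    apply: cvgD; apply: cvgM; try exact: cvg_cst; last exact: cvg_id.
    by apply: cvgB; [exact: cvg_cst|exact: cvg_id].
  by have [h _ _ _] := hga (circ i); exact: h.
- by move=> [e|i]; rewrite inE => ha /=; rewrite ?(emb_0 H ha) // arc0 (pu_t hP).
- by move=> [e|i]; rewrite inE => ha /=; rewrite ?(emb_1 H ha) // arc1 // (pu_t hP).
- move=> [e|i] [e'|i'] x y; rewrite !inE => ha ha' x01 y01 /=.
  + by move=> /(pu_i hP) h; have [-> ->] := emb_i H ha ha' x01 y01 h.
  + have [y0|y0] := eqVneq y 0.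
      by rewrite y0 arc0 -(puT i') => /(pu_i hP) h; case: (emb_v H ha (tauA i') x01 h).
    have [y1|y1] := eqVneq y 1.
      by rewrite y1 (arc1 _ ha') -(puT (nx i')) => /(pu_i hP) h; case: (emb_v H ha (tauA (nx i')) x01 h).
    by move=> h; case: (noP i' y (path e x) ha') => //; rewrite !lt_neqAle y1 eq_sym y0.
  + by move=> h; case: (noP i x (path e' y) ha x01).
  + have [y0|y0] := eqVneq y 0; first by rewrite y0 arc0 => h; case: (nterm i x i' ha x01 h).
    have [y1|y1] := eqVneq y 1; first by rewrite y1 arc1 // => h; case: (nterm i x (nx i') ha x01 h).
    have y01' : 0 < y < 1 by rewrite !lt_neqAle y1 eq_sym y0.
    move=> h; have ce : circ i = circ i' by apply: (Cuniq _ _ (arc i x)) => //; rewrite h.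
    have [_ gI _ _] := hga (circ i).
    have pe : (1 - x) * th i + x * th (nx i) = (1 - y) * th i' + y * th (nx i').
      by apply: gI; rewrite -[LHS]/(arc i x) h /arc ce.
    have /andP[a1 a2] := sc i x ha x01; have /andP[b1 b2] := sc i' y ha' y01'.
    have [_ c1 c2] := nxE i ha; have [_ d1 d2] := nxE i' ha'.
    have ii : i = i'.
      apply: thI => //; have [lt|lt|//] := ltgtP (th i) (th i').
        have := lt_le_trans a2 (c2 i' (esym ce) lt); by rewrite pe => /(lt_trans b1); rewrite ltxx.
      have := lt_le_trans b2 (d2 i ce lt); by rewrite -pe => /(lt_trans a1); rewrite ltxx.
    split; first by rewrite ii.
    move: pe; rewrite ii => pe; have n0 : th (nx i') - th i' != 0 by rewrite subr_eq0 gt_eqF.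
    apply: (mulIf n0); have -> : x * (th (nx i') - th i') = (1 - x) * th i' + x * th (nx i') - th i' by ring.
    by rewrite pe; ring.
- move=> [e|i] v x; rewrite inE => ha vA x01 /=; last exact: noP.
  by move=> /(pu_i hP); exact: (emb_v H ha vA x01).
Qed.

End Arcs.

End CircleArcs.

(** * Reduction of the graph *)

Module Contraction.
Import Discs Embeddings Stars FlatDiscs Merging.
Local Open Scope classical_set_scope.
Local Open Scope ring_scope.

Section Contract.
Variables (R : realType) (T : topologicalType) (V E : finType).
Hypothesis hT : hausdorff_space T.
Hypothesis hD : forall x : T, exists f g r, @disc R T f g (f x) r /\ g (f x) = x.
Implicit Types (s t : E -> V) (A K : {set V}) (F : {set E}) (pos : V -> T) (path : E -> R -> T).

(** [K] holds the terminals, which have to stay in place. The separating potentials prevent an edge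
    of [F0] from joining two of them, so one end is always free to be absorbed. Loops are discarded
    after each step, as [absorb] admits none at the absorbed vertex. *)
Lemma contract n s t A F pos path (F0 : {set E}) K : (#|A| <= n)%N -> emb s t A F pos path ->
  (forall e, e \in F -> s e != t e) -> F0 \subset F -> K \subset A ->
  (forall k k', k \in K -> k' \in K -> k != k' -> exists si : V -> bool,
     (forall e, e \in F0 -> si (s e) = si (t e)) /\ si k != si k') ->
  exists (rho : V -> V) path', [/\ forall v, v \in A -> rho v \in A, forall k, k \in K -> rho k = k,
    forall e, e \in F0 -> rho (s e) = rho (t e),
    forall si : V -> bool, (forall e, e \in F0 -> si (s e) = si (t e)) -> forall v, v \in A -> si (rho v) = si v &
    emb (rho \o s) (rho \o t) (rho @: A)%SET [set e in F | rho (s e) != rho (t e)]%SET pos path'].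
Proof.
elim: n s t A F path F0 => [|n IH] s t A F path F0 cA H nl sF0 KA sep;
  have [[e0 e0F]|no] := pselect (exists e0, e0 \in F0).
- by move: cA; rewrite leqn0 cards_eq0 => /eqP A0; have := emb_s H (fintype.subsetP sF0 _ e0F); rewrite A0 inE.
- exists id, path; split => //.
  + by move=> e eF; case: no; exists e.
  + apply: (emb_sub H).
    * by apply/fintype.subsetP => v /finset.imsetP[w wA ->].
    * by apply/fintype.subsetP => e; rewrite inE => /andP[].
    * by move=> e; rewrite inE => /andP[eF _]; rewrite finset.imset_id (emb_s H eF) (emb_t H eF).
- have e0F' := fintype.subsetP sF0 _ e0F.
  have [b0 [uA vA vu vK]] : exists b0, [/\ endp s t b0 e0 \in A, endp s t (~~ b0) e0 \in A,
      endp s t (~~ b0) e0 != endp s t b0 e0 & endp s t (~~ b0) e0 \notin K].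
    have [tK|tK] := boolP (t e0 \in K).
      exists true; split; [exact: (emb_t H e0F')|exact: (emb_s H e0F')|exact: nl|apply/negP => sK].
      by have [si [h1 h2]] := sep _ _ sK tK (nl _ e0F'); rewrite h1 ?eqxx in h2.
    by exists false; split => //; [exact: (emb_s H e0F')|exact: (emb_t H e0F')|rewrite /= eq_sym nl].
  set u0 := endp s t b0 e0 in uA vu; set v := endp s t (~~ b0) e0 in vA vu vK.
  have [hu hv] : endp s t b0 e0 = u0 /\ endp s t (~~ b0) e0 = v by [].
  clearbody u0 v.
  have m1 : mg v u0 u0 = u0 by rewrite /mg eq_sym (negbTE vu).
  have m2 : mg v u0 v = u0 by rewrite /mg eqxx.
  have m3 w : w != v -> mg v u0 w = w by rewrite /mg => /negbTE ->.
  have me0 : mg v u0 (s e0) = mg v u0 (t e0) by case: (b0) hu hv => /= -> ->; rewrite m1 m2.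
  have sic (si : V -> bool) : (forall e, e \in F0 -> si (s e) = si (t e)) -> forall w, si (mg v u0 w) = si w.
    move=> h w; have [->|/m3 -> //] := eqVneq w v.
    by rewrite m2; have := h _ e0F; case: (b0) hu hv => /= -> ->.
  have [f [g [rad [D gp]]]] := hD (pos u0).
  have nlu w e : e \in F -> ~ (s e = w /\ t e = w) by move=> eF [h1 h2]; move: (nl e eF); rewrite h1 h2 eqxx.
  have [p1 [r1 [d1 [H1 Fl _]]]] := flatten hT H uA D (esym gp) (nlu u0).
  have [p2 [d2 [H2 _ _ _]]] := absorb hT hD H1 Fl uA vA vu (nlu v) e0F' hu hv ltr01.
  set s' := fun e => mg v u0 (s e) in H2; set t' := fun e => mg v u0 (t e) in H2.
  pose F' : {set E} := [set e in F :\ e0 | s' e != t' e]%SET.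
  have F'F e : e \in F' -> e \in F by rewrite !inE => /andP[/andP[]].
  have mA w : w \in A -> mg v u0 w \in A :\ v.
    move=> wA; rewrite in_setD1; have [->|wv] := eqVneq w v; first by rewrite m2 eq_sym vu uA.
    by rewrite m3 // wv.
  have H3 : emb s' t' (A :\ v) F' pos p2.
    apply: emb_sub H2 _ _ _ => //; first by apply/fintype.subsetP => e; rewrite inE => /andP[].
    by move=> e /F'F eF; split; apply: mA; [exact: (emb_s H eF)|exact: (emb_t H eF)].
  have [||||| rho [p3 [q1 q2 q3 q4 q5]]] := IH s' t' (A :\ v) F' p2 (F0 :&: F') _ H3.
  + by move: cA; rewrite (cardsD1 v A) vA.
  + by move=> e; rewrite inE => /andP[].
  + exact: subsetIr.
  + apply/fintype.subsetP => k kK; rewrite in_setD1 (fintype.subsetP KA) // andbT.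
    by apply: contraNneq vK => <-.
  + move=> k k' kK kK' kk; have [si [h1 h2]] := sep k k' kK kK' kk; exists si; split => // e.
    by rewrite finset.in_setI => /andP[eF0 _]; rewrite /s' /t' !(sic _ h1) h1.
  exists (rho \o mg v u0), p3; split.
  + by move=> w /mA/q1; rewrite in_setD1 => /andP[].
  + by move=> k kK; rewrite /= m3 ?q2 //; apply: contraNneq vK => <-.
  + move=> e eF0; have [->|ee] := eqVneq e e0; first by rewrite /= me0.
    have [h|h] := eqVneq (s' e) (t' e); first by rewrite /= -/(s' e) -/(t' e) h.
    apply: q3; rewrite finset.in_setI eF0 /= inE in_setD1 ee h andbT.
    exact: (fintype.subsetP sF0).
  + move=> si h w wA; rewrite /= q4 ?sic //; last exact: mA.
    by move=> e; rewrite finset.in_setI => /andP[eF0 _]; rewrite /s' /t' !(sic _ h) h.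
  + have EA : (rho @: (A :\ v) = (rho \o mg v u0) @: A)%SET.
      apply/setP => y; apply/finset.imsetP/finset.imsetP => -[w wA ->].
        by move: wA; rewrite in_setD1 => /andP[wv wA]; exists w => //=; rewrite m3.
      by exists (mg v u0 w) => //; exact: mA.
    have EF : [set e in F' | rho (s' e) != rho (t' e)]%SET = [set e in F | (rho \o mg v u0) (s e) != (rho \o mg v u0) (t e)]%SET.
      apply/setP => e; rewrite !inE /= -/(s' e) -/(t' e).
      have [->|ee] /= := eqVneq e e0; first by rewrite /s' /t' me0 eqxx andbF.
      by have [->|h] := eqVneq (s' e) (t' e); rewrite ?eqxx ?andbF // andbT.
    by rewrite -EA -EF.
- exists id, path; split => //.
  + by move=> e eF; case: no; exists e.
  + apply: (emb_sub H).
    * by apply/fintype.subsetP => v /finset.imsetP[w wA ->].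
    * by apply/fintype.subsetP => e; rewrite inE => /andP[].
    * by move=> e; rewrite inE => /andP[eF _]; rewrite finset.imset_id (emb_s H eF) (emb_t H eF).
Qed.

End Contract.

End Contraction.

(** * Bound on the number of components *)

Module FewComponents.
Import Discs Embeddings Stars FlatDiscs CrossingParity TriangleParity Merging LoopHomotopy BoundaryCharts PathParity Detours SegmentParity LoopPieces RadialOrder BasePoints RadialParity ChartCover Bouquets DualWalks MinimalCuts CutCount CutDuality HalfEdges CyclicJumps ParityComparison BoundaryPushing CircleArcs.
Local Open Scope classical_set_scope.
Local Open Scope ring_scope.

Section Gamma.
Variables (R : realType) (T : topologicalType) (V E : finType) (N k : nat).
Hypothesis hT : hausdorff_space T.
Hypothesis cT : compact [set: T].
Hypothesis hD : forall x : T, exists f g r, @disc R T f g (f x) r /\ g (f x) = x.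
Variables (I Q : finType) (ch : I -> chart R T) (qc : Q -> chart R T) (qi qj : Q -> I).
Hypothesis subi : forall q y, Oc (qc q) y -> Kc (3 / 4) (ch (qi q)) y.
Hypothesis subj : forall q y, Oc (qc q) y -> Kc (3 / 4) (ch (qj q)) y.
Hypothesis hI : forall x, exists i, oset (cg (ch i)) (cc (ch i)) (1 / 2 * crad (ch i)) x.
Hypothesis hQ : forall i j x, Kc (1 / 2) (ch i) x -> Kc (1 / 2) (ch j) x -> exists q, [/\ qi q = i, qj q = j & Oc (qc q) x].
Local Notation bd := (@surface_boundary R T).
Local Notation KI := ('I_k * {ffun Q -> bool})%type.
Local Notation bound := (32 * (2 ^ (#|{: KI}| + k)) ^ 3 * N ^ 4)%N.

Section Dualize.
Variables (s t : E -> V) (A : {set V}) (F : {set E}) (pos : V -> T) (path : E -> R -> T) (tau : 'I_N -> V).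
Variables (circ : 'I_N -> 'I_k) (E0 : {set E}).
Hypothesis H : emb s t A F pos path.
Hypothesis nl : forall e, e \in F -> s e != t e.
Hypothesis tauI : injective tau.
Hypothesis tauA : forall i, tau i \in A.
Hypothesis tbd : forall i, bd (pos (tau i)).
Hypothesis cE0 : (#|E0| <= N)%N.
Hypothesis hc0 : forall si : V -> bool, (forall e, e \in F :&: E0 -> si (s e) = si (t e)) ->
  forall i j, circ i = circ j -> si (tau i) = si (tau j).
Hypothesis N0 : (0 < N)%N.
Variable w : E -> R.
Hypothesis w0 : forall e, 0 <= w e.

Let ed v u := [exists e in F, ((s e == v) && (t e == u)) || ((s e == u) && (t e == v))].

Let ed_sym : connect_sym ed.
Proof. by apply: sym_connect_sym => v u; apply: eq_existsb => e; rewrite orbC. Qed.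

Definition term_comp : {set V} := [set v in A | [exists i, connect ed (tau i) v]]%SET.
Local Notation A' := term_comp.

Let edF e : e \in F -> connect ed (s e) (t e).
Proof. by move=> eF; apply: connect1; apply/existsP; exists e; rewrite eF !eqxx. Qed.

Lemma term_comp_edge e : e \in F -> (s e \in A') = (t e \in A').
Proof.
move=> eF; rewrite !inE (emb_s H eF) (emb_t H eF) /=; apply: eq_existsb => i.
exact: (same_connect_r ed_sym (edF eF)).
Qed.

Lemma tau_term i : tau i \in A'.
Proof. by rewrite inE tauA; apply/existsP; exists i; exact: connect0. Qed.

Let F3 : {set E} := [set e in F | s e \in A']%SET.
Let i00 : 'I_N := Ordinal N0.
(** A component is filed under the circle of one of its terminals. The arcs join all terminals of a
    circle, so the vertices filed under the same circle are connected. *)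
Let kp v : 'I_k := if [pick i | connect ed (tau i) v] is Some i then circ i else circ i00.

Let kpE v u : connect ed v u -> kp v = kp u.
Proof.
move=> c; rewrite /kp; congr (if _ is Some i then circ i else _).
by apply: eq_pick => i; exact: (same_connect_r ed_sym c).
Qed.

Let walkc (si : V -> bool) v u : (forall e, e \in F3 -> si (s e) = si (t e)) -> v \in A' -> connect ed v u -> si v = si u.
Proof.
move=> h vA /connectP[p pp ->]; elim: p v vA pp => //= x p IH v vA /andP[/existsP[e /andP[eF hx]] pp].
have sA : s e \in A'.
  by case/orP: hx => /andP[/eqP h1 /eqP h2]; [rewrite h1|rewrite (term_comp_edge eF) h2].
have e3 : e \in F3 by rewrite inE eF.
have xA : x \in A'.
  by case/orP: hx => /andP[/eqP h1 /eqP h2]; [rewrite -h2 -(term_comp_edge eF)|rewrite -h1].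
rewrite -(IH x xA pp); case/orP: hx => /andP[/eqP <- /eqP <-]; first exact: h.
by rewrite (h e e3).
Qed.

Let csame i j : circ i = circ j -> connect ed (tau i) (tau j).
Proof.
move=> c; have <- : connect ed (tau i) (tau i) = connect ed (tau i) (tau j); last exact: connect0.
apply: hc0 c => e; rewrite finset.in_setI => /andP[eF _].
exact: (same_connect_r ed_sym (edF eF)).
Qed.

Let hk v : v \in A' -> exists i, connect ed (tau i) v /\ circ i = kp v.
Proof.
rewrite inE => /andP[_ /existsP[i hi]]; rewrite /kp; case: pickP => [j hj|/(_ i)]; last by rewrite hi.
by exists j.
Qed.

(** The marked vertex is a terminal, hence a boundary point, which is where the directions are
    ordered by [xi] and where [comp_dd] applies. *)
Let dual_comp (c : 'I_k) : exists (l r : E -> {set E * bool}) (S : {ffun Q -> bool} -> {set E}),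
  let Fc := [set e in F3 | kp (s e) == c]%SET in
  [/\ forall si phi, \big[addb/false]_(e in Fc) ((si (s e) (+) si (t e)) && (phi (l e) (+) phi (r e))) = false,
      forall q, S q \subset Fc &
   forall z : E -> bool, (forall si : V -> bool, \big[addb/false]_(e in Fc) (z e && (si (s e) (+) si (t e))) = false) ->
    (forall q, \big[addb/false]_(e in S q) z e = false) ->
    exists phi : {set E * bool} -> bool, forall e, e \in Fc -> z e = phi (l e) (+) phi (r e)].
Proof.
set Fc : {set E} := [set e in F3 | kp (s e) == c]%SET.
have FcP e : e \in Fc -> [/\ e \in F, s e \in A', kp (s e) = c & kp (t e) = c].
  rewrite !inE => /andP[/andP[eF sA] /eqP kc]; split => //; rewrite -kc; exact/esym/kpE/edF.
have [[v vA vc]|no] := pselect (exists2 v, v \in A' & kp v = c); last first.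
  have F0 : Fc = finset.set0.
    apply/setP => e; rewrite finset.in_set0; apply/negP => /FcP[eF sA sc _]; apply: no; by exists (s e).
  exists (fun=> finset.set0), (fun=> finset.set0), (fun=> finset.set0); rewrite /= F0; split.
  - by move=> si phi; rewrite big_set0.
  - by move=> q; exact: fintype.subxx.
  - by move=> z _ _; exists (fun=> false) => e; rewrite inE.
have [i [ci ei]] := hk vA; set u := tau i in ci.
pose Ac : {set V} := [set v in A' | kp v == c]%SET.
have uA' := tau_term i; have uc : kp u = c by rewrite (kpE ci).
have uA : u \in Ac by rewrite inE uA' uc eqxx.
have A'A v' : v' \in A' -> v' \in A by rewrite inE => /andP[].
have Hc : emb s t Ac Fc pos path.
  apply: (emb_sub H).
  - by apply/fintype.subsetP => v'; rewrite inE => /andP[/A'A].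
  - by apply/fintype.subsetP => e /FcP[].
  - move=> e /FcP[eF sA sc tc]; split; rewrite inE ?sA ?sc ?tc ?eqxx // andbT.
    by rewrite -(term_comp_edge eF).
have [i0 Oo] := hI (pos u).
have h12 : (1 / 2 : R) < 1 by rewrite ltr_pdivrMr // mul1r ltr1n.
have Oc0 : Oc (ch i0) (pos u).
  case: Oo => p /= /andP[k1 k2] <-; exists p => //=; rewrite /hboxo k2 andbT.
  by apply: lt_trans k1 _; rewrite gtr_pMl ?(disc_r (cD (ch i0))).
have c2 := bd_zero (@tbd i) Oc0; rewrite -/u in c2.
have [gu hu _] := oset_gf (cD (ch i0)) Oc0; have /andP[hu1 _] := hu.
have rho0 : 0 < crad (ch i0) - `|cf (ch i0) (pos u) - cc (ch i0)| by rewrite subr_gt0.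
have D : disc (cf (ch i0)) (cg (ch i0)) (cf (ch i0) (pos u)) (crad (ch i0) - `|cf (ch i0) (pos u) - cc (ch i0)|).
  by apply: (sub_disc (cD (ch i0))) => //; rewrite ?c2 // addrC subrK.
have [|p1 [r1 [d1 [H1 Fl _]]]] := flatten hT Hc uA D (esym gu).
  by move=> e /FcP[eF _ _ _] [h1 h2]; move: (nl eF); rewrite h1 h2 eqxx.
have [||l [r [ga [S HS]]]] := comp_dd hT hD subi subj hI hQ (leqnn #|Ac|) H1 uA Oo c2 Fl.
- by move=> e /FcP[eF _ _ _] h1; move: (nl eF); rewrite h1 eqxx.
- move=> si hsi v'; rewrite inE => /andP[vA' /eqP vc'].
  have [j [cj ej]] := hk vA'.
  have cu : connect ed v' u.
    by rewrite ed_sym; apply: connect_trans cj; apply: csame; rewrite ej vc' ei vc.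
  have := @walkc (fun x => (kp x == c) && si x) v' u _ vA' cu; rewrite vc' uc eqxx /=; apply => e e3.
  have eF : e \in F by move: e3; rewrite inE => /andP[].
  rewrite -(kpE (edF eF)); case: (eqVneq (kp (s e)) c) => //= kc; apply: hsi; by rewrite inE e3 kc eqxx.
by exists l, r, S; split; [exact: (dd_cut HS)|exact: (dd_sub HS)|exact: (dd_cyc HS)].
Qed.

(** The duals for the various circles are put side by side. If [rho] identifies the ends of all
    edges of [F3] outside [X] and [E0], each subset of its image gives a cut inside [X]; comparison
    with [few_cuts] bounds the size of the image by the exponent. *)
Lemma few_comps : exists X : {set E},
  (forall Rr : {set 'I_N}, exists si : V -> bool, [/\ forall i, si (tau i) = (i \in Rr),
     forall e, e \in F3 -> e \notin E0 -> e \notin X -> si (s e) = si (t e) &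
     forall si' : V -> bool, (forall i, si' (tau i) = (i \in Rr)) ->
       \sum_(e in F3 :\: E0 | si (s e) != si (t e)) w e <= \sum_(e in F3 :\: E0 | si' (s e) != si' (t e)) w e]) /\
  forall rho : V -> V, (forall e, e \in F3 -> e \notin E0 -> e \notin X -> rho (s e) = rho (t e)) ->
    (#|(rho @: A')%SET| <= bound)%N.
Proof.
have /choice[dat hdat] : forall c : 'I_k, exists d : (E -> {set E * bool}) * (E -> {set E * bool}) * ({ffun Q -> bool} -> {set E}),
    let Fc := [set e in F3 | kp (s e) == c]%SET in
  [/\ forall si phi, \big[addb/false]_(e in Fc) ((si (s e) (+) si (t e)) && (phi (d.1.1 e) (+) phi (d.1.2 e))) = false,
      forall q, d.2 q \subset Fc &
   forall z : E -> bool, (forall si : V -> bool, \big[addb/false]_(e in Fc) (z e && (si (s e) (+) si (t e))) = false) ->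
    (forall q, \big[addb/false]_(e in d.2 q) z e = false) ->
    exists phi : {set E * bool} -> bool, forall e, e \in Fc -> z e = phi (d.1.1 e) (+) phi (d.1.2 e)].
  by move=> c; have [l [r [S h]]] := dual_comp c; exists (l, r, S).
pose V' : finType := {v : V | v \in A'}.
pose vd : V' := exist _ (tau i00) (tau_term i00).
(* Edges outside [F3] become loops at a dummy vertex and thus belong to no cut. *)
pose s3 e : V' := if e \in F3 then insubd vd (s e) else vd.
pose t3 e : V' := if e \in F3 then insubd vd (t e) else vd.
pose tau3 i : V' := insubd vd (tau i).
pose O : finType := ('I_k * {set E * bool} + option E)%type.
(* An edge outside [F3] joins a private face to a common one, so any value of [z] on it is a
   coboundary. *)
pose l3 e : O := if e \in F3 then inl (kp (s e), (dat (kp (s e))).1.1 e) else inr (Some e).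
pose r3 e : O := if e \in F3 then inl (kp (s e), (dat (kp (s e))).1.2 e) else inr None.
pose S3 (q : KI) : {set E} := (dat q.1).2 q.2.
pose sx (si : {ffun V' -> bool}) v := si (insubd vd v).
have F3P e : e \in F3 -> [/\ e \in F, s e \in A' & t e \in A'].
  by rewrite inE => /andP[eF sA]; split; rewrite -?(term_comp_edge eF).
have cutE si e : (e \in cut s3 t3 si) = (e \in F3) && (sx si (s e) != sx si (t e)).
  by rewrite inE /s3 /t3; case: ifP => //=; rewrite eqxx.
have sxE (si : V -> bool) v : v \in A' -> sx [ffun v' : V' => si (val v')] v = si v.
  by move=> vA; rewrite /sx ffunE insubdK.
have bd_cut si x : DualWalks.bd l3 r3 (cut s3 t3 si) x = false.
  rewrite /DualWalks.bd; case: x => [[c o]|x]; last first.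
    rewrite big1 // => e; rewrite cutE /l3 /r3 => /andP[-> _]; by case: x.
  have [h _ _] := hdat c.
  rewrite -[RHS](h (sx si) (fun o' => o' == o)).
  rewrite big_set_addb [RHS]big_set_addb; apply: eq_bigr => e _; rewrite cutE inE /l3 /r3.
  case: (boolP (e \in F3)) => //= e3.
  rewrite -![inl _ == inl _]/((_, _) == (_, _)) !xpair_eqE; case: (eqVneq (kp (s e)) c) => [->|_] /=; last by rewrite andbF.
  by case: (sx si (s e)); case: (sx si (t e)).
have star : forall Y : {set E}, (forall x, DualWalks.bd l3 r3 Y x = false) -> exists (si : {ffun V' -> bool}) (y : {ffun KI -> bool}),
    forall e, (e \in Y) = (e \in cut s3 t3 si) (+) \big[addb/false]_q (y q && (e \in S3 q)).
  move=> Y; apply: star_of => z hz hS.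
  have /choice[ph hph] : forall c : 'I_k, exists phi : {set E * bool} -> bool, forall e, e \in [set e in F3 | kp (s e) == c]%SET ->
      z e = phi ((dat c).1.1 e) (+) phi ((dat c).1.2 e).
    move=> c; have [_ sub h] := hdat c; apply: h.
      move=> si; rewrite -[RHS](hz [ffun v' : V' => (kp (val v') == c) && si (val v')]).
      rewrite big_set_addb; apply: eq_bigr => e _; rewrite cutE inE.
      case: (boolP (e \in F3)) => //= e3; last by rewrite andbF.
      have [eF sA tA] := F3P e e3.
      rewrite (sxE (fun v => (kp v == c) && si v)) // (sxE (fun v => (kp v == c) && si v)) // -(kpE (edF eF)).
      by case: (kp (s e) == c); rewrite /= ?andbF //; case: (si (s e)); case: (si (t e)).
    move=> q; rewrite -[RHS](hS (c, q)) big_set_addb; apply: eq_bigr => e _; by rewrite andbC.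
  exists (fun x => match x with inl (c, o) => ph c o | inr (Some e) => z e | inr None => false end) => e.
  rewrite /l3 /r3; case: (boolP (e \in F3)) => e3; last by rewrite addbF.
  by apply: hph; rewrite inE e3 eqxx.
have hc3 : forall si, (forall e, e \in E0 -> e \notin cut s3 t3 si) -> forall i j, circ i = circ j -> si (tau3 i) = si (tau3 j).
  move=> si h i j c; apply: (hc0 (si := sx si) _ c) => e; rewrite finset.in_setI => /andP[eF e0].
  have := h e e0; rewrite cutE negb_and negbK => /orP[h1|/eqP //].
  have nA : s e \notin A' by move: h1; rewrite inE eF.
  have nA' : t e \notin A' by rewrite -(term_comp_edge eF).
  by rewrite /sx; congr (si _); apply: val_inj; rewrite !val_insubd (negbTE nA) (negbTE nA').
have hconn : forall si, cut s3 t3 si = finset.set0 -> (forall i, si (tau3 i) = false) -> forall v, si v = false.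
  move=> si c0 ht v; have vA := valP v.
  have [i [ci _]] := hk vA.
  have E1 : sx si (tau i) = sx si (val v).
    apply: (@walkc (sx si) _ _ _ (tau_term i) ci) => e e3; apply/eqP; apply: contraT => h.
    have h' : e \in cut s3 t3 si by rewrite cutE e3 h.
    by rewrite c0 inE in h'.
  by rewrite -(ht i) -[RHS]/(sx si (tau i)) E1 /sx valKd.
have t3I : injective tau3.
  by move=> i j /(congr1 val); rewrite !val_insubd !tau_term => /tauI.
(* [few_cuts] takes an edge as a default value; without edges only the terminals are left. *)
have [e00|noE] := pselect (inhabited E); last first.
  have F30 e : e \in F3 -> False by move=> _; apply: noE; constructor.
  have noe (e : E) : False by apply: noE; constructor.
  exists finset.set0; split.
    move=> Rr; exists (fun v => [exists i, (tau i == v) && (i \in Rr)]); split.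
    - move=> i; apply/existsP/idP => [[j /andP[/eqP/tauI -> //]]|iR]; by exists i; rewrite eqxx.
    - by move=> e; case: (noe e).
    - by move=> si' _; rewrite !big_pred0 // => e; case: (noe e).
  move=> rho _; apply: leq_trans (leq_imset_card _ _) _.
  have sub : A' \subset [set tau i | i : 'I_N]%SET.
    apply/fintype.subsetP => v; rewrite inE => /andP[_ /existsP[i /connectP[[|x p]]]].
      by move=> _ ->; apply/finset.imsetP; exists i.
    by move=> /= /andP[/existsP[e _] _]; case: (noe e).
  apply: leq_trans (subset_leq_card sub) _; apply: leq_trans (leq_imset_card _ _) _.
  rewrite cardT size_enum_ord; have N4 : (N <= N ^ 4)%N by rewrite -{1}[N]expn1; apply: leq_pexp2l.
  apply: leq_trans N4 _; apply: leq_pmull; by rewrite muln_gt0 !expn_gt0.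
case: e00 => e00.
have [X [hX cX]] := few_cuts bd_cut star hc3 hconn cE0 t3I w0 e00 N0.
have sumE si : \sum_(e in cut s3 t3 si :\: E0) w e = \sum_(e in F3 :\: E0 | sx si (s e) != sx si (t e)) w e.
  by apply: eq_bigl => e; rewrite !finset.in_setD cutE andbA.
exists X; split.
  move=> Rr; have [si [h1 h2 h3]] := hX Rr; exists (sx si); split; first exact: h1.
    move=> e e3 e0 eX; apply/eqP; apply: contraNT eX => h; apply: (fintype.subsetP h2).
    by rewrite finset.in_setD e0 cutE e3 h.
  move=> si' h'; have := h3 [ffun v' : V' => si' (val v')]; rewrite !sumE.
  have -> : \sum_(e in F3 :\: E0 | sx [ffun v' : V' => si' (val v')] (s e) != sx [ffun v' : V' => si' (val v')] (t e)) w e =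
            \sum_(e in F3 :\: E0 | si' (s e) != si' (t e)) w e.
    apply: eq_bigl => e; rewrite finset.in_setD; case: (boolP (e \in F3)) => e3; last by rewrite andbF.
    by have [_ sA tA] := F3P e e3; rewrite !sxE.
  by apply => i; rewrite ffunE val_insubd tau_term.
move=> rho hrho; set B := (rho @: A')%SET.
rewrite -(leq_exp2l (m := 2)) //; apply: leq_trans cX; rewrite -card_powerset.
pose G (U : {set V}) : {ffun V' -> bool} := [ffun v' : V' => rho (val v') \in U].
have GI : {in powerset B &, injective G}.
  move=> U U'; rewrite !powersetE => hU hU' /ffunP e; apply/setP => y.
  have [yB|yB] := boolP (y \in B); last first.
    by rewrite (contraNF (fintype.subsetP hU y) yB) (contraNF (fintype.subsetP hU' y) yB).
  case/finset.imsetP: yB => v vA ->; have := e (exist _ v vA : V'); by rewrite !ffunE.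
rewrite -(card_in_imset GI); apply: subset_leq_card; apply/fintype.subsetP => si /finset.imsetP[U _ ->].
rewrite inE; apply/fintype.subsetP => e; rewrite finset.in_setD cutE => /andP[e0 /andP[e3 h]].
apply: contraNT h => eX; have [_ sA tA] := F3P e e3.
by rewrite !(sxE (fun v => rho v \in U)) // (hrho e e3 e0 eX).
Qed.

End Dualize.
End Gamma.

End FewComponents.

(** * Min-cuts as minima over two-colourings of the vertices *)

Module MinCuts.
Import Discs Embeddings Stars FlatDiscs CrossingParity TriangleParity Merging LoopHomotopy BoundaryCharts PathParity Detours SegmentParity LoopPieces RadialOrder BasePoints RadialParity ChartCover Bouquets DualWalks MinimalCuts CutCount CutDuality HalfEdges CyclicJumps ParityComparison BoundaryPushing CircleArcs Contraction FewComponents.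
Local Open Scope classical_set_scope.
Local Open Scope ring_scope.

Section Mincut.
Variables (R : realType) (N : nat).
Implicit Types (G : wgraph R N) (Rr : {set 'I_N}).

Definition cutb G (si : vert G -> bool) (e : {set vert G}) : bool := [exists x in e, [exists y in e, si x != si y]].
Definition cutval G (si : vert G -> bool) : R := \sum_(e in edges G | cutb si e) weight G e.

Lemma cutb2 G (si : vert G -> bool) x y : cutb si [set x; y]%SET = (si x != si y).
Proof.
apply/idP/idP => [/existsP[a /andP[]]|h].
  rewrite !inE => ha /existsP[b /andP[]]; rewrite !inE => hb.
  by case/orP: ha => /eqP ->; case/orP: hb => /eqP -> //; rewrite ?eqxx // eq_sym.
by apply/existsP; exists x; rewrite !inE eqxx /=; apply/existsP; exists y; rewrite !inE eqxx orbT.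
Qed.

(** The edges cut by a colouring separate, and conversely a separating set contains the cut of the
    set of vertices that remain linked to the region. *)
Lemma mincutP G Rr c : wf_graph G -> mincut G Rr c <->
  (exists si : vert G -> bool, (forall i, si (bvert G i) = (i \in Rr)) /\ cutval si = c) /\
  (forall si : vert G -> bool, (forall i, si (bvert G i) = (i \in Rr)) -> c <= cutval si).
Proof.
move=> wf.
have sep si : (forall i, si (bvert G i) = (i \in Rr)) -> separates [set e in edges G | cutb si e]%SET Rr.
  move=> h i j iR jR; apply/negP => /connectP[p pp lp].
  have : si (bvert G i) = si (bvert G j); last by rewrite !h iR (negbTE jR).
  rewrite lp; elim: p (bvert G i) pp {lp} => //= y p IH x /andP[].
  rewrite finset.in_setD inE => /andP[h1 h2] /IH <-; move: h1; rewrite h2 /= cutb2 negbK => /eqP //.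
have sumF si : \sum_(e in [set e in edges G | cutb si e]%SET) weight G e = cutval si.
  by apply: eq_bigl => e; rewrite inE.
have pot (F : {set {set vert G}}) : F \subset edges G -> separates F Rr -> exists si : vert G -> bool,
    (forall i, si (bvert G i) = (i \in Rr)) /\ cutval si <= \sum_(e in F) weight G e.
  move=> sF hF; pose si v := [exists i, (i \in Rr) && linked F (bvert G i) v].
  exists si; split.
    move=> j; apply/existsP/idP => [[i /andP[iR l]]|jR]; last by exists j; rewrite jR; exact: connect0.
    by apply: contraT => jR; have := hF i j iR jR; rewrite l.
  have step x y : [set x; y]%SET \in edges G :\: F -> si x -> si y.
    move=> he /existsP[i /andP[iR l]]; apply/existsP; exists i; rewrite iR.
    by apply: connect_trans l _; apply: connect1.
  have sub e : e \in edges G -> cutb si e -> e \in F.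
    move=> eG; apply: contraTT => eF.
    have [c2 _] := wf e eG; have /cards2P[x [y [xy ee]]] : #|e| == 2%N by apply/eqP.
    have h1 : [set x; y]%SET \in edges G :\: F by rewrite -ee finset.in_setD eF.
    have h2 : [set y; x]%SET \in edges G :\: F by rewrite finset.setUC.
    rewrite ee cutb2 negbK; apply/eqP; apply/idP/idP; [exact: (step _ _ h1)|exact: (step _ _ h2)].
  rewrite /cutval [X in _ <= X](bigID (fun e => cutb si e)) /= -[X in X <= _]addr0; apply: lerD.
    rewrite le_eqVlt; apply/orP; left; apply/eqP; apply: eq_bigl => e.
    case: (boolP (cutb si e)) => hc; rewrite ?andbF // !andbT.
    by apply/idP/idP => [eG|]; [exact: sub|exact: (fintype.subsetP sF)].
  by apply: sumr_ge0 => e /andP[/(fintype.subsetP sF)/wf[]].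
split=> [[[F [sF hF hc]] hmin]|[[si [h hc]] hmin]].
  have lo si : (forall i, si (bvert G i) = (i \in Rr)) -> c <= cutval si.
    move=> h; rewrite -sumF; apply: hmin; last exact: sep.
    by apply/fintype.subsetP => e; rewrite inE => /andP[].
  split => //; have [si [h1 h2]] := pot F sF hF; exists si; split => //.
  by apply/eqP; rewrite eq_le lo // andbT -hc.
split; last by move=> F sF hF; have [si' [h1 h2]] := pot F sF hF; apply: le_trans h2; exact: hmin.
exists [set e in edges G | cutb si e]%SET; split; [|exact: sep|by rewrite sumF].
by apply/fintype.subsetP => e; rewrite inE => /andP[].
Qed.

Lemma mincut_min G Rr c m : wf_graph G ->
  (exists si : vert G -> bool, (forall i, si (bvert G i) = (i \in Rr)) /\ cutval si = m) ->
  (forall si : vert G -> bool, (forall i, si (bvert G i) = (i \in Rr)) -> m <= cutval si) ->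
  mincut G Rr c <-> c = m.
Proof.
move=> wf [s0 [h0 e0]] hm; rewrite mincutP //; split => [[[si [h e]] hc]|->].
  by apply/eqP; rewrite eq_le -{1}e0 hc //= -e hm.
by split; [exists s0|].
Qed.

End Mincut.

End MinCuts.

Import Discs Embeddings Stars FlatDiscs CrossingParity TriangleParity Merging LoopHomotopy BoundaryCharts PathParity Detours SegmentParity LoopPieces RadialOrder BasePoints RadialParity ChartCover Bouquets DualWalks MinimalCuts CutCount CutDuality HalfEdges CyclicJumps ParityComparison BoundaryPushing CircleArcs Contraction FewComponents MinCuts.
Local Open Scope classical_set_scope.
Local Open Scope ring_scope.

(** * Construction of the small graph *)

Section Reduce.
Variables (R : realType) (T : topologicalType) (N : nat) (k : nat).
Hypothesis hT : hausdorff_space T.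
Hypothesis cT : compact [set: T].
Hypothesis hD : forall x : T, exists f g r, @disc R T f g (f x) r /\ g (f x) = x.
Variables (I Q : finType) (ch : I -> chart R T) (qc : Q -> chart R T) (qi qj : Q -> I).
Hypothesis subi : forall q y, Oc (qc q) y -> Kc (3 / 4) (ch (qi q)) y.
Hypothesis subj : forall q y, Oc (qc q) y -> Kc (3 / 4) (ch (qj q)) y.
Hypothesis hI : forall x, exists i, oset (cg (ch i)) (cc (ch i)) (1 / 2 * crad (ch i)) x.
Hypothesis hQ : forall i j x, Kc (1 / 2) (ch i) x -> Kc (1 / 2) (ch j) x -> exists q, [/\ qi q = i, qj q = j & Oc (qc q) x].
Variable C : 'I_k -> set T.
Hypothesis hC : forall i, homeo_sets (C i) (@unit_circle R).
Hypothesis dC : forall i j, i != j -> C i `&` C j = set0.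
Hypothesis bC : [set x | exists i, C i x] = @surface_boundary R T.
Variables (A : 'I_N -> set T) (G : wgraph R N).
Hypothesis dA : forall i j, i != j -> A i `&` A j = set0.
Hypothesis bA : [set x | exists j, A j x] = @surface_boundary R T.
Hypothesis wf : wf_graph G.
Hypothesis N0 : (0 < N)%N.
Local Notation V := (vert G).
Local Notation E := {set vert G}.
Local Notation tau := (bvert G).
Local Notation bound := (32 * (2 ^ (#|{: 'I_k * {ffun Q -> bool}}| + k)) ^ 3 * N ^ 4)%N.

(** Orientations are chosen, and the paths become total by clamping the parameter to the unit
    interval. *)
Lemma embeds_emb : embeds A G -> exists (s t : E -> V) (pos : V -> T) (path : E -> R -> T),
  [/\ emb s t [set: V]%SET (edges G) pos path, forall j, A j (pos (tau j)),
      forall e, e \in edges G -> e = [set s e; t e]%SET & forall e, e \in edges G -> s e != t e].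
Proof.
move=> [pos [path [pI pA pe pc]]].
pose v0 : V := tau (Ordinal N0).
have /choice[st hst] : forall e : E, exists st : V * V, e \in edges G -> [/\ e = [set st.1; st.2]%SET, path e 0 = pos st.1 & path e 1 = pos st.2].
  move=> e; case: (boolP (e \in edges G)) => [eG|_]; last by exists (v0, v0).
  by have [_ _ [x [y [h1 h2 h3]]] _] := pe e eG; exists (x, y).
have neq e : e \in edges G -> (st e).1 != (st e).2.
  move=> eG; have [c2 _] := wf eG; have [ee _ _] := hst e eG.
  by move: c2; rewrite {1}ee cards2; case: eqVneq.
have pth e (x : R) : 0 <= x <= 1 -> path e (clamp01 x) = path e x by move=> x01; rewrite clamp01_id.
have o0 : 0 <= (0 : R) <= 1 by rewrite lexx ler01.
have o1 : 0 <= (1 : R) <= 1 by rewrite lexx ler01.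
have W (x : R) : 0 < x < 1 -> 0 <= x <= 1 by move=> /andP[h1 h2]; rewrite !ltW.
exists (fun e => (st e).1), (fun e => (st e).2), pos, (fun e x => path e (clamp01 x)); split => //; last first.
  by move=> e /hst[].
split => //.
- by move=> v w _ _; exact: pI.
- move=> e eG; have [c _ _ _] := pe e eG.
  by apply: (within_comp c); [exact: clampR_cts|exact: clamp01_in].
- by move=> e /hst[_ h _]; rewrite pth.
- by move=> e /hst[_ _ h]; rewrite pth.
- move=> e e' x y eG eG' x01 y01; have x01' := W x x01; rewrite !pth // => h.
  have [ee|ne] := eqVneq e e'.
    split => //; have [_ inj _ _] := pe e eG; by apply: inj => //; rewrite h ee.
  have [v [_ hv]] := pc e e' x y eG eG' ne x01' y01 h.
  by have [_ _ _ hn] := pe e eG; case: (hn x v x01 hv).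
- move=> e v x eG _ x01; rewrite pth ?W //; have [_ _ _ hn] := pe e eG; exact: hn.
Qed.

(** The pushed drawing and the arcs only serve to find [X]; the contraction acts on the original
    drawing, restricted to the vertices joined to terminals by edges or arcs. *)
Lemma reduce : embeds A G -> exists H : wgraph R N,
  [/\ wf_graph H, embeds A H, (#|vert H| <= bound)%N & forall (Rr : {set 'I_N}) (c : R), mincut G Rr c <-> mincut H Rr c].
Proof.
move=> /embeds_emb[s [t [pos [path [HG pA est nl]]]]].
have tauI : injective tau.
  move=> i j e; apply/eqP; apply: contraT => ne; have : (A i `&` A j) (pos (tau i)) by split; [exact: pA|rewrite e; exact: pA].
  by rewrite dA.
have tbd i : @surface_boundary R T (pos (tau i)) by rewrite -bA; exists i; exact: pA.
have /choice[circ hcirc] : forall i, exists c, C c (pos (tau i)) by move=> i; have := @tbd i; rewrite -bC.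
have [P [hP hPn]] := push_all hT tbd hD cT.
have tauT i : tau i \in [set: V]%SET by rewrite finset.in_setT.
have [act [nx [arc [hact hc H2]]]] := arcs hC dC bC HG tauI tauT hP hPn hcirc.
set s2 := fun e : E + 'I_N => _ in H2; set t2 := fun e : E + 'I_N => _ in H2; set F2 : {set E + 'I_N} := [set e | _]%SET in H2.
have nl2 e : e \in F2 -> s2 e != t2 e.
  case: e => [e|i]; rewrite inE /s2 /t2; first exact: nl.
  by move=> /hact h; rewrite (inj_eq tauI) eq_sym.
have tbd2 i : @surface_boundary R T ((P \o pos) (tau i)) by rewrite /= (pu_t hP); exact: tbd.
pose E0 : {set E + 'I_N} := [set inr i | i : 'I_N]%SET.
have E0l e : (inl e : E + 'I_N) \notin E0 by apply/negP => /finset.imsetP[i _].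
have E0r i : (inr i : E + 'I_N) \in E0 by apply: imset_f.
have cE0 : (#|E0| <= N)%N by apply: leq_trans (leq_imset_card _ _) _; rewrite cardT size_enum_ord.
have hc0 : forall si : V -> bool, (forall e, e \in F2 :&: E0 -> si (s2 e) = si (t2 e)) ->
  forall i j, circ i = circ j -> si (tau i) = si (tau j).
  move=> si h; apply: hc => i ia; apply: (h (inr i)).
  by rewrite finset.in_setI E0r andbT inE.
pose w2 (e : E + 'I_N) : R := if e is inl e' then (if e' \in edges G then weight G e' else 0) else 0.
have w20 e : 0 <= w2 e by case: e => [e|i] //=; case: ifP => // /wf[].
have [X2 [hX cX]] := few_comps hT hD subi subj hI hQ H2 nl2 tauI tauT tbd2 cE0 hc0 N0 w20.
set A1 := term_comp s2 t2 [set: V]%SET F2 tau in hX cX.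
have A1e e : e \in edges G -> (s e \in A1) = (t e \in A1).
  by move=> eG; apply: (@term_comp_edge _ _ _ _ _ s2 t2 _ F2 _ _ tau H2 (inl e)); rewrite inE.
have tauA1 i : tau i \in A1 by apply: tau_term.
clearbody A1.
pose FA : {set E} := [set e in edges G | s e \in A1]%SET.
pose X : {set E} := [set e | inl e \in X2]%SET.
have FAG e : e \in FA -> e \in edges G by rewrite inE => /andP[].
have HA : emb s t A1 FA pos path.
  apply: (emb_sub HG); first by apply/fintype.subsetP => v _; rewrite finset.in_setT.
    by apply/fintype.subsetP => e /FAG.
  by move=> e; rewrite inE => /andP[eG sA]; rewrite -A1e.
have F3l e : (inl e \in [set e in F2 | s2 e \in A1]%SET) = (e \in FA) by rewrite !inE.
have sumE (si : V -> bool) : \sum_(e in [set e in F2 | s2 e \in A1]%SET :\: E0 | si (s2 e) != si (t2 e)) w2 e =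
   \sum_(e in FA | si (s e) != si (t e)) weight G e.
  rewrite big_sumType /= [X in _ + X]big_pred0 ?addr0 => [|i]; last by rewrite finset.in_setD E0r.
  rewrite [LHS]big_mkcond [RHS]big_mkcond; apply: eq_bigr => e _.
  rewrite finset.in_setD E0l F3l /=; case: (boolP (e \in FA)) => //= eFA.
  by rewrite (FAG _ eFA).
pose K : {set V} := [set tau i | i : 'I_N]%SET.
pose F0 : {set E} := FA :\: X.
have F0P e : e \in F0 -> (inl e : E + 'I_N) \in [set e in F2 | s2 e \in A1]%SET /\ inl e \notin X2.
  by rewrite finset.in_setD F3l inE => /andP[].
have [||||rho [path' [q1 q2 q3 q4 q5]]] := @contract R T V E hT hD #|A1| s t A1 FA pos path F0 K (leqnn _) HA.
- by move=> e /FAG; exact: nl.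
- exact: subsetDl.
- by apply/fintype.subsetP => v /finset.imsetP[i _ ->].
(* The optimal cut for the region with the single element [i] separates two terminals and is
   constant along [F0]. *)
- move=> x y /finset.imsetP[i _ ->] /finset.imsetP[j _ ->]; rewrite (inj_eq tauI) => ij.
  have [si [h1 h2 _]] := hX [set i]%SET; exists si; split; last by rewrite !h1 !inE eqxx (eq_sym j i) (negbTE ij).
  by move=> e /F0P[e3 eX]; apply: (h2 (inl e)).
set B := (rho @: A1)%SET in q5; set F1 : {set E} := [set e in FA | _]%SET in q5.
have cB : (#|B| <= bound)%N.
  apply: cX => -[e|i] e3 e0 eX; last by rewrite E0r in e0.
  by apply: q3; rewrite finset.in_setD -F3l e3 inE eX.
pose VH : finType := {v : V | v \in B}.
have tauB i : tau i \in B by apply/finset.imsetP; exists (tau i) => //; rewrite q2 //; apply: imset_f.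
pose tv i : VH := exist (fun v : V => is_true (v \in B)) (tau i) (tauB i).
pose vd : VH := tv (Ordinal N0).
pose sh e : VH := insubd vd (rho (s e)); pose th e : VH := insubd vd (rho (t e)).
have F1FA e : e \in F1 -> e \in FA by rewrite inE => /andP[].
have rB v : v \in A1 -> rho v \in B by move=> vA; apply: imset_f.
have vs e : e \in FA -> val (sh e) = rho (s e) by move=> eF; rewrite val_insubd rB // (emb_s HA).
have vt e : e \in FA -> val (th e) = rho (t e) by move=> eF; rewrite val_insubd rB // (emb_t HA).
have sth e : e \in F1 -> sh e != th e.
  by move=> eF; rewrite -val_eqE vs ?vt ?F1FA //; move: eF; rewrite inE => /andP[].
pose eh e : {set VH} := [set sh e; th e]%SET.
(* Edges are sets of two vertices, so parallel edges are merged: their weights are added, and one of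
   their paths is drawn. *)
pose H : wgraph R N := @WGraph R N VH (eh @: F1)%SET (fun ep => \sum_(e in F1 | eh e == ep) weight G e) tv.
have w0 e : e \in F1 -> 0 <= weight G e by move=> /F1FA/FAG/wf[].
have wfH : wf_graph H.
  move=> ep /finset.imsetP[e eF ->]; split; first by rewrite cards2 sth.
  by apply: sumr_ge0 => e' /andP[/w0].
have cvH (si : VH -> bool) : cutval (G := H) si = \sum_(e in F1 | si (sh e) != si (th e)) weight G e.
  rewrite /cutval /= [RHS](partition_big eh (fun ep => (ep \in (eh @: F1)%SET) && cutb (G := H) si ep)) /=; last first.
    by move=> e /andP[eF h]; rewrite imset_f //= (cutb2 (G := H)).
  apply: eq_bigr => ep /andP[_ hc']; apply: eq_bigl => e.
  case: (eqVneq (eh e) ep) => [ee|_]; last by rewrite !andbF.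
  by rewrite -ee (cutb2 (G := H)) in hc'; rewrite hc' !andbT.
have cvG (si : V -> bool) : cutval si = \sum_(e in edges G | si (s e) != si (t e)) weight G e.
  by apply: eq_bigl => e; case: (boolP (e \in edges G)) => //= eG; rewrite {1}(est e eG) cutb2.
have cvFA (si : V -> bool) : \sum_(e in FA | si (s e) != si (t e)) weight G e <= cutval si.
  rewrite cvG [X in _ <= X](bigID (fun e => e \in FA)) /= -[X in X <= _]addr0; apply: lerD.
    rewrite le_eqVlt; apply/orP; left; apply/eqP; apply: eq_bigl => e.
    by case: (boolP (e \in FA)) => [eF|]; rewrite ?andbF //= (FAG _ eF) andbT.
  by apply: sumr_ge0 => e /andP[/andP[/wf[]]].
(* Outside [A1] the lifted colouring is constant, and no edge leaves [A1], so only edges with both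
   ends in [A1] are cut. *)
pose lift (sH : VH -> bool) v := (v \in A1) && sH (insubd vd (rho v)).
have cvl (sH : VH -> bool) : cutval (lift sH) = cutval (G := H) sH.
  rewrite cvG cvH; apply: eq_bigl => e; rewrite /lift.
  case: (boolP (e \in edges G)) => eG /=; last by apply/esym/negbTE; rewrite negb_and; apply/orP; left; apply: contra eG => /F1FA/FAG.
  have -> : (e \in F1) = (s e \in A1) && (rho (s e) != rho (t e)) by rewrite !inE eG.
  rewrite -(A1e e eG); case: (boolP (s e \in A1)) => //= sA.
  by rewrite -/(sh e) -/(th e); case: (eqVneq (rho (s e)) (rho (t e))) => [h|//] /=; rewrite /sh /th h eqxx.
have lt' (sH : VH -> bool) i : lift sH (tau i) = sH (bvert H i).
  rewrite /lift tauA1 /=; congr (sH _); apply: val_inj; rewrite val_insubd rB //= q2 //; exact: imset_f.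
exists H; split => //.
- pose rep (ep : {set VH}) : E := odflt finset.set0 [pick e in F1 | eh e == ep].
  have repP ep : ep \in edges H -> rep ep \in F1 /\ eh (rep ep) = ep.
    move=> /finset.imsetP[e eF ->]; rewrite /rep; case: pickP => [e' /andP[h1 /eqP h2] //|/(_ e)].
    by rewrite eF eqxx.
  have vB e : e \in F1 -> val (sh e) \in B /\ val (th e) \in B by move=> _; split; exact: valP.
  have p0 e : e \in F1 -> path' e 0 = pos (val (sh e)) by move=> eF; rewrite (emb_0 q5 eF) vs ?F1FA.
  have p1 e : e \in F1 -> path' e 1 = pos (val (th e)) by move=> eF; rewrite (emb_1 q5 eF) vt ?F1FA.
  have pI (x y : VH) : pos (val x) = pos (val y) -> x = y.
    by move=> /(emb_inj q5 (valP x) (valP y)) /val_inj.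
  have I3 (x : R) : 0 <= x <= 1 -> [\/ 0 < x < 1, x = 0 | x = 1].
    move=> /andP[h1 h2]; have [->|n0] := eqVneq x 0; first by constructor 2.
    have [->|n1] := eqVneq x 1; first by constructor 3.
    by constructor 1; rewrite !lt_neqAle n1 eq_sym n0 h1 h2.
  exists (fun v : VH => pos (val v)), (fun ep => path' (rep ep)); split.
  + by move=> x y; exact: pI.
  + by move=> j; exact: pA.
  + move=> ep epH; have [rF re] := repP ep epH; split.
    * by apply: continuous_subspaceT; exact: (emb_c q5 rF).
    * move=> x y x01 y01 h; have [xo|x0|x1] := I3 x x01.
        by have [_ ->] := emb_i q5 rF rF xo y01 h.
      - have [yo|-> //|y1] := I3 y y01; first by have [_ ->] := emb_i q5 rF rF yo x01 (esym h).
        by move: h; rewrite x0 y1 p0 // p1 // => /pI e; move: (sth _ rF); rewrite e eqxx.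
      - have [yo|y0|-> //] := I3 y y01; first by have [_ ->] := emb_i q5 rF rF yo x01 (esym h).
        by move: h; rewrite x1 y0 p0 // p1 // => /pI e; move: (sth _ rF); rewrite e eqxx.
    * by exists (sh (rep ep)), (th (rep ep)); rewrite p0 // p1 // -{1}re.
    * by move=> x v x01; exact: (emb_v q5 rF (valP v) x01).
  + move=> ep ep' x y epH epH' ne x01 y01 h.
    have [rF re] := repP ep epH; have [rF' re'] := repP ep' epH'.
    have nr : rep ep != rep ep' by apply: contra ne => /eqP er; rewrite -re -re' er.
    have end_ e z : e \in F1 -> z = 0 \/ z = 1 -> exists v : VH, v \in eh e /\ path' e z = pos (val v).
      by move=> eF [->|->]; [exists (sh e); rewrite p0|exists (th e); rewrite p1] => //; rewrite !inE eqxx ?orbT.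
    have xe : x = 0 \/ x = 1.
      have [xo|->|->] := I3 x x01; [|by left|by right].
      by have [e _] := emb_i q5 rF rF' xo y01 h; rewrite e eqxx in nr.
    have ye : y = 0 \/ y = 1.
      have [yo|->|->] := I3 y y01; [|by left|by right].
      by have [e _] := emb_i q5 rF' rF yo x01 (esym h); rewrite e eqxx in nr.
    have [v [v1 v2]] := end_ _ _ rF xe; have [v' [v1' v2']] := end_ _ _ rF' ye.
    have vv : v = v' by apply: pI; rewrite -v2 h v2'.
    subst v'; exists v; split => //; apply/finset.setIP; split; [rewrite -re|rewrite -re'] => //.
- by rewrite card_sig; apply: leq_trans cB; apply: eq_leq; apply: eq_card => v; rewrite inE.
(* Both min-cuts equal [mn]: the optimal colouring is constant along contracted edges and descends
   to [H], while colourings of [H] lift to [G] with the same value. *)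
move=> Rr c; have [si [h1 h2 h3]] := hX Rr; rewrite sumE in h3.
set mn := \sum_(e in FA | si (s e) != si (t e)) weight G e in h3.
have loG sg : (forall i, sg (tau i) = (i \in Rr)) -> mn <= cutval sg.
  by move=> h; have := h3 sg h; rewrite sumE => /le_trans; apply; exact: cvFA.
pose sH (v : VH) := si (val v).
have sHi i : sH (bvert H i) = (i \in Rr) by rewrite /sH /= h1.
have si0 v : v \in A1 -> si (rho v) = si v.
  by move=> vA; apply: q4 => // e /F0P[e3 eX]; apply: (h2 (inl e)).
have vH : cutval (G := H) sH = mn.
  rewrite cvH /mn; apply: eq_bigl => e; rewrite /sH.
  case: (boolP (e \in F1)) => eF /=.
    by rewrite vs ?vt ?F1FA // !si0 ?(emb_s HA) ?(emb_t HA) ?F1FA.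
  case: (boolP (e \in FA)) => //= eFA; move: eF; rewrite inE eFA /= negbK => /eqP er.
  by rewrite -(si0 (s e)) ?(emb_s HA) // -(si0 (t e)) ?(emb_t HA) // er eqxx.
have EG : mincut G Rr c <-> c = mn.
  apply: (mincut_min _ wf) loG; exists (lift sH); split; last by rewrite cvl.
  by move=> i; rewrite lt'.
have EH : mincut H Rr c <-> c = mn.
  apply: (mincut_min _ wfH); first by exists sH.
  by move=> sg h; rewrite -cvl; apply: loG => i; rewrite lt'; exact: h.
by rewrite EG EH.
Qed.

End Reduce.

(** * The case without atomic regions *)

Section NoTerminal.
Variable R : realType.

Definition empty_graph : wgraph R 0 := @WGraph R 0 void finset.set0 (fun=> 0)
  (fun i => match notF (ltn_ord i) with end).

Lemma mincut_noterm (G : wgraph R 0) Rr c : wf_graph G -> mincut G Rr c <-> c = 0.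
Proof.
move=> wf; split=> [[[F [sF _ <-]] h]|->].
  apply/eqP; rewrite eq_le sumr_ge0 ?andbT => [|e /(fintype.subsetP sF)/wf[] //].
  by have := h finset.set0 (finset.sub0set _); rewrite big_set0; apply => -[].
split; first by exists finset.set0; split; [exact: finset.sub0set|case|rewrite big_set0].
by move=> F sF _; apply: sumr_ge0 => e /(fintype.subsetP sF)/wf[].
Qed.

End NoTerminal.

Theorem theorem4 (R : realType) (T : topologicalType) (k : nat) :
  is_surface R T -> has_circle_boundaries R T k ->
  exists C : R, forall (N : nat) (A : 'I_N -> set T), atomic_arcs R A ->
  forall (m : nat) (Rs : 'I_m -> {set 'I_N}) (S : 'I_m -> R),
    (forall i, 0 <= S i) ->
  forall G : wgraph R N, wf_graph G -> solves_DBRP G Rs S -> embeds A G ->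
  exists H : wgraph R N,
    [/\ wf_graph H, embeds A H, (#|vert H|%:R <= C * N%:R ^+ 4) &
        forall (Rr : {set 'I_N}) (c : R), mincut G Rr c <-> mincut H Rr c].
Proof.
move=> sf [C [hC dC bC]]; have hD := surf_disc sf; case: sf => hT cT _ _.
have [I [Q [ch [qc [qi [qj [h1 h2 h3 h4]]]]]]] := cover_data hT cT hD.
(* [Q] comes from the atlas, so the constant depends on the surface and [k], and not on [N] or the
   graph. *)
exists (32 * (2 ^ (#|{: 'I_k * {ffun Q -> bool}}| + k)) ^ 3)%N%:R => N A [_ dA bA] m Rs S _ G wf _ eG.
case: (posnP N) => [N0|N0]; last first.
  have [H [w1 w2 w3 w4]] := reduce hT cT hD h1 h2 h3 h4 hC dC bC dA bA wf N0 eG.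
  by exists H; split => //; rewrite -natrX -natrM ler_nat.
subst N; case: eG => _ [path _].
have wf0 : wf_graph (empty_graph R) by move=> e; rewrite inE.
exists (empty_graph R); split => //.
(* A drawing needs path values even without edges; the drawing of [G] provides a point of [T]. *)
- exists (fun v : void => match v with end), (fun _ _ => path finset.set0 0); split => //.
  + by move=> [].
  + by move=> e; rewrite inE.
  + by move=> e e' x y; rewrite inE.
- by rewrite card_void expr0n /= mulr0.
- by move=> Rr c; rewrite !mincut_noterm.
Qed.
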